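(* Let $k$ be an algebraically closed field of characteristic $p>2$ and let $G$ be a connected reductive algebraic group over $k$. Then the category $\mathcal{T}(G)$ of tilting modules for $G$ is a cellular category.
   Context: Setup: $T\subset G$ is a maximal torus, $X=X(T)$ its character group, $R$ the root system, $R^+$ a choice of positive roots, $X^+\subset X$ the dominant characters, $\leq$ the order on $X$ determined by $R^+$, $B\supset T$ the Borel subgroup with roots $-R^+$. It is assumed that $\rho=\frac12\sum_{\alpha\in R^+}\alpha\in X$. $\mathcal{C}(G)$ is the category of finite dimensional $G$-modules. For $\lambda\in X^+$ put $\nabla(\lambda)=\mathrm{Ind}_B^G\lambda$ and $\Delta(\lambda)={}^\tau\nabla(\lambda)$ (the Weyl module), where ${}^\tau M$ is $M^*$ with $G$-action twisted by the anti-automorphism $\tau$ of $G$ which is an involution, is the identity on $T$, and takes $U_\alpha$ to $U_{-\alpha}$ for all roots $\alpha$. A module $Q\in\mathcal{C}(G)$ is tilting if it has both a finite filtration with all quotients of the form $\Delta(\mu)$ and one with all quotients of the form $\nabla(\mu)$, $\mu\in X^+$. $\mathcal{T}(G)$ is the full subcategory of $\mathcal{C}(G)$ of tilting modules. Definition (cellular category, Westbury). A $k$-linear category $\mathcal{A}$ is cellular if there are: a $k$-linear contravariant functor $\dagger$ on $\mathcal{A}$ that is the identity on objects and satisfies $f^{\dagger\dagger}=f$ for all morphisms $f$; a poset $\Lambda$; for each object $P$ and $\lambda\in\Lambda$ a finite set $K(P,\lambda)$; and for all objects $P,Q$ and $\lambda\in\Lambda$ an injective family $c^\lambda_{ij}(P,Q)\in\mathrm{Hom}(P,Q)$,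 $i\in K(Q,\lambda)$, $j\in K(P,\lambda)$, such that: (1) for all $P,Q$ the elements $c^\lambda_{ij}(P,Q)$, with $\lambda\in\Lambda$, $i,j$ varying, form a basis of $\mathrm{Hom}(P,Q)$; (2) $c^\lambda_{ij}(P,Q)^\dagger=c^\lambda_{ji}(Q,P)$; (3) for every $\varphi\in\mathrm{Hom}(Q,R)$ one has $\varphi\circ c^\lambda_{ij}(P,Q)\equiv\sum_{m\in K(R,\lambda)}r_\varphi(i,m)\,c^\lambda_{mj}(P,R)$ modulo the span of the $c^\mu_{i'j'}(P,R)$ with $\mu<\lambda$, for scalars $r_\varphi(i,m)\in k$ independent of $j$. *)

(* Defs.v *)
From HB Require Import structures.
From mathcomp Require Import all_boot all_order all_algebra.
From mathcomp Require Import all_classical.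

Set Implicit Arguments.
Unset Strict Implicit.
Unset Printing Implicit Defensive.

Import GRing.Theory.
Local Open Scope classical_set_scope.
Local Open Scope ring_scope.

Definition subalg (k : fieldType) (X : Type) (A : set (X -> k)) : Prop :=
  [/\ forall c : k, A (fun=> c),
      forall f g, A f -> A g -> A (fun x => f x + g x)
    & forall f g, A f -> A g -> A (fun x => f x * g x)].

Definition genalg (k : fieldType) (X : Type) (S : set (X -> k)) :
  set (X -> k) := smallest (@subalg k X) S.

(* A pair (D, A) with D : set X and A : set (X -> k) stands for the affine
   variety D whose regular functions are the restrictions to D of the functions
   in A; values outside D are irrelevant. *)
Definition regular_map (k : fieldType) (X Y : Type) (D : set X)
    (A : set (X -> k)) (B : set (Y -> k)) (phi : X -> Y) : Prop :=
  forall f, B f -> exists2 g, A g & forall x, D x -> f (phi x) = g x.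

(* phi is an isomorphism of the variety (D, A) onto (phi @` D, B). *)
Definition regular_embedding (k : fieldType) (X Y : Type) (D : set X)
    (A : set (X -> k)) (B : set (Y -> k)) (phi : X -> Y) : Prop :=
  [/\ set_inj D phi, regular_map D A B phi
    & forall g, A g -> exists2 f, B f & forall x, D x -> f (phi x) = g x].

(* An affine algebraic group in the classical sense: a group with a finitely
   generated algebra of k-valued functions, compatible with multiplication and
   inversion, whose k-points are exactly the elements of the group. *)
Record algGroup (k : closedFieldType) := AlgGroup {
  alg_sort :> groupType;
  reg : set (alg_sort -> k);
  reg_fingen : exists (n : nat) (g : 'I_n -> alg_sort -> k),
    reg = genalg (range g);
  reg_points : forall chi : (alg_sort -> k) -> k,
    (forall c : k, chi (fun=> c) = c) ->
    (forall f g, reg f -> reg g -> chi (fun x => f x + g x) = chi f + chi g) ->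
    (forall f g, reg f -> reg g -> chi (fun x => f x * g x) = chi f * chi g) ->
    exists! x : alg_sort, forall f, reg f -> chi f = f x;
  reg_mul : forall f, reg f -> exists (n : nat) (a b : 'I_n -> alg_sort -> k),
    [/\ forall i, reg (a i), forall i, reg (b i)
      & forall x y, f (x * y)%g = \sum_(i < n) a i x * b i y];
  reg_inv : forall f, reg f -> reg (fun x => f x^-1%g)
}.
Arguments reg {k} G _ : rename.

Section AlgebraicGroups.
Variables (k : closedFieldType) (G : algGroup k).
Implicit Types (H T B : set G) (lam chi alpha : G -> k).

Lemma reg_subalg : subalg (reg G).
Proof.
have [n [g ->]] := reg_fingen G; split.
- by move=> c A [[hc _ _] _]; apply: hc.
- move=> f h hf hh A hA; case: (hA) => -[_ hD _] _.
  by apply: hD; [apply: hf | apply: hh].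
- move=> f h hf hh A hA; case: (hA) => -[_ _ hM] _.
  by apply: hM; [apply: hf | apply: hh].
Qed.

Definition zclosed (Z : set G) : Prop :=
  exists2 S : set (G -> k), S `<=` reg G
    & Z = [set x | forall f, S f -> f x = 0].

(* Meant for H closed: the closed subsets of H are then the closed subsets of G
   contained in H. *)
Definition zconnected H : Prop :=
  forall Z1 Z2, zclosed Z1 -> zclosed Z2 ->
    H = Z1 `|` Z2 -> Z1 `&` Z2 = set0 -> Z1 = set0 \/ Z2 = set0.

Definition subgroup H : Prop :=
  [/\ H 1%g, forall x y, H x -> H y -> H (x * y)%g
    & forall x, H x -> H x^-1%g].

Definition closed_subgroup H : Prop := subgroup H /\ zclosed H.

Definition normal_subgroup H : Prop :=
  subgroup H /\ forall x h, H h -> H (h ^ x)%g.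

Definition derived H : set G :=
  smallest subgroup [set c | exists x y, [/\ H x, H y & c = [~ x, y]%g]].

Definition solvable_set H : Prop := exists n, iter n derived H = [set 1%g].

(* x is unipotent when right translation by x is a locally unipotent
   operator on the regular functions. *)
Definition unipotent (x : G) : Prop :=
  forall f, reg G f ->
    exists n : nat,
      iter n (fun h : G -> k => (fun y => h (y * x)%g - h y)) f = (fun=> 0).

Definition unipotent_radical_trivial : Prop :=
  forall U, closed_subgroup U -> zconnected U -> normal_subgroup U ->
    (forall x, U x -> unipotent x) -> U = [set 1%g].

Definition connected_reductive : Prop :=
  zconnected setT /\ unipotent_radical_trivial.

(* The r-th power of the multiplicative group; its regular functions are the
   Laurent polynomials. *)
Definition Gm_pow (r : nat) : set ('I_r -> k) := [set s | forall i, s i != 0].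
Definition laurent (r : nat) : set (('I_r -> k) -> k) :=
  genalg (range (fun (i : 'I_r) s => s i) `|`
          range (fun (i : 'I_r) s => (s i)^-1)).

Definition torus T : Prop :=
  closed_subgroup T /\
  exists (r : nat) (phi : ('I_r -> k) -> G),
    [/\ regular_embedding (@Gm_pow r) (@laurent r) (reg G) phi,
        T = phi @` @Gm_pow r
      & forall s s', Gm_pow s -> Gm_pow s' ->
          phi (fun i => s i * s' i) = (phi s * phi s')%g].

Definition maximal_torus T : Prop :=
  torus T /\ forall T', torus T' -> T `<=` T' -> T' = T.

Definition connected_solvable B : Prop :=
  [/\ closed_subgroup B, zconnected B & solvable_set B].

Definition borel B : Prop :=
  connected_solvable B /\
  forall B', connected_solvable B' -> B `<=` B' -> B' = B.

(* A character of H is extended by 0 outside H, so that two characters of H are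
   equal exactly when they agree on H. The group structure of X(H), written
   additively on paper, is pointwise multiplication here. *)
Definition character H chi : Prop :=
  [/\ exists2 f, reg G f & forall x, H x -> chi x = f x,
      forall x, ~ H x -> chi x = 0,
      chi 1%g = 1
    & forall x y, H x -> H y -> chi (x * y)%g = chi x * chi y].

(* Tangent vectors at 1, given by their values on regular functions. *)
Definition point_derivation (delta : (G -> k) -> k) : Prop :=
  (forall (c : k) f g, reg G f -> reg G g ->
    delta (fun x => c * f x + g x) = c * delta f + delta g) /\
  (forall f g, reg G f -> reg G g ->
    delta (fun x => f x * g x) = delta f * g 1%g + f 1%g * delta g).

Definition in_Lie H (delta : (G -> k) -> k) : Prop :=
  point_derivation delta /\
  forall f, reg G f -> (forall x, H x -> f x = 0) -> delta f = 0.

(* A root of H with respect to T: a nontrivial character of T that is a weight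
   of T acting on Lie(H) by the adjoint action
   (Ad(t) delta)(f) = delta(x |-> f(t x t^-1)). *)
Definition is_root H T alpha : Prop :=
  [/\ character T alpha, exists2 t, T t & alpha t != 1
    & exists delta, [/\ in_Lie H delta, exists2 f, reg G f & delta f != 0
        & forall t f, T t -> reg G f ->
            delta (fun x => f (t * x * t^-1)%g) = alpha t * delta f]].

Definition opp_char chi : G -> k := fun t => (chi t)^-1.
Definition add_char chi1 chi2 : G -> k := fun t => chi1 t * chi2 t.

Definition positive_system T (Rp : set (G -> k)) : Prop :=
  [/\ Rp `<=` is_root setT T,
      forall alpha, is_root setT T alpha -> (Rp alpha <-> ~ Rp (opp_char alpha))
    & forall alpha beta, Rp alpha -> Rp beta ->
        is_root setT T (add_char alpha beta) -> Rp (add_char alpha beta)].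

Definition rho_in_X T (Rp : set (G -> k)) : Prop :=
  exists2 rho, character T rho
    & forall t, T t -> rho t ^+ 2 = \big[*%R/1]_(alpha \in Rp) alpha t.

(* An isomorphism x_alpha of the additive group onto the root subgroup
   U_alpha. *)
Definition root_hom T alpha (x : k -> G) : Prop :=
  [/\ regular_embedding setT (genalg [set id]) (reg G) x,
      forall a b, x (a + b) = (x a * x b)%g
    & forall t a, T t -> (t * x a * t^-1)%g = x (alpha t * a)].

Definition SL2 : set 'M[k]_2 := [set A | \det A = 1].
Definition mx_coords : set ('M[k]_2 -> k) :=
  range (fun (ij : 'I_2 * 'I_2) (A : 'M[k]_2) => A ij.1 ij.2).

(* phi : SL_2 -> G attached to alpha: it restricts to parametrizations of
   U_alpha and U_(- alpha) on the two unipotent triangular subgroups. *)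
Definition SL2_hom T alpha (phi : 'M[k]_2 -> G) : Prop :=
  [/\ regular_map SL2 (genalg mx_coords) (reg G) phi,
      forall X Y, SL2 X -> SL2 Y -> phi (X *m Y) = (phi X * phi Y)%g,
      root_hom T alpha (fun a => phi (1%:M + a *: delta_mx 0 1))
    & root_hom T (opp_char alpha) (fun a => phi (1%:M + a *: delta_mx 1 0))].

(* <lam, alpha^vee> = n, with alpha^vee(a) = phi(diag(a, a^-1)). *)
Definition coroot_pairing T lam alpha (n : int) : Prop :=
  exists2 phi, SL2_hom T alpha phi
    & forall a : k, a != 0 ->
        lam (phi (a *: delta_mx 0 0 + a^-1 *: delta_mx 1 1)) = a ^ n.

Definition dominant T (Rp : set (G -> k)) lam : Prop :=
  character T lam /\
  forall alpha, Rp alpha ->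
    exists2 n : int, coroot_pairing T lam alpha n & (0 <= n)%R.

Record anti_involution := AntiInvolution {
  anti_fun :> G -> G;
  anti_reg : forall f, reg G f -> reg G (fun x => f (anti_fun x));
  antiM : forall x y, anti_fun (x * y)%g = (anti_fun y * anti_fun x)%g;
  antiK : involutive anti_fun
}.

Definition chevalley T (tau : anti_involution) : Prop :=
  (forall t, T t -> tau t = t) /\
  forall alpha, is_root setT T alpha ->
    forall x y, root_hom T alpha x -> root_hom T (opp_char alpha) y ->
      tau @` range x = range y.

Record Gmodule := GModule {
  gspace :> vectType k;
  gact : G -> 'End(gspace);
  gact1 : gact 1%g = \1%VF;
  gactM : forall x y, gact (x * y)%g = (gact x \o gact y)%VF;
  gact_reg : forall (phi : 'Hom(gspace, k^o)) (v : gspace),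
    reg G (fun g => phi (gact g v))
}.
Arguments gact {M} g : rename.

Definition equivariant (M N : Gmodule) : {pred 'Hom(M, N)} :=
  fun f => `[< forall (g : G) (v : M), f (gact g v) = gact g (f v) >].
Arguments equivariant : clear implicits.

Lemma equivariantP (M N : Gmodule) (f : 'Hom(M, N)) :
  reflect (forall (g : G) (v : M), f (gact g v) = gact g (f v))
          (f \in equivariant M N).
Proof. exact: asboolP. Qed.

Lemma equivariant_submod (M N : Gmodule) : submod_closed (equivariant M N).
Proof.
split=> [|a f h /equivariantP hf /equivariantP hh].
  by apply/equivariantP => g v; rewrite !lfunE /= linear0.
apply/equivariantP => g v.
by rewrite !add_lfunE !scale_lfunE hf hh linearP.
Qed.

HB.instance Definition _ (M N : Gmodule) :=
  GRing.isSubmodClosed.Build k 'Hom(M, N) (equivariant M N)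
    (equivariant_submod M N).

Record Ghom (M N : Gmodule) := GHom {
  ghom_val :> 'Hom(M, N);
  ghomP : ghom_val \in equivariant M N
}.
HB.instance Definition _ (M N : Gmodule) := [isSub for @ghom_val M N].
HB.instance Definition _ (M N : Gmodule) := [Choice of Ghom M N by <:].
HB.instance Definition _ (M N : Gmodule) :=
  [SubChoice_isSubLmodule of Ghom M N by <:].

Definition Giso (M N : Gmodule) : Prop :=
  exists f : Ghom M N, lker f = 0%VS /\ limg f = fullv.

Lemma ghom_id_subproof (M : Gmodule) :
  (\1%VF : 'Hom(M, M)) \in equivariant M M.
Proof. by apply/equivariantP => g v; rewrite !id_lfunE. Qed.

Definition ghom_id (M : Gmodule) : Ghom M M := GHom (ghom_id_subproof M).

Lemma ghom_comp_subproof (M N P : Gmodule) (f : Ghom N P) (h : Ghom M N) :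
  (f \o h)%VF \in equivariant M P.
Proof.
apply/equivariantP => g v; rewrite !comp_lfunE.
by move/equivariantP: (ghomP h) => ->; move/equivariantP: (ghomP f) => ->.
Qed.

Definition ghom_comp (M N P : Gmodule) (f : Ghom N P) (h : Ghom M N) :
  Ghom M P := GHom (ghom_comp_subproof f h).

Section TwistedDual.
Variables (tau : anti_involution) (M : Gmodule).

Definition dual_space : vectType k := 'Hom(M, k^o).

Definition dual_act_fun (g : G) (phi : dual_space) : dual_space :=
  (phi \o gact (tau g))%VF.

Fact dual_act_linear (g : G) : linear (dual_act_fun g).
Proof.
by move=> a f h; rewrite /dual_act_fun comp_lfunDl comp_lfunZl.
Qed.

HB.instance Definition _ (g : G) :=
  GRing.isLinear.Build k dual_space dual_space _ (dual_act_fun g)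
    (dual_act_linear g).

Definition dual_act (g : G) : 'End(dual_space) := linfun (dual_act_fun g).

Lemma dual_actE (g : G) (phi : dual_space) :
  dual_act g phi = (phi \o gact (tau g))%VF.
Proof. by rewrite lfunE. Qed.

Lemma anti1 : tau 1%g = 1%g.
Proof.
have h := antiM tau 1%g (tau 1%g).
by rewrite mul1g antiK mul1g in h.
Qed.

Fact dual_act1 : dual_act 1%g = \1%VF.
Proof.
by apply/lfunP => phi; rewrite dual_actE anti1 gact1 comp_lfun1r id_lfunE.
Qed.

Fact dual_actM x y : dual_act (x * y)%g = (dual_act x \o dual_act y)%VF.
Proof.
apply/lfunP => phi.
by rewrite comp_lfunE !dual_actE antiM gactM comp_lfunA.
Qed.

Lemma reg_sum (n : nat) (f : 'I_n -> G -> k) :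
  (forall i, reg G (f i)) -> reg G (fun x => \sum_(i < n) f i x).
Proof.
have [hc hD _] := reg_subalg.
elim: n f => [|n IH] f hf.
  by under eq_fun do rewrite big_ord0; apply: hc.
by under eq_fun do rewrite big_ord_recr /=; apply: hD => //; apply: IH.
Qed.

Fact dual_act_reg (Phi : 'Hom(dual_space, k^o)) (phi : dual_space) :
  reg G (fun g => Phi (dual_act g phi)).
Proof.
pose e := vbasis {:M}.
have eB : basis_of {:M} e := vbasisP _.
pose xi (i : 'I_(\dim {:M})) : dual_space := linfun (coord e i : M -> k^o).
have E (psi : dual_space) : psi = \sum_(i < \dim {:M}) psi e`_i *: xi i.
  apply/lfunP => v; rewrite {1}(coord_basis eB (memvf v)) linear_sum sum_lfunE.
  apply: eq_bigr => i _; rewrite linearZ scale_lfunE lfunE /=.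
  exact: mulrC.
have -> : (fun g => Phi (dual_act g phi)) =
          (fun g => \sum_(i < \dim {:M}) phi (gact (tau g) e`_i) * Phi (xi i)).
  apply/funext => g; rewrite dual_actE {1}(E (phi \o _)%VF) linear_sum.
  by apply: eq_bigr => i _; rewrite linearZ comp_lfunE.
have [hc _ hM] := reg_subalg.
apply: reg_sum => i; apply: hM; last exact: hc.
exact: (anti_reg tau (gact_reg phi e`_i)).
Qed.

(* The dual of M with g acting on phi by (g phi)(v) = phi (tau(g) v). *)
Definition tdual : Gmodule := GModule dual_act1 dual_actM dual_act_reg.

End TwistedDual.

Definition ind B chi : set (G -> k) :=
  [set f | reg G f /\ forall g b, B b -> f (g * b)%g = (chi b)^-1 * f g].

(* M is isomorphic to Ind_B^G(lam), where lam is viewed as a character of B via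
   its (unique) extension chi, and G acts by left translation. *)
Definition is_nabla T B lam (M : Gmodule) : Prop :=
  exists chi, [/\ character B chi, forall t, T t -> chi t = lam t
    & exists iota : M -> (G -> k),
      [/\ forall (c : k) v w x, iota (c *: v + w) x = c * iota v x + iota w x,
          injective iota, range iota = ind B chi
        & forall g v x, iota (gact g v) x = iota v (g^-1 * x)%g]].

Definition is_delta T B (tau : anti_involution) lam (M : Gmodule) : Prop :=
  exists2 N, is_nabla T B lam N & Giso M (tdual tau N).

(* W / U is isomorphic to N, by the map induced by pi. *)
Definition subquotient_iso (M : Gmodule) (U W : {vspace M}) (N : Gmodule) :
    Prop :=
  exists pi : 'Hom(M, N),
    [/\ (pi @: W = fullv)%VS, (W :&: lker pi = U)%VS
      & forall (g : G) v, v \in W -> pi (gact g v) = gact g (pi v)].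

Definition filtered (F : Gmodule -> Prop) (M : Gmodule) : Prop :=
  exists (r : nat) (U : nat -> {vspace M}),
    [/\ U 0%N = 0%VS, U r = fullv,
        forall i (g : G) v, (i <= r)%N -> v \in U i -> gact g v \in U i
      & forall i, (i < r)%N -> (U i <= U i.+1)%VS /\
          exists2 N, F N & subquotient_iso (U i) (U i.+1) N].

Definition tilting T B (Rp : set (G -> k)) (tau : anti_involution)
    (Q : Gmodule) : Prop :=
  filtered (fun N => exists2 mu, dominant T Rp mu & is_delta T B tau mu N) Q /\
  filtered (fun N => exists2 mu, dominant T Rp mu & is_nabla T B mu N) Q.

End AlgebraicGroups.

Record lincat (k : fieldType) := LinCat {
  obj :> Type;
  hom : obj -> obj -> lmodType k;
  idm : forall P, hom P P;
  comp : forall P Q R, hom Q R -> hom P Q -> hom P R;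
  comp1m : forall P Q (f : hom P Q), comp (idm Q) f = f;
  compm1 : forall P Q (f : hom P Q), comp f (idm P) = f;
  compA : forall P Q R S (f : hom R S) (g : hom Q R) (h : hom P Q),
    comp f (comp g h) = comp (comp f g) h;
  comp_linl : forall P Q R (a : k) (f f' : hom Q R) (g : hom P Q),
    comp (a *: f + f') g = a *: comp f g + comp f' g;
  comp_linr : forall P Q R (a : k) (f : hom Q R) (g g' : hom P Q),
    comp f (a *: g + g') = a *: comp f g + comp f g'
}.
Arguments hom {k A} P Q : rename.
Arguments idm {k A} P : rename.
Arguments comp {k A P Q R} f g : rename.

Definition full_subcat (k : fieldType) (A : lincat k) (S : A -> Prop) :
    lincat k :=
  @LinCat k {P : A | S P} (fun P Q => hom (sval P) (sval Q))
    (fun P => idm (sval P)) (fun P Q R => @comp k A _ _ _)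
    (fun P Q => @comp1m k A _ _) (fun P Q => @compm1 k A _ _)
    (fun P Q R X => @compA k A _ _ _ _)
    (fun P Q R => @comp_linl k A _ _ _) (fun P Q R => @comp_linr k A _ _ _).

Definition in_span (k : fieldType) (V : lmodType k) (I : eqType) (D : set I)
    (v : I -> V) (x : V) : Prop :=
  exists (s : seq I) (a : I -> k),
    (forall i, i \in s -> D i) /\ x = \sum_(i <- s) a i *: v i.

Definition lin_indep (k : fieldType) (V : lmodType k) (I : eqType)
    (v : I -> V) : Prop :=
  forall (s : seq I) (a : I -> k), uniq s ->
    \sum_(i <- s) a i *: v i = 0 -> forall i, i \in s -> a i = 0.

Definition is_basis (k : fieldType) (V : lmodType k) (I : eqType)
    (v : I -> V) : Prop :=
  lin_indep v /\ forall x, in_span setT v x.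

Record cell_datum (k : fieldType) (A : lincat k) := CellDatum {
  dag : forall P Q : A, hom P Q -> hom Q P;
  dag_linear : forall (P Q : A) (a : k) (f g : hom P Q),
    dag (a *: f + g) = a *: dag f + dag g;
  dag_id : forall P : A, dag (idm P) = idm P;
  dag_comp : forall (P Q R : A) (f : hom Q R) (g : hom P Q),
    dag (comp f g) = comp (dag g) (dag f);
  dagK : forall (P Q : A) (f : hom P Q), dag (dag f) = f;
  cell_disp : Order.disp_t;
  cell_poset : porderType cell_disp;
  cell_index : A -> cell_poset -> finType;
  cell_elt : forall (P Q : A) (l : cell_poset),
    cell_index Q l -> cell_index P l -> hom P Q;
  cell_inj : forall (P Q : A) (l : cell_poset)
      (i i' : cell_index Q l) (j j' : cell_index P l),
    cell_elt i j = cell_elt i' j' -> i = i' /\ j = j';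
  cell_basis : forall P Q : A,
    is_basis (fun x : {l : cell_poset & (cell_index Q l * cell_index P l)%type} =>
                cell_elt (tagged x).1 (tagged x).2);
  cell_dag : forall (P Q : A) (l : cell_poset)
      (i : cell_index Q l) (j : cell_index P l),
    dag (cell_elt i j) = cell_elt j i;
  (* The scalars r depend only on phi, l, i and m, hence neither on j nor on
     the source object P. *)
  cell_mul : forall (Q R : A) (l : cell_poset) (phi : hom Q R),
    exists r : cell_index Q l -> cell_index R l -> k,
      forall (P : A) (i : cell_index Q l) (j : cell_index P l),
        in_span
          [set x : {m : cell_poset & (cell_index R m * cell_index P m)%type} |
             (tag x < l)%O]
          (fun x => cell_elt (tagged x).1 (tagged x).2)
          (comp phi (cell_elt i j) - \sum_m r i m *: cell_elt m j)
}.

Definition cellular (k : fieldType) (A : lincat k) : Prop :=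
  inhabited (cell_datum A).

Section ModuleCategory.
Variables (k : closedFieldType) (G : algGroup k).

Fact ghom_comp1m (M N : Gmodule G) (f : Ghom M N) :
  ghom_comp (ghom_id N) f = f.
Proof. by apply: val_inj; rewrite /= comp_lfun1l. Qed.

Fact ghom_compm1 (M N : Gmodule G) (f : Ghom M N) :
  ghom_comp f (ghom_id M) = f.
Proof. by apply: val_inj; rewrite /= comp_lfun1r. Qed.

Fact ghom_compA (M N P Q : Gmodule G) (f : Ghom P Q) (g : Ghom N P)
    (h : Ghom M N) :
  ghom_comp f (ghom_comp g h) = ghom_comp (ghom_comp f g) h.
Proof. by apply: val_inj; rewrite /= comp_lfunA. Qed.

Fact ghom_comp_linl (M N P : Gmodule G) (a : k) (f f' : Ghom N P)
    (g : Ghom M N) :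
  ghom_comp (a *: f + f') g = a *: ghom_comp f g + ghom_comp f' g.
Proof. by apply: val_inj; rewrite /= comp_lfunDl comp_lfunZl. Qed.

Fact ghom_comp_linr (M N P : Gmodule G) (a : k) (f : Ghom N P)
    (g g' : Ghom M N) :
  ghom_comp f (a *: g + g') = a *: ghom_comp f g + ghom_comp f g'.
Proof. by apply: val_inj; rewrite /= comp_lfunDr comp_lfunZr. Qed.

Definition module_cat : lincat k :=
  @LinCat k (Gmodule G) (fun M N => Ghom M N) (@ghom_id k G) (@ghom_comp k G)
    ghom_comp1m ghom_compm1 ghom_compA ghom_comp_linl ghom_comp_linr.

Definition tilting_cat (T B : set G) (Rp : set (G -> k))
    (tau : anti_involution G) : lincat k :=
  @full_subcat k module_cat (tilting T B Rp tau).

End ModuleCategory.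

(* Main.v *)
(* Neither Kempf's vanishing theorem nor Ext groups are used. Fix a total order
   on the weights of T that refines the order given by R^+. A homomorphism from a
   submodule S of E to nabla(mu) extends to E whenever E/S = Delta(nu): for
   nu <= mu because nabla(mu) is coinduced, and for nu > mu because the submodule
   generated by a lift of the top vector of Delta(nu) meets S inside the kernel.
   Consequently, for P and Q tilting, u in Q_l generating a submodule with weights
   <= l, and a functional xi on P_l killing everything that comes from weights
   > l, some f : P -> Q equals xi (x) u on P_l and 0 on the weights > l.

   Realizing such rank one maps between Q and its twisted dual Q*, one finds a
   symmetric nondegenerate contravariant form on Q: among the pairs of symmetric
   maps beta : Q -> Q*, gamma : Q* -> Q that are generalised inverses of each
   other, one for which gamma beta has maximal rank is a pair of isomorphisms.
   The involution is the adjoint for these forms, and c_ij is half the sum of a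
   map realizing (u_j, .) (x) u_i and of the adjoint of a map realizing
   (u_i, .) (x) u_j, where (u_i) is a basis of the vectors u as above. The form
   and the c_ij are the two places where p > 2 is needed for symmetrization.

   Of the structure of G only three facts enter: the weights of T on k[B] are sums
   of negative roots, a function of weight 0 on B is determined by its restriction
   to T, and tau(B)B is dense. They are checked on tangent spaces, since in
   characteristic p a radical ideal stable under sufficiently many derivations
   defines a set that is smooth of full dimension. The one-parameter subgroups of
   the roots are found in the loci where all functions with weights outside a ray
   are constant, and C_G(T) has the same Lie algebra as T because the unipotent
   part of its identity component is normal in G. *)

Require Import Defs.
From HB Require Import structures.
From mathcomp Require Import all_boot all_order all_algebra.
From mathcomp Require Import all_classical.
From mathcomp Require Import mpoly.
From mathcomp Require Import ring zify.

Set Implicit Arguments.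
Unset Strict Implicit.
Unset Printing Implicit Defensive.

Import GRing.Theory.
Local Open Scope classical_set_scope.
Local Open Scope ring_scope.

(** * Noetherian algebras and the Nullstellensatz *)

(** No structure theory of reductive groups is presupposed, and [is_root] only speaks of weights in
    the tangent space at 1. The link to the group is dominance: one dominant weight provides a
    homomorphism from SL_2 for each positive root, hence coroots, reflections and root subgroups;
    without dominant weights all tilting modules are zero. The loci at hand are given by ideals not
    known to be radical. Hence a recurring pattern: work modulo powers of the maximal ideal at 1,
    where T-weights are compared monomial by monomial, and return to functions by Krull's
    intersection theorem. A total order on the weights makes the complement of {c <= l} equal to {c
    > l}, so that each weight argument is a dichotomy; it also serves as the poset of the cell
    datum. K(P, l) indexes a basis of the vectors of weight l that generate a submodule with weights
    <= l. The form on P turns the same basis into the functionals needed on the source side, which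
    is why one set serves for both indices. *)

Section Ideals.
Variable A : comNzRingType.
Implicit Types (J I : set A) (s : seq A).

Definition is_ideal J : Prop :=
  [/\ J 0, forall x y, J x -> J y -> J (x + y) & forall a x, J x -> J (a * x)].

Definition igen (S : set A) : set A :=
  [set x | forall J, is_ideal J -> S `<=` J -> J x].

Lemma igen_ideal S : is_ideal (igen S).
Proof.
split=> [J [? _ _] _ //|x y hx hy J hJ hS|a x hx J hJ hS].
  by case: (hJ) => _ h _; apply: h; [exact: hx|exact: hy].
by case: (hJ) => _ _ h; apply: h; exact: hx.
Qed.

Lemma sub_igen S : S `<=` igen S.
Proof. by move=> x hx J _; apply. Qed.

Lemma igen_min S J : is_ideal J -> S `<=` J -> igen S `<=` J.
Proof. by move=> hJ hS x; apply. Qed.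

Lemma igen_mono S S' : S `<=` S' -> igen S `<=` igen S'.
Proof. by move=> h; apply: igen_min; [exact: igen_ideal|move=> x /h/sub_igen]. Qed.

Lemma is_ideal0 J : is_ideal J -> J 0. Proof. by case. Qed.
Lemma is_idealD J x y : is_ideal J -> J x -> J y -> J (x + y).
Proof. by case=> _ h _; apply: h. Qed.
Lemma is_idealMr J a x : is_ideal J -> J x -> J (a * x).
Proof. by case=> _ _; apply. Qed.
Lemma is_idealMl J a x : is_ideal J -> J x -> J (x * a).
Proof. by rewrite mulrC; apply: is_idealMr. Qed.
Lemma is_idealN J x : is_ideal J -> J x -> J (- x).
Proof. by rewrite -mulN1r; apply: is_idealMr. Qed.
Lemma is_idealB J x y : is_ideal J -> J x -> J y -> J (x - y).
Proof. by move=> hJ hx hy; apply: is_idealD => //; apply: is_idealN. Qed.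
Lemma is_ideal_sum J (I : Type) (r : seq I) (P : pred I) (F : I -> A) :
  is_ideal J -> (forall i, P i -> J (F i)) -> J (\sum_(i <- r | P i) F i).
Proof.
move=> hJ hF; elim/big_ind: _ => //; first exact: is_ideal0.
by move=> *; apply: is_idealD.
Qed.

Lemma igen_seqP s x : igen [set` s] x ->
  exists c : nat -> A, x = \sum_(i < size s) c i * s`_i.
Proof.
apply: (igen_min (J := [set x | exists c : nat -> A, x = \sum_(i < size s) c i * s`_i])).
  split.
  - by exists (fun=> 0); rewrite big1 // => i _; rewrite mul0r.
  - move=> y z [c ->] [d ->]; exists (fun i => c i + d i).
    by rewrite -big_split; apply: eq_bigr => i _; rewrite mulrDl.
  - move=> a y [c ->]; exists (fun i => a * c i).
    by rewrite mulr_sumr; apply: eq_bigr => i _; rewrite mulrA.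
move=> y /= ys; have hi : (index y s < size s)%N by rewrite index_mem.
exists (fun i => (i == index y s)%:R).
rewrite (bigD1 (Ordinal hi)) //= eqxx mul1r nth_index // big1 ?addr0 // => i.
by rewrite -val_eqE /= => /negPf ->; rewrite mul0r.
Qed.

Definition fg J : Prop := exists s, J = igen [set` s].

Definition noetherian : Prop := forall J, is_ideal J -> fg J.

Lemma chain_stable (J : nat -> set A) : noetherian ->
  (forall n, is_ideal (J n)) -> (forall n, J n `<=` J n.+1) ->
  exists n, forall m, J m `<=` J n.
Proof.
move=> hN hJ hS.
have hle m n : (m <= n)%N -> J m `<=` J n.
  elim: n => [|n IH]; first by rewrite leqn0 => /eqP ->.
  rewrite leq_eqVlt => /orP [/eqP -> //|]; rewrite ltnS => /IH h x /h; exact: hS.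
pose U : set A := [set x | exists n, J n x].
have hU : is_ideal U.
  split=> [|x y [n hx] [m hy]|a x [n hx]].
  - by exists 0%N; apply: is_ideal0.
  - exists (maxn n m); apply: is_idealD => //.
      by apply: hle hx; rewrite leq_maxl.
    by apply: hle hy; rewrite leq_maxr.
  - by exists n; apply: is_idealMr.
have [s hs] := hN _ hU.
have [n hn] : exists n, [set` s] `<=` J n.
  have : [set` s] `<=` U by rewrite hs; apply: sub_igen.
  elim: s {hs} => [|x s IH] h; first by exists 0%N.
  have [n hn] := IH (fun y hy => h y (mem_behead (s := x :: s) hy)).
  have [m hm] := h x (mem_head x s).
  exists (maxn n m) => y /=; rewrite inE => /orP [/eqP ->|hy].
    by apply: hle hm; rewrite leq_maxr.
  by apply: (@hle n _ _ _ (hn y hy)); rewrite leq_maxl.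
exists n => m x hx; have : U x by exists m.
rewrite hs; exact: igen_min.
Qed.

(** Otherwise every member of [P] has a strictly larger one in [P], and choice produces a chain that
    violates [chain_stable]. *)
Lemma noetherian_max (P : set (set A)) : noetherian ->
  (forall J, P J -> is_ideal J) -> P !=set0 ->
  exists2 J, P J & forall I, P I -> J `<=` I -> I `<=` J.
Proof.
move=> hN hP [J0 hJ0]; apply: contrapT => hno.
have nxt J : P J -> exists I, P I /\ J `<=` I /\ ~ I `<=` J.
  move=> hJ; apply: contrapT => h; apply: hno; exists J => // I hI hJI.
  by apply: contrapT => hIJ; apply: h; exists I.
pose T := {J | P J}.
have /choice [f hf] : forall J : T, exists I : T, sval J `<=` sval I /\ ~ sval I `<=` sval J.
  by case=> J hJ; have [I [hI h]] := nxt J hJ; exists (exist _ I hI).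
pose g n := iter n f (exist _ J0 hJ0).
have [n hn] : exists n, forall m, sval (g m) `<=` sval (g n).
  apply: (@chain_stable (fun n => sval (g n)) hN) => n; last by case: (hf (g n)).
  exact: hP (svalP (g n)).
by case: (hf (g n)) => _ h; apply: h; apply: (hn n.+1).
Qed.

End Ideals.

Lemma noetherian_field (k : fieldType) : noetherian k.
Proof.
move=> J hJ; have [[x hx x0]|h] := pselect (exists2 x, J x & x != 0).
  exists [:: x]; rewrite eqEsubset; split; last first.
    by apply: igen_min => // y /=; rewrite inE => /eqP ->.
  move=> y _; rewrite -[y](mulfVK x0); apply: (is_idealMr _ (igen_ideal _)).
  by apply: sub_igen => /=; rewrite inE.
exists [::]; rewrite eqEsubset; split; last first.
  by apply: igen_min => // y /=; rewrite inE.
move=> y hy; have [->|y0] := eqVneq y 0; first exact: (is_ideal0 (igen_ideal _)).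
by case: h; exists y.
Qed.

Lemma noetherian_surj (A B : comNzRingType) (f : {rmorphism A -> B}) :
  (forall y, exists x, f x = y) -> noetherian A -> noetherian B.
Proof.
move=> fs hA J hJ.
have hI : is_ideal (f @^-1` J).
  split=> [|x y|a x] /=; rewrite ?rmorph0 ?rmorphD ?rmorphM.
  - exact: is_ideal0.
  - exact: is_idealD.
  - exact: is_idealMr.
have [s hs] := hA _ hI; exists (map f s); rewrite eqEsubset; split; last first.
  apply: igen_min => // y /= /mapP [x xs ->].
  by have : (f @^-1` J) x by rewrite hs; apply: sub_igen.
move=> y hy; have [x xy] := fs y; subst y.
have : (f @^-1` J) x by [].
rewrite hs => /igen_seqP [c ->]; rewrite rmorph_sum; apply: is_ideal_sum => [|i _].
  exact: igen_ideal.
rewrite rmorphM; apply: (is_idealMr _ (igen_ideal _)).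
by apply: sub_igen => /=; rewrite map_f // mem_nth.
Qed.

(** If [J] were not finitely generated, one could choose again and again an element of least size in
    [J] outside the ideal of its predecessors. The ideals of leading coefficients become stationary,
    so some leading coefficient is a combination of earlier ones, and cancelling it gives a smaller
    element outside. *)
Lemma hilbert_basis (A : comNzRingType) : noetherian A -> noetherian {poly A}.
Proof.
move=> hA J hJ; apply: contrapT => hno.
have nxt (s : seq {poly A}) : exists p, [set` s] `<=` J ->
    [/\ J p, ~ igen [set` s] p &
        forall q, J q -> ~ igen [set` s] q -> (size p <= size q)%N].
  have [hs|hs] := pselect ([set` s] `<=` J); last by exists 0.
  have [p0 hp0 np0] : exists2 p, J p & ~ igen [set` s] p.
    apply: contrapT => h; apply: hno; exists s; rewrite eqEsubset; split.
      by move=> p hp; apply: contrapT => np; apply: h; exists p.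
    exact: igen_min.
  pose Q n := `[< exists p, [/\ J p, ~ igen [set` s] p & size p = n] >].
  have exQ : exists n, Q n by exists (size p0); apply/asboolP; exists p0.
  case: (ex_minnP exQ) => m /asboolP [p [h1 h2 h3]] hm.
  exists p => _; split=> // q hq nq; rewrite h3; apply: hm; apply/asboolP.
  by exists q.
have /choice [f hf] := nxt.
pose st n := iter n (fun s => rcons s (f s)) [::].
have stS n : st n.+1 = rcons (st n) (f (st n)) by [].
have stJ n : [set` st n] `<=` J.
  elim: n => [|n IH] x //=; rewrite mem_rcons inE => /orP [/eqP ->|]; last exact: IH.
  by case: (hf _ IH).
pose P n := f (st n).
have PJ n : J (P n) by case: (hf _ (stJ n)).
have Pst i n : (i < n)%N -> P i \in st n.
  elim: n => // n IH; rewrite ltnS leq_eqVlt stS mem_rcons inE => /orP [/eqP ->|/IH ->].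
    by rewrite eqxx.
  by rewrite orbT.
have Pnst i n : (i <= n)%N -> ~ igen [set` st i] (P n).
  move=> hin; case: (hf _ (stJ n)) => _ h _; apply: contra_not h.
  apply: igen_mono => x /=; elim: n hin => [|n IH]; first by rewrite leqn0 => /eqP ->.
  rewrite leq_eqVlt => /orP [/eqP -> //|]; rewrite ltnS => /IH h /h.
  by rewrite mem_rcons inE => ->; rewrite orbT.
have Psz i n : (i <= n)%N -> (size (P i) <= size (P n))%N.
  by move=> hin; case: (hf _ (stJ i)) => _ _; apply=> //; apply: Pnst.
pose L n : set A := igen [set a | exists2 i, (i < n)%N & a = lead_coef (P i)].
have [n hn] : exists n, forall m, L m `<=` L n.
  apply: chain_stable => // n; first exact: igen_ideal.
  by apply: igen_mono => x [i hi ->]; exists i => //; apply: ltnW.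
have : L n (lead_coef (P n)) by apply: (hn n.+1); apply: sub_igen; exists n.
(* Combinations of leading coefficients are realized as the coefficient at a fixed index, which may
   be zero; this makes the condition on [a] an ideal. *)
suff H a : L n a -> exists2 q, igen [set` st n] q &
    (size q <= size (P n))%N /\ q`_(size (P n)).-1 = a.
  move=> /H [q hq [sq lq]].
  have P0 : P n != 0.
    apply/eqP => h; case: (Pnst n n (leqnn n)); rewrite h; exact: (is_ideal0 (igen_ideal _)).
  case: (hf _ (stJ n)) => _ nPn /(_ (P n - q)).
  have hqJ : J q by apply: igen_min hq; [|exact: stJ].
  move=> /(_ (is_idealB hJ (PJ n) hqJ)) hsz.
  have : (size (P n) <= size (P n - q)%R)%N.
    apply: hsz => h; apply: nPn; rewrite -[f _](subrK q); exact: is_idealD (igen_ideal _) h hq.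
  apply/negP; rewrite -ltnNge.
  have sP : (0 < size (P n))%N by rewrite size_poly_gt0.
  rewrite -(prednK sP) ltnS; apply/leq_sizeP => j hj.
  rewrite coefB; move: hj; rewrite leq_eqVlt => /orP [/eqP <-|hj].
    by rewrite lq lead_coefE subrr.
  have hj' : (size (P n) <= j)%N by rewrite -(prednK sP).
  by rewrite !nth_default ?subrr // (leq_trans sq).
apply: (igen_min (J := [set a | exists2 q, igen [set` st n] q &
    (size q <= size (P n))%N /\ q`_(size (P n)).-1 = a])).
  split.
- by exists 0; [exact: (is_ideal0 (igen_ideal _))|rewrite size_poly0 coef0].
- move=> x y [q hq [sq <-]] [r hr [sr <-]]; exists (q + r).
    exact: (is_idealD (igen_ideal _)).
  split; last by rewrite coefD.
  by apply: (leq_trans (size_polyD _ _)); rewrite geq_max sq.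
- move=> b x [q hq [sq <-]]; exists (b%:P * q).
    exact: (is_idealMr _ (igen_ideal _)).
  split; last by rewrite coefCM.
  by rewrite mul_polyC (leq_trans (size_scale_leq _ _)).
move=> x [i hi ->]; exists ('X^(size (P n) - size (P i)) * P i).
  by apply: (is_idealMr _ (igen_ideal _)); apply: sub_igen; apply: Pst.
have hle := Psz _ _ (ltnW hi).
have P0 : P i != 0.
  apply/eqP => h; case: (Pnst i i (leqnn i)); rewrite h; exact: (is_ideal0 (igen_ideal _)).
have sP : (0 < size (P i))%N by rewrite size_poly_gt0.
split.
  apply: (leq_trans (size_polyMleq _ _)); rewrite size_polyXn.
  lia.
rewrite coefXnM ifF; last by apply/negbTE; lia.
by rewrite lead_coefE; congr (_`_ _); lia.
Qed.

Section Powers.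
Variable A : comNzRingType.
Implicit Types (J I m : set A).

Fixpoint ipow m (n : nat) : set A :=
  if n is n'.+1 then igen [set z | exists x y, [/\ m x, ipow m n' y & z = x * y]]
  else setT.

Lemma ipow_ideal m n : is_ideal (ipow m n).
Proof. by case: n => [|n] //=; exact: igen_ideal. Qed.

Lemma ipow_step m n x y : m x -> ipow m n y -> ipow m n.+1 (x * y).
Proof. by move=> hx hy; apply: sub_igen; exists x, y. Qed.

Lemma ipow_ind m n J : is_ideal J ->
  (forall x y, m x -> ipow m n y -> J (x * y)) -> ipow m n.+1 `<=` J.
Proof. by move=> hJ h; apply: igen_min => // z [x [y [hx hy ->]]]; apply: h. Qed.

Lemma ipow_mul m i j x y : ipow m i x -> ipow m j y -> ipow m (i + j) (x * y).
Proof.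
elim: i x => [|i IH] x hx hy; first by rewrite add0n; exact: (is_idealMr x (ipow_ideal m j) hy).
rewrite addSn /=.
apply: (igen_min (J := [set x | igen _ (x * y)])) hx => [|z [a [b [ha hb ->]]]].
  split=> [|u v hu hv|a u hu] /=.
  - by rewrite mul0r; apply: (is_ideal0 (igen_ideal _)).
  - by rewrite mulrDl; apply: (is_idealD (igen_ideal _)).
  - by rewrite -mulrA; apply: (is_idealMr _ (igen_ideal _)).
by apply: sub_igen; exists a, (b * y); split; rewrite ?mulrA //; apply: IH.
Qed.

Lemma ipow1 m x : m x -> ipow m 1 x.
Proof. by move=> hx; apply: sub_igen; exists x, 1; rewrite mulr1. Qed.

Lemma ipow_leq m i j : (i <= j)%N -> ipow m j `<=` ipow m i.
Proof.
elim: j i => [|j IH] [|i] //= hij.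
apply: igen_mono => z [x [y [hx hy ->]]]; exists x, y; split=> //.
exact: IH hy.
Qed.

Lemma ipow_exp m n x : m x -> ipow m n (x ^+ n).
Proof.
move=> hx; elim: n => // n IH; rewrite exprS -add1n; apply: ipow_mul => //.
exact: ipow1.
Qed.

Lemma ipow_sub_ideal m n : is_ideal m -> ipow m n.+1 `<=` m.
Proof.
by move=> hm; apply: igen_min => // z [x [y [hx _ ->]]]; apply: is_idealMl.
Qed.

Lemma ipow_prod m (I : Type) (r : seq I) (f : I -> A) (a : I -> nat) :
  (forall i, m (f i)) ->
  ipow m (\sum_(i <- r) a i) (\prod_(i <- r) f i ^+ a i).
Proof.
move=> hf; elim: r => [|i r IH]; first by rewrite !big_nil.
by rewrite !big_cons; apply: ipow_mul => //; apply: ipow_exp.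
Qed.

Lemma ipow_nil (s : seq A) J : is_ideal J ->
  (forall a, a \in s -> exists n, J (a ^+ n)) ->
  exists n, ipow (igen [set` s]) n `<=` J.
Proof.
move=> hJ; elim: s => [|a s IH] hs.
  exists 1%N; apply: igen_min => // z [x [y [hx _ ->]]]; apply: is_idealMl => //.
  by apply: igen_min hx => // t; rewrite /= inE.
have [n hn] := IH (fun b hb => hs b (mem_behead (s := a :: s) hb)).
have [k hk] := hs a (mem_head _ _).
(* Separating the generator [a]: the N-th power of the full ideal consists of combinations of a^i
   times the (N - i)-th power of the ideal of the others. For N = k + n either i >= k or N - i >=
   n. *)
pose E N := igen [set z | exists i y, [/\ (i <= N)%N, ipow (igen [set` s]) (N - i) y & z = a ^+ i * y]].
have hE N : ipow (igen [set` a :: s]) N `<=` E N.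
  elim: N => [|N IHN].
    by move=> x _; apply: sub_igen; exists 0%N, x; rewrite mul1r.
  apply: igen_min; first exact: igen_ideal.
  move=> z [x [y [hx hy ->]]].
  have [c [x' [hx' ->]]] : exists c x', igen [set` s] x' /\ x = c * a + x'.
    apply: (igen_min (J := [set x | exists c x', igen [set` s] x' /\ x = c * a + x'])) hx.
      split.
      - by exists 0, 0; rewrite mul0r addr0; split=> //; exact: (is_ideal0 (igen_ideal _)).
      - move=> u v [c [x1 [h1 ->]]] [d [x2 [h2 ->]]]; exists (c + d), (x1 + x2).
        by split; [exact: (is_idealD (igen_ideal _))|ring].
      - move=> b u [c [x1 [h1 ->]]]; exists (b * c), (b * x1).
        by split; [exact: (is_idealMr _ (igen_ideal _))|ring].
    move=> t /=; rewrite inE => /orP [/eqP ->|ht].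
      by exists 1, 0; split; [exact: (is_ideal0 (igen_ideal _))|ring].
    by exists 0, t; split; [exact: sub_igen|ring].
  apply: (igen_min (J := [set y | E N.+1 ((c * a + x') * y)])) (IHN _ hy).
    split=> [|u v hu hv|b u hu] /=.
    - by rewrite mulr0; exact: (is_ideal0 (igen_ideal _)).
    - by rewrite mulrDr; exact: (is_idealD (igen_ideal _)).
    - by rewrite mulrCA; exact: (is_idealMr _ (igen_ideal _)).
  move=> u [i [w [hi hw ->]]] /=.
  have -> : (c * a + x') * (a ^+ i * w) = c * (a ^+ i.+1 * w) + a ^+ i * (x' * w).
    by rewrite exprS; ring.
  apply: (is_idealD (igen_ideal _)).
    by apply: (is_idealMr _ (igen_ideal _)); apply: sub_igen; exists i.+1, w; rewrite subSS.
  apply: sub_igen; exists i, (x' * w); split=> //; first exact: leqW.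
  by rewrite subSn // -add1n; apply: ipow_mul => //; apply: ipow1.
exists (k + n)%N => x /hE; apply: igen_min => // z [i [y [hi hy ->]]].
have [hki|hki] := leqP k i.
  by rewrite -(subnK hki) exprD -mulrA mulrCA; apply: is_idealMl.
by apply: is_idealMr => //; apply: hn; apply: ipow_leq hy; lia.
Qed.

(* Take [J] maximal with [J ∩ (f) = m f]. For [a] in [m] the chain [(J : a^k)] is
   stationary, which forces [a^k] into [J]; hence [J] contains a power of [m]. *)
Lemma krull m I f : noetherian A -> is_ideal m -> is_ideal I ->
  (forall n, exists2 u, ipow m n u & I (f - u)) -> exists2 a, m a & I (f - a * f).
Proof.
move=> hN hm hI hf.
pose P := [set J | [/\ is_ideal J, I `<=` J &
  forall x, J (x * f) <-> exists2 a, m a & I (x * f - a * f)]].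
have [||J [hJ IJ hJf] hmax] := noetherian_max (P := P) hN.
- by move=> J [].
- exists [set z | exists2 a, m a & I (z - a * f)]; split=> //.
    split=> [|x y [a ha hx] [b hb hy]|c x [a ha hx]] /=.
    - by exists 0; [exact: is_ideal0|rewrite mul0r subr0; exact: is_ideal0].
    - exists (a + b); first exact: is_idealD.
      by rewrite mulrDl opprD addrACA; apply: is_idealD.
    - exists (c * a); first exact: is_idealMr.
      by rewrite -mulrA -mulrBr; apply: is_idealMr.
  by move=> x Ix; exists 0; [exact: is_ideal0|rewrite mul0r subr0].
have hmJ a : m a -> exists n, J (a ^+ n).
  move=> ha; pose C k : set A := [set x | J (a ^+ k * x)].
  have [k hk] : exists n, forall i, C i `<=` C n.
    apply: chain_stable => // n.
      split=> [|x y|c x]; rewrite /C /= ?mulr0 ?mulrDr.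
      - by move=> *; exact: is_ideal0.
      - exact: is_idealD.
      - by rewrite mulrCA; exact: is_idealMr.
    by move=> x; rewrite /C /= exprS -mulrA; apply: is_idealMr.
  exists k.
  pose J' : set A := [set z | exists j b, J j /\ z = j + a ^+ k * b].
  have JJ' : J `<=` J' by move=> x hx; exists x, 0; rewrite mulr0 addr0.
  suff hJ' : P J'.
    apply: (hmax J') => //.
    by exists 0, 1; split; [exact: is_ideal0|rewrite add0r mulr1].
  split.
  - split=> [|x y [j [b [hj ->]]] [j' [b' [hj' ->]]]|c x [j [b [hj ->]]]].
    - by exists 0, 0; split; [exact: is_ideal0|ring].
    - by exists (j + j'), (b + b'); split; [exact: is_idealD|ring].
    - by exists (c * j), (c * b); split; [exact: is_idealMr|ring].
  - by move=> x /IJ /JJ'.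
  move=> x; split=> [[j [b [hj e]]]|/hJf]; last exact: JJ'.
  apply/hJf; rewrite e; apply: is_idealD => //; apply: (hk k.+1).
  rewrite /C /= exprS.
  have -> : a * a ^+ k * b = a * x * f - a * j.
    by rewrite -[a * x * f]mulrA e; ring.
  apply: is_idealB => //; last exact: is_idealMr.
  by apply/hJf; exists (a * x); [exact: is_idealMl|rewrite subrr; exact: is_ideal0].
have [s hs] := hN _ hm.
have [n hn] : exists n, ipow m n `<=` J.
  rewrite hs; apply: ipow_nil => // a ha; apply: hmJ; rewrite hs; exact: sub_igen.
have [u /hn Ju /IJ Jfu] := hf n.
have : J (1 * f) by rewrite mul1r -(subrK u f); apply: is_idealD.
by move=> /hJf; rewrite mul1r.
Qed.

End Powers.

Arguments ipow : simpl never.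

Section Nullstellensatz.
Variable k : closedFieldType.

Definition prime_ideal (A : comNzRingType) (P : set A) : Prop :=
  [/\ is_ideal P, ~ P 1 & forall x y, P (x * y) -> P x \/ P y].

(** The Nullstellensatz in a form that passes from [A] to [{poly A}]: an element outside a prime
    ideal is nonzero at some [k]-point of its zero locus. Here [c] is the structure map of the
    algebra. *)
Definition jacobson (A : comNzRingType) (c : {rmorphism k -> A}) : Prop :=
  forall P, prime_ideal P -> forall f, ~ P f ->
  exists chi : {rmorphism A -> k},
    [/\ forall a, chi (c a) = a, forall x, P x -> chi x = 0 & chi f != 0].

Lemma jacobson_field : jacobson (idfun : {rmorphism k -> k}).
Proof.
move=> P [hP P1 _] f nf; exists idfun; split=> // [x hx|].
  apply/eqP; apply: contraT => x0; case: P1.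
  by rewrite -(mulVf x0); apply: is_idealMr.
by apply/eqP => /= f0; apply: nf; rewrite f0; apply: is_ideal0.
Qed.

Section Step.
Variables (A : comNzRingType) (c : {rmorphism k -> A}).
Hypothesis hA : jacobson c.
Variables (P : set {poly A}) (f : {poly A}).
Hypotheses (hP : prime_ideal P) (nf : ~ P f).

Let Pi : is_ideal P. Proof. by case: hP. Qed.
Let nP1 : ~ P 1. Proof. by case: hP. Qed.
Let PM x y : P (x * y) -> P x \/ P y. Proof. by case: hP => _ _; apply. Qed.
Let P' : set A := [set a | P a%:P].

Let P'ideal : is_ideal P'.
Proof.
split=> [|x y|a x]; rewrite /P' /= ?polyC0 ?polyCD ?polyCM.
- exact: is_ideal0.
- exact: is_idealD.
- exact: is_idealMr.
Qed.

Let P'prime : prime_ideal P'.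
Proof.
split=> //.
by move=> x y; rewrite /P' /= polyCM => /PM.
Qed.

Let coefP (h : {poly A}) : (forall i, P' h`_i) -> P h.
Proof.
move=> hh; rewrite -[h]coefK poly_def; apply: is_ideal_sum => // i _.
by rewrite -mul_polyC; apply: is_idealMl => //; apply: hh.
Qed.

Let minimal_elt (I : set {poly A}) : is_ideal I -> P `<=` I ->
  (exists2 h, I h & exists i, ~ P' h`_i) ->
  exists q, [/\ I q, ~ P' (lead_coef q) &
    forall h, I h -> (size h < size q)%N -> forall i, P' h`_i].
Proof.
move=> hI hPI [h0 hh0 [i0 ni0]].
pose Q n := `[< exists h, [/\ I h, exists i, ~ P' h`_i & size h = n] >].
have exQ : exists n, Q n by exists (size h0); apply/asboolP; exists h0; split=> //; exists i0.
case: (ex_minnP exQ) => m /asboolP [q [Iq [i ni] sq]] hm.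
have hmin h : I h -> (size h < size q)%N -> forall i, P' h`_i.
  move=> Ih sh j; apply: contrapT => nj.
  have /hm : Q (size h) by apply/asboolP; exists h; split=> //; exists j.
  by rewrite -sq leqNgt sh.
exists q; split=> // hl.
have hid : i != (size q).-1 by apply/eqP => e; apply: ni; rewrite e -lead_coefE.
have q0 : (0 < size q)%N.
  rewrite lt0n; apply/eqP => /eqP; rewrite size_poly_eq0 => /eqP q0.
  by apply: ni; rewrite q0 coef0; apply: is_ideal0.
have : P' (q - lead_coef q *: 'X^((size q).-1))`_i.
  apply: hmin.
    apply: is_idealB => //; apply: hPI.
    by rewrite -mul_polyC; apply: is_idealMl.
  rewrite -[X in (_ < X)%N](prednK q0) ltnS; apply/leq_sizeP => j.
  rewrite leq_eqVlt => /orP [/eqP <-|hj].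
    by rewrite coefB coefZ coefXn eqxx mulr1 lead_coefE subrr.
  rewrite coefB coefZ coefXn gtn_eqF // mulr0 subr0 nth_default //.
  by rewrite -(prednK q0).
by rewrite coefB coefZ coefXn (negPf hid) mulr0 subr0.
Qed.

Let pseudo_div (q h : {poly A}) : q != 0 ->
  exists e u r, lead_coef q ^+ e *: h = q * u + r /\ (size r < size q)%N.
Proof.
move=> q0; have sq : (0 < size q)%N by rewrite size_poly_gt0.
have [n] := ubnP (size h); elim: n h => // n IH h; rewrite ltnS => hn.
have [hs|hs] := ltnP (size h) (size q).
  by exists 0%N, 0, h; rewrite scale1r mulr0 add0r.
have h0 : (0 < size h)%N by apply: leq_trans hs.
pose h' := lead_coef q *: h - lead_coef h *: (q * 'X^(size h - size q)).
have sh' : (size h' < n)%N.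
  apply: leq_trans hn; rewrite -[X in (_ < X)%N](prednK h0) ltnS; apply/leq_sizeP => j.
  rewrite coefB !coefZ coefMXn leq_eqVlt => /orP [/eqP <-|hj].
    rewrite ifF; last by apply/negbTE; lia.
    have -> : ((size h).-1 - (size h - size q) = (size q).-1)%N by lia.
    by rewrite -!lead_coefE mulrC subrr.
  rewrite (@nth_default _ _ _ j); last by rewrite -(prednK h0).
  rewrite mulr0 ifF; last by apply/negbTE; lia.
  rewrite nth_default ?mulr0 ?subrr // leq_subRL; last by apply: leq_trans (leq_subr _ _) _; rewrite -(prednK h0).
  by rewrite subnK // -(prednK h0).
have [e [u [r [e1 sr]]]] := IH h' sh'.
exists e.+1, (u + lead_coef q ^+ e *: (lead_coef h *: 'X^(size h - size q))), r.
split=> //; rewrite exprSr -scalerA.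
have -> : lead_coef q *: h = h' + lead_coef h *: (q * 'X^(size h - size q)).
  by rewrite subrK.
by rewrite scalerDr e1 mulrDr addrAC; congr (_ + _); rewrite -!scalerAr.
Qed.

(** Let P' be the contraction of P to [A]. If P is extended from P', a point of P' at which a
    coefficient of f survives is combined with a non-root of the specialized f. Otherwise an element
    q of P of least size with a coefficient outside P' plays the role of a minimal polynomial of X.
    The ideal (f) + P then contains a constant g outside P', and a point of P' at which g and the
    leading coefficient of q are nonzero extends to a root of q. *)
Lemma jacobson_step : exists chi : {rmorphism {poly A} -> k},
    [/\ forall a, chi (c a)%:P = a, forall x, P x -> chi x = 0 & chi f != 0].
Proof.
have lift (ch : {rmorphism A -> k}) (b : k) :
    (forall a, ch (c a) = a) ->
    exists chi : {rmorphism {poly A} -> k},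
      (forall a, chi (c a)%:P = a) /\ (forall h, chi h = (map_poly ch h).[b]).
  move=> hch; exists (horner_eval b \o map_poly ch); split=> [a|h] //=.
  by rewrite /horner_eval map_polyC hornerC; apply: hch.
have [hall|hex] := pselect (forall h, P h -> forall i, P' h`_i).
  have [i ni] : exists i, ~ P' f`_i.
    by apply: contrapT => h; apply/nf/coefP => i; apply: contrapT => ni; apply: h; exists i.
  have [ch [ch1 ch2 ch3]] := hA P'prime ni.
  have : map_poly ch f != 0.
    by apply/eqP => /(congr1 (fun p : {poly k} => p`_i)); rewrite coef_map coef0; apply/eqP.
  move=> /closed_nonrootP [b hb].
  have [chi [h1 h2]] := lift ch b ch1; exists chi; split=> // [x /hall hx|]; last by rewrite h2.
  by rewrite h2 [map_poly _ _](_ : _ = 0) ?horner0 //; apply/polyP => j; rewrite coef_map coef0 /= ch2.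
have {hex} hex : exists2 h, P h & exists i, ~ P' h`_i.
  apply: contrapT => h; apply: hex => g hg i; apply: contrapT => ni.
  by apply: h; exists g => //; exists i.
have [q [Pq lq qmin]] := minimal_elt Pi (fun x h => h) hex.
have q0 : q != 0 by apply/eqP => h; apply: lq; rewrite h lead_coef0; apply: is_ideal0.
have sq : (1 < size q)%N.
  rewrite ltnNge; apply/negP => /size1_polyC e.
  by apply: lq; rewrite e lead_coefC /P' /= -e.
pose I : set {poly A} := [set z | exists u v, P v /\ z = u * f + v].
have hI : is_ideal I.
  split=> [|x y [u [v [hv ->]]] [u' [v' [hv' ->]]]|a x [u [v [hv ->]]]].
  - by exists 0, 0; split; [exact: is_ideal0|ring].
  - by exists (u + u'), (v + v'); split; [exact: is_idealD|ring].
  - by exists (a * u), (a * v); split; [exact: is_idealMr|ring].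
have PI : P `<=` I by move=> x hx; exists 0, x; split=> //; ring.
have If : I f by exists 1, 0; split; [exact: is_ideal0|ring].
have [r [Ir lr rmin]] := minimal_elt hI PI (let: ex_intro2 h a b := hex in ex_intro2 _ _ h (PI _ a) b).
have r0 : r != 0 by apply/eqP => h; apply: lr; rewrite h lead_coef0; apply: is_ideal0.
have nPl e (h : {poly A}) (l : A) : ~ P' l -> ~ P h -> ~ P (l ^+ e *: h).
  move=> nl nh; rewrite -mul_polyC; elim: e => [|e IH]; first by rewrite mul1r.
  by rewrite exprS polyCM -mulrA => /PM [].
have nPr : ~ P r.
  move=> Pr; have [e [u [t [e1 st]]]] := pseudo_div f r0.
  apply: (nPl e f _ lr nf); rewrite e1; apply: is_idealD => //; first exact: is_idealMl.
  apply: coefP; apply: rmin => //.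
  have -> : t = lead_coef r ^+ e *: f - r * u by rewrite e1; ring.
  apply: is_idealB => //; last exact: is_idealMl.
  by rewrite -mul_polyC; apply: is_idealMr.
(* By minimality r divides q up to leading coefficients, with a cofactor u in P. If r had positive
   degree, u cut off after its last coefficient outside P' would be an element of P smaller than q.
   So all coefficients of u lie in P', contrary to the leading coefficient of q. *)
have [g rg] : exists g, r = g%:P.
  have [e [u [t [e1 st]]]] := pseudo_div q r0.
  have Pt : P t.
    apply: coefP; apply: rmin => //.
    have -> : t = lead_coef r ^+ e *: q - r * u by rewrite e1; ring.
    apply: is_idealB => //; last exact: is_idealMl.
    by rewrite -mul_polyC; apply: is_idealMr => //; apply: PI.
  have Pru : P (r * u).
    have -> : r * u = lead_coef r ^+ e *: q - t by rewrite e1; ring.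
    by apply: is_idealB => //; rewrite -mul_polyC; apply: is_idealMr.
  have Pu : P u by case: (PM Pru).
  exists r`_0; apply: size1_polyC; rewrite leqNgt; apply/negP => sr.
  have nl : ~ P' (lead_coef r ^+ e * lead_coef q).
    case: P'prime => _ n1 hPM; elim: e {e1} => [|e IH]; first by rewrite mul1r.
    by rewrite exprS -mulrA => /hPM [].
  apply: nl.
  have -> : lead_coef r ^+ e * lead_coef q = (r * u + t)`_(size q).-1.
    by rewrite -e1 coefZ lead_coefE.
  have hu i : P' u`_i.
    apply: contrapT => ni.
    pose Q j := `[< ~ P' u`_j >].
    have exQ : exists j, Q j by exists i; apply/asboolP.
    have Qb j : Q j -> (j <= size u)%N.
      move=> /asboolP nj; rewrite leqNgt; apply/negP => hj; apply: nj.
      by rewrite nth_default ?(ltnW hj) //; apply: is_ideal0.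
    case: (ex_maxnP exQ Qb) => j /asboolP nj jmax.
    have hgt i' : (j < i')%N -> P' u`_i'.
      by move=> hi; apply: contrapT => n'; move: hi; rewrite ltnNge jmax //; apply/asboolP.
    have nj' : ~ P' (r * u)`_((size r).-1 + j).
      have hs : ((size r).-1 < ((size r).-1 + j).+1)%N by lia.
      rewrite coefM (bigD1 (Ordinal hs)) //= addKn -lead_coefE => h.
      have : P' (lead_coef r * u`_j).
        rewrite -(addrK (\sum_(i' < ((size r).-1 + j).+1 | i' != Ordinal hs) r`_i' * u`_((size r).-1 + j - i')) (lead_coef r * u`_j)).
        apply: is_idealB => //; apply: is_ideal_sum => // i'; rewrite -val_eqE /= => hi'.
        have [hlt|hge] := ltnP i' (size r).-1.
          by apply: is_idealMr => //; apply: hgt; rewrite ltn_subRL ltn_add2r.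
        have hi2 : (size r <= i')%N.
          by apply: leq_trans (leqSpred _) _; rewrite ltn_neqAle eq_sym hi' hge.
        by rewrite [r`_i']nth_default // mul0r; apply: is_ideal0.
      by case: P'prime => _ _ hPM /hPM [].
    have hjq : ((size r).-1 + j < size q)%N.
      rewrite ltnNge; apply/negP => hge; apply: nj'.
      have -> : r * u = lead_coef r ^+ e *: q - t by rewrite e1; ring.
      rewrite coefB coefZ [q`__]nth_default // mulr0 sub0r; apply: is_idealN => //.
      have [stq|stq] := ltnP (size t) (size q); first exact: qmin.
      have [hh|hh] := ltnP ((size r).-1 + j) (size t).
        by move: (rmin t); move/(_ (PI _ Pt) st ((size r).-1 + j)%N).
      by rewrite nth_default //; apply: is_ideal0.
    apply: nj.
    have -> : u`_j = (take_poly j.+1 u)`_j by rewrite coef_take_poly ltnS leqnn.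
    apply: qmin.
      have -> : take_poly j.+1 u = u - (u - take_poly j.+1 u) by ring.
      apply: is_idealB => //; apply: coefP => i'; rewrite coefB coef_take_poly ltnS.
      by case: leqP; [rewrite subrr => _; exact: is_ideal0|rewrite subr0 => /hgt].
    by apply: leq_ltn_trans (size_take_poly _ _) _; lia.
  have hq : P' ((r * u)`_(size q).-1).
    by rewrite coefM; apply: is_ideal_sum => // i _; apply: is_idealMr.
  rewrite coefD; apply: is_idealD => //.
  exact: (rmin t (PI _ Pt) st).
have ng : ~ P' (g * lead_coef q).
  case: P'prime => _ _ hPM /hPM [] //.
  by move=> h; apply: nPr; rewrite rg.
have [ch [ch1 ch2 ch3]] := hA P'prime ng.
move: ch3; rewrite rmorphM mulf_eq0 negb_or => /andP [chg chl].
have : size (map_poly ch q) != 1%N.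
  by rewrite size_map_poly_id0 //; lia.
move=> /closed_rootP [b /eqP hb].
have [chi [h1 h2]] := lift ch b ch1.
have chiP x : P x -> chi x = 0.
  move=> Px; have [e [u [t [e1 st]]]] := pseudo_div x q0.
  have Pt : P t.
    have -> : t = lead_coef q ^+ e *: x - q * u by rewrite e1; ring.
    apply: is_idealB => //; last exact: is_idealMl.
    by rewrite -mul_polyC; apply: is_idealMr.
  have : chi (lead_coef q ^+ e *: x) = 0.
    rewrite e1 rmorphD rmorphM (h2 q) hb mul0r add0r h2.
    rewrite [map_poly _ _](_ : _ = 0) ?horner0 //; apply/polyP => j.
    by rewrite coef_map coef0 /= ch2 //; apply: qmin.
  rewrite -mul_polyC rmorphM (h2 (_%:P)) map_polyC hornerC /= rmorphXn => /eqP.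
  by rewrite mulf_eq0 expf_eq0 (negPf chl) andbF => /eqP.
exists chi; split=> //; apply/eqP => cf.
case: Ir => u [v [Pv e]]; move: chg; rewrite -[ch g]/((fun x => x) (ch g)).
have -> : ch g = chi r by rewrite rg h2 map_polyC hornerC.
by rewrite e rmorphD rmorphM cf mulr0 add0r chiP // eqxx.
Qed.

End Step.

Lemma jacobson_poly (A : comNzRingType) (c : {rmorphism k -> A}) :
  jacobson c -> jacobson (polyC \o c : {rmorphism k -> {poly A}}).
Proof. by move=> hA P hP f nf; exact: (jacobson_step hA hP nf). Qed.

Lemma prime_avoiding (A : comNzRingType) (J : set A) (f : A) : noetherian A ->
  is_ideal J -> (forall n, ~ J (f ^+ n)) ->
  exists P, [/\ prime_ideal P, J `<=` P & ~ P f].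
Proof.
move=> hN hJ hf.
pose Q := [set I | [/\ is_ideal I, J `<=` I & forall n, ~ I (f ^+ n)]].
have [|P [hP JP nP] hmax] := noetherian_max (P := Q) hN (fun I h => let: And3 a _ _ := h in a).
  by exists J; split.
exists P; split=> //; last by rewrite -[f]expr1.
split=> //; first by move=> h; apply: (nP 0%N); rewrite expr0.
pose ad x : set A := [set z | exists a b, P b /\ z = a * x + b].
have adQ x : ~ P x -> exists n, ad x (f ^+ n).
  move=> nx; apply: contrapT => h; apply: nx; apply: (hmax (ad x)).
  - split.
    + split=> [|y z [u [v [hv ->]]] [u' [v' [hv' ->]]]|a y [u [v [hv ->]]]].
      * by exists 0, 0; split; [exact: is_ideal0|ring].
      * by exists (u + u'), (v + v'); split; [exact: is_idealD|ring].
      * by exists (a * u), (a * v); split; [exact: is_idealMr|ring].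
    + by move=> y /JP hy; exists 0, y; split=> //; ring.
    + by move=> n hn; apply: h; exists n.
  - by move=> y hy; exists 0, y; split=> //; ring.
  - by exists 1, 0; split; [exact: is_ideal0|ring].
move=> x y hxy; have [Px|Px] := pselect (P x); first by left.
have [Py|Py] := pselect (P y); first by right.
have [n [a [b [hb e]]]] := adQ x Px; have [m [a' [b' [hb' e']]]] := adQ y Py.
case: (nP (n + m)%N); rewrite exprD e e'.
have -> : (a * x + b) * (a' * y + b') = a * a' * (x * y) + (a * x + b) * b' + a' * y * b by ring.
by apply: is_idealD => //; [apply: is_idealD => //|]; apply: is_idealMr.
Qed.

Theorem nullstellensatz (A : comNzRingType) (c : {rmorphism k -> A}) (J : set A) (f : A) :
  noetherian A -> jacobson c -> is_ideal J ->
  (forall chi : {rmorphism A -> k}, (forall a, chi (c a) = a) ->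
     (forall x, J x -> chi x = 0) -> chi f = 0) ->
  exists n, J (f ^+ n).
Proof.
move=> hN hA hJ hchi; apply: contrapT => h.
have [P [hP JP nf]] := prime_avoiding hN hJ (fun n hn => h (ex_intro _ n hn)).
have [chi [h1 h2 h3]] := hA P hP f nf.
by move: h3; rewrite hchi ?eqxx // => x /JP /h2.
Qed.

(* A polynomial ring in [n] variables, given by its universal property. *)
Lemma free_algebra (n : nat) : exists (A : comNzRingType) (c : {rmorphism k -> A}),
  [/\ noetherian A, jacobson c &
   exists x : 'I_n -> A, forall (B : comNzRingType) (d : {rmorphism k -> B}) (y : 'I_n -> B),
     exists psi : {rmorphism A -> B}, [/\ forall a, psi (c a) = d a,
       forall i, psi (x i) = y i &
       forall S : set B, (forall a, S (d a)) -> (forall i, S (y i)) ->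
         (forall u v, S u -> S v -> S (u + v)) -> (forall u v, S u -> S v -> S (u * v)) ->
         forall a, S (psi a)]].
Proof.
elim: n => [|n [A [c [hN hA [x hx]]]]].
  exists k, idfun; split; [exact: noetherian_field|exact: jacobson_field|].
  exists (fun _ => 0) => B d y; exists d; split=> //; first by case.
exists {poly A}, (polyC \o c); split; [exact: hilbert_basis|exact: jacobson_poly|].
exists (fun i => if unlift ord0 i is Some j then (x j)%:P else 'X) => B d y.
have [psi [h1 h2 h3]] := hx B d (fun i => y (lift ord0 i)).
have cpsi : commr_rmorph psi (y ord0) by move=> a; apply: mulrC.
exists (horner_morph cpsi); split=> [a|i|S hd hy hD hM a] /=.
- by rewrite horner_morphC.
- by case: unliftP => [j ->|->]; rewrite ?horner_morphC ?horner_morphX.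
have hpsi b : S (psi b) by apply: h3.
elim/poly_ind: a => [|p b IH]; first by rewrite rmorph0 -(rmorph0 d).
rewrite rmorphD rmorphM /= horner_morphX horner_morphC.
by apply: hD => //; apply: hM.
Qed.

End Nullstellensatz.

Section IdealSum.
Variable A : comNzRingType.
Implicit Types I J : set A.

Definition isum I J : set A := [set z | exists x y, [/\ I x, J y & z = x + y]].

Lemma isum_ideal I J : is_ideal I -> is_ideal J -> is_ideal (isum I J).
Proof.
move=> hI hJ; split=> [|u v [x [y [hx hy ->]]] [x' [y' [hx' hy' ->]]]|a u [x [y [hx hy ->]]]].
- by exists 0, 0; split; [exact: is_ideal0|exact: is_ideal0|ring].
- by exists (x + x'), (y + y'); split; [exact: is_idealD|exact: is_idealD|ring].
- by exists (a * x), (a * y); split; [exact: is_idealMr|exact: is_idealMr|ring].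
Qed.

Lemma isum_l I J x : is_ideal J -> I x -> isum I J x.
Proof. by move=> hJ hx; exists x, 0; rewrite addr0; split=> //; apply: is_ideal0. Qed.

Lemma isum_r I J x : is_ideal I -> J x -> isum I J x.
Proof. by move=> hI hx; exists 0, x; rewrite add0r; split=> //; apply: is_ideal0. Qed.

Lemma isum_mono I I' J : I `<=` I' -> isum I J `<=` isum I' J.
Proof. by move=> h z [x [y [/h hx hy ->]]]; exists x, y. Qed.

Lemma isum_powM m I i j x y : is_ideal I -> isum (ipow m i) I x ->
  isum (ipow m j) I y -> isum (ipow m (i + j)) I (x * y).
Proof.
move=> hI [a [b [ha hb ->]]] [a' [b' [ha' hb' ->]]].
exists (a * a'), (a * b' + b * (a' + b')); split; [exact: ipow_mul| |ring].
by apply: is_idealD => //; [apply: is_idealMr|apply: is_idealMl].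
Qed.

Lemma isum_powX m I i n x : is_ideal I -> isum (ipow m i) I x ->
  isum (ipow m (i * n)) I (x ^+ n).
Proof.
move=> hI hx; elim: n => [|n IH]; last by rewrite exprS mulnS; apply: isum_powM.
by rewrite muln0; apply: isum_l.
Qed.

End IdealSum.

(** * Smoothness at a point in characteristic p, by p-bases *)

Section Smooth.
Variables (k : closedFieldType) (p : nat).
Hypothesis char_k : p \in [pchar k].
Variables (A : comNzRingType) (c : {rmorphism k -> A}) (e : {rmorphism A -> k}).
Hypothesis ec : forall a, e (c a) = a.
Hypothesis hN : noetherian A.
Variables (r : nat) (g : 'I_r -> A).
Hypothesis hgen : forall S : set A, (forall a, S (c a)) -> (forall i, S (g i)) ->
  (forall u v, S u -> S v -> S (u + v)) -> (forall u v, S u -> S v -> S (u * v)) ->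
  forall a, S a.

Let m : set A := [set x | e x = 0].

Lemma max_ideal : is_ideal m.
Proof.
split=> [|x y|a x]; rewrite /m /= ?rmorph0 ?rmorphD ?rmorphM //.
  by move=> -> ->; rewrite addr0.
by move=> ->; rewrite mulr0.
Qed.

Variables (d : nat) (x : 'I_d -> A) (D : 'I_d -> A -> A).
Hypothesis xm : forall i, e (x i) = 0.
Hypothesis DD : forall i u v, D i (u + v) = D i u + D i v.
Hypothesis DM : forall i u v, D i (u * v) = D i u * v + u * D i v.
Hypothesis Dc : forall i a, D i (c a) = 0.
Hypothesis Dx : forall i j, e (D i (x j)) = (i == j)%:R.

Let prime_p : prime p. Proof. by case/andP: char_k. Qed.
Let p_gt0 : (0 < p)%N. Proof. exact: prime_gt0. Qed.

Let char_A : p \in [pchar A]. Proof. exact: (rmorph_pchar c). Qed.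

Let Fr : {rmorphism A -> A} := pFrobenius_aut char_A.

Let FrE u : Fr u = u ^+ p. Proof. exact: pFrobenius_autE. Qed.

Let exprDp u v : (u + v) ^+ p = u ^+ p + v ^+ p :> A.
Proof. by rewrite -!FrE rmorphD. Qed.

Let expr_sump (T : Type) (s : seq T) (P : pred T) (F : T -> A) :
  (\sum_(i <- s | P i) F i) ^+ p = \sum_(i <- s | P i) F i ^+ p.
Proof. by rewrite -FrE rmorph_sum; apply: eq_bigr => i _; rewrite FrE. Qed.

Let D0 i : D i 0 = 0. Proof. by have := Dc i 0; rewrite rmorph0. Qed.
Let D1 i : D i 1 = 0. Proof. by have := Dc i 1; rewrite rmorph1. Qed.

Let D_sum (T : Type) (s : seq T) (P : pred T) (F : T -> A) i :
  D i (\sum_(j <- s | P j) F j) = \sum_(j <- s | P j) D i (F j).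
Proof. exact: (big_morph _ (DD i) (D0 i)). Qed.

Let DX i u n : D i (u ^+ n) = n%:R * u ^+ n.-1 * D i u.
Proof.
elim: n => [|n IH]; first by rewrite expr0 D1 !mul0r.
rewrite exprS DM IH /=; case: n {IH} => [|n] /=.
  by rewrite expr0; ring.
by rewrite [u ^+ n.+1]exprS; ring.
Qed.

Let DXp i u : D i (u ^+ p) = 0.
Proof. by rewrite DX (pcharf0 char_A) !mul0r. Qed.

(** Exponent vectors with all entries below p: they index the monomials of a p-basis. *)
Let B := {ffun 'I_d -> 'I_p}.
Let bm (b : B) : 'X_{1..d} := [multinom (b i : nat) | i < d].
Let ev : {rmorphism {mpoly k[d]} -> A} := mmap c x.

Let evX a : ev 'X_[a] = \prod_i x i ^+ a i.
Proof. by rewrite /ev /= mmapX. Qed.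
Let evC a : ev a%:MP = c a.
Proof. by rewrite /ev /= mmapC. Qed.
Let evZ a F : ev (a *: F) = c a * ev F.
Proof. by rewrite -mul_mpolyC rmorphM /= evC. Qed.

Let ev_pow a : ipow m (mdeg a) (ev 'X_[a]).
Proof. by rewrite evX mdegE; apply: ipow_prod. Qed.

Lemma ev_ipow n F : (forall a, a \in msupp F -> (n <= mdeg a)%N) -> ipow m n (ev F).
Proof.
move=> hF; rewrite [F]mpolyE rmorph_sum big_seq; apply: is_ideal_sum.
  exact: ipow_ideal.
move=> a /hF ha; rewrite /= evZ; apply: is_idealMr; first exact: ipow_ideal.
exact: ipow_leq ha _ (ev_pow a).
Qed.

Let D_ev i F : D i (ev F) = \sum_j ev F^`M(j) * D i (x j).
Proof.
have evD0 : D i (ev 0) = 0 by rewrite rmorph0 D0.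
rewrite [F]mpolyE; elim/big_rec: _ => [|a G _ IH].
  by rewrite evD0 big1 // => j _; rewrite mderiv0 rmorph0 mul0r.
rewrite rmorphD DD IH (_ : D i _ = \sum_j ev (F@_a *: 'X_[a])^`M(j) * D i (x j)); last first.
  rewrite evZ DM Dc mul0r add0r evX.
  have -> : D i (\prod_j x j ^+ a j) = \sum_j ev 'X_[a]^`M(j) * D i (x j).
    have gen (s : seq 'I_d) : uniq s -> D i (\prod_(j <- s) x j ^+ a j) =
        \sum_(j <- s) (a j)%:R * (\prod_(l <- s) x l ^+ (a l - (j == l))%N) * D i (x j).
      elim: s => [|l s IHs] /=; first by rewrite !big_nil D1.
      move=> /andP [ls us]; rewrite !big_cons DM DX IHs // eqxx subn1; congr (_ + _).
        rewrite -!mulrA; congr (_ * (_ * _)); rewrite mulrC; congr (_ * _).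
        apply: eq_big_seq => j js; rewrite (_ : (l == j) = false) ?subn0 //.
        by apply/negbTE; apply: contraNneq ls => ->.
      rewrite mulr_sumr; apply: eq_big_seq => j js; rewrite big_cons.
      rewrite (_ : (j == l) = false) ?subn0; first by ring.
      by apply/negbTE; apply: contraNneq ls => <-.
    rewrite gen ?index_enum_uniq //; apply: eq_bigr => j _.
    rewrite mderivX evZ rmorph_nat evX; congr (_ * _ * _); apply: eq_bigr => l _.
    by rewrite mnmBE mnm1E.
  rewrite mulr_sumr; apply: eq_bigr => j _; rewrite mderivZ evZ mulrA //.
rewrite -big_split; apply: eq_bigr => j _.
by rewrite mderivD rmorphD mulrDl.
Qed.

Let D_ipow i n y : ipow m n.+1 y -> ipow m n (D i y).
Proof.
elim: n y => [//|n IH] y hy.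
suff [] : ipow m n.+2 y /\ ipow m n.+1 (D i y) by [].
apply: (ipow_ind (J := [set y | ipow m n.+2 y /\ ipow m n.+1 (D i y)])) hy.
  have h2 := ipow_ideal m n.+2; have h1 := ipow_ideal m n.+1.
  split=> [|u v [hu hu'] [hv hv']|a u [hu hu']].
  - by rewrite /= D0; split; [exact: (is_ideal0 h2)|exact: (is_ideal0 h1)].
  - by rewrite /= DD; split; [exact: (is_idealD h2)|exact: (is_idealD h1)].
  - rewrite /= DM; split; first exact: (is_idealMr _ h2).
    apply: (is_idealD h1); last exact: (is_idealMr _ h1).
    by apply: (is_idealMr _ h1); apply: ipow_leq hu.
move=> u v hu hv; split; first exact: ipow_step.
rewrite /= DM; apply: (is_idealD (ipow_ideal m n.+1)).
  exact: (is_idealMr _ (ipow_ideal m n.+1)).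
by apply: ipow_step => //; apply: IH.
Qed.

(** The order of the list matters: the [D i] are not assumed to commute. *)
Let Ds (js : seq 'I_d) (h : A) := foldr D h js.

Let Ds_ipow js n y : ipow m (size js + n) y -> ipow m n (Ds js y).
Proof.
elim: js n => [|j js IH] n //= hy.
by apply: D_ipow; apply: IH; rewrite addnS.
Qed.

(** On leading forms at the point the [D j] act like partial derivatives, since [D j (x i)] differs
    from the Kronecker delta by an element of m. *)
Let Ds_ev js n F : F \is (size js + n).-homog ->
  foldr (@mderiv d k) F js \is n.-homog /\
  ipow m n.+1 (Ds js (ev F) - ev (foldr (@mderiv d k) F js)).
Proof.
elim: js n => [|j js IH] n hF /=.
  by rewrite subrr; split=> //; exact: (is_ideal0 (ipow_ideal _ _)).
have [|h1 h2] := IH n.+1; first by rewrite addnS.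
set F' := foldr _ _ _ in h1 h2 *.
have hd i : F'^`M(i) \is n.-homog.
  apply/dhomogP => a; rewrite mcoeff_msupp mcoeff_deriv => ha.
  have : (a + U_(i))%MM \in msupp F'.
    by rewrite mcoeff_msupp; apply: contraNneq ha => ->; rewrite mul0rn.
  by move=> /(dhomog_mf h1); rewrite /= mdegD mdeg1 addn1 => -[].
split=> //.
have -> : D j (Ds js (ev F)) = D j (ev F') + D j (Ds js (ev F) - ev F').
  by rewrite -DD; congr (D j _); ring.
rewrite D_ev addrAC; apply: (is_idealD (ipow_ideal _ _)); last exact: D_ipow.
have -> : \sum_i ev F'^`M(i) * D j (x i) - ev F'^`M(j) =
          \sum_i (D j (x i) - (j == i)%:R) * ev F'^`M(i).
  rewrite (bigD1 j) //= [RHS](bigD1 j) //= eqxx addrAC; congr (_ + _).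
    by rewrite mulrBl mul1r mulrC.
  by apply: eq_bigr => i ij; rewrite eq_sym (negPf ij) subr0 mulrC.
apply: (is_ideal_sum _ (ipow_ideal _ _)) => i _; apply: ipow_step.
  by rewrite /m /= rmorphB Dx rmorph_nat subrr.
by apply: ev_ipow => a /(dhomog_mf (hd i)) /= ->.
Qed.

Let jl (b : 'X_{1..d}) : seq 'I_d := flatten [seq nseq (b i) i | i <- enum 'I_d].

Let size_jl b : size (jl b) = mdeg b.
Proof.
rewrite /jl size_flatten /shape -map_comp sumnE big_map big_enum mdegE.
by apply: eq_bigr => i _ /=; rewrite size_nseq.
Qed.

(** Evaluated at the point, the matrix of iterated derivatives of monomials is triangular with
    respect to the degree. Its diagonal consists of products of factorials, which are nonzero in k
    for exponents below p. *)
Let e_Ds b b' : (mdeg b' <= mdeg b)%N ->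
  e (Ds (jl b') (ev 'X_[b])) = if b == b' then (\prod_i (b i)`!)%:R else 0.
Proof.
rewrite leq_eqVlt => /orP [/eqP hb|hb].
  have [|h1 h2] := @Ds_ev (jl b') 0 'X_[b].
    by rewrite dhomogX size_jl addn0 hb /=.
  have : m (Ds (jl b') (ev 'X_[b]) - ev (foldr (@mderiv d k) 'X_[b] (jl b'))).
    by apply: ipow_sub_ideal h2; apply: max_ideal.
  rewrite /m /= rmorphB => /eqP; rewrite subr_eq0 => /eqP ->.
  rewrite /jl -mderivm_foldr mderivmX evZ rmorphM /= ec evX.
  case: eqP => [<-|nb].
    rewrite [\prod_i x i ^+ _]big1 ?rmorph1 ?mulr1 => [|i _]; last by rewrite mnmBE subnn.
    by congr (_%:R); apply: eq_bigr => i _; rewrite ffactnn.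
  suff [i hi] : exists i, (b i < b' i)%N.
    by rewrite (bigD1 i) //= ffact_small // mul0n mul0r.
  apply: contrapT => h; apply: nb; apply/mnmP => i.
  have hle i0 : (b' i0 <= b i0)%N by rewrite leqNgt; apply/negP => h'; apply: h; exists i0.
  apply/eqP; rewrite eqn_leq hle andbT leqNgt; apply/negP => hi.
  move: hb; rewrite !mdegE => /eqP; rewrite ltn_eqF //.
  by rewrite (bigD1 i) //= [ltnRHS](bigD1 i) //= -addSn leq_add // leq_sum.
rewrite ifF; last by apply/eqP => e0; rewrite e0 ltnn in hb.
have : ipow m 1 (Ds (jl b') (ev 'X_[b])).
  by apply: Ds_ipow; apply: ipow_leq (ev_pow b); rewrite size_jl addn1.
by move=> /ipow_sub_ideal; apply; apply: max_ideal.
Qed.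

Let Ds_pM js u h : Ds js (u ^+ p * h) = u ^+ p * Ds js h.
Proof. by elim: js => //= j js ->; rewrite DM DXp mul0r add0r. Qed.

Let Ds_sum (T : Type) (s : seq T) (F : T -> A) js :
  Ds js (\sum_(t <- s) F t) = \sum_(t <- s) Ds js (F t).
Proof. by elim: js => //= j js ->; rewrite D_sum. Qed.

(** p-th powers are constants for the [D i]. Applying iterated derivations to the relation gives a
    linear system for the u_b^p with square matrix [Q]; Cramer's rule puts det(Q) u_b^p into [J],
    and [J] is closed under p-th roots. So t = det(Q), which is nonzero at the point by
    triangularity. *)
Lemma pbasis_indep (J : set A) (u : B -> A) : is_ideal J ->
  (forall v, J (v ^+ p) -> J v) -> (forall i v, J v -> J (D i v)) ->
  J (\sum_b u b ^+ p * ev 'X_[bm b]) ->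
  exists t, e t != 0 /\ forall b, J (t * u b).
Proof.
move=> hJ hp hD hu.
pose N := #|{: B}|.
pose Q : 'M[A]_N := \matrix_(i, j) Ds (jl (bm (enum_val i))) (ev 'X_[bm (enum_val j)]).
exists (\det Q); split; last first.
  move=> b; apply: hp; rewrite exprMn.
  have hDs js v : J v -> J (Ds js v) by move=> hv; elim: js => //= j js IH; apply: hD.
  have hv i : J (\sum_j Q i j * u (enum_val j) ^+ p).
    have := hDs (jl (bm (enum_val i))) _ hu; rewrite Ds_sum.
    rewrite (reindex (@enum_val _ (mem {: B}))) /=; last first.
      by apply: onW_bij; apply: enum_val_bij.
    by under eq_bigr do rewrite Ds_pM mulrC; under [in X in _ -> X]eq_bigr do rewrite mxE.
  have := mul_adj_mx Q => /(congr1 (fun M : 'M_N => (M *m \col_j u (enum_val j) ^+ p) (enum_rank b) 0)).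
  rewrite -mulmxA mul_scalar_mx !mxE enum_rankK => e1.
  rewrite -[p]prednK // exprS -mulrA mulrCA prednK //; apply: is_idealMr => //.
  rewrite -e1; apply: is_ideal_sum => // i _; apply: is_idealMr => //.
  by rewrite mxE; under eq_bigr do rewrite [X in _ * X]mxE; apply: hv.
rewrite -det_map_mx -det_tr; apply/negP => /det0P [v v0 hv].
have [i0 hi0] : exists i, v 0 i != 0.
  apply: contrapT => h; case/eqP: v0; apply/rowP => i; rewrite mxE; apply/eqP.
  by apply: contraT => hi; case: h; exists i.
(* For a kernel vector, the equation belonging to an index of least degree in the support involves
   only that entry. *)
case: (arg_minnP (P := fun i => v 0 i != 0) (fun i => mdeg (bm (enum_val i))) hi0) => i hi imin.
have := congr1 (fun M : 'rV_N => M 0 i) hv; rewrite !mxE (bigD1 i) //= !mxE e_Ds // eqxx.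
rewrite [X in _ + X]big1 ?addr0 => [|j ji].
  apply/eqP; rewrite mulf_neq0 // natr_prod; apply/prodf_neq0 => l _.
  rewrite -(dvdn_pcharf char_k); rewrite mnmE.
  elim: (val _) (ltn_ord (enum_val i l)) => [|n IH] /= hn.
    by rewrite dvdn1 neq_ltn prime_gt1 ?orbT.
  by rewrite factS Euclid_dvdM // negb_or IH ?(ltnW hn) // andbT gtnNdvd.
rewrite !mxE; have [->|vj] := eqVneq (v 0 j) 0; first by rewrite mul0r.
rewrite e_Ds ?imin // ifF ?mulr0 //; apply/negbTE; apply: contra ji => /eqP hb.
apply/eqP/enum_val_inj; apply/ffunP => l; apply: val_inj.
by have := congr1 (fun f : 'X_{1..d} => f l) hb; rewrite !mnmE.
Qed.

Let proot (a : k) : exists b, b ^+ p = a.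
Proof.
have : size ('X^p - a%:P : {poly k}) != 1%N by rewrite size_XnsubC // eqSS -lt0n.
by move=> /closed_rootP [b]; rewrite rootE !hornerE subr_eq0 => /eqP; exists b.
Qed.

(** The submodule generated by [E] over the subring of p-th powers. *)
Let pspan (T : finType) (E : T -> A) : set A :=
  [set h | exists v : T -> A, h = \sum_t v t ^+ p * E t].

Let pspanD (T : finType) (E : T -> A) u v : pspan E u -> pspan E v -> pspan E (u + v).
Proof.
move=> [a ->] [b ->]; exists (fun t => a t + b t); rewrite -big_split.
by apply: eq_bigr => t _; rewrite exprDp mulrDl.
Qed.

Let pspanM (T : finType) (E : T -> A) w u : pspan E u -> pspan E (w ^+ p * u).
Proof.
move=> [a ->]; exists (fun t => w * a t); rewrite mulr_sumr.
by apply: eq_bigr => t _; rewrite exprMn mulrA.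
Qed.

Let pspan_mem (T : finType) (E : T -> A) t : pspan E (E t).
Proof.
exists (fun t' => (t' == t)%:R); rewrite (bigD1 t) //= eqxx expr1n mul1r big1 ?addr0 //.
by move=> t' /negPf ->; rewrite expr0n eqn0Ngt p_gt0 mul0r.
Qed.

Let pspan_sum (T : finType) (E : T -> A) (I : Type) (s : seq I) (P : pred I) (F : I -> A) :
  (forall i, P i -> pspan E (F i)) -> pspan E (\sum_(i <- s | P i) F i).
Proof.
move=> hF; elim/big_rec: _ => [|i u Pi]; last by apply: pspanD; apply: hF.
by exists (fun=> 0); rewrite big1 // => t _; rewrite expr0n eqn0Ngt p_gt0 mul0r.
Qed.

Let Bg := {ffun 'I_r -> 'I_p}.
Let gm (a : Bg) : A := \prod_i g i ^+ (a i : nat).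

Let pspan_mon (a : 'I_r -> nat) : pspan gm (\prod_i g i ^+ a i).
Proof.
pose b : Bg := [ffun i => Ordinal (ltn_pmod (a i) p_gt0)].
have -> : \prod_i g i ^+ a i = (\prod_i g i ^+ (a i %/ p)) ^+ p * gm b.
  rewrite -prodrXl -big_split; apply: eq_bigr => i _; rewrite ffunE /=.
  by rewrite -exprM -exprD -divn_eq.
exact/pspanM/pspan_mem.
Qed.

(** The algebra is finite over its p-th powers: k is perfect, and the exponents of the generators
    are reduced modulo p. *)
Let pspan_gm h : pspan gm h.
Proof.
apply: hgen => [a|i|u v|u v].
- have [b <-] := proot a; rewrite rmorphXn -[_ ^+ p]mulr1; apply: pspanM.
  have := pspan_mon (fun=> 0%N); rewrite big1 // => i _; exact: expr0.
- have := pspan_mon (fun j => (j == i)); rewrite (bigD1 i) //= eqxx big1 ?mulr1 ?expr1 //.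
  by move=> j /negPf ->; rewrite expr0.
- exact: pspanD.
- move=> [a ->] [b ->]; rewrite mulr_suml; apply: pspan_sum => t _.
  rewrite mulr_sumr; apply: pspan_sum => t' _.
  have -> : a t ^+ p * gm t * (b t' ^+ p * gm t') =
            (a t * b t') ^+ p * (\prod_i g i ^+ (t i + t' i)).
    by rewrite exprMn /gm; under [in RHS]eq_bigr do rewrite exprD; rewrite big_split /=; ring.
  exact/pspanM/pspan_mon.
Qed.

Section Span.
Variable I : set A.
Hypothesis hI : is_ideal I.
Hypothesis span1 : forall y, e y = 0 ->
  exists a : 'I_d -> k, isum (ipow m 2) I (y - \sum_i c (a i) * x i).

Let mI n := isum (ipow m n) I.
Let mI_ideal n : is_ideal (mI n).
Proof. exact: isum_ideal (ipow_ideal m n) hI. Qed.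
Let mI_leq i j : (i <= j)%N -> mI j `<=` mI i.
Proof. by move=> ij; apply: isum_mono; apply: ipow_leq. Qed.
Let mI_of n y : ipow m n y -> mI n y. Proof. exact: isum_l. Qed.

Lemma expand_homog n y : mI n y -> exists2 F, F \is n.-homog & mI n.+1 (y - ev F).
Proof.
move=> [y' [i [hy hi ->]]].
suff [_ [F hF h2]] : ipow m n y' /\ exists2 F, F \is n.-homog & mI n.+1 (y' - ev F).
  exists F => //; rewrite addrAC; apply: is_idealD => //; exact: isum_r (ipow_ideal _ _) hi.
elim: n y' hy {i hi y} => [|n IH] y' hy.
  split=> //; exists (e y')%:MP; first by rewrite dhomogE msuppC; case: eqP => //= _; rewrite mdeg0.
  apply: mI_of; rewrite evC -[X in ipow _ _ X]mulr1; apply: ipow_step => //.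
  by rewrite /m /= rmorphB ec subrr.
apply: (ipow_ind (J := [set y' | ipow m n.+1 y' /\
    exists2 F, F \is n.+1.-homog & mI n.+2 (y' - ev F)])) hy.
  split=> [|u v [hu [F hF uF]] [hv [G hG vG]]|a u [hu [F hF uF]]].
  - split; first exact: (is_ideal0 (ipow_ideal _ _)).
    by exists 0; rewrite ?rpred0 // rmorph0 subrr; apply: is_ideal0.
  - split; first exact: (is_idealD (ipow_ideal _ _)).
    exists (F + G); first exact: rpredD.
    by rewrite rmorphD opprD addrACA; apply: is_idealD.
  - split; first exact: (is_idealMr _ (ipow_ideal _ _)).
    exists (e a *: F); first exact: rpredZ.
    have -> : a * u - ev (e a *: F) = (a - c (e a)) * u + c (e a) * (u - ev F).
      by rewrite evZ; ring.
    apply: is_idealD => //; last exact: is_idealMr.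
    by apply: mI_of; apply: ipow_step => //; rewrite /m /= rmorphB ec subrr.
move=> u v hu hv; split; first exact: ipow_step.
have [a ha] := span1 hu; have [_ [G hG vG]] := IH _ hv.
pose L : {mpoly k[d]} := \sum_i a i *: 'X_i.
have eL : ev L = \sum_i c (a i) * x i.
  rewrite rmorph_sum; apply: eq_bigr => i _; rewrite /= evZ; congr (_ * _).
  rewrite evX (bigD1 i) //= mnm1E eqxx expr1 big1 ?mulr1 // => j ji.
  by rewrite mnm1E eq_sym (negPf ji).
have hL : L \is 1.-homog.
  by apply: rpred_sum => i _; apply: rpredZ; rewrite dhomogX /= mdeg1.
exists (L * G); first by rewrite -add1n; apply: dhomogM.
have -> : u * v - ev (L * G) = (u - ev L) * v + ev L * (v - ev G).
  by rewrite rmorphM /=; ring.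
apply: is_idealD => //.
  by rewrite eL; apply: (isum_powM (i := 2) (j := n)) => //; apply: mI_of.
apply: (isum_powM (i := 1) (j := n.+1)) => //; apply: mI_of.
by apply: ev_ipow => b /(dhomog_mf hL) /= ->.
Qed.

Lemma expand n L y : mI n y ->
  exists F, (forall a, a \in msupp F -> (n <= mdeg a < L)%N) /\ mI L (y - ev F).
Proof.
move=> hy; have [nL|Ln] := leqP n L; last first.
  exists 0; rewrite msupp0; split=> //; rewrite rmorph0 subr0.
  exact: mI_leq (ltnW Ln) _ hy.
rewrite -(subnKC nL); elim: (L - n)%N => [|l [F [hF hy']]].
  by exists 0; rewrite msupp0 rmorph0 subr0 addn0.
have [G hG hG'] := expand_homog hy'.
exists (F + G); split; last by rewrite rmorphD opprD addrA addnS.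
move=> a /msuppD_le; rewrite mem_cat => /orP [/hF /andP [-> h]|/(dhomog_mf hG) /= ->].
  by rewrite addnS ltnW.
by rewrite addnS ltnS leqnn leq_addr.
Qed.

(** For q a power of p this is the Frobenius power of m. Unlike [ipow m q] it can be tested
    coefficient by coefficient in a p-basis. *)
Let Mq q := igen [set z | exists2 y, m y & z = y ^+ q].
Let MqI q := isum (Mq q) I.
Let MqI_ideal q : is_ideal (MqI q).
Proof. exact: isum_ideal (igen_ideal _) hI. Qed.

Let pow_Mq q : exists L, ipow m L `<=` Mq q.
Proof.
have [s hs] := hN max_ideal; rewrite {1}hs.
apply: ipow_nil; first exact: igen_ideal.
move=> a ha; exists q; apply: sub_igen; exists a => //.
by rewrite -/m hs; apply: sub_igen.
Qed.

Lemma expand_box n q y : mI n y -> exists F,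
  (forall a, a \in msupp F -> (n <= mdeg a)%N /\ forall i, (a i < q)%N) /\ MqI q (y - ev F).
Proof.
move=> hy; have [L hL] := pow_Mq q; have [F [hF hyF]] := expand L hy.
pose P (a : 'X_{1..d}) := [forall i, (a i < q)%N].
pose F1 : {mpoly k[d]} := \sum_(a <- msupp F | P a) F@_a *: 'X_[a].
pose F2 : {mpoly k[d]} := \sum_(a <- msupp F | ~~ P a) F@_a *: 'X_[a].
have eF : F = F1 + F2 by rewrite [LHS]mpolyE (bigID P).
exists F1; split.
  move=> a /msupp_sum_le /flattenP [s] /mapP [b]; rewrite mem_filter => /andP [Pb hb] ->.
  move=> /msuppZ_le; rewrite msuppX inE => /eqP ->.
  by split; [case/andP: (hF _ hb)|move=> i; move/forallP: Pb; apply].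
have -> : y - ev F1 = (y - ev F) + ev F2 by rewrite [in ev F]eF rmorphD /=; ring.
apply: is_idealD => //; first exact: isum_mono hL _ hyF.
apply: isum_l => //; rewrite rmorph_sum; apply: (is_ideal_sum _ (igen_ideal _)) => a.
rewrite /P negb_forall => /existsP [i]; rewrite -leqNgt => hi /=.
rewrite evZ evX (bigD1 i) //= -(subnK hi) exprD; set R := (\prod_(_ | _) _).
have -> : c F@_a * (x i ^+ (a i - q) * x i ^+ q * R) =
  (c F@_a * x i ^+ (a i - q) * R) * x i ^+ q by ring.
apply: (is_idealMr _ (igen_ideal _)).
by apply: sub_igen; exists (x i) => //; apply: xm.
Qed.

(* Nakayama for the finite extension [A^p ⊆ A], with [det] inverted. *)
Lemma pbasis_span : exists2 s, e s = 1 &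
  forall h, exists u : B -> A, I (s ^+ p * h - \sum_b u b ^+ p * ev 'X_[bm b]).
Proof.
pose NI := isum (pspan (fun b : B => ev 'X_[bm b])) I.
have NID u v : NI u -> NI v -> NI (u + v).
  move=> [a [b [ha hb ->]]] [a' [b' [ha' hb' ->]]]; exists (a + a'), (b + b').
  by split; [exact: pspanD|exact: is_idealD|ring].
have NIM w u : NI u -> NI (w ^+ p * u).
  move=> [a [b [ha hb ->]]]; exists (w ^+ p * a), (w ^+ p * b).
  by split; [exact: pspanM|exact: is_idealMr|ring].
have NI0 : NI 0.
  exists 0, 0; rewrite addr0; split=> //; last exact: is_ideal0.
  exists (fun=> 0); rewrite big1 // => b _.
  by rewrite expr0n eqn0Ngt p_gt0 mul0r.
have NI_sum (T : finType) (F : T -> A) : (forall t, NI (F t)) -> NI (\sum_t F t).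
  by move=> hF; elim/big_rec: _ => // t u _; apply: NID.
(* The error of the box expansion lies, modulo [I], in the ideal generated by the y^p with y in m.
   It is therefore a combination of the generators [gm a] with coefficients w_a^p, where w_a
   vanishes at the point. *)
have hdec h : exists w : Bg -> A, (forall a, e (w a) = 0) /\
    NI (h - \sum_a w a ^+ p * gm a).
  have [|F [hF hh]] := @expand_box 0 p h; first exact: mI_of.
  have hNF : pspan (fun b : B => ev 'X_[bm b]) (ev F).
    rewrite [F]mpolyE rmorph_sum big_seq; apply: pspan_sum => a /hF [_ ha].
    have [z <-] := proot F@_a; rewrite /= evZ rmorphXn; apply: pspanM.
    have -> : a = bm [ffun i => Ordinal (ha i)].
      by apply/mnmP => i; rewrite mnmE ffunE.
    exact: (pspan_mem (fun b : B => ev 'X_[bm b])).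
  have [z [i [hz hi e1]]] := hh.
  suff [w [hw ew]] : exists w : Bg -> A, (forall a, e (w a) = 0) /\ z = \sum_a w a ^+ p * gm a.
    exists w; split=> //; exists (ev F), i; split=> //; rewrite -ew.
    by rewrite -[h](subrK (ev F)) e1; ring.
  apply: (igen_min (J := [set z | exists w : Bg -> A, (forall a, e (w a) = 0) /\
      z = \sum_a w a ^+ p * gm a])) hz.
    split=> [|u v [w [hw ->]] [w' [hw' ->]]|u v [w [hw ->]]].
    - exists (fun=> 0); split=> [_|]; first exact: rmorph0.
      by rewrite big1 // => a _; rewrite expr0n eqn0Ngt p_gt0 mul0r.
    - exists (fun a => w a + w' a); split=> [a|]; first by rewrite rmorphD hw hw' addr0.
      by rewrite -big_split; apply: eq_bigr => a _; rewrite exprDp mulrDl.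
    - have hu a : exists f : Bg -> A, u * gm a = \sum_b f b ^+ p * gm b := pspan_gm _.
      have /choice [f hf] := hu.
      exists (fun b => \sum_a w a * f a b); split=> [b|].
        by rewrite rmorph_sum big1 // => a _; rewrite rmorphM /= hw mul0r.
      rewrite mulr_sumr; under eq_bigr do rewrite mulrCA hf mulr_sumr.
      rewrite exchange_big; apply: eq_bigr => b _; rewrite expr_sump mulr_suml.
      by apply: eq_bigr => a _; rewrite exprMn mulrA.
  move=> _ [y hy ->]; have [f hf] := pspan_gm 1.
  exists (fun a => y * f a); split=> [a|]; first by rewrite rmorphM /= hy mul0r.
  rewrite -[y ^+ p]mulr1 hf mulr_sumr; apply: eq_bigr => a _.
  by rewrite exprMn mulrA.
pose N := #|{: Bg}|.
have /choice [w hw] := fun a => hdec (gm a).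
(* The entries of [W] vanish at the point, so det(1 - W) is 1 there. The relations carry p-th powers
   of the entries, hence the Frobenius image of [S] below. *)
pose W : 'M[A]_N := \matrix_(i, j) w (enum_val i) (enum_val j).
pose S := 1%:M - W.
exists (\det S).
  rewrite -det_map_mx (_ : map_mx e S = 1%:M) ?det1 //; apply/matrixP => i j.
  by rewrite !mxE rmorphB rmorph_nat (proj1 (hw _)) subr0.
move=> h; have [v ->] := pspan_gm h.
suff hs a : NI (\det S ^+ p * gm a).
  have [y [i [[u hu] hi e1]]] : NI (\det S ^+ p * \sum_t v t ^+ p * gm t).
    rewrite mulr_sumr; apply: NI_sum => t; rewrite mulrCA; exact: NIM.
  by exists u; rewrite e1 hu addrAC subrr add0r.
pose G : 'cV[A]_N := \col_i gm (enum_val i).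
have hSG i : NI ((map_mx Fr S *m G) i 0).
  have := proj2 (hw (enum_val i)); congr (NI _).
  rewrite map_mxB map_mx1 mulmxBl mul1mx !mxE; congr (_ - _).
  rewrite (reindex (@enum_val _ (mem {: Bg}))) /=; last by apply: onW_bij; apply: enum_val_bij.
  by apply: eq_bigr => j _; rewrite !mxE FrE.
have := mul_adj_mx (map_mx Fr S) => /(congr1 (fun M : 'M_N => (M *m G) (enum_rank a) 0)).
rewrite -mulmxA mul_scalar_mx det_map_mx -map_mx_adj !mxE enum_rankK FrE => <-.
by apply: NI_sum => j; rewrite mxE FrE; apply: NIM.
Qed.

Hypothesis Ip : forall v, I (v ^+ p) -> I v.
Hypothesis ID : forall i v, I v -> I (D i v).
Hypothesis Im : forall v, I v -> e v = 0.

Let split_p q (F : {mpoly k[d]}) : (forall a, a \in msupp F -> forall i, (a i < p * q)%N) ->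
  exists F' : B -> {mpoly k[d]},
    (forall b a, a \in msupp (F' b) -> forall i, (a i < q)%N) /\
    F = \sum_b F' b ^+ p * 'X_[bm b].
Proof.
have chP : p \in [pchar {mpoly k[d]}] by apply: (rmorph_pchar (@mpolyC d k)).
move=> hF; rewrite [F]mpolyE big_seq.
elim/big_rec: _ => [|a G /hF ha [F' [h1 h2]]].
  exists (fun=> 0); split=> [b a|]; first by rewrite msupp0.
  by rewrite big1 // => b _; rewrite expr0n eqn0Ngt p_gt0 mul0r.
have [z hz] := proot F@_a.
pose b0 : B := [ffun i => Ordinal (ltn_pmod (a i) p_gt0)].
pose a' := [multinom (a i %/ p)%N | i < d].
exists (fun b => F' b + if b == b0 then z *: 'X_[a'] else 0); split=> [b a0|].
  move=> /msuppD_le; rewrite mem_cat => /orP [/h1 //|].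
  case: eqP => _; last by rewrite msupp0.
  by move=> /msuppZ_le; rewrite msuppX inE => /eqP -> i; rewrite mnmE ltn_divLR // mulnC.
have -> : \sum_b (F' b + (if b == b0 then z *: 'X_[a'] else 0)) ^+ p * 'X_[bm b] =
    \sum_b F' b ^+ p * 'X_[bm b] + (z *: 'X_[a']) ^+ p * 'X_[bm b0].
  rewrite -[X in _ = _ + X](_ : \sum_b (if b == b0 then z *: 'X_[a'] else 0) ^+ p * 'X_[bm b] = _).
    rewrite -big_split; apply: eq_bigr => b _ /=.
    by rewrite -!(pFrobenius_autE chP) rmorphD mulrDl.
  rewrite (bigD1 b0) //= eqxx big1 ?addr0 // => b /negPf ->.
  by rewrite expr0n eqn0Ngt p_gt0 mul0r.
rewrite h2 addrC; congr (_ + _); rewrite exprZn hz -scalerAl mpolyXn -mpolyXD.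
congr (_ *: 'X_[_]); apply/mnmP => i; rewrite mnmDE mulmnE !mnmE ffunE /=.
exact: divn_eq.
Qed.

(** Descent along Frobenius: splitting exponents modulo p writes F as a sum of F'_b^p times p-basis
    monomials. Spanning and independence of the p-basis turn membership of s F in the Frobenius
    power of exponent p^(j+1) into membership of each F'_b in that of exponent p^j, up to factors
    that are nonzero at the point. *)
Lemma box_indep j s F : e s != 0 ->
  (forall a, a \in msupp F -> forall i, (a i < p ^ j)%N) ->
  MqI (p ^ j) (s * ev F) -> F = 0.
Proof.
elim: j s F => [|j IH] s F hs hF hsF.
  have eF : F = (F@_0%MM)%:MP.
    apply/mpolyP => a; rewrite mcoeffC; have [->|a0] := eqVneq a 0%MM; first by rewrite mulr1.
    rewrite mulr0; apply/eqP; rewrite mcoeff_eq0; apply: contra a0 => /hF ha.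
    apply/eqP/mnmP => i; rewrite mnm0E; move: (ha i); rewrite expn0.
    by rewrite ltnS leqn0 => /eqP.
  have : m (s * ev F).
    have [u [v [hu hv ->]]] := hsF; apply: (is_idealD max_ideal); last exact: Im.
    apply: igen_min hu; first exact: max_ideal.
    by move=> _ [y hy ->]; rewrite expn0 expr1.
  rewrite /m /= eF rmorphM /= evC ec => /eqP.
  by rewrite mulf_eq0 (negPf hs) /= => /eqP ->; rewrite mpolyC0.
rewrite expnS in hF hsF.
have [F' [hF' eF]] := split_p hF.
have [s1 hs1 hspan] := pbasis_span.
suff h0 : forall b, F' b = 0.
  by rewrite eF big1 // => b _; rewrite h0 expr0n eqn0Ngt p_gt0 mul0r.
have [v hv] : exists v : B -> A, (forall b, MqI (p ^ j) (v b)) /\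
    I (s1 ^+ p * (s ^+ p * ev F) - \sum_b v b ^+ p * ev 'X_[bm b]).
  have {hsF} : MqI (p * p ^ j) (s ^+ p * ev F).
    have -> : s ^+ p = s ^+ p.-1 * s by rewrite -exprSr prednK.
    by rewrite -mulrA; apply: is_idealMr.
  move=> [y [i [hy hi ->]]].
  suff /(_ 1) [v [h1 h2]] : forall a, exists v : B -> A, (forall b, MqI (p ^ j) (v b)) /\
      I (s1 ^+ p * (a * y) - \sum_b v b ^+ p * ev 'X_[bm b]).
    exists v; split=> //; rewrite mulrDr addrAC -[y]mul1r.
    by apply: is_idealD => //; apply: is_idealMr.
  apply: (igen_min (J := [set y | forall a, exists v : B -> A, (forall b, MqI (p ^ j) (v b)) /\
      I (s1 ^+ p * (a * y) - \sum_b v b ^+ p * ev 'X_[bm b])])) hy.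
    split=> [a|y1 y2 h1 h2 a|a y1 h1 a'].
    - exists (fun=> 0); split=> [b|]; first exact: is_ideal0.
      rewrite !mulr0 big1 ?subrr; first exact: is_ideal0.
      by move=> b _; rewrite expr0n eqn0Ngt p_gt0 mul0r.
    - have [v1 [h1' h1'']] := h1 a; have [v2 [h2' h2'']] := h2 a.
      exists (fun b => v1 b + v2 b); split=> [b|]; first exact: is_idealD.
      have -> : s1 ^+ p * (a * (y1 + y2)) - \sum_b (v1 b + v2 b) ^+ p * ev 'X_[bm b] =
        (s1 ^+ p * (a * y1) - \sum_b v1 b ^+ p * ev 'X_[bm b]) +
        (s1 ^+ p * (a * y2) - \sum_b v2 b ^+ p * ev 'X_[bm b]).
        by under eq_bigr do rewrite exprDp mulrDl; rewrite big_split /=; ring.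
      exact: is_idealD.
    - by have := h1 (a' * a); rewrite -mulrA.
  move=> _ [t ht ->] a; have [u hu] := hspan a.
  exists (fun b => t ^+ (p ^ j) * u b); split=> [b|].
    apply: isum_l => //; apply: (is_idealMl _ (igen_ideal _)).
    by apply: sub_igen; exists t.
  have -> : s1 ^+ p * (a * t ^+ (p * p ^ j)) - \sum_b (t ^+ (p ^ j) * u b) ^+ p * ev 'X_[bm b] =
      t ^+ (p * p ^ j) * (s1 ^+ p * a - \sum_b u b ^+ p * ev 'X_[bm b]).
    rewrite mulrBr mulr_sumr; congr (_ - _); first by ring.
    by apply: eq_bigr => b _; rewrite exprMn -exprM [(p ^ j * p)%N]mulnC mulrA.
  exact: is_idealMr.
case: hv => hv hI'.
have hsub : I (\sum_b (s1 * s * ev (F' b) - v b) ^+ p * ev 'X_[bm b]).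
  congr (I _): hI'; rewrite eF rmorph_sum !mulr_sumr -sumrB; apply: eq_bigr => b _.
  by rewrite rmorphM rmorphXn -!FrE rmorphB !rmorphM /=; ring.
have [t [ht ht']] := pbasis_indep hI Ip ID hsub.
move=> b; apply: (IH (t * s1 * s)); rewrite ?rmorphM ?hs1 ?mulr1 ?mulf_neq0 //; first exact: hF'.
have -> : t * s1 * s * ev (F' b) = t * v b + t * (s1 * s * ev (F' b) - v b) by ring.
apply: is_idealD => //; first exact: is_idealMr.
exact: isum_r (igen_ideal _) (ht' b).
Qed.

(** The monomials in the [x i] are independent modulo [I] to every order, so that the local ring of
    [I] at the point is regular with parameters [x i]. In degree at most N all exponents are below
    p^N, where [box_indep] applies; higher terms are absorbed by the power of m. *)
Theorem smooth N F : mI N.+1 (ev F) -> forall a, (mdeg a <= N)%N -> F@_a = 0.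
Proof.
move=> hF.
pose P (a : 'X_{1..d}) := (mdeg a <= N)%N.
pose F1 : {mpoly k[d]} := \sum_(a <- msupp F | P a) F@_a *: 'X_[a].
pose F2 : {mpoly k[d]} := \sum_(a <- msupp F | ~~ P a) F@_a *: 'X_[a].
have eF : F = F1 + F2 by rewrite [LHS]mpolyE (bigID P).
have supp (Q : pred 'X_{1..d}) a :
    a \in msupp (\sum_(a <- msupp F | Q a) F@_a *: 'X_[a]) -> Q a.
  move=> /msupp_sum_le /flattenP [s] /mapP [b]; rewrite mem_filter => /andP [Qb hb] ->.
  by move=> /msuppZ_le; rewrite msuppX inE => /eqP ->.
have Np : (N < p ^ N)%N by apply: ltn_expl; apply: prime_gt1.
have hF1 : mI N.+1 (ev F1).
  have -> : ev F1 = ev F - ev F2 by rewrite [in ev F]eF rmorphD /=; ring.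
  apply: is_idealB => //; apply: mI_of; apply: ev_ipow => a /supp.
  by rewrite /P -ltnNge.
have [G [hG hG']] := @expand_box _ (p ^ N) _ hF1.
have eG : F1 - G = 0.
  apply: (@box_indep N 1); rewrite ?rmorph1 ?oner_eq0 //; last by rewrite mul1r rmorphB.
  move=> a /msuppB_le; rewrite mem_cat => /orP [/supp ha i|/hG [_ //]].
  apply: leq_ltn_trans Np; apply: leq_trans ha.
  by rewrite mdegE (bigD1 i) //= leq_addr.
move=> a ha; rewrite eF mcoeffD (_ : F2@_a = 0) ?addr0; last first.
  by apply/eqP; rewrite mcoeff_eq0; apply/negP => /supp; rewrite /P ha.
move/eqP: eG; rewrite subr_eq0 => /eqP ->.
apply/eqP; rewrite mcoeff_eq0; apply/negP => /hG [].
by rewrite ltnNge ha.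
Qed.

Lemma mI_unit n s f : e s != 0 -> mI n (s * f) -> mI n f.
Proof.
move=> hs hsf.
suff h i : (i <= n)%N -> mI i f by apply: h.
elim: i => [_|i IH lin]; first exact: mI_of.
have -> : f = c (e s)^-1 * (s * f) + (1 - c (e s)^-1 * s) * f by ring.
apply: is_idealD => //; first by apply: is_idealMr => //; apply: mI_leq hsf.
apply: (isum_powM (i := 1) (j := i)) => //; last exact/IH/ltnW.
apply: mI_of; rewrite -[_ - _]mulr1; apply: ipow_step => //.
by rewrite /m /= rmorphB rmorphM /= rmorph1 ec mulVf // subrr.
Qed.

(* Modulo p-th powers the x_i form a p-basis, on which the D_i act like partial
   derivatives; J being radical, the coordinates of an element of J are in J. *)
Theorem derivation_stable_flat (J : set A) : is_ideal J ->
  (forall v, J (v ^+ p) -> J v) -> (forall i v, J v -> J (D i v)) ->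
  I `<=` J -> (forall v, J v -> e v = 0) ->
  forall n f, J f -> mI n f.
Proof.
move=> hJ Jp JD IJ Jm n f Jf.
suff [s hs /(mI_unit hs)] : exists2 s, e s != 0 & mI n (s * f) by [].
elim: n f Jf => [|n IH] f Jf.
  by exists 1; [rewrite rmorph1 oner_eq0|exact: mI_of].
case: n IH => [|n] IH.
  exists 1; rewrite ?rmorph1 ?oner_eq0 // mul1r; apply: mI_of.
  by rewrite -[f]mulr1; apply: ipow_step => //; apply: Jm.
have [s1 hs1 /(_ f) [u hu]] := pbasis_span.
have [t [ht htu]] : exists t, e t != 0 /\ forall b, J (t * u b).
  apply: pbasis_indep => //.
  have -> : \sum_b u b ^+ p * ev 'X_[bm b] = s1 ^+ p * f - (s1 ^+ p * f - \sum_b u b ^+ p * ev 'X_[bm b]) by ring.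
  by apply: is_idealB => //; [exact: is_idealMr|exact: IJ].
have /choice [s hs] : forall b, exists s, e s != 0 /\ mI n.+1 (s * (t * u b)).
  by move=> b; have [s h1 h2] := IH _ (htu b); exists s.
pose s' := \prod_b s b.
exists ((s' * t * s1) ^+ p).
  rewrite rmorphXn /= expf_neq0 // !rmorphM /= hs1 mulr1 mulf_neq0 // rmorph_prod.
  by apply/prodf_neq0 => b _; case: (hs b).
have -> : (s' * t * s1) ^+ p * f = (s' * t) ^+ p * (s1 ^+ p * f - \sum_b u b ^+ p * ev 'X_[bm b]) +
   \sum_b (s' * (t * u b)) ^+ p * ev 'X_[bm b].
  have -> : \sum_b (s' * (t * u b)) ^+ p * ev 'X_[bm b] =
      \sum_b (s' * t) ^+ p * (u b ^+ p * ev 'X_[bm b]).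
    by apply: eq_bigr => b _; rewrite !exprMn; ring.
  by rewrite mulrBr mulr_sumr subrK exprMn mulrA.
apply: is_idealD => //.
  by apply: is_idealMr => //; apply: isum_r (ipow_ideal _ _) hu.
apply: is_ideal_sum => // b _; apply: is_idealMl => //.
apply: (@mI_leq _ (n.+1 * p)%N).
  by have := prime_gt1 prime_p; nia.
apply: isum_powX => //; rewrite /s' (bigD1 b) //= -mulrA mulrCA.
by apply: (is_idealMr _ (mI_ideal n.+1)); exact: (hs b).2.
Qed.

End Span.
End Smooth.

Section WeightSplit.
Variables (k : fieldType) (V : lmodType k) (S : Type) (I : eqType).
Variables (chi : S -> I -> k) (T : S -> V -> V).
Hypothesis TD : forall t u v, T t (u + v) = T t u + T t v.

Hypothesis TZ : forall t c u, T t (c *: u) = c *: T t u.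

(** Applying [T t] minus the scalar [chi t b] removes the component of index b and multiplies every
    other one by a scalar, which is nonzero at a given index for a suitable t. Induction on the list
    then applies. *)
Lemma weight_split (J : set V) (F : I -> V) (s : seq I) :
  J 0 -> (forall u v, J u -> J v -> J (u + v)) -> (forall c u, J u -> J (c *: u)) ->
  (forall t u, J u -> J (T t u)) ->
  (forall t a, a \in s -> T t (F a) = chi t a *: F a) ->
  (forall a b, a \in s -> b \in s -> a != b -> exists t, chi t a != chi t b) ->
  uniq s -> J (\sum_(a <- s) F a) -> forall a, a \in s -> J (F a).
Proof.
move=> J0 JD JZ JT.
have T0 t : T t 0 = 0 by apply: (addrI (T t 0)); rewrite -TD !addr0.
elim: s F => [|b s IH] F hF hsep //= /andP [bs us] hJ.
have hs a : a \in s -> J (F a).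
  move=> has.
  have ab : a != b by apply: contraNneq bs => <-.
  have [t ht] := hsep a b (mem_behead (s := b :: s) has) (mem_head _ _) ab.
  have : J ((chi t a - chi t b) *: F a).
    apply: (IH (fun a => (chi t a - chi t b) *: F a)) => //.
    - by move=> t' a' ha'; rewrite TZ hF ?inE ?ha' ?orbT // !scalerA mulrC.
    - by move=> a1 b1 h1 h2; apply: hsep; rewrite inE ?h1 ?h2 orbT.
    have -> : \sum_(a0 <- s) (chi t a0 - chi t b) *: F a0 =
        T t (\sum_(a0 <- b :: s) F a0) + (- chi t b) *: \sum_(a0 <- b :: s) F a0.
      rewrite (big_morph (T t) (TD t) (T0 t)) scaler_sumr -big_split big_cons /=.
      rewrite hF ?mem_head // scaleNr subrr add0r; apply: eq_big_seq => a0 ha0.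
      by rewrite hF ?inE ?ha0 ?orbT // scalerBl scaleNr.
    by apply: JD; [exact: JT|exact: JZ].
  move=> /(JZ (chi t a - chi t b)^-1); rewrite scalerA mulVf ?scale1r //.
  by rewrite subr_eq0.
move=> a; rewrite inE => /orP [/eqP ->|]; last exact: hs.
have -> : F b = \sum_(a <- b :: s) F a + (-1) *: \sum_(a <- s) F a.
  by rewrite big_cons scaleN1r addrK.
apply: (JD) => //; apply: (JZ); rewrite big_seq; apply: (big_ind J) => //.
Qed.

End WeightSplit.

(** * Regular functions and weights *)

Section Regfun.
Variables (k : closedFieldType) (G : algGroup k).

(** Regular functions are bundled in order to carry ring and module structures; proof irrelevance
    keeps equality pointwise. *)
Record regfun := RegFun { rf :> G -> k; rf_reg : reg G rf }.

Lemma regfunP (f g : regfun) : (forall x, f x = g x) -> f = g.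
Proof.
case: f g => [f hf] [g hg] /= h; have e : f = g by apply/funext.
by subst g; rewrite (Prop_irrelevance hf hg).
Qed.

Lemma reg_const (c : k) : reg G (fun=> c). Proof. by case: (reg_subalg G). Qed.
Lemma reg_add f g : reg G f -> reg G g -> reg G (fun x => f x + g x).
Proof. by case: (reg_subalg G) => _ h _; apply: h. Qed.
Lemma reg_prod f g : reg G f -> reg G g -> reg G (fun x => f x * g x).
Proof. by case: (reg_subalg G) => _ _; apply. Qed.
Lemma reg_scale c f : reg G f -> reg G (fun x => c * f x).
Proof. exact/reg_prod/reg_const. Qed.
Lemma reg_opp f : reg G f -> reg G (fun x => - f x).
Proof. by move=> hf; under eq_fun do rewrite -mulN1r; apply: reg_scale. Qed.

HB.instance Definition _ := gen_eqMixin regfun.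
HB.instance Definition _ := gen_choiceMixin regfun.

Definition rf_add (f g : regfun) := RegFun (reg_add (rf_reg f) (rf_reg g)).
Definition rf_opp (f : regfun) := RegFun (reg_opp (rf_reg f)).
Definition rf_mul (f g : regfun) := RegFun (reg_prod (rf_reg f) (rf_reg g)).
Definition rf_const (c : k) := RegFun (reg_const c).
Definition rf_scale (c : k) (f : regfun) := RegFun (reg_scale c (rf_reg f)).

Fact rf_addA : associative rf_add.
Proof. by move=> f g h; apply/regfunP => x /=; rewrite addrA. Qed.
Fact rf_addC : commutative rf_add.
Proof. by move=> f g; apply/regfunP => x /=; rewrite addrC. Qed.
Fact rf_add0 : left_id (rf_const 0) rf_add.
Proof. by move=> f; apply/regfunP => x /=; rewrite add0r. Qed.
Fact rf_addN : left_inverse (rf_const 0) rf_opp rf_add.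
Proof. by move=> f; apply/regfunP => x /=; rewrite addNr. Qed.
HB.instance Definition _ := GRing.isZmodule.Build regfun rf_addA rf_addC rf_add0 rf_addN.

Fact rf_mulA : associative rf_mul.
Proof. by move=> f g h; apply/regfunP => x /=; rewrite mulrA. Qed.
Fact rf_mulC : commutative rf_mul.
Proof. by move=> f g; apply/regfunP => x /=; rewrite mulrC. Qed.
Fact rf_mul1 : left_id (rf_const 1) rf_mul.
Proof. by move=> f; apply/regfunP => x /=; rewrite mul1r. Qed.
Fact rf_mulD : left_distributive rf_mul +%R.
Proof. by move=> f g h; apply/regfunP => x /=; rewrite mulrDl. Qed.
Fact rf_1neq0 : rf_const 1 != 0.
Proof. by apply/eqP => /(congr1 (fun f : regfun => f 1%g)) /eqP; rewrite /= oner_eq0. Qed.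
HB.instance Definition _ :=
  GRing.Zmodule_isComNzRing.Build regfun rf_mulA rf_mulC rf_mul1 rf_mulD rf_1neq0.

Fact rf_scaleA a b (f : regfun) : rf_scale a (rf_scale b f) = rf_scale (a * b) f.
Proof. by apply/regfunP => x /=; rewrite mulrA. Qed.
Fact rf_scale1 : left_id 1 rf_scale.
Proof. by move=> f; apply/regfunP => x /=; rewrite mul1r. Qed.
Fact rf_scaleDr : right_distributive rf_scale +%R.
Proof. by move=> a f g; apply/regfunP => x /=; rewrite mulrDr. Qed.
Fact rf_scaleDl (f : regfun) : {morph rf_scale^~ f : a b / a + b}.
Proof. by move=> a b; apply/regfunP => x /=; rewrite mulrDl. Qed.
HB.instance Definition _ :=
  GRing.Zmodule_isLmodule.Build k regfun rf_scaleA rf_scale1 rf_scaleDr rf_scaleDl.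

Lemma rfD (f g : regfun) x : (f + g) x = f x + g x. Proof. by []. Qed.
Lemma rfN (f : regfun) x : (- f) x = - f x. Proof. by []. Qed.
Lemma rfB (f g : regfun) x : (f - g) x = f x - g x. Proof. by []. Qed.
Lemma rfM (f g : regfun) x : (f * g) x = f x * g x. Proof. by []. Qed.
Lemma rf0 x : (0 : regfun) x = 0. Proof. by []. Qed.
Lemma rf1 x : (1 : regfun) x = 1. Proof. by []. Qed.
Lemma rfZ c (f : regfun) x : (c *: f) x = c * f x. Proof. by []. Qed.
Lemma rfX (f : regfun) n x : (f ^+ n) x = f x ^+ n.
Proof. by elim: n => [|n IH]; rewrite ?expr0 // !exprS rfM IH. Qed.
Lemma rf_sum (I : Type) (r : seq I) (P : pred I) (F : I -> regfun) x :
  (\sum_(i <- r | P i) F i) x = \sum_(i <- r | P i) F i x.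
Proof. exact: (big_morph (fun f : regfun => f x)). Qed.
Lemma rf_prod (I : Type) (r : seq I) (P : pred I) (F : I -> regfun) x :
  (\prod_(i <- r | P i) F i) x = \prod_(i <- r | P i) F i x.
Proof. exact: (big_morph (fun f : regfun => f x)). Qed.

Definition rfE := (rfD, rfN, rfM, rf0, rf1, rfZ, rfX, rf_sum, rf_prod).

Fact rf_const_zmod : zmod_morphism rf_const.
Proof. by move=> a b; apply/regfunP => x. Qed.
Fact rf_const_monoid : monoid_morphism rf_const.
Proof. by split=> [|a b]; apply/regfunP => x. Qed.
HB.instance Definition _ := GRing.isZmodMorphism.Build k regfun rf_const rf_const_zmod.
HB.instance Definition _ := GRing.isMonoidMorphism.Build k regfun rf_const rf_const_monoid.

Definition rf_ev (x : G) (f : regfun) : k := f x.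
Fact rf_ev_zmod x : zmod_morphism (rf_ev x). Proof. by []. Qed.
Fact rf_ev_monoid x : monoid_morphism (rf_ev x). Proof. by []. Qed.
HB.instance Definition _ x := GRing.isZmodMorphism.Build regfun k (rf_ev x) (rf_ev_zmod x).
HB.instance Definition _ x := GRing.isMonoidMorphism.Build regfun k (rf_ev x) (rf_ev_monoid x).

Lemma rf_scaleE c (f : regfun) : c *: f = rf_const c * f.
Proof. by apply/regfunP. Qed.

Lemma regfun_presentation : exists (A : comNzRingType) (c : {rmorphism k -> A}) (psi : {rmorphism A -> regfun}),
  [/\ noetherian A, jacobson c, forall a, psi (c a) = rf_const a & forall f, exists a, psi a = f].
Proof.
have [n [g hg]] := reg_fingen G.
have gr i : reg G (g i) by rewrite hg => S [_]; apply; exists i.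
have [A [c [hN hJ [x hx]]]] := free_algebra k n.
have [psi [h1 h2 h3]] := hx regfun rf_const (fun i => RegFun (gr i)).
exists A, c, psi; split=> // -[f hf].
have : genalg (range g) f by rewrite -hg.
move=> /(_ [set f | exists a, rf (psi a) = f]) [].
  split; last by move=> _ [i _ <-]; exists (x i); rewrite h2.
  split=> [a|u v [a <-] [b <-]|u v [a <-] [b <-]].
  - by exists (c a); rewrite h1.
  - by exists (a + b); rewrite rmorphD.
  - by exists (a * b); rewrite rmorphM.
by move=> a e; exists a; apply/regfunP => y; rewrite e.
Qed.

Lemma regfun_noetherian : noetherian regfun.
Proof. by have [A [c [psi [hN _ _ hs]]]] := regfun_presentation; apply: noetherian_surj hs hN. Qed.

Lemma regfun_gen : exists (r : nat) (g : 'I_r -> regfun), forall S : set regfun,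
  (forall a, S (rf_const a)) -> (forall i, S (g i)) ->
  (forall u v, S u -> S v -> S (u + v)) -> (forall u v, S u -> S v -> S (u * v)) ->
  forall a, S a.
Proof.
have [n [g hg]] := reg_fingen G.
have gr i : reg G (g i) by rewrite hg => S [_]; apply; exists i.
exists n, (fun i => RegFun (gr i)) => S hc hi hD hM [f hf].
have : genalg (range g) f by rewrite -hg.
move=> /(_ [set f | exists2 a, S a & rf a = f]) [].
  split; last by move=> _ [i _ <-]; exists (RegFun (gr i)).
  split=> [a|u v [a ha <-] [b hb <-]|u v [a ha <-] [b hb <-]].
  - by exists (rf_const a).
  - by exists (a + b) => //; apply: hD.
  - by exists (a * b) => //; apply: hM.
move=> a ha e; have -> : RegFun hf = a by apply/regfunP => y /=; rewrite e.
exact: ha.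
Qed.

Lemma regfun_point (chi : regfun -> k) :
  (forall a, chi (rf_const a) = a) -> (forall f g, chi (f + g) = chi f + chi g) ->
  (forall f g, chi (f * g) = chi f * chi g) -> exists x : G, forall f, chi f = f x.
Proof.
move=> h1 hD hM.
pose ch (f : G -> k) : k := if pselect (reg G f) is left hf then chi (RegFun hf) else 0.
have chE (f : G -> k) (hf : reg G f) : ch f = chi (RegFun hf).
  by rewrite /ch; case: pselect => // hf'; congr chi; apply/regfunP.
have [||f g hf hg|x [hx _]] := @reg_points k G ch.
- by move=> c; rewrite (chE _ (reg_const c)) -[RHS](h1 c); congr chi; apply/regfunP.
- move=> f g hf hg; rewrite (chE _ hf) (chE _ hg) (chE _ (reg_add hf hg)) -hD.
  by congr chi; apply/regfunP.
- rewrite (chE _ hf) (chE _ hg) (chE _ (reg_prod hf hg)) -hM.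
  by congr chi; apply/regfunP.
by exists x => -[f hf]; rewrite /= -(hx f hf) (chE _ hf).
Qed.

(** The ideal is pulled back to a polynomial ring. An algebra map that kills the pullback factors
    through [regfun] and is a point of the group by [regfun_point]. *)
Theorem regfun_nullstellensatz (J : set regfun) (f : regfun) : is_ideal J ->
  (forall x, (forall h, J h -> h x = 0) -> f x = 0) -> exists n, J (f ^+ n).
Proof.
move=> hJ hf; have [A [c [psi [hN hA hc hs]]]] := regfun_presentation.
have [a ha] := hs f.
have hJ' : is_ideal (psi @^-1` J).
  split=> [|x y|b x] /=; rewrite ?rmorph0 ?rmorphD ?rmorphM.
  - exact: is_ideal0.
  - exact: is_idealD.
  - exact: is_idealMr.
suff [n hn] : exists n, (psi @^-1` J) (a ^+ n) by exists n; rewrite -ha -rmorphXn.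
apply: (nullstellensatz hN hA hJ') => chi chic chiJ.
have /choice [l hl] := hs.
have chil b h : psi b = h -> chi (l h) = chi b.
  move=> hb; apply/eqP; rewrite -subr_eq0 -rmorphB; apply/eqP/chiJ.
  by rewrite /= rmorphB hl hb subrr; apply: is_ideal0.
have [||g g'|x hx] := @regfun_point (fun h => chi (l h)).
- by move=> b; rewrite (chil (c b)).
- move=> g g'; rewrite (chil (l g + l g')); first exact: rmorphD.
  by rewrite rmorphD /= !hl.
- rewrite (chil (l g * l g')); first exact: rmorphM.
  by rewrite rmorphM /= !hl.
rewrite -(chil a f) // hx; apply: hf => h hh.
by rewrite -hx; apply: chiJ; rewrite /= hl.
Qed.

Corollary regfun_unit_ideal (J : set regfun) : is_ideal J ->
  (forall x, exists2 h, J h & h x != 0) -> J 1.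
Proof.
move=> hJ h; have [|n] := @regfun_nullstellensatz J 1 hJ; last by rewrite expr1n.
by move=> x hx; have [g /hx -> /eqP] := h x.
Qed.

Lemma reg_comulE (f : regfun) : exists (n : nat) (a b : 'I_n -> regfun),
  forall x y, f (x * y)%g = \sum_(i < n) a i x * b i y.
Proof.
have [n [a [b [ha hb h]]]] := reg_mul (rf_reg f).
by exists n, (fun i => RegFun (ha i)), (fun i => RegFun (hb i)).
Qed.

Lemma reg_ltrans (y : G) f : reg G f -> reg G (fun x => f (y * x)%g).
Proof.
move=> hf; have [n [a [b [ha hb h]]]] := reg_mul hf.
by under eq_fun do rewrite h; apply: reg_sum => i; apply: reg_scale.
Qed.

Lemma reg_rtrans (y : G) f : reg G f -> reg G (fun x => f (x * y)%g).
Proof.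
move=> hf; have [n [a [b [ha hb h]]]] := reg_mul hf.
under eq_fun do rewrite h; apply: reg_sum => i.
by under eq_fun do rewrite mulrC; apply: reg_scale.
Qed.

Definition ltr (y : G) (f : regfun) := RegFun (reg_ltrans y (rf_reg f)).
Definition rtr (y : G) (f : regfun) := RegFun (reg_rtrans y (rf_reg f)).
Definition rinv (f : regfun) := RegFun (reg_inv (rf_reg f)).
Definition cnj (y : G) (f : regfun) : regfun := ltr y (rtr y^-1%g f).

Lemma cnjE y f x : cnj y f x = f (y * x * y^-1)%g.
Proof. by []. Qed.

End Regfun.

(** [M] need not have a unit and a [chi a] may vanish identically, so the conclusion is about
    products. It is [weight_split] for translations acting on functions, with the zero subspace. *)
Lemma char_indep (k : fieldType) (M : Type) (op : M -> M -> M) (I : eqType)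
    (chi : I -> M -> k) (s : seq I) (c : I -> k) :
  (forall a x y, a \in s -> chi a (op x y) = chi a x * chi a y) ->
  (forall a b, a \in s -> b \in s -> a != b -> exists x, chi a x != chi b x) ->
  uniq s -> (forall x, \sum_(a <- s) c a * chi a x = 0) ->
  forall a x, a \in s -> c a * chi a x = 0.
Proof.
move=> hM hsep us h0 a x has.
pose T (t : M) (f : M -> k^o) : M -> k^o := fun x => f (op t x).
pose F (b : I) : M -> k^o := fun x => c b * chi b x.
have hF b t : b \in s -> T t (F b) = chi b t *: F b.
  by move=> hb; apply/funext => y; rewrite /T /F hM // mulrCA.
have sum0 (l : seq I) y : (\sum_(b <- l) F b) y = \sum_(b <- l) c b * chi b y.
  by elim: l => [|b l IH]; rewrite ?big_nil // !big_cons -IH.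
have := @weight_split k (M -> k^o) M I (fun t a => chi a t) T _ _ [set 0] F s erefl.
move=> /(_ (fun _ _ _ => erefl) (fun _ _ _ => erefl)) h.
have : [set 0] (F a); last by move=> /(congr1 (fun f : M -> k^o => f x)).
apply: h => //.
- by move=> u v -> ->; rewrite addr0.
- by move=> b u ->; rewrite scaler0.
- by move=> t u ->; apply/funext.
- by move=> t b hb; apply: hF.
- by apply/funext => y; rewrite sum0 h0.
Qed.

Lemma closed_field_nonroot (k : closedFieldType) (n : int) : n != 0 ->
  exists2 z : k, z != 0 & z ^ n != 1.
Proof.
move=> n0; pose q : {poly k} := 'X * ('X^`|n|%N - 1).
have q0 : q != 0.
  rewrite mulf_neq0 ?polyX_eq0 // -size_poly_eq0 size_XnsubC //.
  by rewrite lt0n absz_eq0.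
have /closed_nonrootP [z] := q0.
rewrite rootM negb_or rootX rootE !hornerE => /andP [z0 hz].
exists z => //; rewrite subr_eq0 in hz; case: n n0 q q0 hz => n n0 q q0 hz //.
by rewrite NegzE -invr_expz invr_eq1.
Qed.

Lemma quotient_basis (k : fieldType) (V : lmodType k) (Q : set V) (ys : seq V) :
  Q 0 -> (forall u v, Q u -> Q v -> Q (u + v)) -> (forall c u, Q u -> Q (c *: u)) ->
  exists xs : seq V, [/\ {subset xs <= ys},
    forall c : nat -> k, Q (\sum_(i < size xs) c i *: xs`_i) -> forall i, (i < size xs)%N -> c i = 0 &
    forall y, y \in ys -> exists c : nat -> k, Q (y - \sum_(i < size xs) c i *: xs`_i)].
Proof.
move=> Q0 QD QZ; elim: ys => [|y ys [xs [h1 h2 h3]]].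
  by exists [::]; split.
have [[c hc]|hno] := pselect (exists c : nat -> k, Q (y - \sum_(i < size xs) c i *: xs`_i)).
  exists xs; split=> // z; first by move=> /h1; rewrite inE => ->; rewrite orbT.
  by rewrite inE => /orP [/eqP ->|/h3 //]; exists c.
exists (y :: xs); split.
- move=> z; rewrite !inE => /orP [->//|/h1 ->]; exact: orbT.
- move=> c; rewrite /= big_ord_recl /= => hQ.
  have c0 : c 0%N = 0.
    apply/eqP; apply: contraT => c0; case: hno.
    exists (fun i => - ((c 0%N)^-1 * c i.+1)); have := QZ (c 0%N)^-1 _ hQ.
    rewrite scalerDr scalerA mulVf // scale1r; congr (Q (_ + _)).
    rewrite scaler_sumr -sumrN; apply: eq_bigr => i _.
    by rewrite scaleNr opprK scalerA.
  move: hQ; rewrite c0 scale0r add0r => /(h2 (fun i => c i.+1)) hc [|i] //.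
  exact: hc.
- move=> z; rewrite inE => /orP [/eqP ->|/h3 [c hc]].
    exists (fun i => (i == 0%N)%:R); rewrite /= big_ord_recl /= scale1r big1 ?addr0 ?subrr //.
    by move=> i _; rewrite scale0r.
  exists (fun i => if i is i'.+1 then c i' else 0).
  by rewrite /= big_ord_recl /= scale0r add0r.
Qed.

(** * Characters of a torus as exponent vectors *)

Section Laurent.
Variables (k : closedFieldType) (r : nat).
Implicit Types (s : 'I_r -> k).

Definition wt : zmodType := {ffun 'I_r -> int}.
Implicit Types (a b : wt).

Definition mon s a : k := \prod_i (s i) ^ (a i).

Lemma mon0 s : mon s 0 = 1.
Proof. by rewrite /mon big1 // => i _; rewrite ffunE expr0z. Qed.

Lemma monD s a b : Gm_pow s -> mon s (a + b) = mon s a * mon s b.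
Proof.
move=> hs; rewrite /mon -big_split; apply: eq_bigr => i _ /=.
by rewrite ffunE expfzDr // hs.
Qed.

Lemma monM s s' a : mon (fun i => s i * s' i) a = mon s a * mon s' a.
Proof. by rewrite /mon -big_split; apply: eq_bigr => i _; rewrite expfzMl. Qed.

Lemma mon_neq0 s a : Gm_pow s -> mon s a != 0.
Proof. by move=> hs; apply/prodf_neq0 => i _; apply: expfz_neq0; apply: hs. Qed.

Lemma monN s a : Gm_pow s -> mon s (- a) = (mon s a)^-1.
Proof.
move=> hs; apply: (mulIf (mon_neq0 a hs)).
by rewrite -monD // addNr mon0 mulVf // mon_neq0.
Qed.

Lemma mon_mul_nat s a n : Gm_pow s -> mon s (a *+ n) = mon s a ^+ n.
Proof.
by move=> hs; elim: n => [|n IH]; rewrite ?mon0 // mulrS monD // IH exprS.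
Qed.

Lemma mon1 a : mon (fun=> 1) a = 1.
Proof. by rewrite /mon big1 // => i _; rewrite exp1rz. Qed.

Lemma Gm1 : Gm_pow (fun _ : 'I_r => 1 : k). Proof. by move=> i; apply: oner_neq0. Qed.

Lemma GmM s s' : Gm_pow s -> Gm_pow s' -> Gm_pow (fun i => s i * s' i).
Proof. by move=> h h' i; apply: mulf_neq0; [apply: h|apply: h']. Qed.

Lemma GmV s : Gm_pow s -> Gm_pow (fun i => (s i)^-1).
Proof. by move=> h i; rewrite invr_neq0 ?h. Qed.

Lemma mon_sep a b : a != b -> exists2 s, Gm_pow s & mon s a != mon s b.
Proof.
move=> ab; have [i hi] : exists i, a i != b i.
  apply: contrapT => h; case/eqP: ab; apply/ffunP => i; apply/eqP.
  by apply: contraT => hi; case: h; exists i.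
have [|z z0 hz] := @closed_field_nonroot k (a i - b i); first by rewrite subr_eq0.
pose s j := if j == i then z else 1.
have hs : Gm_pow s by move=> j; rewrite /s; case: ifP => _ //; rewrite oner_neq0.
have ms c : mon s c = z ^ (c i).
  rewrite /mon (bigD1 i) //= /s eqxx big1 ?mulr1 // => j /negPf ->.
  exact: exp1rz.
exists s => //; rewrite !ms; apply: contra hz => /eqP e.
by rewrite expfzDr // e -expfzDr // addrN expr0z.
Qed.

Lemma mon_indep (l : seq wt) (c : wt -> k) : uniq l ->
  (forall s, Gm_pow s -> \sum_(a <- l) c a * mon s a = 0) ->
  forall a, a \in l -> c a = 0.
Proof.
move=> ul h a ha.
pose M := {s : 'I_r -> k | @Gm_pow k r s}.
pose op (s t : M) : M := exist _ _ (GmM (svalP s) (svalP t)).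
have := @char_indep k M op wt (fun (a : wt) (x : M) => mon (sval x) a) l c.
move=> /(_ _ _ ul _ a (exist _ _ Gm1) ha); rewrite /= mon1 mulr1; apply.
- by move=> *; apply: monM.
- by move=> b b' _ _ /mon_sep [s hs hb]; exists (exist _ s hs).
- by move=> [s hs]; apply: h.
Qed.

Lemma laurentP f : @laurent k r f -> exists l : seq (k * wt),
  forall s, Gm_pow s -> f s = \sum_(x <- l) x.1 * mon s x.2.
Proof.
pose e (i : 'I_r) : wt := [ffun j => (j == i)%:Z].
have me s i : mon s (e i) = s i.
  rewrite /mon (bigD1 i) //= big1 ?mulr1 => [|j /negPf ji]; first by rewrite ffunE eqxx expr1z.
  by rewrite ffunE ji expr0z.
move=> /(_ [set f | exists l : seq (k * wt),
  forall s, Gm_pow s -> f s = \sum_(x <- l) x.1 * mon s x.2]); apply; split; first split.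
- by move=> c; exists [:: (c, 0)] => s _; rewrite big_seq1 mon0 mulr1.
- move=> u v [l hl] [l' hl']; exists (l ++ l') => s hs.
  by rewrite big_cat hl // hl'.
- move=> u v [l hl] [l' hl']; exists [seq (x.1 * y.1, x.2 + y.2) | x <- l, y <- l'] => s hs.
  rewrite hl // hl' // big_allpairs_dep mulr_suml; apply: eq_bigr => x _.
  rewrite mulr_sumr; apply: eq_bigr => y _ /=; rewrite monD //; ring.
- move=> _ [[i _ <-]|[i _ <-]].
    by exists [:: (1, e i)] => s _; rewrite big_seq1 mul1r me.
  by exists [:: (1, - e i)] => s hs; rewrite big_seq1 mul1r monN // me.
Qed.

Lemma sum_by_weight (A C : zmodType) (l : seq (A * wt)) (h : A -> wt -> C)
    (hD : forall x y a, h (x + y) a = h x a + h y a) (h0 : forall a, h 0 a = 0) :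
  \sum_(x <- l) h x.1 x.2 =
  \sum_(a <- undup [seq x.2 | x <- l]) h (\sum_(x <- l | x.2 == a) x.1) a.
Proof.
have hs a : h (\sum_(x <- l | x.2 == a) x.1) a = \sum_(x <- l | x.2 == a) h x.1 a.
  exact: (big_morph (h^~ a) (fun x y => hD x y a) (h0 a)).
under [RHS]eq_bigr do rewrite hs.
rewrite (exchange_big_dep predT) //= big_seq [RHS]big_seq; apply: eq_bigr => x xl.
have hx : x.2 \in undup [seq x.2 | x <- l] by rewrite mem_undup map_f.
rewrite big_mkcond (bigD1_seq x.2) ?undup_uniq //= eqxx big1 ?addr0 // => a.
by rewrite eq_sym => /negPf ->.
Qed.

End Laurent.

Section Torus.
Variables (k : closedFieldType) (G : algGroup k).
Variables (r : nat) (phi : ('I_r -> k) -> G).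
Hypothesis phi_emb : regular_embedding (@Gm_pow k r) (@laurent k r) (reg G) phi.
Hypothesis phiM : forall s s', Gm_pow s -> Gm_pow s' ->
  phi (fun i => s i * s' i) = (phi s * phi s')%g.
Local Notation wt := (wt r).
Local Notation kG := (regfun G).

Lemma phi1 : phi (fun=> 1) = 1%g.
Proof.
have h1 : Gm_pow (fun _ : 'I_r => 1 : k) by apply: Gm1.
have e := phiM h1 h1; apply: (mulgI (phi (fun=> 1))); rewrite mulg1 -e.
by congr phi; apply/funext => i; rewrite mulr1.
Qed.

Lemma phiV s : Gm_pow s -> phi (fun i => (s i)^-1) = (phi s)^-1%g.
Proof.
move=> hs; apply: (mulgI (phi s)); rewrite -phiM ?mulgV; last exact: GmV.
  by rewrite -phi1; congr phi; apply/funext => i; rewrite mulfV ?hs.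
exact: hs.
Qed.

(** Weights refer to conjugation, which fixes 1 and therefore acts on all powers of the maximal
    ideal there. *)
Definition wvec (a : wt) (f : kG) : Prop :=
  forall s x, Gm_pow s -> f (phi s * x * (phi s)^-1)%g = mon s a * f x.

Lemma wvecD a f g : wvec a f -> wvec a g -> wvec a (f + g).
Proof. by move=> hf hg s x hs; rewrite !rfE hf // hg // mulrDr. Qed.
Lemma wvecZ a c f : wvec a f -> wvec a (c *: f).
Proof. by move=> hf s x hs; rewrite !rfE hf // mulrCA. Qed.
Lemma wvecM a b f g : wvec a f -> wvec b g -> wvec (a + b) (f * g).
Proof. by move=> hf hg s x hs; rewrite !rfE hf // hg // monD // mulrACA. Qed.
Lemma wvec1 : wvec 0 1.
Proof. by move=> s x hs; rewrite mon0 !rfE mulr1. Qed.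
Lemma wvec0 a : wvec a 0.
Proof. by move=> s x hs; rewrite !rfE mulr0. Qed.

Lemma wvec_at1 a f : wvec a f -> a != 0 -> f 1%g = 0.
Proof.
move=> hf a0; have [s hs] := @mon_sep k r a 0 a0.
rewrite mon0 => h; have := hf s 1%g hs; rewrite mulg1 mulgV => /eqP.
rewrite -subr_eq0 -{1}[f _]mul1r -mulrBl mulf_eq0 subr_eq0 eq_sym (negPf h) /=.
by move/eqP.
Qed.

(** Two comultiplications expand f(t x t^-1) with coefficients that are Laurent polynomials in t.
    Collecting by exponent gives the components. *)
Lemma wvec_decomp f : exists (l : seq wt) (F : wt -> kG),
  [/\ uniq l, forall a, wvec a (F a) & f = \sum_(a <- l) F a].
Proof.
have /choice [cm hcm] : forall f : kG, exists L : seq (kG * kG), forall x y,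
    f (x * y)%g = \sum_(p <- L) p.1 x * p.2 y.
  move=> g; have [n [a [b hab]]] := reg_comulE g.
  exists [seq (a i, b i) | i <- enum 'I_n] => x y.
  by rewrite hab big_map big_enum.
have [_ phi_reg _] := phi_emb.
have /choice [lau hlau] : forall uv : kG * kG, exists l : seq (k * wt), forall s, Gm_pow s ->
    uv.1 (phi s) * uv.2 (phi s)^-1%g = \sum_(x <- l) x.1 * mon s x.2.
  case=> u v; have [u' hu' eu] := phi_reg _ (rf_reg u).
  have [v' hv' ev] := phi_reg _ (rf_reg (rinv v)).
  have [_ _ lauM] : subalg (@laurent k r).
    split=> [c|f1 f2 h1 h2|f1 f2 h1 h2] B hB; case: (hB) => -[hc hD hM] _; first exact: hc.
      by apply: hD; [apply: h1|apply: h2].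
    by apply: hM; [apply: h1|apply: h2].
  have [l hl] := laurentP (lauM _ _ hu' hv'); exists l => s hs.
  by rewrite -hl //= -eu // -ev.
pose L : seq (kG * wt) := flatten [seq flatten [seq [seq (x.1 *: q.2, x.2) | x <- lau (q.1, p.2)]
   | q <- cm p.1] | p <- cm f].
have hL s y : Gm_pow s -> f (phi s * y * (phi s)^-1)%g = \sum_(x <- L) mon s x.2 * x.1 y.
  move=> hs; rewrite hcm big_flatten big_map; apply: eq_bigr => p _.
  rewrite hcm mulr_suml big_flatten big_map; apply: eq_bigr => q _.
  rewrite mulrAC (hlau (q.1, p.2)) // big_map mulr_suml; apply: eq_bigr => x _ /=.
  by ring.
pose F a : kG := \sum_(x <- L | x.2 == a) x.1.
pose l := undup [seq x.2 | x <- L].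
have hF s y : Gm_pow s -> f (phi s * y * (phi s)^-1)%g = \sum_(a <- l) mon s a * F a y.
  move=> hs; rewrite hL // (@sum_by_weight r kG k L (fun g a => mon s a * g y)) //.
    by move=> g g' a; rewrite rfE mulrDr.
  by move=> a; rewrite rfE mulr0.
(* Expand f at x conjugated by a product of two torus elements in two ways, and compare coefficients
   in the outer one. *)
have hw a : a \in l -> wvec a (F a).
  move=> al s y hs; apply/eqP; rewrite -subr_eq0; apply/eqP.
  apply: (mon_indep (c := fun a => F a (phi s * y * (phi s)^-1)%g - mon s a * F a y) (undup_uniq _) _ al).
  move=> s' hs'; under eq_bigr do rewrite mulrBl; rewrite sumrB; apply/eqP; rewrite subr_eq0; apply/eqP.
  have := hF s' (phi s * y * (phi s)^-1)%g hs'.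
  have -> : (phi s' * (phi s * y * (phi s)^-1) * (phi s')^-1 =
            phi (fun i => s' i * s i)%R * y * (phi (fun i => s' i * s i)%R)^-1)%g.
    by rewrite phiM // invgM !mulgA.
  rewrite hF; last exact: GmM.
  under eq_bigr do rewrite mulrC; under [X in X = _ -> _]eq_bigr do rewrite monM.
  move=> h; transitivity (\sum_(a <- l) mon s' a * F a (phi s * y / phi s)%g).
    by apply: eq_bigr => a' _; rewrite mulrC.
  by rewrite -h; apply: eq_bigr => a' _; ring.
exists l, (fun a => if a \in l then F a else 0); split; first exact: undup_uniq.
  by move=> a; case: ifP => [/hw //|_]; apply: wvec0.
apply/regfunP => y; have := hF _ y (@Gm1 k r); rewrite phi1 mul1g invg1 mulg1 => ->.
by rewrite rfE; apply: eq_big_seq => a ->; rewrite mon1 mul1r.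
Qed.

Lemma wvec_split (J : set kG) (l : seq wt) (F : wt -> kG) :
  J 0 -> (forall u v, J u -> J v -> J (u + v)) -> (forall c u, J u -> J (c *: u)) ->
  (forall s u, Gm_pow s -> J u -> J (cnj (phi s) u)) ->
  uniq l -> (forall a, a \in l -> wvec a (F a)) -> J (\sum_(a <- l) F a) ->
  forall a, a \in l -> J (F a).
Proof.
move=> J0 JD JZ JT ul hF hJ a ha.
have := @weight_split k kG {s : 'I_r -> k | Gm_pow s} wt (fun s a => mon (sval s) a)
  (fun s u => cnj (phi (sval s)) u) _ _ J F l.
apply => //.
- by move=> s u v; apply/regfunP => x; rewrite !cnjE.
- by move=> s c u; apply/regfunP => x; rewrite !cnjE.
- by move=> [s hs] u; apply: JT.
- by move=> [s hs] b hb; apply/regfunP => x; rewrite cnjE hF.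
move=> b b' _ _ hb; have [s hs h'] := mon_sep k hb.
by exists (exist (fun s => @Gm_pow k r s) s hs).
Qed.

Definition mx1 : set kG := [set f | f 1%g = 0].

Lemma mx1_ideal : is_ideal mx1.
Proof. exact: (@max_ideal k kG (rf_ev 1%g)). Qed.

Lemma cotangent_basis : exists (d : nat) (x : 'I_d -> kG) (w : 'I_d -> wt),
  [/\ forall i, x i 1%g = 0, forall i, wvec (w i) (x i),
    forall c : 'I_d -> k, ipow mx1 2 (\sum_i c i *: x i) -> forall i, c i = 0 &
    forall y : kG, y 1%g = 0 -> exists c : 'I_d -> k, ipow mx1 2 (y - \sum_i c i *: x i)].
Proof.
have [n [g hg]] := regfun_gen G.
pose y0 i := g i - rf_const G (g i 1%g).
have hy0 i : y0 i 1%g = 0 by rewrite /y0 rfE /= subrr.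
have hdec (f : kG) : f 1%g = 0 -> exists ys : seq kG,
    (forall y, y \in ys -> y 1%g = 0 /\ exists a, wvec a y) /\ f = \sum_(y <- ys) y.
  move=> hf; have [l [F [ul hF eF]]] := wvec_decomp f.
  exists [seq F a | a <- l]; split; last by rewrite big_map.
  move=> _ /mapP [a ha ->]; split; last by exists a.
  have [a0|a0] := eqVneq a 0; last exact: wvec_at1 (hF a) a0.
  move: hf; rewrite eF rfE (bigD1_seq a) //= big1 ?addr0 // => b.
  by rewrite a0 => b0; apply: wvec_at1 (hF b) b0.
have /choice [ys hys] := fun i => hdec _ (hy0 i).
pose Y := flatten [seq ys i | i <- enum 'I_n].
have hQ := ipow_ideal mx1 2.
have [||c u hu|xs [h1 h2 h3]] := @quotient_basis k kG (ipow mx1 2) Y.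
- exact: is_ideal0.
- by move=> u v; apply: is_idealD.
- by rewrite rf_scaleE; apply: (is_idealMr _ hQ).
have hY y : y \in Y -> y 1%g = 0 /\ exists a, wvec a y.
  by move=> /flattenP [s /mapP [i _ ->]]; apply: (hys i).1.
have /choice [w hw] : forall i : 'I_(size xs), exists a, wvec a xs`_i.
  by move=> i; apply: (hY _ (h1 _ (mem_nth _ (ltn_ord i)))).2.
exists (size xs), (fun i => xs`_i), w; split=> //.
- by move=> i; apply: (hY _ (h1 _ (mem_nth _ (ltn_ord i)))).1.
- move=> c hc i; have := h2 (fun j => if insub j is Some i' then c i' else 0).
  move=> /(_ _ i (ltn_ord i)); rewrite valK; apply.
  by under eq_bigr do rewrite valK.
pose sp y := exists c : 'I_(size xs) -> k, ipow mx1 2 (y - \sum_i c i *: xs`_i).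
have spD u v : sp u -> sp v -> sp (u + v).
  move=> [c hc] [c' hc']; exists (fun i => c i + c' i).
  under eq_bigr do rewrite scalerDl; rewrite big_split opprD addrACA; exact: (is_idealD hQ hc hc').
have spZ b u : sp u -> sp (b *: u).
  move=> [c hc]; exists (fun i => b * c i); under eq_bigr do rewrite -scalerA.
  by rewrite -scaler_sumr -scalerBr rf_scaleE; apply: (is_idealMr _ hQ).
have sp0 u : ipow mx1 2 u -> sp u.
  by move=> hu; exists (fun=> 0); rewrite big1 ?subr0 // => i _; rewrite scale0r.
have sps (l : seq kG) : (forall y, y \in l -> sp y) -> sp (\sum_(y <- l) y).
  elim: l => [|y l IH] hl; first by rewrite big_nil; apply: sp0; apply: is_ideal0.
  rewrite big_cons; apply: spD; first by apply: hl; rewrite mem_head.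
  by apply: IH => z hz; apply: hl; rewrite inE hz orbT.
have spy i : sp (y0 i).
  rewrite (hys i).2; apply: sps => y hy; have [|c hc] := h3 y; last by exists (fun i => c i).
  by apply/flattenP; exists (ys i) => //; apply: map_f; rewrite mem_enum.
suff H (f : kG) : sp (f - rf_const G (f 1%g)) by move=> y y1; have := H y; rewrite y1 rmorph0 subr0.
apply: (hg [set f : kG | sp (f - rf_const G (f 1%g))]) => [c|i|u v hu hv|u v hu hv] /=.
- by rewrite subrr; apply: sp0; apply: is_ideal0.
- exact: spy.
- by rewrite rmorphD opprD addrACA; apply: spD.
- have -> : u * v - rf_const G (u 1%g * v 1%g) = (u - rf_const G (u 1%g)) * (v - rf_const G (v 1%g)) +
    (v 1%g *: (u - rf_const G (u 1%g)) + u 1%g *: (v - rf_const G (v 1%g))).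
    by apply/regfunP => x; rewrite !rfE /= ; ring.
  apply: (spD); last by apply: (spD); apply: (spZ).
  by apply: sp0; apply: (ipow_mul (i := 1) (j := 1)); apply: ipow1; rewrite /mx1 /= subrr.
Qed.

End Torus.

(** * Closed subsets, germs at 1, and identity components *)

Section Closed.
Variables (k : closedFieldType) (G : algGroup k).
Local Notation kG := (regfun G).
Implicit Types (Z H K : set G) (f g h s : kG).

Definition vanish Z : set kG := [set f | forall x, Z x -> f x = 0].

Lemma vanish_ideal Z : is_ideal (vanish Z).
Proof.
split=> [x _|f g hf hg x Zx|a f hf x Zx] /=; rewrite ?rfE //.
  by rewrite hf // hg // addr0.
by rewrite hf // mulr0.
Qed.

Lemma zclosedP Z : zclosed Z <-> exists S : set kG, Z = [set x | forall f, S f -> f x = 0].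
Proof.
split=> [[S SG ->]|[S ->]].
  exists [set f : kG | S f]; apply/seteqP; split=> x h f Sf; first exact: h.
  exact: (h (RegFun (SG _ Sf))).
exists [set f : G -> k | exists2 g : kG, S g & f = g].
  by move=> _ [g _ ->]; apply: rf_reg.
by apply/seteqP; split=> x h f; [move=> [g Sg ->]; apply: h|move=> Sf; apply: h; exists f].
Qed.

Lemma zclosed_vanish Z x : zclosed Z -> (forall f, vanish Z f -> f x = 0) -> Z x.
Proof.
by move=> /zclosedP [S ->] h f Sf; apply: h => y; apply.
Qed.

Lemma zclosedI Z1 Z2 : zclosed Z1 -> zclosed Z2 -> zclosed (Z1 `&` Z2).
Proof.
move=> /zclosedP [S1 ->] /zclosedP [S2 ->]; apply/zclosedP.
exists (S1 `|` S2); apply/seteqP; split=> x.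
  by move=> [h1 h2] f [/h1|/h2].
by move=> h; split=> f hf; apply: h; [left|right].
Qed.

Lemma zclosedU Z1 Z2 : zclosed Z1 -> zclosed Z2 -> zclosed (Z1 `|` Z2).
Proof.
move=> h1 h2; apply/zclosedP.
exists [set f | exists f1 f2, [/\ vanish Z1 f1, vanish Z2 f2 & f = f1 * f2]].
apply/seteqP; split=> x.
  move=> h f [f1 [f2 [hf1 hf2 ->]]]; rewrite rfE.
  by case: h => h; [rewrite hf1 // mul0r|rewrite [f2 x]hf2 // mulr0].
move=> h; have [Z1x|nZ1] := pselect (Z1 x); [by left|right].
have [f1 [hf1 f1x]] : exists f1, vanish Z1 f1 /\ f1 x != 0.
  apply: contrapT => no; apply: nZ1; apply: zclosed_vanish => // f hf.
  by apply/eqP; apply: contraT => fx; case: no; exists f.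
apply: zclosed_vanish => // f2 hf2; have : (f1 * f2) x = 0 by apply: h; exists f1, f2.
by rewrite rfE => /eqP; rewrite mulf_eq0 (negPf f1x) => /eqP.
Qed.

Lemma zclosed_preim (F : G -> G) Z : (forall f, reg G f -> reg G (f \o F)) ->
  zclosed Z -> zclosed (F @^-1` Z).
Proof.
move=> hF /zclosedP [S ->]; apply/zclosedP.
exists [set f | exists2 g, S g & f = RegFun (hF _ (rf_reg g))].
apply/seteqP; split=> x h f; first by move=> [g Sg ->]; apply: h.
by move=> Sf; apply: (h (RegFun (hF _ (rf_reg f)))); exists f.
Qed.

Lemma zclosed_cond (I : Type) (P : I -> Prop) (F : I -> kG) Z : zclosed Z ->
  zclosed [set x | Z x /\ forall i, P i -> F i x = 0].
Proof.
move=> hZ; apply: zclosedI => //; apply/zclosedP.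
exists [set f | exists2 i, P i & f = F i]; apply/seteqP; split=> x h.
  by move=> f [i Pi ->]; apply: h.
by move=> i Pi; apply: h; exists i.
Qed.

(* The germs at 1 of functions vanishing on H form an ideal stable under the
   translations by a neighbourhood of 1 in H, hence under those of an open and
   closed subgroup of H. *)
Theorem germ_vanish H s f : closed_subgroup H -> zconnected H ->
  vanish H (s * f) -> s 1%g != 0 -> vanish H f.
Proof.
move=> [[H1 HM HV] Hc] Hconn hsf s1.
pose L : set kG := [set f | exists2 s : kG, s 1%g != 0 & vanish H (s * f)].
have hL : is_ideal L.
  split=> [|f1 f2 [s1' h1 h1'] [s2 h2 h2']|a f1 [s1' h1 h1']].
  - by exists 1; rewrite ?rfE ?oner_neq0 // mulr0; apply: is_ideal0 (vanish_ideal _).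
  - exists (s1' * s2); first by rewrite rfE mulf_neq0.
    have -> : s1' * s2 * (f1 + f2) = s2 * (s1' * f1) + s1' * (s2 * f2) by ring.
    by apply: (is_idealD (vanish_ideal _)); apply: (is_idealMr _ (vanish_ideal _)).
  - by exists s1' => //; rewrite mulrCA; apply: (is_idealMr _ (vanish_ideal _)).
have L1 g : L g -> g 1%g = 0.
  by move=> [t t1 /(_ _ H1)]; rewrite rfE => /eqP; rewrite mulf_eq0 (negPf t1) => /eqP.
have [t t1 ht] : exists2 t : kG, t 1%g != 0 & forall g, L g -> vanish H (t * g).
  have [l el] := @regfun_noetherian k G L hL.
  have hl g : g \in l -> L g by move=> gl; rewrite el; apply: sub_igen.
  suff [t t1 ht] : exists2 t : kG, t 1%g != 0 & forall g, g \in l -> vanish H (t * g).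
    exists t => // g; rewrite el => /(_ [set g | vanish H (t * g)]); apply=> [|g' /ht //].
    split=> [|u v|c u] /=; rewrite ?mulr0 ?mulrDr.
    - exact: is_ideal0 (vanish_ideal _).
    - exact: is_idealD (vanish_ideal _).
    - by rewrite mulrCA; apply: is_idealMr (vanish_ideal _).
  elim: l hl {el} => [_|g l IH hl]; first by exists 1; rewrite ?rfE ?oner_neq0.
  have [|t t1 ht] := IH; first by move=> h hh; apply: hl; rewrite inE hh orbT.
  have [s' h1 h2] := hl g (mem_head _ _).
  exists (s' * t) => [|h]; first by rewrite rfE mulf_neq0.
  rewrite inE => /orP [/eqP ->|/ht hh].
    by rewrite mulrAC; apply: (is_idealMl _ (vanish_ideal _)).
  by rewrite -mulrA; apply: (is_idealMr _ (vanish_ideal _)).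
have stab x : H x -> t x != 0 -> forall g, L g <-> L (ltr x g).
  move=> Hx tx.
  have lsub g : L g -> L (ltr x g).
    move=> Lg; exists (ltr x t); first by rewrite /= mulg1.
    by move=> y Hy; rewrite rfE /=; have := ht g Lg (x * y)%g (HM _ _ Hx Hy); rewrite rfE.
  move=> g; split; first exact: lsub.
  (* Translation by x maps [L] into itself, so the preimages of [L] under its iterates increase. As
     they become stationary, [L] is also equal to its own preimage. *)
  pose C n : set kG := [set g | L (iter n (ltr x) g)].
  have itD n : {morph iter n (ltr x) : u v / u + v}.
    by elim: n => [|n IH] u v //=; rewrite IH; apply/regfunP.
  have itM n : {morph iter n (ltr x) : u v / u * v}.
    by elim: n => [|n IH] u v //=; rewrite IH; apply/regfunP.
  have it0 n : iter n (ltr x) 0 = 0.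
    by elim: n => //= n ->; apply/regfunP.
  have [n hn] : exists n, forall i, C i `<=` C n.
    apply: chain_stable; first exact: regfun_noetherian.
      move=> n; split=> [|u v|c u]; rewrite /C /= ?it0 ?itD ?itM.
      - exact: is_ideal0.
      - exact: is_idealD.
      - exact: is_idealMr.
    by move=> n u; rewrite /C /=; apply: lsub.
  pose y := iter n (ltr x^-1%g) g.
  have ey : iter n (ltr x) y = g.
    rewrite /y; elim: n {hn y} => // n IH.
    rewrite iterSr iterS -[RHS]IH; congr (iter n _ _).
    by apply/regfunP => z /=; rewrite mulgA mulVg mul1g.
  move=> Lg; rewrite -ey; apply: (hn n.+1); by rewrite /C /= ey.
pose S : set G := [set x | H x /\ forall g, L g <-> L (ltr x g)].
have SM x y : S x -> S y -> S (x * y)%g.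
  move=> [Hx hx] [Hy hy]; split=> [|g]; first exact: HM.
  rewrite hx hy (_ : ltr y (ltr x g) = ltr (x * y)%g g) //.
  by apply/regfunP => z /=; rewrite mulgA.
have SV x : S x -> S x^-1%g.
  move=> [Hx hx]; split=> [|g]; first exact: HV.
  rewrite [L (ltr _ _)]hx (_ : ltr x (ltr x^-1%g g) = g) //.
  by apply/regfunP => z /=; rewrite mulgA mulVg mul1g.
have S1 : S 1%g.
  by split=> // g; rewrite (_ : ltr 1%g g = g) //; apply/regfunP => z /=; rewrite mul1g.
have St x : H x -> t x != 0 -> S x by move=> Hx tx; split=> //; apply: stab.
have c1 : zclosed [set x | H x /\ forall y, S y -> ltr y^-1%g t x = 0].
  exact: zclosed_cond.
have c2 : zclosed [set x | H x /\ forall y, H y /\ ~ S y -> ltr y^-1%g t x = 0].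
  exact: zclosed_cond.
have e2 x : (H x /\ forall y, H y /\ ~ S y -> ltr y^-1%g t x = 0) <-> S x.
  split=> [[Hx hx]|Sx].
    apply: contrapT => nSx; have := hx x (conj Hx nSx).
    by rewrite /= mulVg; apply/eqP.
  split=> [|y [Hy nSy]]; first by case: Sx.
  apply/eqP; apply: contraT => tyx; case: nSy.
  have Syx : S (y^-1 * x)%g by apply: St => //; apply: HM; [apply: HV|case: Sx].
  rewrite (_ : y = x * (y^-1 * x)^-1)%g; first by apply: SM => //; apply: SV.
  by rewrite invgM invgK mulgA mulgV mul1g.
have [] := Hconn _ _ c2 c1.
- apply/seteqP; split=> x => [Hx|[[]|[]]//].
  have [Sx|nSx] := pselect (S x); first by left; apply/e2.
  right; split=> // y Sy; apply/eqP; apply: contraT => tyx; case: nSx.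
  have Syx : S (y^-1 * x)%g by apply: St => //; apply: HM => //; apply: HV; case: Sy.
  by rewrite -[x](mulVKg y); apply: SM.
- apply/seteqP; split=> // x [/e2 Sx [_ /(_ _ Sx)]] /=.
  by rewrite mulVg => /eqP; rewrite (negPf t1).
- by move=> h; have : set0 (1%g : G) by rewrite -h; apply/e2.
move=> h x Hx; have [Sx|nSx] := pselect (S x).
  have : L (ltr x f) by apply/(Sx.2 f); exists s.
  by move/L1; rewrite /= mulg1.
suff : set0 x by [].
rewrite -h; split=> // y Sy; apply/eqP; apply: contraT => tyx; case: nSx.
have Syx : S (y^-1 * x)%g by apply: St => //; apply: HM => //; apply: HV; case: Sy.
by rewrite -[x](mulVKg y); apply: SM.
Qed.

Corollary flat_vanish H f : closed_subgroup H -> zconnected H ->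
  (forall n, isum (ipow (@mx1 k G) n) (vanish H) f) -> vanish H f.
Proof.
move=> hH hc hf.
have [||a a1 ha] := @krull kG (@mx1 k G) (vanish H) f (@regfun_noetherian k G) (mx1_ideal G).
- exact: vanish_ideal.
- move=> n; have [u [v [hu hv ->]]] := hf n; exists u => //.
  by rewrite addrAC subrr add0r.
apply: (@germ_vanish H (1 - a)) => //; first by rewrite mulrBl mul1r.
by rewrite !rfE a1 subr0 oner_neq0.
Qed.

Theorem identity_component H : closed_subgroup H -> exists (K : set G) (h : kG),
  [/\ closed_subgroup K, zconnected K, K `<=` H,
    forall x, H x -> h x = (if `[< K x >] then 1 else 0) &
    forall F : G -> G, (forall f, reg G f -> reg G (f \o F)) -> F 1%g = 1%g ->
      (forall x, H x -> H (F x)) -> forall x, K x -> K (F x)].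
Proof.
move=> [[H1 HM HV] Hc].
pose clopen (K : set G) := [/\ zclosed K, zclosed (H `\` K), K `<=` H & K 1%g].
have cap K K' : clopen K -> clopen K' -> clopen (K `&` K').
  move=> [c1 c2 c3 c4] [d1 d2 d3 d4]; split=> //; first exact: zclosedI.
    by rewrite setDIr; apply: zclosedU.
  by move=> x [/c3].
pose P : set (set kG) := [set J | exists2 K, clopen K & J = vanish K].
have [||J [K cK ->] hmax] := noetherian_max (P := P) (@regfun_noetherian k G).
- by move=> J [K _ ->]; apply: vanish_ideal.
- exists (vanish H), H => //; split=> //; rewrite setDv.
  apply/zclosedP; exists setT; apply/seteqP; split=> // x /(_ 1 Logic.I) /eqP.
  by rewrite rfE oner_eq0.
have Kmin K' : clopen K' -> K `<=` K'.
  move=> cK'; have cKK' := cap _ _ cK cK'.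
  have : vanish (K `&` K') `<=` vanish K.
    by apply: hmax; [exists (K `&` K')|move=> f hf x [/hf]].
  move=> h x Kx; suff [] : (K `&` K') x by [].
  by apply: zclosed_vanish => [|f /h]; [case: cKK'|apply].
have pre (F : G -> G) : (forall f, reg G f -> reg G (f \o F)) -> K (F 1%g) ->
    (forall x, H x -> H (F x)) -> clopen (H `&` F @^-1` K).
  move=> hF F1 HF; have [c1 c2 c3 c4] := cK; split=> //.
  - by apply: zclosedI => //; apply: zclosed_preim.
  - rewrite (_ : _ `\` _ = H `&` F @^-1` (H `\` K)).
      by apply: zclosedI => //; apply: zclosed_preim.
    apply/seteqP; split=> x [Hx h]; split=> //=; last by move=> [_]; case: h.
    by split; [apply: HF|move=> Kx; apply: h].
have [c1 c2 c3 c4] := cK.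
have KM x y : K x -> K y -> K (x * y)%g.
  move=> Kx; have : clopen (H `&` (fun y => x * y)%g @^-1` K).
    apply: pre => [f|/=|z]; [exact: reg_ltrans|by rewrite mulg1|].
    by apply: HM; apply: c3.
  by move=> /Kmin h /h [].
have KV x : K x -> K x^-1%g.
  have : clopen (H `&` (fun y => y^-1)%g @^-1` K).
    apply: pre => [f|/=|y]; [exact: reg_inv|by rewrite invg1|exact: HV].
  by move=> /Kmin h /h [].
have [h hK] : exists h : kG, forall x, H x -> h x = if `[< K x >] then 1 else 0.
  have : isum (vanish K) (vanish (H `\` K)) 1.
    apply: regfun_unit_ideal; first by apply: isum_ideal; apply: vanish_ideal.
    move=> x; apply: contrapT => no.
    have Kx : K x.
      apply: zclosed_vanish => // f hf; apply/eqP; apply: contraT => fx.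
      by case: no; exists f => //; apply: isum_l => //; apply: vanish_ideal.
    suff [_] : (H `\` K) x by [].
    apply: zclosed_vanish => // f hf; apply/eqP; apply: contraT => fx.
    by case: no; exists f => //; apply: isum_r => //; apply: vanish_ideal.
  move=> [a [b [ha hb e]]]; exists b => x Hx; case: asboolP => Kx; last by apply: hb.
  by have := congr1 (fun f : kG => f x) e; rewrite !rfE ha // add0r.
exists K, h; split=> //.
- move=> Z1 Z2 z1 z2 e i; have clop Z Z' : zclosed Z -> zclosed Z' -> K = Z `|` Z' ->
    Z `&` Z' = set0 -> Z 1%g -> Z' = set0.
    move=> z z' e' i' Z1'; have : clopen Z.
      split=> //; last by move=> x Zx; apply: c3; rewrite e'; left.
      rewrite (_ : _ `\` _ = (H `\` K) `|` Z'); first exact: zclosedU.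
      apply/seteqP; split=> x.
        move=> [Hx nZ]; have [Kx|] := pselect (K x); last by left.
        by right; move: Kx; rewrite e' => -[].
      move=> [[Hx nK]|Z'x]; split=> //.
      - by move=> Zx; apply: nK; rewrite e'; left.
      - by apply: c3; rewrite e'; right.
      - by move=> Zx; have : set0 x by rewrite -i'.
    move=> /Kmin KZ; apply/seteqP; split=> // x Z'x; rewrite -i'; split=> //.
    by apply: KZ; rewrite e'; right.
  move: (c4); rewrite e => -[h1|h2]; [right; exact: (clop Z1)|left].
  by apply: (clop Z2) => //; [rewrite setUC|rewrite setIC].
- move=> F hF F1 HF x; have : clopen (H `&` F @^-1` K) by apply: pre => //; rewrite F1.
  by move=> /Kmin hh /hh [].
Qed.

End Closed.

Lemma ipow_map (A : comNzRingType) (m : set A) (f : A -> A) n y :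
  (forall u v, f (u + v) = f u + f v) -> (forall u v, f (u * v) = f u * f v) ->
  (forall u, m u -> m (f u)) -> f 0 = 0 -> ipow m n y -> ipow m n (f y).
Proof.
move=> fD fM fm f0; elim: n y => [//|n IH] y.
move=> /(@ipow_ind A m n [set y | ipow m n.+1 (f y)]); apply.
  split=> [|u v|a u] /=; rewrite ?f0 ?fD ?fM.
  - exact: is_ideal0 (ipow_ideal _ _).
  - exact: is_idealD (ipow_ideal _ _).
  - exact: is_idealMr (ipow_ideal _ _).
by move=> u v hu hv /=; rewrite fM; apply: ipow_step; [apply: fm|apply: IH].
Qed.

(* A group with a torus, parametrized by k^* ^ r, and a basis of weight vectors
   of the cotangent space at 1. *)
Record frame (k : closedFieldType) (G : algGroup k) := Frame {
  frk : nat;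
  fphi : ('I_frk -> k) -> G;
  fphi_emb : regular_embedding (@Gm_pow k frk) (@laurent k frk) (reg G) fphi;
  fphiM : forall s s', Gm_pow s -> Gm_pow s' ->
    fphi (fun i => s i * s' i) = (fphi s * fphi s')%g;
  fdim : nat;
  fx : 'I_fdim -> regfun G;
  fw : 'I_fdim -> wt frk;
  fx1 : forall i, fx i 1%g = 0;
  fxw : forall i, wvec fphi (fw i) (fx i);
  fx_free : forall c : 'I_fdim -> k,
    ipow (@mx1 k G) 2 (\sum_i c i *: fx i) -> forall i, c i = 0;
  fx_span : forall y : regfun G, y 1%g = 0 ->
    exists c : 'I_fdim -> k, ipow (@mx1 k G) 2 (y - \sum_i c i *: fx i) }.

(** * Tangent vectors at 1, invariant derivations, and loci cut out by weights *)

Section Frame.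
Variables (k : closedFieldType) (G : algGroup k) (F : frame G).
Local Notation kG := (regfun G).
Local Notation d := (fdim F).
Local Notation wt := (wt (frk F)).
Local Notation x := (@fx _ _ F).
Local Notation w := (@fw _ _ F).
Local Notation phi := (@fphi _ _ F).
Local Notation m := (@mx1 k G).
Implicit Types (f g h : kG) (i j : 'I_d).

Lemma m_ideal n : is_ideal (ipow m n). Proof. exact: ipow_ideal. Qed.
Lemma ipowZ n c f : ipow m n f -> ipow m n (c *: f).
Proof. by rewrite rf_scaleE; apply: (is_idealMr _ (m_ideal n)). Qed.

Lemma delta_ex f : exists c : 'I_d -> k, ipow m 2 (f - rf_const G (f 1%g) - \sum_i c i *: x i).
Proof. by apply: fx_span; rewrite !rfE /= subrr. Qed.

(** The tangent vectors at 1 dual to the coordinates [x i]. *)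
Definition delta i f : k := projT1 (cid (delta_ex f)) i.

Lemma deltaP f : ipow m 2 (f - rf_const G (f 1%g) - \sum_i delta i f *: x i).
Proof. exact: (projT2 (cid (delta_ex f))). Qed.

Lemma sum_x1 (c : 'I_d -> k) : (\sum_i c i *: x i) 1%g = 0.
Proof. by rewrite rf_sum big1 // => i _; rewrite rfZ fx1 mulr0. Qed.

Lemma delta_uniq f a c : ipow m 2 (f - rf_const G a - \sum_i c i *: x i) ->
  forall i, delta i f = c i.
Proof.
move=> h i; have e : a = f 1%g.
  have := ipow_sub_ideal (mx1_ideal G) h.
  by rewrite /mx1 /= sum_x1 subr0 => /eqP; rewrite subr_eq0 => /eqP.
apply/eqP; rewrite -subr_eq0; apply/eqP.
apply: (@fx_free _ _ F (fun i => delta i f - c i)).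
under eq_bigr do rewrite scalerBl; rewrite sumrB.
have := is_idealB (m_ideal 2) h (deltaP f); rewrite e.
by congr (ipow m 2 _); ring.
Qed.

Lemma deltaD i f g : delta i (f + g) = delta i f + delta i g.
Proof.
apply: (@delta_uniq _ (f 1%g + g 1%g) (fun i => delta i f + delta i g)).
under eq_bigr do rewrite scalerDl; rewrite big_split rmorphD.
have := is_idealD (m_ideal 2) (deltaP f) (deltaP g).
by congr (ipow m 2 _) => /=; ring.
Qed.

Lemma deltaZ i c f : delta i (c *: f) = c * delta i f.
Proof.
apply: (@delta_uniq _ (c * f 1%g) (fun i => c * delta i f)).
under eq_bigr do rewrite -scalerA; rewrite -scaler_sumr rmorphM.
have := ipowZ c (deltaP f).
by congr (ipow m 2 _); rewrite !rf_scaleE; ring.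
Qed.

Lemma delta0 i : delta i 0 = 0.
Proof. by rewrite -(scale0r (0 : kG)) deltaZ mul0r. Qed.

Lemma deltaM i f g : delta i (f * g) = delta i f * g 1%g + f 1%g * delta i g.
Proof.
apply: (@delta_uniq _ (f 1%g * g 1%g) (fun i => delta i f * g 1%g + f 1%g * delta i g)).
under eq_bigr do rewrite scalerDl [_ * g 1%g]mulrC -!scalerA.
rewrite big_split -!scaler_sumr rmorphM /=.
set u := \sum_i _ *: _; set v := \sum_i _ *: _.
have hu := deltaP f; have hv := deltaP g.
have hfg : ipow m 2 ((f - rf_const G (f 1%g)) * (g - rf_const G (g 1%g))).
  by apply: (ipow_mul (i := 1) (j := 1)); apply: ipow1; rewrite /mx1 /= subrr.
have := is_idealD (m_ideal 2) hfg (is_idealD (m_ideal 2) (ipowZ (g 1%g) hu) (ipowZ (f 1%g) hv)).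
by congr (ipow m 2 _); rewrite !rf_scaleE -/u -/v; ring.
Qed.

Lemma delta_x i j : delta i (x j) = (i == j)%:R.
Proof.
apply: (@delta_uniq _ 0 (fun i => (i == j)%:R)).
rewrite rmorph0 subr0 (bigD1 j) //= eqxx scale1r big1 ?addr0 ?subrr.
  exact: is_ideal0 (m_ideal 2).
by move=> l /negPf ->; rewrite scale0r.
Qed.

Lemma delta_const i c : delta i (rf_const G c) = 0.
Proof.
apply: (@delta_uniq _ c (fun=> 0)).
rewrite subrr sub0r big1 ?oppr0 => [|j _]; last by rewrite scale0r.
exact: is_ideal0 (m_ideal 2).
Qed.

Lemma delta_sum i (I : Type) (l : seq I) (P : pred I) (H : I -> kG) :
  delta i (\sum_(a <- l | P a) H a) = \sum_(a <- l | P a) delta i (H a).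
Proof. exact: (big_morph (delta i) (deltaD i) (delta0 i)). Qed.

Lemma cnjD y f g : cnj y (f + g) = cnj y f + cnj y g.
Proof. exact/regfunP. Qed.
Lemma cnjM y f g : cnj y (f * g) = cnj y f * cnj y g.
Proof. exact/regfunP. Qed.
Lemma cnjZ y c f : cnj y (c *: f) = c *: cnj y f.
Proof. exact/regfunP. Qed.
Lemma cnj1 y f : cnj y f 1%g = f 1%g.
Proof. by rewrite cnjE mulg1 mulgV. Qed.

Lemma cnj_ipow y n f : ipow m n f -> ipow m n (cnj y f).
Proof.
apply: ipow_map; [exact: cnjD|exact: cnjM| |exact/regfunP].
by move=> u; rewrite /mx1 /= => <-; apply: cnj1.
Qed.

Lemma delta_cnj i s f : Gm_pow s -> delta i (cnj (phi s) f) = mon s (w i) * delta i f.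
Proof.
move=> hs; rewrite mulrC.
apply: (@delta_uniq _ (f 1%g) (fun i => delta i f * mon s (w i))).
have := cnj_ipow (phi s) (deltaP f); congr (ipow m 2 _).
have cB u v : cnj (phi s) (u - v) = cnj (phi s) u - cnj (phi s) v by apply/regfunP.
rewrite !cB; congr (_ - _ - _); first by apply/regfunP.
rewrite (big_morph _ (cnjD _) (_ : cnj (phi s) 0 = 0)); last exact/regfunP.
apply: eq_bigr => j _; rewrite cnjZ -scalerA; congr (_ *: _).
by apply/regfunP => y; rewrite cnjE fxw // rfE.
Qed.

Lemma pder_delta (D : kG -> k) : (forall c f g, D (c *: f + g) = c * D f + D g) ->
  (forall f g, D (f * g) = D f * g 1%g + f 1%g * D g) ->
  forall f, D f = \sum_i D (x i) * delta i f.
Proof.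
move=> DL DM f.
have D0 : D 0 = 0.
  have := DL 1 0 0; rewrite scaler0 addr0 mul1r => /eqP.
  by rewrite -{1}[D 0]addr0 (inj_eq (addrI _)) eq_sym => /eqP.
have DA u v : D (u + v) = D u + D v by have := DL 1 u v; rewrite scale1r mul1r.
have DZ c u : D (c *: u) = c * D u by have := DL c u 0; rewrite D0 !addr0.
have D1 : D 1 = 0.
  have := DM 1 1; rewrite mulr1 !rfE mulr1 mul1r => /eqP.
  by rewrite -{1}[D 1]addr0 (inj_eq (addrI _)) eq_sym => /eqP.
have Dc c : D (rf_const G c) = 0 by rewrite -[rf_const G c]mulr1 -rf_scaleE DZ D1 mulr0.
have Dsq u : ipow m 2 u -> D u = 0.
  pose J : set kG := [set u | D u = 0 /\ u 1%g = 0].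
  have hJ : is_ideal J.
    split=> [|a b [ha ha'] [hb hb']|a b [hb hb']]; rewrite /J /= ?D0 ?rfE //.
      by rewrite DA ha hb ha' hb' addr0.
    by rewrite DM hb hb' !mulr0 addr0.
  move=> /(ipow_ind (J := J) hJ) [] // a b ha hb.
  have {}hb := ipow_sub_ideal (mx1_ideal G) hb.
  by split; rewrite ?DM ?rfE hb ha !(mulr0, mul0r) ?addr0.
have := Dsq _ (deltaP f); set u := \sum_i _ *: _.
have -> : f - rf_const G (f 1%g) - u = -1 *: (rf_const G (f 1%g) + u) + f.
  by rewrite scaleN1r; ring.
rewrite DL DA Dc add0r mulN1r addrC => /eqP; rewrite subr_eq0 => /eqP ->.
rewrite (big_morph D DA D0); apply: eq_bigr => i _.
by rewrite DZ mulrC.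
Qed.

Lemma ltr_ex (D : kG -> k) : (forall f g, D (f + g) = D f + D g) ->
  (forall c f, D (c *: f) = c * D f) ->
  forall f, exists g : kG, forall y, g y = D (ltr y f).
Proof.
move=> DA DZ f; have D0 : D 0 = 0 by rewrite -(scale0r (0 : kG)) DZ mul0r.
have [n [a [b h]]] := reg_comulE f; exists (\sum_l D (b l) *: a l) => y.
rewrite (_ : ltr y f = \sum_l a l y *: b l).
  rewrite (big_morph D DA D0) rf_sum; apply: eq_bigr => l _.
  by rewrite DZ rfE mulrC.
by apply/regfunP => z; rewrite /= h rf_sum.
Qed.

(** The left-invariant vector field with value [delta i] at 1. *)
Definition lder i f : kG := projT1 (cid (ltr_ex (deltaD i) (deltaZ i) f)).

Lemma lderE i f y : lder i f y = delta i (ltr y f).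
Proof. exact: (projT2 (cid (ltr_ex (deltaD i) (deltaZ i) f))). Qed.

Lemma lderD i f g : lder i (f + g) = lder i f + lder i g.
Proof. by apply/regfunP => y; rewrite rfD !lderE -deltaD; congr delta; apply/regfunP. Qed.

Lemma lderM i f g : lder i (f * g) = lder i f * g + f * lder i g.
Proof.
apply/regfunP => y; rewrite !rfE !lderE (_ : ltr y (f * g) = ltr y f * ltr y g).
  by rewrite deltaM /= mulg1.
exact/regfunP.
Qed.

Lemma lderC i c : lder i (rf_const G c) = 0.
Proof. by apply/regfunP => y; rewrite lderE rfE -[RHS](delta_const i c); congr delta; apply/regfunP. Qed.

Lemma lder1 i f : lder i f 1%g = delta i f.
Proof. by rewrite lderE; congr delta; apply/regfunP => y /=; rewrite mul1g. Qed.

Section Smooth.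
Variable (p : nat).
Hypothesis char_k : p \in [pchar k].

Section Sub.
Variables (n0 : nat) (em : 'I_n0 -> 'I_d) (I : set kG).
Hypothesis em_inj : injective em.
Hypothesis hI : is_ideal I.
Hypothesis Ix : forall j, (forall l, em l != j) -> I (x j).
Let xS (l : 'I_n0) : kG := x (em l).
Let cG : {rmorphism k -> kG} := rf_const G.

Lemma sub_span (y : kG) : y 1%g = 0 ->
  exists a : 'I_n0 -> k, isum (ipow m 2) I (y - \sum_l cG (a l) * xS l).
Proof.
move=> y1; have [c hc] := @fx_span _ _ F y y1; exists (fun l => c (em l)).
have -> : \sum_l cG (c (em l)) * xS l = \sum_(j in codom em) c j *: x j.
  rewrite -big_uniq; last by rewrite map_inj_uniq ?enum_uniq.
  rewrite /codom /image_mem big_map big_enum.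
  by apply: eq_bigr => l _; rewrite rf_scaleE.
exists (y - \sum_i c i *: x i), (\sum_(i | i \notin codom em) c i *: x i); split=> //.
  apply: is_ideal_sum => // j jS; rewrite rf_scaleE; apply: is_idealMr => //; apply: Ix => l.
  by apply: contra jS => /eqP <-; apply: codom_f.
by rewrite [\sum_i c i *: x i](bigID (mem (codom em))) /= opprD addrA subrK.
Qed.

Lemma sub_expand n L y : isum (ipow m n) I y -> exists P : {mpoly k[n0]},
  (forall a, a \in msupp P -> (n <= mdeg a < L)%N) /\ isum (ipow m L) I (y - mmap cG xS P).
Proof.
apply: (@expand k kG cG (rf_ev 1%g) (fun=> erefl) n0 xS _ I hI sub_span n L y).
by move=> i; apply: fx1.
Qed.

Hypothesis Ip : forall v, I (v ^+ p) -> I v.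
Hypothesis ID : forall l v, I v -> I (lder (em l) v).
Hypothesis I1 : forall v, I v -> v 1%g = 0.

Lemma sub_smooth n (P : {mpoly k[n0]}) :
  isum (ipow m n.+1) I (mmap cG xS P) -> forall a, (mdeg a <= n)%N -> P@_a = 0.
Proof.
have [r [g hg]] := regfun_gen G.
apply: (@smooth k p char_k kG cG (rf_ev 1%g) (fun=> erefl) (@regfun_noetherian k G)
  r g hg n0 xS (fun l => lder (em l)) _ _ _ _ _ I hI sub_span Ip _ I1 n P).
- by move=> i; apply: fx1.
- by move=> i u v; apply: lderD.
- by move=> i u v; apply: lderM.
- by move=> i a; apply: lderC.
- by move=> i j; rewrite -(inj_eq em_inj) -delta_x; apply: lder1.
- exact: ID.
Qed.

End Sub.

Lemma kG_reduced (Z : set G) v : vanish Z (v ^+ p) -> vanish Z v.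
Proof.
move=> h y /h; rewrite rfE => /eqP; rewrite expf_eq0 => /andP [_] /eqP //.
Qed.

Lemma vanish_lder (Z : set G) i v :
  (forall y f, Z y -> vanish Z f -> delta i (ltr y f) = 0) -> vanish Z v -> vanish Z (lder i v).
Proof. by move=> h hv y Zy; rewrite lderE h. Qed.

(** The hypothesis says that every translate y^-1 [Om], with y in [Om], has the full tangent space
    at 1. So the vanishing ideal of [Om] is stable under all left-invariant derivations; by
    [derivation_stable_flat] its elements vanish at 1 to every order, hence on the connected
    group. *)
Theorem dense_of_lie (Om : set G) f : zconnected (@setT G) -> Om 1%g ->
  (forall y g i, Om y -> vanish Om g -> delta i (ltr y g) = 0) -> vanish Om f -> f = 0.
Proof.
move=> Gc Om1 hD hf.
have hT : closed_subgroup (@setT G).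
  split; first by split.
  by apply/zclosedP; exists set0; apply/seteqP; split=> // y _ ? [].
have h0 : is_ideal (vanish (@setT G)) by apply: vanish_ideal.
suff : vanish setT f by move=> h; apply/regfunP => y; rewrite h.
apply: flat_vanish => // n.
have [r [g hg]] := regfun_gen G.
have hS j : (forall l : 'I_d, id l != j) -> vanish setT (x j) by move=> /(_ j); rewrite eqxx.
apply: (@derivation_stable_flat k p char_k kG (rf_const G) (rf_ev 1%g) (fun=> erefl)
  (@regfun_noetherian k G) r g hg _ _ lder _ _ _ _ _ (vanish setT)
  h0 (sub_span (@inj_id _) h0 hS) (vanish Om)) => //.
- by move=> i; apply: fx1.
- by move=> i u v; apply: lderD.
- by move=> i u v; apply: lderM.
- by move=> i a; apply: lderC.
- by move=> i j; rewrite -delta_x; apply: lder1.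
- exact: vanish_ideal.
- exact: kG_reduced.
- by move=> i v; apply: vanish_lder => y h; apply: hD.
- by move=> u hu y _; apply: hu.
- by move=> v; apply.
Qed.

(* The analogue of a fixed point set (for Pi = 0) or of a root subgroup. *)
Definition wlocus (Pi : wt -> Prop) : set G :=
  [set g | forall a h, wvec phi a h -> ~ Pi a -> h g = h 1%g].

Lemma wlocus_closed Pi : zclosed (wlocus Pi).
Proof.
apply/zclosedP; exists [set h | exists a g, [/\ wvec phi a g, ~ Pi a & h = g - rf_const G (g 1%g)]].
apply/seteqP; split=> y hy.
  by move=> _ [a [g [h1 h2 ->]]]; rewrite !rfE /= (hy a g) ?subrr.
move=> a g h1 h2; have : (g - rf_const G (g 1%g)) y = 0 by apply: hy; exists a, g.
by rewrite !rfE /= => /eqP; rewrite subr_eq0 => /eqP.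
Qed.

Lemma wvec_const c : wvec phi 0 (rf_const G c).
Proof. by move=> s y hs; rewrite mon0 mul1r. Qed.

Lemma wvec_shift a g : wvec phi a g -> wvec phi a (g - rf_const G (g 1%g)).
Proof.
move=> hg; have [a0|a0] := eqVneq a 0.
  by rewrite -scaleN1r; apply: wvecD => //; apply: wvecZ; rewrite a0; apply: wvec_const.
by rewrite (wvec_at1 hg a0) rmorph0 subr0.
Qed.

Lemma wvec_prod (I : Type) (l : seq I) (a : I -> wt) (h : I -> kG) :
  (forall i : I, wvec phi (a i) (h i)) -> wvec phi (\sum_(i <- l) a i) (\prod_(i <- l) h i).
Proof.
move=> hh; elim: l => [|i l IH]; first by rewrite !big_nil; apply: wvec1.
by rewrite !big_cons; apply: wvecM.
Qed.

Lemma wvecX a h n : wvec phi a h -> wvec phi (a *+ n) (h ^+ n).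
Proof.
move=> hh; elim: n => [|n IH]; first exact: wvec1.
by rewrite mulrS exprS; apply: wvecM.
Qed.

Section Locus.
Variable Pi : wt -> Prop.
Hypothesis PiD : forall a b, Pi a -> Pi b -> Pi (a + b).
Variable M : nat.
(** A linear model of the locus to order M: [J1] kills the coordinates with weight outside [Pi], and
    [JJ] adds the M+1-st power of the maximal ideal. *)
Let J1 : set kG := igen [set y | exists2 j, ~ Pi (w j) & y = x j].
Let JJ := isum (ipow m M.+1) J1.
Let hJJ : is_ideal JJ.
Proof. by apply: isum_ideal; [apply: m_ideal|apply: igen_ideal]. Qed.

Let JJ_cnj s u : Gm_pow s -> JJ u -> JJ (cnj (phi s) u).
Proof.
move=> hs [a [b [ha hb ->]]]; rewrite cnjD; apply: is_idealD => //.
  by apply: isum_l; [apply: igen_ideal|apply: cnj_ipow].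
apply: isum_r; first exact: m_ideal.
apply: (hb [set b | J1 (cnj (phi s) b)]) => [|y [j hj ->]].
  have hJ1 : is_ideal J1 by apply: igen_ideal.
  split=> [|u' v|a' u'] /=.
  - by rewrite (_ : cnj _ 0 = 0); [apply: is_ideal0|apply/regfunP].
  - by rewrite cnjD; apply: is_idealD.
  - by rewrite cnjM; apply: is_idealMr.
have -> : [set b | J1 (cnj (phi s) b)] (x j) = J1 (mon s (w j) *: x j).
  by rewrite /=; congr J1; apply/regfunP => z; rewrite cnjE fxw // rfE.
by rewrite rf_scaleE; apply: (is_idealMr _ (igen_ideal _)); apply: sub_igen; exists j.
Qed.

Let h0 : is_ideal [set 0 : kG].
Proof. by split=> [//|u v -> ->|a u ->]; rewrite ?addr0 ?mulr0. Qed.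

(** [Pi] is closed under addition, so a monomial of positive degree in coordinates with weights in
    [Pi] has its weight in [Pi]. In the Taylor expansion of a function of weight outside [Pi], each
    monomial of that weight therefore contains a coordinate from [J1]. *)
Let wvec_in_JJ a h : ~ Pi a -> wvec phi a h -> JJ (h - rf_const G (h 1%g)).
Proof.
move=> na /wvec_shift; set g := h - _ => hg.
have g1 : g 1%g = 0 by rewrite !rfE /= subrr.
have hS j : (forall l : 'I_d, id l != j) -> [set 0 : kG] (x j) by move=> /(_ j); rewrite eqxx.
have [|P [hP [u [v [hu -> e]]]]] := @sub_expand _ id _ (@inj_id _) h0 hS 1 M.+1 g.
  by apply: (isum_l h0); apply: ipow1.
pose mm (b : 'X_{1..d}) : kG := rf_const G P@_b * mmap1 x b.
pose wm (b : 'X_{1..d}) : wt := \sum_i w (i) *+ b i.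
have eg : g = \sum_(b <- msupp P) mm b + u by rewrite -[g](subrK (mmap (rf_const G) x P)) e addr0 addrC.
pose ok (b : 'X_{1..d}) := `[< forall i, b i != 0%N -> Pi (w i) >].
have mmw b : wvec phi (wm b) (mm b).
  rewrite /mm -rf_scaleE; apply: wvecZ; apply: wvec_prod => i; apply: wvecX.
  exact: fxw.
have nok b : ~~ ok b -> JJ (mm b).
  move=> /asboolPn /existsNP [i /not_implyP [bi nPi]].
  apply: isum_r; first exact: m_ideal.
  apply: (is_idealMr _ (igen_ideal _)); rewrite /mmap1 (bigD1 i) //=.
  apply: (is_idealMl _ (igen_ideal _)); case: (b i) bi => // n _; rewrite exprS.
  by apply: (is_idealMl _ (igen_ideal _)); apply: sub_igen; exists (i).
have okw b : b \in msupp P -> ok b -> Pi (wm b).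
  move=> /hP /andP [b1 _] /asboolP hb.
  have [i bi] : exists i, b i != 0%N.
    apply: contrapT => hno; move: b1; rewrite mdegE big1 // => i _.
    by apply/eqP; apply: contraT => bi; case: hno; exists i.
  have PiX c n : Pi c -> Pi (c *+ n.+1).
    by move=> hc; elim: n => // n IH; rewrite mulrS; apply: PiD.
  rewrite /wm (bigD1 i) //=.
  have hi : Pi (w (i) *+ b i).
    by have := hb _ bi; case: (b i) bi => // n _; apply: PiX.
  have [->|h'] : \sum_(j | j != i) w j *+ b j = 0 \/ Pi (\sum_(j | j != i) w j *+ b j).
  - apply: (big_ind (fun c => c = 0 \/ Pi c)); [by left| |].
      move=> c c' [->|hc] [->|hc']; rewrite ?addr0 ?add0r; [by left|by right|by right|].
      by right; apply: PiD.
    move=> j _; have [->|bj] := eqVneq (b j) 0%N; first by left; rewrite mulr0n.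
    by right; have := hb _ bj; case: (b j) bj => // n _; apply: PiX.
  - by rewrite addr0.
  - exact: PiD.
pose L := [seq (mm b, wm b) | b <- msupp P & ok b].
pose l' := undup [seq x.2 | x <- L].
pose F' c : kG := \sum_(x <- L | x.2 == c) x.1.
have eL : \sum_(b <- msupp P | ok b) mm b = \sum_(c <- l') F' c.
  have := @sum_by_weight (frk F) kG kG L (fun g _ => g) (fun _ _ _ => erefl) (fun _ => erefl).
  by rewrite big_map big_filter.
have l'P c : c \in l' -> Pi c.
  rewrite mem_undup => /mapP [z /mapP [b]]; rewrite mem_filter => /andP [hb hb'] -> ->.
  exact: okw.
have al' : a \notin l' by apply/negP => /l'P.
have F'w c : wvec phi c (F' c).
  rewrite /F' big_map; apply: (big_ind (wvec phi c)); [exact: wvec0|exact: wvecD|].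
  by move=> b /= /eqP <-; apply: mmw.
have := @wvec_split _ _ _ phi JJ (a :: l') (fun c => if c == a then g else - F' c).
rewrite /= => /(_ _ _ _ _ _ _ _ a (mem_head _ _)); rewrite eqxx; apply.
- exact: is_ideal0.
- by move=> *; apply: is_idealD.
- by move=> c v' hv'; rewrite rf_scaleE; apply: is_idealMr.
- exact: JJ_cnj.
- by rewrite al' undup_uniq.
- move=> c _; have [->|_] := eqVneq c a; first exact: hg.
  by rewrite -scaleN1r; apply/wvecZ/F'w.
rewrite big_cons eqxx (eq_big_seq (fun c => - F' c)) => [|c hc]; last first.
  by rewrite ifN //; apply: contra al' => /eqP <-.
rewrite sumrN -eL eg (bigID ok) /=; set X := \sum_(_ <- _ | _) _; set Y := \sum_(_ <- _ | _) _.
have -> : X + Y + u - X = u + Y by ring.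
apply: is_idealD => //; first by apply: isum_l => //; apply: igen_ideal.
by apply: is_ideal_sum => // b; apply: nok.
Qed.

Definition locus_ideal : set kG :=
  igen [set h | exists a g, [/\ wvec phi a g, ~ Pi a & h = g - rf_const G (g 1%g)]].

Lemma locus_ideal_sub : locus_ideal `<=` JJ.
Proof. by move=> u /(_ JJ hJJ); apply => _ [a [g [h1 h2 ->]]]; apply: wvec_in_JJ h2 h1. Qed.

Variables (i0 : 'I_d).
Hypothesis Pii : Pi (w i0).

(** Restriction to the axis of the coordinate [i0]. *)
Let th : {rmorphism {mpoly k[d]} -> {poly k}} :=
  mmap (@polyC k) (fun j : 'I_d => (j == i0)%:R *: 'X).

Let th_coef (P : {mpoly k[d]}) : (forall a, (mdeg a <= M)%N -> P@_a = 0) -> (th P)`_M = 0.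
Proof.
move=> hP; rewrite {1}(mpolyE P) rmorph_sum coef_sum big1 // => b _.
rewrite -mul_mpolyC rmorphM /= mmapX mmapC /= coefCM.
have -> : mmap1 (fun j : 'I_d => (j == i0)%:R *: 'X) b =
    (\prod_j ((j == i0)%:R : k) ^+ b j) *: ('X ^+ mdeg b : {poly k}).
  rewrite /mmap1 mdegE -prodrXr -scaler_prod; apply: eq_bigr => j _.
  by rewrite exprZn.
rewrite coefZ coefXn; case: eqP => [e|_]; last by rewrite !mulr0.
by rewrite hP ?mul0r // -e.
Qed.

Let JJ_ev v : JJ v -> exists2 P : {mpoly k[d]}, th P = 0 & ipow m M.+1 (v - mmap (rf_const G) x P).
Proof.
have hS j : (forall l : 'I_d, id l != j) -> [set 0 : kG] (x j) by move=> /(_ j); rewrite eqxx.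
have hm := m_ideal M.+1.
pose V : set kG := [set v | exists2 P : {mpoly k[d]}, th P = 0 &
  ipow m M.+1 (v - mmap (rf_const G) x P)].
have hV : is_ideal V.
  split=> [|u v' [P hP hu] [Q hQ hv]|a u [P hP hu]].
  - by exists 0; rewrite ?rmorph0 // subr0; apply: is_ideal0.
  - by exists (P + Q); rewrite rmorphD /= ?hP ?hQ ?addr0 // opprD addrACA; apply: (is_idealD hm hu hv).
  - have [|A [_ [a1 [a2 [ha -> e]]]]] := @sub_expand _ id _ (@inj_id _) h0 hS 0 M.+1 a.
      by apply: (isum_l h0).
    exists (A * P); rewrite rmorphM /= ?hP ?mulr0 //.
    have -> : a * u - mmap (rf_const G) x A * mmap (rf_const G) x P =
      u * (a - mmap (rf_const G) x A) + mmap (rf_const G) x A * (u - mmap (rf_const G) x P) by ring.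
    by apply: (is_idealD hm); apply: (is_idealMr _ hm) => //; rewrite e addr0; exact: ha.
move=> [a [b [ha hb ->]]]; apply: (is_idealD hV).
  by exists 0; rewrite ?rmorph0 // subr0.
apply: (hb V) => // _ [j hj ->]; exists 'X_j.
  rewrite /= mmapX mmap1U; case: eqP => [e|_]; last by rewrite scale0r.
  by case: hj; rewrite e.
by rewrite mmapX mmap1U subrr; apply: is_ideal0.
Qed.

Hypothesis M_gt0 : (0 < M)%N.

(** On the axis of [i0] the elements of [JJ] are 0 to order M, whereas f^M starts with the M-th
    power of [delta i0 f] times X^M. The comparison is legitimate because G is smooth at 1
    ([sub_smooth] with the zero ideal). *)
Let locus_delta_pow f : f 1%g = 0 -> JJ (f ^+ M) -> delta i0 f = 0.
Proof.
move=> f1 hf.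
pose l : {mpoly k[d]} := \sum_j delta j f *: 'X_j.
have el : mmap (rf_const G) x l = \sum_j delta j f *: x j.
  rewrite /l (rmorph_sum (mmap (rf_const G) x)); apply: eq_bigr => j _.
  by rewrite -mul_mpolyC rmorphM /= mmapX mmapC mmap1U rf_scaleE.
have hl : ipow m 2 (f - mmap (rf_const G) x l).
  by have := deltaP f; rewrite f1 rmorph0 subr0 el.
have lm : m (mmap (rf_const G) x l) by rewrite el; apply: sum_x1.
have hfl : ipow m M.+1 (f ^+ M - mmap (rf_const G) x l ^+ M).
  rewrite subrXX; apply: ipow_leq (ipow_mul (i := 2) (j := M.-1) hl _).
    by rewrite add2n prednK.
  apply: is_ideal_sum => [|[i hi] _ /=]; first exact: m_ideal.
  rewrite (_ : M.-1 = (M.-1 - i) + i)%N; last by rewrite subnK // -ltnS prednK.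
  by apply: ipow_mul; rewrite ?addnK; apply: ipow_exp.
have [P hP hPv] := JJ_ev hf.
have hL : forall a, (mdeg a <= M)%N -> (l ^+ M - P)@_a = 0.
  apply: (@sub_smooth d id [set 0] (@inj_id _) h0).
  - by move=> j /(_ j); rewrite eqxx.
  - move=> v hv; apply/regfunP => y; have := congr1 (fun f : kG => f y) hv.
    by rewrite rfE => /eqP; rewrite expf_eq0 => /andP [_ /eqP].
  - by move=> j v ->; rewrite -[0](rmorph0 (rf_const G)) lderC rmorph0.
  - by move=> v ->.
  change (isum (ipow m M.+1) [set 0] (mmap (rf_const G) x (l ^+ M - P))).
  apply: (isum_l h0); rewrite rmorphB rmorphXn /=.
  have := is_idealB (m_ideal M.+1) hPv hfl; congr (ipow m _ _).
  by ring.
have := th_coef hL; rewrite rmorphB rmorphXn hP subr0.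
have -> : th l = delta i0 f *: 'X.
  rewrite /l rmorph_sum (bigD1 i0) //= big1 => [|j /negPf ji].
    by rewrite addr0 -mul_mpolyC rmorphM /= mmapX mmapC mmap1U eqxx scale1r mul_polyC.
  by rewrite -mul_mpolyC rmorphM /= mmapX mmap1U ji scale0r mulr0.
by rewrite exprZn coefZ coefXn eqxx mulr1 => /eqP; rewrite expf_eq0 => /andP [_ /eqP].
Qed.

Lemma locus_delta_ideal f : f 1%g = 0 -> locus_ideal (f ^+ M) -> delta i0 f = 0.
Proof. by move=> f1 /locus_ideal_sub; apply: locus_delta_pow. Qed.

End Locus.

(** The ideal that defines the locus need not be radical: a function vanishing there only has a
    power in it. The argument is therefore made for f^M with arbitrary positive M. *)
Theorem wlocus_lie (Pi : wt -> Prop) f i : (forall a b, Pi a -> Pi b -> Pi (a + b)) ->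
  vanish (wlocus Pi) f -> Pi (w i) -> delta i f = 0.
Proof.
move=> PiD hf hi; have [|n hn] := @regfun_nullstellensatz k G (locus_ideal Pi) f (igen_ideal _).
  move=> y hy; apply: hf => a h ha na.
  have : (h - rf_const G (h 1%g)) y = 0 by apply: hy; apply: sub_igen; exists a, h.
  by rewrite !rfE /= => /eqP; rewrite subr_eq0 => /eqP.
have f1 : f 1%g = 0 by apply: hf.
apply: (@locus_delta_ideal Pi PiD n.+1 i hi) => //.
by rewrite exprS; apply: (is_idealMr _ (igen_ideal _)).
Qed.

End Smooth.
End Frame.

Lemma wt_mulIn r (a : wt r) n n' : a != 0 -> a *+ n = a *+ n' -> n = n'.
Proof.
move=> a0 e; have [i ai] : exists i, a i != 0.
  apply: contrapT => h; case/eqP: a0; apply/ffunP => i; rewrite ffunE; apply/eqP.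
  by apply: contraT => ai; case: h; exists i.
have := congr1 (fun b : wt r => b i) e; rewrite !ffunMnE => h.
exact: (Num.Theory.mulrIn ai).
Qed.

Lemma nth_root (k : closedFieldType) (z : k) n : (0 < n)%N -> exists c, c ^+ n = z.
Proof.
move=> n0; have : size ('X^n - z%:P) != 1%N by rewrite size_XnsubC // eqSS -lt0n.
by move=> /closed_rootP [c]; rewrite rootE !hornerE subr_eq0 => /eqP; exists c.
Qed.

Lemma mon_surj (k : closedFieldType) r (a : wt r) (z : k) : a != 0 -> z != 0 ->
  exists2 s, Gm_pow s & mon s a = z.
Proof.
move=> a0 z0; have [i ai] : exists i, a i != 0.
  apply: contrapT => h; case/eqP: a0; apply/ffunP => i; rewrite ffunE; apply/eqP.
  by apply: contraT => ai; case: h; exists i.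
have [c hc] : exists c : k, c ^ (a i) = z.
  case: (a i) ai => n n0; first by apply: nth_root; rewrite lt0n.
  have [c hc] := @nth_root k z^-1 n.+1 isT; exists c.
  by change ((c ^+ n.+1)^-1 = z); rewrite hc invrK.
exists (fun j => if j == i then c else 1); last first.
  rewrite /mon (bigD1 i) //= eqxx big1 ?mulr1 // => j /negPf ->; exact: exp1rz.
have c0 : c != 0.
  apply: contra z0 => /eqP c0; move: hc; rewrite c0 => <-.
  by rewrite exp0rz (negPf ai).
by move=> j; case: ifP => _ //; rewrite oner_neq0.
Qed.

Lemma mon_poly0 (k : closedFieldType) r (a : wt r) (P : {poly k}) : a != 0 ->
  (forall s, Gm_pow s -> P.[mon s a] = 0) -> P = 0.
Proof.
move=> a0 h; apply/eqP; apply: contraT => P0.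
have /closed_nonrootP [z] : P * 'X != 0 by rewrite mulf_neq0 // polyX_eq0.
rewrite rootM negb_or rootX => /andP [hz z0].
have [s hs e] := mon_surj a0 z0.
by move: hz; rewrite rootE -e h // eqxx.
Qed.

(** * Roots *)

Section RootGroup.
Variables (k : closedFieldType) (G : algGroup k) (F : frame G).
Local Notation kG := (regfun G).
Local Notation d := (fdim F).
Local Notation wt := (wt (frk F)).
Local Notation x := (@fx _ _ F).
Local Notation w := (@fw _ _ F).
Local Notation phi := (@fphi _ _ F).
Local Notation m := (@mx1 k G).
Implicit Types (f g h : kG).

Lemma regfun_sep (u v : G) : (forall f, f u = f v) -> u = v.
Proof.
move=> h; have [z [_ hz]] := @reg_points _ G (fun f : G -> k => f u) (fun=> erefl)
  (fun _ _ _ _ => erefl) (fun _ _ _ _ => erefl).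
rewrite -(hz u) // -(hz v) // => f hf; exact: (h (RegFun hf)).
Qed.

Variable al : wt.
Hypothesis al0 : al != 0.
Definition ray (c : wt) : Prop := exists n, c = al *+ n.+1.

Lemma rayD a b : ray a -> ray b -> ray (a + b).
Proof. by move=> [n ->] [n' ->]; exists (n + n'.+1)%N; rewrite -mulrnDr addSn. Qed.

Lemma ray_neq0 : ~ ray 0.
Proof. by move=> [n /esym]; rewrite -(mulr0n al) => /(wt_mulIn al0). Qed.

(** The candidate for the unipotent group whose Lie algebra has the positive multiples of [al] as
    weights; restriction to the whole ray makes the locus a group ([U_mul]). *)
Definition U := wlocus ray.

Lemma U1 : U 1%g. Proof. by []. Qed.

Lemma U_const u a h : U u -> wvec phi a h -> ~ ray a -> h u = h 1%g.
Proof. by move=> Uu; apply: Uu. Qed.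

Definition cj s (u : G) : G := (phi s * u * (phi s)^-1)%g.

Lemma U_cj s u : Gm_pow s -> U u -> U (cj s u).
Proof.
move=> hs Uu a h hh na; rewrite hh // (U_const Uu hh na).
have [->|a0] := eqVneq a 0; first by rewrite mon0 mul1r.
by rewrite (wvec_at1 hh a0) mulr0.
Qed.

Lemma U_graded f : exists (L : seq nat) (g : nat -> kG),
  [/\ forall n, wvec phi (al *+ n) (g n),
      forall u, U u -> f u = \sum_(n <- L) g n u & 0%N \in L /\ uniq L].
Proof.
have [l [H [ul hH ef]]] := wvec_decomp (@fphi_emb _ _ F) (@fphiM _ _ F) f.
have /choice [nu hnu] : forall a : wt, exists n, (exists n', a = al *+ n') -> a = al *+ n.
  move=> a; have [[n ->]|h] := pselect (exists n', a = al *+ n'); first by exists n.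
  by exists 0%N.
pose isr (a : wt) := `[< exists n', a = al *+ n' >].
pose L0 := [seq nu a | a <- l & isr a].
exists (undup (0%N :: L0)), (fun n => if al *+ n \in l then H (al *+ n) else 0); split.
- by move=> n; case: ifP => _; [apply: hH|apply: wvec0].
- move=> u Uu; rewrite {1}ef rf_sum (bigID isr) /= [X in _ + X]big1 ?addr0; last first.
    move=> a /asboolPn na; rewrite (U_const Uu (hH a)); last by move=> [n e]; apply: na; exists n.+1.
    by apply: (wvec_at1 (hH a)); apply/eqP => a0; apply: na; exists 0%N.
  rewrite -big_filter; transitivity (\sum_(n <- L0) (if al *+ n \in l then H (al *+ n) else 0) u).
    rewrite big_map big_seq [RHS]big_seq; apply: eq_bigr => a.
    by rewrite mem_filter => /andP [/asboolP /hnu <- ->].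
  have uL0 : uniq L0.
    rewrite map_inj_in_uniq ?filter_uniq // => a b.
    rewrite !mem_filter => /andP [/asboolP /hnu ea _] /andP [/asboolP /hnu eb _] e.
    by rewrite ea eb e.
  have [h|h] := boolP (0%N \in L0); first by rewrite undup_id /= ?h // undup_id.
  rewrite /= big_cons undup_id //.
  case: ifP => [h0|]; last by rewrite rf0 add0r.
  case/negP: h; apply/mapP; exists 0.
    by rewrite mem_filter -{2}(mulr0n al) h0 andbT; apply/asboolP; exists 0%N.
  have := hnu 0 _ ; rewrite -{1}(mulr0n al) => h.
  by apply: (wt_mulIn al0); apply: h; exists 0%N; rewrite mulr0n.
- by rewrite mem_undup mem_head undup_uniq.
Qed.

Lemma wvec_U0 g u : wvec phi 0 g -> U u -> g u = g 1%g.
Proof. by move=> hg Uu; apply: (Uu 0 _ hg); apply: ray_neq0. Qed.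

Lemma wvec_ray1 n g : wvec phi (al *+ n.+1) g -> g 1%g = 0.
Proof.
move=> hg; apply: (wvec_at1 hg); apply/eqP; rewrite -(mulr0n al).
by move=> /(wt_mulIn al0).
Qed.

Lemma wvec_cj a g s u : Gm_pow s -> wvec phi a g -> g (cj s u) = mon s a * g u.
Proof. by move=> hs hg; apply: hg. Qed.

Lemma graded_at1 f L (g : nat -> kG) : (forall n, wvec phi (al *+ n) (g n)) ->
  (forall u, U u -> f u = \sum_(n <- L) g n u) -> 0%N \in L -> uniq L ->
  forall u, U u -> g 0%N u = f 1%g.
Proof.
move=> hg hf L0 uL u Uu; have g0 : wvec phi 0 (g 0%N) by have := hg 0%N; rewrite mulr0n.
rewrite (wvec_U0 g0 Uu) (hf _ U1) (bigD1_seq 0%N) //= big1 ?addr0 // => n.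
by case: n => // n _; apply: wvec_ray1 (hg _).
Qed.

(* The orbit of u under T extends to a curve through 1, parametrized by al. *)
Lemma U_curve u f : U u -> exists2 P : {poly k}, P`_0 = f 1%g &
  forall s, Gm_pow s -> f (cj s u) = P.[mon s al].
Proof.
move=> Uu; have [L [g [hg hf [L0 uL]]]] := U_graded f.
exists (\sum_(n <- L) g n u *: 'X^n).
  rewrite coef_sum (bigD1_seq 0%N) //= coefZ coefXn mulr1 big1 ?addr0.
    exact: (graded_at1 hg hf).
  by move=> n n0; rewrite coefZ coefXn eq_sym (negPf n0) mulr0.
move=> s hs; rewrite hf; last exact: U_cj.
rewrite horner_sum; apply: eq_bigr => n _.
by rewrite (wvec_cj _ hs (hg n)) mon_mul_nat // !hornerE mulrC.
Qed.

(** Along the curves of [U_curve] a function h(uv) of weight [a] becomes a polynomial in [mon s al]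
    with constant term h(1). It also equals h(uv) times [mon s a], which is impossible for [a]
    outside the ray unless h(uv) = h(1). *)
Lemma U_mul u v : U u -> U v -> U (u * v)%g.
Proof.
move=> Uu Uv a h hh na; have [n [c [b hcb]]] := reg_comulE h.
have /choice [Pc hPc] : forall i : 'I_n, exists P : {poly k}, P`_0 = c i 1%g /\
    forall s, Gm_pow s -> c i (cj s u) = P.[mon s al].
  by move=> i; have [P h1 h2] := U_curve (c i) Uu; exists P.
have /choice [Pb hPb] : forall i : 'I_n, exists P : {poly k}, P`_0 = b i 1%g /\
    forall s, Gm_pow s -> b i (cj s v) = P.[mon s al].
  by move=> i; have [P h1 h2] := U_curve (b i) Uv; exists P.
pose P := \sum_i Pc i * Pb i.
have hP s : Gm_pow s -> mon s a * h (u * v)%g = P.[mon s al].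
  move=> hs; rewrite -hh // (_ : phi s * (u * v) * (phi s)^-1 = cj s u * cj s v)%g; last by rewrite /cj !mulgA mulgVK.
  rewrite hcb horner_sum; apply: eq_bigr => i _.
  by rewrite (hPc i).2 // (hPb i).2 // hornerM.
have P0 : P`_0 = h 1%g.
  rewrite coef_sum -{1}(mulg1 1%g) hcb; apply: eq_bigr => i _.
  by rewrite coef0M (hPc i).1 (hPb i).1.
have [a0|a0] := eqVneq a 0.
  have e : P = (h (u * v)%g)%:P.
    apply/eqP; rewrite -subr_eq0; apply/eqP; apply: (mon_poly0 al0) => s hs.
    by rewrite !hornerE -hP // a0 mon0 mul1r subrr.
  by rewrite -P0 e coefC.
rewrite (wvec_at1 hh a0).
pose l := undup (a :: [seq al *+ i | i <- iota 0 (size P)]).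
have hl s : Gm_pow s -> \sum_(b <- l)
    ((if b == a then h (u * v)%g else 0) -
     \sum_(i < size P | al *+ i == b) P`_i) * mon s b = 0.
  move=> hs; under eq_bigr do rewrite mulrBl; rewrite sumrB.
  rewrite (bigD1_seq a) ?undup_uniq ?mem_undup ?mem_head //= eqxx big1; last first.
    by move=> b' /negPf ->; rewrite mul0r.
  rewrite addr0 mulrC hP // horner_coef; apply/eqP; rewrite subr_eq0; apply/eqP.
  under [RHS]eq_bigr do rewrite big_mkcond mulr_suml.
  rewrite exchange_big /=; apply: eq_bigr => i _.
  rewrite (bigD1_seq (al *+ i)) ?undup_uniq //=; last first.
    rewrite mem_undup inE; apply/orP; right; apply/mapP.
    by exists (nat_of_ord i) => //; rewrite mem_iota add0n /= ltn_ord.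
  rewrite eqxx big1 ?addr0 ?mon_mul_nat // => b' ; rewrite eq_sym => /negPf ->.
  by rewrite mul0r.
have := mon_indep (undup_uniq _) hl (a := a).
rewrite mem_undup mem_head eqxx => /(_ isT) /eqP; rewrite subr_eq0 => /eqP ->.
rewrite big1 // => i /eqP e; case: na; case: (nat_of_ord i) e => [|i'] e.
  by move: a0; rewrite -e mulr0n eqxx.
by exists i'.
Qed.

(** The n-th power of the maximal ideal vanishes to order n along the curves of [U_curve]. *)
Lemma U_order u f n : U u -> ipow m n f -> exists P : {poly k},
  forall s, Gm_pow s -> f (cj s u) = (mon s al) ^+ n * P.[mon s al].
Proof.
move=> Uu; elim: n f => [|n IH] f hf.
  by have [P _ hP] := U_curve f Uu; exists P => s hs; rewrite mul1r hP.
pose J : set kG := [set f | exists P : {poly k},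
  forall s, Gm_pow s -> f (cj s u) = (mon s al) ^+ n.+1 * P.[mon s al]].
apply: (ipow_ind (J := J)) hf.
  split=> [|g h [P hP] [Q hQ]|g h [P hP]].
  - by exists 0 => s hs; rewrite rf0 horner0 mulr0.
  - by exists (P + Q) => s hs; rewrite rfD hP // hQ // hornerD mulrDr.
  - have [Q _ hQ] := U_curve g Uu; exists (Q * P) => s hs.
    by rewrite rfM hP // hQ // hornerM mulrCA.
move=> g h g1 /IH [P hP]; have [Q Q0 hQ] := U_curve g Uu.
have [Q' eQ] : exists Q', Q = 'X * Q'.
  have : root Q 0 by rewrite rootE horner_coef0 Q0 g1.
  by move=> /factor_theorem [Q' ->]; exists Q'; rewrite subr0 mulrC.
exists (Q' * P) => s hs.
by rewrite rfM hQ // hP // eQ !hornerM hornerX exprS; ring.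
Qed.

Variable p : nat.
Hypothesis char_k : p \in [pchar k].

Let Sr : {set 'I_d} := [set i | `[< ray (w i) >]]%SET.
Definition nU := #|Sr|.
Definition em (l : 'I_nU) : 'I_d := enum_val l.

Lemma em_inj : injective em. Proof. exact: enum_val_inj. Qed.

Lemma em_ray l : ray (w (em l)).
Proof. by have := enum_valP l; rewrite finset.inE => /asboolP. Qed.

Lemma em_cover j : ray (w j) -> exists l, em l = j.
Proof.
move=> hj; have jS : j \in Sr by rewrite finset.inE; apply/asboolP.
by exists (enum_rank_in jS j); rewrite /em enum_rankK_in.
Qed.

Definition ee l : nat := projT1 (cid (em_ray l)).
Lemma eeP l : w (em l) = al *+ (ee l).+1.
Proof. exact: (projT2 (cid (em_ray l))). Qed.

Definition xU l : kG := x (em l).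

Lemma xU_wvec l : wvec phi (al *+ (ee l).+1) (xU l).
Proof. by rewrite -eeP; apply: fxw. Qed.

Lemma xU_out j : (forall l, em l != j) -> vanish U (x j).
Proof.
move=> hj u Uu; rewrite (U_const Uu (fxw j)) ?fx1 // => /em_cover [l hl].
by move: (hj l); rewrite hl eqxx.
Qed.

Let hI : is_ideal (vanish U) := @vanish_ideal _ _ _.
Let evU (P : {mpoly k[nU]}) : kG := mmap (rf_const G) xU P.

Lemma evU_at P u : evU P u = P.@[fun l => xU l u].
Proof.
rewrite /evU /mmap rf_sum mevalE; apply: eq_bigr => b _.
by rewrite rfM /mmap1 rf_prod; congr (_ * _); apply: eq_bigr => l _; rewrite rfX.
Qed.

Lemma U_indep P : vanish U (evU P) -> P = 0.
Proof.
move=> hP; apply/mpolyP => b; rewrite mcoeff0.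
apply: (@sub_smooth _ _ F p char_k nU em (vanish U) em_inj hI xU_out _ _ _ (mdeg b) P) => //.
- exact: kG_reduced.
- move=> l v; apply: vanish_lder => y f Uy hf.
  apply: (wlocus_lie char_k rayD _ (em_ray l)) => z Uz; apply: hf; exact: U_mul.
- by move=> v; apply; apply: U1.
exact: isum_r (ipow_ideal _ _) hP.
Qed.

Let aux (A B C : k) : C = B -> A - B - (A - C) = 0.
Proof. by move=> ->; ring. Qed.

Lemma U_linear g u : wvec phi al g -> U u ->
  g u = \sum_(l | ee l == 0%N) delta (em l) g * xU l u.
Proof.
move=> hg Uu; have g1 : g 1%g = 0 by apply: (@wvec_ray1 0%N).
have := deltaP F g; rewrite g1 rmorph0 subr0 => /(U_order Uu) [P hP].
have e : g u *: 'X - \sum_l (delta (em l) g * xU l u) *: 'X^((ee l).+1) - 'X^2 * P = 0.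
  apply: (mon_poly0 al0) => s hs; rewrite !hornerE -hP // horner_sum.
  rewrite rfB rf_sum (wvec_cj u hs hg) [mon s al * _]mulrC; apply: aux.
  rewrite (bigID (mem (codom em))) /= [X in _ + X]big1 ?addr0; last first.
    move=> j hj; rewrite (xU_out _ (U_cj hs Uu)) ?mulr0 // => l.
    by apply: contra hj => /eqP <-; apply: codom_f.
  rewrite -big_uniq; last by rewrite map_inj_uniq ?enum_uniq //; apply: em_inj.
  rewrite /codom /image_mem big_map big_enum; apply: eq_bigr => l _.
  by rewrite -/(xU l) (wvec_cj u hs (xU_wvec l)) mon_mul_nat // hornerZ hornerXn mulrCA mulrC.
have := congr1 (fun Q : {poly k} => Q`_1) e.
rewrite !coefB coefZ coefX mulr1 coef0 coefXnM subr0 coef_sum => /eqP.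
rewrite subr_eq0 => /eqP ->; rewrite [RHS]big_mkcond; apply: eq_bigr => l _.
by rewrite coefZ coefXn eqSS eq_sym; case: eqP => _; rewrite ?mulr1 ?mulr0.
Qed.

(** For a function of weight n times [al], a Taylor expansion up to order n suffices: the remainder
    vanishes to order n + 1 along the curves, so the coefficient of the n-th power of the parameter
    shows that the function is a polynomial in the coordinates on [U]. *)
Lemma U_span f : exists P, vanish U (f - evU P).
Proof.
have [L [g [hg hf _]]] := U_graded f.
suff H n h : wvec phi (al *+ n) h -> exists P, vanish U (h - evU P).
  have /choice [P hP] := fun n => H n (g n) (hg n).
  exists (\sum_(n <- L) P n) => u Uu.
  rewrite rfB evU_at hf // (raddf_sum (meval _)) -sumrB big1 // => n _ /=.
  by have := hP n u Uu; rewrite rfB evU_at.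
move=> hh; have [|P [_ [a [b [ha hb e]]]]] := @sub_expand _ _ F nU em (vanish U) em_inj hI xU_out 0 n.+1 h.
  by apply: (isum_l hI).
pose wb (b : 'X_{1..nU}) := (\sum_l b l * (ee l).+1)%N.
exists (\sum_(b <- msupp P | wb b == n) P@_b *: 'X_[b]) => u Uu.
have [Q hQ] := U_order Uu ha.
have mw c s : Gm_pow s -> 'X_[c].@[fun l => xU l (cj s u)] = (mon s al) ^+ wb c * 'X_[c].@[fun l => xU l u].
  move=> hs; rewrite !mevalX /wb -prodrXr -big_split; apply: eq_bigr => l _ /=.
  by rewrite (wvec_cj u hs (xU_wvec l)) mon_mul_nat // exprMn -exprM mulnC.
have e' : h u *: 'X^n - \sum_(c <- msupp P) (P@_c * 'X_[c].@[fun l => xU l u]) *: 'X^(wb c) - 'X^(n.+1) * Q = 0.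
  apply: (mon_poly0 al0) => s hs; rewrite !hornerE -hQ // horner_sum.
  have ea : a (cj s u) = h (cj s u) - evU P (cj s u).
    by have := congr1 (fun f : kG => f (cj s u)) e; rewrite !rfE (hb _ (U_cj hs Uu)) addr0 => <-.
  rewrite ea (wvec_cj u hs hh) mon_mul_nat // [mon s al ^+ n * _]mulrC; apply: aux.
  rewrite evU_at {1}(mpolyE P) (raddf_sum (meval _)); apply: eq_bigr => c _ /=.
  by rewrite mevalZ mw // hornerZ hornerXn mulrCA mulrC.
have := congr1 (fun Q : {poly k} => Q`_n) e'.
rewrite !coefB coefZ coefXn eqxx mulr1 coef0 coefXnM ltnSn subr0 coef_sum.
move=> e2; rewrite rfB evU_at (raddf_sum (meval _)) -[RHS]e2 big_mkcond; congr (_ - _).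
apply: eq_bigr => c _ /=; rewrite mevalZ coefZ coefXn eq_sym.
by case: eqP => _; rewrite ?mulr1 ?mulr0.
Qed.

Lemma U_inj u v : U u -> U v -> (forall l, xU l u = xU l v) -> u = v.
Proof.
move=> Uu Uv h; apply: regfun_sep => f; have [P hP] := U_span f.
have := hP u Uu; have := hP v Uv; rewrite !rfB !evU_at (_ : (fun l => xU l u) = (fun l => xU l v)).
  by move=> /eqP; rewrite subr_eq0 => /eqP -> /eqP; rewrite subr_eq0 => /eqP ->.
by apply/funext.
Qed.

(** With [U_indep] and [U_span] the functions on [U] form a polynomial ring, so any prescribed
    coordinates define an algebra map and hence a point: [U] is an affine space. *)
Lemma U_point (v : 'I_nU -> k) : exists u, U u /\ forall l, xU l u = v l.
Proof.
have /choice [P hP] := U_span.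
have uP f Q : vanish U (f - evU Q) -> P f = Q.
  move=> hQ; apply/eqP; rewrite -subr_eq0; apply/eqP; apply: U_indep.
  rewrite /evU rmorphB /=; have := is_idealB hI hQ (hP f); congr (vanish U _).
  by rewrite /evU; ring.
have [|f g|f g|u hu] := @regfun_point _ G (fun f => (P f).@[v]).
- move=> c; rewrite (uP _ c%:MP) ?mevalC // => u Uu.
  by rewrite rfB evU_at mevalC /= subrr.
- rewrite (uP _ (P f + P g)) ?mevalD // /evU rmorphD /= opprD addrACA.
  by apply: (is_idealD hI); apply: hP.
- rewrite (uP _ (P f * P g)) ?mevalM // /evU rmorphM /=.
  have -> : f * g - mmap (rf_const G) xU (P f) * mmap (rf_const G) xU (P g) =
    g * (f - mmap (rf_const G) xU (P f)) + mmap (rf_const G) xU (P f) * (g - mmap (rf_const G) xU (P g)) by ring.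
  by apply: (is_idealD hI); apply: (is_idealMr _ hI); apply: hP.
exists u; split=> [|l].
  apply: zclosed_vanish; first exact: wlocus_closed.
  by move=> f hf; rewrite -hu (uP _ 0) ?meval0 // /evU rmorph0 subr0.
rewrite -hu (uP _ 'X_l) ?mevalXU // => z Uz.
by rewrite rfB evU_at mevalXU subrr.
Qed.

(* Comparing coefficients along the curves of U_curve: only products of weights
   summing to the weight of h contribute to h (u * v). *)
Lemma U_comul e h : wvec phi (al *+ e) h -> exists L : seq (nat * kG * kG),
  (forall t, t \in L -> [/\ (t.1.1 <= e)%N, wvec phi (al *+ t.1.1) t.1.2 &
     wvec phi (al *+ (e - t.1.1)) t.2]) /\
  (forall u v, U u -> U v -> h (u * v)%g = \sum_(t <- L) t.1.2 u * t.2 v).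
Proof.
move=> hh; have [n [a [b hab]]] := reg_comulE h.
have /choice [La hLa] := fun i => U_graded (a i).
have /choice [ga hga] := hLa.
have /choice [Lb hLb] := fun i => U_graded (b i).
have /choice [gb hgb] := hLb.
pose L := flatten [seq [seq (y, ga i y, gb i (e - y)%N) | y <- La i & (y <= e)%N && ((e - y)%N \in Lb i)]
  | i <- enum 'I_n].
exists L; split.
  move=> t /flattenP [_ /mapP [i _ ->] /mapP [y]]; rewrite mem_filter => /andP [/andP [ye _] _] -> /=.
  by have [h1 _ _] := hga i; have [h2 _ _] := hgb i; split.
move=> u v Uu Uv.
pose P := h (u * v)%g *: 'X^e - \sum_(i < n) \sum_(y <- La i) \sum_(z <- Lb i)
  (ga i y u * gb i z v) *: 'X^(y + z) : {poly k}.
have P0 : P = 0.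
  apply: (mon_poly0 al0) => s hs; rewrite /P !hornerE horner_sum.
  rewrite -mon_mul_nat // mulrC -hh //.
  rewrite (_ : phi s * (u * v) * (phi s)^-1 = cj s u * cj s v)%g; last by rewrite /cj !mulgA mulgVK.
  rewrite hab -sumrB big1 // => i _; apply/eqP; rewrite subr_eq0; apply/eqP.
  have [ha1 ha2 _] := hga i; have [hb1 hb2 _] := hgb i.
  rewrite ha2 ?hb2; try exact: U_cj.
  rewrite horner_sum mulr_suml; apply: eq_bigr => y _.
  rewrite horner_sum mulr_sumr; apply: eq_bigr => z _.
  by rewrite (wvec_cj u hs (ha1 y)) (wvec_cj v hs (hb1 z)) !mon_mul_nat // hornerZ hornerXn exprD mulrACA mulrC.
have := congr1 (fun Q : {poly k} => Q`_e) P0.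
rewrite coefB coefZ coefXn eqxx mulr1 coef0 coef_sum => /eqP; rewrite subr_eq0 => /eqP ->.
rewrite big_flatten big_map big_enum; apply: eq_bigr => i _.
rewrite big_map big_filter coef_sum [RHS]big_mkcond; apply: eq_bigr => y _ /=.
rewrite coef_sum; have [_ _ [_ ub]] := hgb i.
have [ye|ye] := leqP y e; last first.
  rewrite big1 // => z _; rewrite coefZ coefXn; case: eqP => [ez|_]; last by rewrite mulr0.
  by move: ye; rewrite ez ltnNge leq_addr.
have [h'|h'] := boolP ((e - y)%N \in Lb i) => /=.
  rewrite (bigD1_seq (e - y)%N) //= coefZ coefXn subnKC // eqxx mulr1 big1 ?addr0 // => z.
  move=> hz; rewrite coefZ coefXn; case: eqP => [ez|_]; last by rewrite mulr0.
  by case/eqP: hz; rewrite ez addKn.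
rewrite big_seq big1 // => z hz; rewrite coefZ coefXn; case: eqP => [ez|_]; last by rewrite mulr0.
by case/negP: h'; rewrite ez addKn.
Qed.

(** In [U_comul] the terms with one factor of weight 0, which is constant on [U], are identified by
    setting u = 1 or v = 1; they are h(v) and h(u). *)
Lemma U_law e h : wvec phi (al *+ e.+1) h -> exists L : seq (nat * kG * kG),
  (forall t, t \in L -> [/\ (0 < t.1.1 <= e)%N, wvec phi (al *+ t.1.1) t.1.2 &
     wvec phi (al *+ (e.+1 - t.1.1)) t.2]) /\
  (forall u v, U u -> U v -> h (u * v)%g = h u + h v + \sum_(t <- L) t.1.2 u * t.2 v).
Proof.
move=> hh; have [L [hL hm]] := U_comul hh.
exists [seq t <- L | (0 < t.1.1 <= e)%N]; split.
  by move=> t; rewrite mem_filter => /andP [h1 /hL [_ h2 h3]].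
have split3 u v : U u -> U v -> h (u * v)%g = \sum_(t <- L | t.1.1 == e.+1) t.1.2 u * t.2 v +
    (\sum_(t <- L | t.1.1 == 0%N) t.1.2 u * t.2 v + \sum_(t <- L | (0 < t.1.1 <= e)%N) t.1.2 u * t.2 v).
  move=> Uu Uv; rewrite hm // big_seq (bigID (fun t => t.1.1 == e.+1)) /= -big_seq_cond; congr (_ + _).
  rewrite (bigID (fun t => t.1.1 == 0%N)) /=; congr (_ + _).
    rewrite [RHS]big_seq_cond; apply: eq_bigl => t; case: (t \in L) => //=.
    by case: eqP => [->|]; rewrite ?andbF ?andbT.
  rewrite [RHS]big_seq_cond; apply: eq_bigl => t; have [tL|//] := boolP (t \in L).
  have [h1 _ _] := hL t tL; rewrite /= -lt0n.
  by rewrite andbC; congr (_ && _); rewrite -[RHS]ltnS [RHS]ltn_neqAle h1 andbT.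
have z1 n g (u : G) : (0 < n)%N -> wvec phi (al *+ n) g -> g 1%g = 0.
  by case: n => // n _; apply: wvec_ray1.
have A u v v' : U u -> U v -> U v' -> \sum_(t <- L | t.1.1 == e.+1) t.1.2 u * t.2 v =
    \sum_(t <- L | t.1.1 == e.+1) t.1.2 u * t.2 v'.
  move=> Uu Uv Uv'; rewrite big_seq_cond [RHS]big_seq_cond; apply: eq_bigr => t /andP [/hL [_ _ h3] /eqP te].
  by move: h3; rewrite te subnn mulr0n => h3; rewrite !(wvec_U0 h3).
have B u u' v : U u -> U u' -> U v -> \sum_(t <- L | t.1.1 == 0%N) t.1.2 u * t.2 v =
    \sum_(t <- L | t.1.1 == 0%N) t.1.2 u' * t.2 v.
  move=> Uu Uv Uv'; rewrite big_seq_cond [RHS]big_seq_cond; apply: eq_bigr => t /andP [/hL [_ h2 _] /eqP te].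
  by move: h2; rewrite te mulr0n => h2; rewrite !(wvec_U0 h2).
have C1 v : \sum_(t <- L | (0 < t.1.1 <= e)%N) t.1.2 1%g * t.2 v = 0.
  rewrite big_seq_cond big1 // => t /andP [/hL [_ h2 _] /andP [t0 _]].
  by rewrite (z1 _ _ 1%g t0 h2) mul0r.
have C2 v : \sum_(t <- L | (0 < t.1.1 <= e)%N) t.1.2 v * t.2 1%g = 0.
  rewrite big_seq_cond big1 // => t /andP [/hL [_ _ h2] /andP [_ te]].
  by rewrite (z1 _ _ 1%g _ h2) ?mulr0 // subn_gt0 ltnS.
have A1 v : U v -> \sum_(t <- L | t.1.1 == e.+1) t.1.2 1%g * t.2 v = 0.
  move=> Uv; rewrite big_seq_cond big1 // => t /andP [/hL [_ h2 _] /eqP te].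
  by rewrite (z1 _ _ 1%g _ h2) ?mul0r // te.
have B1 v : U v -> \sum_(t <- L | t.1.1 == 0%N) t.1.2 v * t.2 1%g = 0.
  move=> Uv; rewrite big_seq_cond big1 // => t /andP [/hL [_ _ h2] /eqP te].
  by rewrite (z1 _ _ 1%g _ h2) ?mulr0 // te subn0.
move=> u v Uu Uv; have := split3 1%g v U1 Uv; rewrite mul1g A1 // C1 add0r addr0 => ->.
have := split3 u 1%g Uu U1; rewrite mulg1 B1 // C2 !addr0 => ->.
rewrite split3 // big_filter addrA; congr (_ + _ + _); first exact: A.
exact: B.
Qed.

Hypothesis p_neq2 : (2 : k) != 0.
Hypothesis ee_le1 : forall l, (ee l <= 1)%N.

Lemma U_law1 l u v : ee l = 0%N -> U u -> U v -> xU l (u * v)%g = xU l u + xU l v.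
Proof.
move=> el Uu Uv; have := xU_wvec l; rewrite el => /U_law [L [hL ->]] //.
rewrite big_seq big1 ?addr0 // => t /hL [/andP [t0 t1]].
by move: (leq_trans t0 t1).
Qed.

Lemma U_law2 l : ee l = 1%N -> exists b : 'I_nU -> 'I_nU -> k, forall u v, U u -> U v ->
  xU l (u * v)%g = xU l u + xU l v +
    \sum_(i | ee i == 0%N) \sum_(j | ee j == 0%N) b i j * (xU i u * xU j v).
Proof.
move=> el; have := xU_wvec l; rewrite el => /U_law [L [hL h]].
exists (fun i j => \sum_(t <- L) delta (em i) t.1.2 * delta (em j) t.2) => u v Uu Uv.
rewrite h //; congr (_ + _).
transitivity (\sum_(t <- L) \sum_(i | ee i == 0%N) \sum_(j | ee j == 0%N)
  delta (em i) t.1.2 * delta (em j) t.2 * (xU i u * xU j v)).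
  rewrite big_seq [RHS]big_seq; apply: eq_bigr => t /hL [/andP [t0 t1]].
  have -> : t.1.1 = 1%N by case: (t.1.1) t0 t1 => [|[|]].
  rewrite subSS subn0 => h1 h2; rewrite (U_linear h1 Uu) (U_linear h2 Uv).
  rewrite mulr_suml; apply: eq_bigr => i _; rewrite mulr_sumr; apply: eq_bigr => j _.
  by ring.
rewrite exchange_big; apply: eq_bigr => i _; rewrite exchange_big; apply: eq_bigr => j _.
by rewrite mulr_suml.
Qed.

(** With only the weights [al] and 2 [al] present, the group law of [U] is additive in the
    coordinates of weight [al], and in those of weight 2 [al] it is additive up to a bilinear term
    in the former. *)
Theorem root_curve (T : set G) (alpha : G -> k) l0 : T = phi @` @Gm_pow k (frk F) ->
  (forall s, Gm_pow s -> alpha (phi s) = mon s al) -> ee l0 = 0%N ->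
  exists2 y : k -> G, root_hom T alpha y &
    forall a l, ee l = 0%N -> xU l (y a) = (l == l0)%:R * a.
Proof.
move=> eT ha e0.
have /choice [b hb] : forall l, exists b : k, forall (a a' : k) u v, U u -> U v ->
    (forall i, ee i = 0%N -> xU i u = (i == l0)%:R * a) ->
    (forall i, ee i = 0%N -> xU i v = (i == l0)%:R * a') ->
    xU l (u * v)%g = xU l u + xU l v + (ee l)%:R * (b * (a * a')).
  move=> l; have := ee_le1 l; rewrite leq_eqVlt ltnS leqn0 => /orP [] /eqP el.
    have [b hb] := U_law2 el; exists (b l0 l0) => a a' u v Uu Uv hu hv.
    rewrite hb // el mul1r; congr (_ + _).
    rewrite (bigD1 l0) ?e0 //= [X in _ + X]big1 ?addr0; last first.
      move=> i /andP [/eqP ei /negPf i0]; rewrite big1 // => j _.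
      by rewrite hu // i0 !mul0r mulr0.
    rewrite (bigD1 l0) ?e0 //= [X in _ + X]big1 ?addr0; last first.
      by move=> i /andP [/eqP ei /negPf i0]; rewrite [xU i v]hv // i0 mul0r !mulr0.
    by rewrite hu // hv // eqxx !mul1r.
  exists 0 => a a' u v Uu Uv _ _; rewrite U_law1 // el mul0r addr0 //.
(* The term a^2 / 2 absorbs the bilinear term, since (a + a')^2 / 2 = a^2 / 2 + a'^2 / 2 + a a'.
   Here 2 must be invertible. *)
pose v (a : k) l := if ee l == 0%N then (l == l0)%:R * a else 2^-1 * b l * a ^+ 2.
have /choice [y hy] := fun a => U_point (v a).
have yU a : U (y a) by case: (hy a).
have y0 a l : ee l = 0%N -> xU l (y a) = (l == l0)%:R * a.
  by move=> el; rewrite (hy a).2 /v el.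
have y1 a l : ee l = 1%N -> xU l (y a) = 2^-1 * b l * a ^+ 2.
  by move=> el; rewrite (hy a).2 /v el.
have case01 l : ee l = 0%N \/ ee l = 1%N.
  by have := ee_le1 l; rewrite leq_eqVlt ltnS leqn0 => /orP [] /eqP; [right|left].
exists y => //; split.
- have yk a : xU l0 (y a) = a by rewrite y0 // eqxx mul1r.
  split.
  + by move=> a a' _ _ e; rewrite -(yk a) e yk.
  + move=> f hf; have [P hP] := U_span (RegFun hf).
    exists (fun a => P.@[v a]); last first.
      move=> a _; have := hP _ (yU a); rewrite rfB evU_at => /eqP.
      rewrite subr_eq0 => /eqP /= ->; congr (P.@[_]).
      by apply/funext => l; apply: (hy a).2.
    move=> A [[hc hD hM] hid].
    have hX (g : k -> k) n : A g -> A (fun a => g a ^+ n).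
      move=> Ag; elim: n => [|n IH]; first exact: hc.
      by under eq_fun do rewrite exprS; apply: hM.
    have hv l : A (fun a => v a l).
      rewrite /v; case: eqP => _; apply: (hM) => //; try exact: hc.
      + by apply: hid.
      + by apply: hX; apply: hid.
    under eq_fun do rewrite mevalE.
    elim: (msupp P) => [|c r IH]; first by under eq_fun do rewrite big_nil; apply: hc.
    under eq_fun do rewrite big_cons; apply: (hD) => //; apply: (hM); first exact: hc.
    elim: (index_enum _) => [|l r' IH']; first by under eq_fun do rewrite big_nil; apply: hc.
    by under eq_fun do rewrite big_cons; apply: (hM) => //; apply: (hX).
  + move=> g /(_ [set g | exists2 f, reg G f & forall a : k, setT a -> f (y a) = g a]); apply.
    split; first split.
    * by move=> c; exists (fun=> c) => //; apply: reg_const.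
    * move=> g1 g2 [f1 r1 h1] [f2 r2 h2]; exists (fun u => f1 u + f2 u); first exact: reg_add.
      by move=> a _; rewrite h1 ?h2.
    * move=> g1 g2 [f1 r1 h1] [f2 r2 h2]; exists (fun u => f1 u * f2 u); first exact: reg_prod.
      by move=> a _; rewrite h1 ?h2.
    * by move=> _ ->; exists (xU l0); [apply: rf_reg|move=> a _; rewrite yk].
- move=> a a'; apply: U_inj => // [|l]; first exact: U_mul.
  rewrite (hb l a a') //; try by move=> i; apply: y0.
  case: (case01 l) => el; first by rewrite !y0 // el mul0r addr0 mulrDr.
  by rewrite !y1 // el mul1r; field.
- move=> t a; rewrite eT => -[s hs <-]; rewrite ha //.
  apply: U_inj => // [|l]; first exact: (U_cj hs).
  rewrite (wvec_cj (y a) hs (xU_wvec l)) mon_mul_nat //.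
  case: (case01 l) => el; rewrite el ?(y0 _ _ el) ?(y1 _ _ el) ?expr1; ring.
Qed.

End RootGroup.

Import Order.TTheory Num.Theory.

(** * Sums of roots in a finite system with reflections *)

Section RootSystem.
Variables (V : zmodType) (R : seq V) (c : V -> V -> int).
Hypothesis tf : forall (v : V) n, v *+ n.+1 = 0 -> v = 0.
Hypothesis cD : forall a x y, a \in R -> c a (x + y) = c a x + c a y.
Hypothesis caa : forall a, a \in R -> c a a = 2.
Let refl (f : V -> int) a x := x - a *~ f x.
Hypothesis cR : forall a b, a \in R -> b \in R -> refl (c a) a b \in R.
Hypothesis R0 : 0 \notin R.
Hypothesis uR : uniq R.

Lemma tf_int (v : V) (n : int) : v *~ n = 0 -> v = 0 \/ n = 0.
Proof.
case: n => [[|n]|n]; first by right.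
  by move=> /tf ->; left.
by rewrite NegzE mulrNz => /eqP; rewrite oppr_eq0 => /eqP /tf ->; left.
Qed.

Lemma no_line (b v : V) : (forall n : nat, b + v *+ n \in R) -> v = 0.
Proof.
move=> h; apply: contrapT => v0.
pose l := [seq b + v *+ n | n <- iota 0 (size R).+1].
have ul : uniq l.
  rewrite map_inj_uniq ?iota_uniq // => n n' /addrI.
  wlog le : n n' / (n <= n')%N => [H|].
    by case/orP: (leq_total n n') => le e; [apply: H|apply/esym/H].
  move=> e; apply/eqP; rewrite eqn_leq le /= leqNgt; apply/negP => lt.
  apply: v0; apply: (tf (n := (n' - n).-1)); rewrite prednK ?subn_gt0 // mulrnBr //.
  by rewrite e subrr.
have : (size l <= size R)%N by apply: uniq_leq_size => // _ /mapP [n _ ->].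
by rewrite size_map size_iota ltnn.
Qed.

(** The product of two reflections in the same root is the transvection x + (g(x) - f(x)) a; unless
    f = g on [R], its iterates would give an infinite line of roots. *)
Lemma coroot_uniq a (f g : V -> int) : a \in R ->
  (forall x y, f (x + y) = f x + f y) -> (forall x y, g (x + y) = g x + g y) ->
  f a = 2 -> g a = 2 -> (forall b, b \in R -> refl f a b \in R) ->
  (forall b, b \in R -> refl g a b \in R) -> forall b, b \in R -> f b = g b.
Proof.
move=> aR fD gD fa ga fR gR b bR.
have lin (h : V -> int) : (forall x y, h (x + y) = h x + h y) ->
    forall x n, h (x + a *~ n) = h x + h a * n.
  move=> hD x n.
  have h0 : h 0 = 0 by apply: (addrI (h 0)); rewrite -hD !addr0.
  have hN y : h (- y) = - h y by apply: (addrI (h y)); rewrite -hD !subrr.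
  have hn y m : h (y *+ m) = h y *+ m by elim: m => [|m IH] //; rewrite !mulrS hD IH.
  rewrite hD; case: n => n; first by rewrite -pmulrn hn -mulr_natr natz.
  by rewrite NegzE mulrNz hN -pmulrn hn mulrN -mulr_natr natz.
have e x : refl f a (refl g a x) = x + a *~ (g x - f x).
  rewrite /refl -!mulrNz (lin f fD) fa -addrA -mulrzDr; congr (_ + a *~ _).
  ring.
have it n : b + a *~ (g b - f b) *+ n \in R.
  elim: n => [|n IH]; first by rewrite mulr0n addr0.
  have := fR _ (gR _ IH); rewrite e mulrSr addrA.
  congr (_ + a *~ _ \in R).
  by rewrite pmulrn -mulrzA (lin g gD) (lin f fD) fa ga; ring.
have := no_line it => /tf_int [a0|/eqP]; first by rewrite a0 (negPf R0) in aR.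
by rewrite subr_eq0 => /eqP.
Qed.

(** The usual invariant form, the sum over all coroots. It is positive on roots, but possibly
    degenerate on [V], which [R] need not span. *)
Let form x y : int := \sum_(g <- R) c g x * c g y.
Let s a x := refl (c a) a x.

Let c_lin a b x n : b \in R -> c b (x + a *~ n) = c b x + c b a * n.
Proof.
move=> bR.
have h0 : c b 0 = 0 by apply: (addrI (c b 0)); rewrite -cD ?addr0.
have hN y : c b (- y) = - c b y by apply: (addrI (c b y)); rewrite -cD ?subrr.
have hn y m : c b (y *+ m) = c b y *+ m by elim: m => [|m IH] //; rewrite !mulrS cD // IH.
rewrite cD //; case: n => n; first by rewrite -pmulrn hn -mulr_natr natz.
by rewrite NegzE mulrNz hN -pmulrn hn mulrN -mulr_natr natz.
Qed.

Let sE a b x : b \in R -> c b (s a x) = c b x - c b a * c a x.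
Proof. by move=> bR; rewrite /s /refl -mulrNz c_lin // mulrN. Qed.

Let sK a x : a \in R -> s a (s a x) = x.
Proof.
move=> aR; rewrite {1}/s /refl sE // caa // /s /refl -addrA -!mulrNz -mulrzDr.
rewrite (_ : - c a x - (c a x - 2 * c a x) = 0) ?mulr0z ?addr0 //; ring.
Qed.

Let sD a x y : a \in R -> s a (x + y) = s a x + s a y.
Proof. by move=> aR; rewrite /s /refl cD // mulrzDr opprD addrACA. Qed.

Let sN a x n : a \in R -> s a (x *~ n) = s a x *~ n.
Proof.
move=> aR; rewrite /s /refl mulrzBl -mulrzA; congr (_ - a *~ _).
have h0 : c a 0 = 0 by apply: (addrI (c a 0)); rewrite -cD ?addr0.
by have := c_lin x 0 n aR; rewrite add0r h0 add0r.
Qed.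

(** Both sides define a reflection in the root s_a(g) that preserves [R], so [coroot_uniq]
    identifies them. This is what makes [form] invariant. *)
Let cs a g y : a \in R -> g \in R -> y \in R -> c (s a g) y = c g (s a y).
Proof.
move=> aR gR yR; have saR := cR aR gR.
apply: (coroot_uniq (a := s a g) (g := fun y => c g (s a y))) => //.
- by move=> u v; apply: cD.
- by move=> u v; rewrite sD // cD.
- exact: caa.
- by rewrite sK // caa.
- by move=> b bR; apply: cR.
- move=> b bR; have := cR aR (cR gR (cR aR bR)).
  rewrite -/(s a b) -/(s a _); congr (_ \in R).
  by rewrite {2}/refl sD // -mulrNz sN // sK // mulrNz.
Qed.

Let form_s a x y : a \in R -> x \in R -> y \in R -> form (s a x) (s a y) = form x y.
Proof.
move=> aR xR yR; have hp : perm_eq R [seq s a g | g <- R].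
  apply: uniq_perm => //.
    by rewrite map_inj_uniq // => u v e; rewrite -(sK u aR) e sK.
  move=> g; apply/idP/mapP => [gR|[h hR ->]]; last exact: cR.
  by exists (s a g); [exact: cR|rewrite sK].
rewrite /form (perm_big _ hp) big_map; rewrite big_seq [RHS]big_seq.
by apply: eq_bigr => g gR; rewrite !cs ?sK //; apply: cR.
Qed.

Let formC x y : form x y = form y x.
Proof. by apply: eq_bigr => g _; rewrite mulrC. Qed.

Let form_lin a x y n : form (x + a *~ n) y = form x y + form a y * n.
Proof.
rewrite /form mulr_suml -big_split /= big_seq [RHS]big_seq; apply: eq_bigr => g gR.
by rewrite c_lin // mulrDl; congr (_ + _); rewrite mulrAC.
Qed.

Let form_pos a : a \in R -> 0 < form a a.
Proof.
move=> aR; rewrite /form (bigD1_seq a) //= caa //.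
apply: ltr_pwDl => //; apply: sumr_ge0 => g _; exact: sqr_ge0.
Qed.

Let form_ge0 x : 0 <= form x x.
Proof. by apply: sumr_ge0 => g _; exact: sqr_ge0. Qed.

Lemma form_coroot a x : a \in R -> x \in R -> 2 * form x a = c a x * form a a.
Proof.
move=> aR xR; have := form_s aR xR aR.
have -> : s a a = 0 + a *~ -1.
  rewrite /s /refl caa // add0r mulrNz mulr1z; change (a - (a + a) = - a).
  by rewrite opprD addrA subrr add0r.
rewrite formC form_lin /s /refl -mulrNz formC.
have f0 y : form 0 y = 0.
  by have := form_lin 0 0 y 1; rewrite mulr1z addr0 mulr1 => e; apply: (addrI (form 0 y)); rewrite -e addr0.
rewrite formC f0 add0r formC form_lin [form x a]formC => e; lia.
Qed.

(** Both pairings are negative with product at most 4 by Cauchy-Schwarz. If one is -1, a reflection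
    yields a + b. *)
Theorem root_sum a b : a \in R -> b \in R -> c a b < 0 -> a + b = 0 \/ a + b \in R.
Proof.
move=> aR bR ab.
have ea := form_coroot aR bR; have eb := form_coroot bR aR.
have pa := form_pos aR; have pb := form_pos bR.
rewrite formC in eb.
have fab : form b a < 0 by nia.
have ba : c b a < 0 by nia.
have cs2 : form b a * form b a <= form a a * form b b.
  have := form_ge0 (0 + a *~ form b b + b *~ - form b a).
  have f0 y : form 0 y = 0.
    by have := form_lin 0 0 y 1; rewrite mulr1z addr0 mulr1 => e; apply: (addrI (form 0 y)); rewrite -e addr0.
  rewrite form_lin form_lin f0 add0r ![form _ (_ + _)]formC !form_lin f0 !add0r.
  rewrite [form a b]formC => h.
  have {h} : 0 <= form b b * (form a a * form b b - form b a * form b a).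
    by move: h; rewrite f0; congr (_ <= _); ring.
  by rewrite pmulr_rge0 // subr_ge0.
have pr : c a b * c b a <= 4.
  have : c a b * c b a * (form a a * form b b) <= 4 * (form a a * form b b).
    have -> : c a b * c b a * (form a a * form b b) = 4 * (form b a * form b a) by nia.
    nia.
  by rewrite ler_pM2r // mulr_gt0.
have [e|ne] := eqVneq (c a b) (- 1).
  by right; have := cR aR bR; rewrite /refl e mulrNz mulr1z opprK addrC.
have [e|ne'] := eqVneq (c b a) (- 1).
  by right; have := cR bR aR; rewrite /refl e mulrNz mulr1z opprK.
(* In the remaining case the product of the two reflections moves [b] along the multiples of 2(a +
   b); as [R] is finite and [V] torsion-free, a + b = 0. *)
have e1 : c a b = - 2 by nia.
have e2 : c b a = - 2 by nia.
left; have h x : s b (s a x) = x + a *~ (- c a x) + b *~ (- c b x - 2 * c a x).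
  rewrite {1}/s /refl sE // e2 /s /refl -!mulrNz; congr (_ + _ *~ _); ring.
pose v := (a + b) *+ 2.
have ev : a *~ 2 + b *~ 2 = v by rewrite -mulrzDl.
have it n : b + v *+ n \in R.
  elim: n => [|n IH]; first by rewrite mulr0n addr0.
  have := cR bR (cR aR IH); rewrite -/(s a _) -/(s b _) h.
  have cn d m : d \in R -> c d (b + v *+ m) = c d b + (c d a + c d b) * 2 * m%:Z.
    move=> dR; have := c_lin (a + b) b (2 * m%:Z) dR; rewrite cD // mulrA => <-.
    by congr (c d (b + _)); rewrite mulrzA -pmulrn.
  rewrite !cn // e1 e2 !caa //; congr (_ \in R).
  have -> : - (- 2 + (2 + - 2) * 2 * n%:Z) = 2 :> int by ring.
  have -> : - (2 + (- 2 + 2) * 2 * n%:Z) - 2 * (- 2 + (2 + - 2) * 2 * n%:Z) = 2 :> int by ring.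
  by rewrite mulrSr -ev !addrA.
exact: (@tf _ 1 (no_line it)).
Qed.

End RootSystem.

(** * Characters of the torus, and roots as weights of tangent vectors *)

Section LaurentChar.
Variables (k : closedFieldType) (r : nat).

Lemma laurent_subalg : subalg (@laurent k r).
Proof.
split=> [c|f1 f2 h1 h2|f1 f2 h1 h2] B hB; case: (hB) => -[hc hD hM] hg; first exact: hc.
  by apply: (hD); [apply: h1|apply: h2].
by apply: (hM); [apply: h1|apply: h2].
Qed.

Lemma laurent_coord i : @laurent k r (fun s => s i).
Proof. by move=> B [_ hB]; apply: hB; left; exists i. Qed.

Lemma laurent_coordV i : @laurent k r (fun s => (s i)^-1).
Proof. by move=> B [_ hB]; apply: hB; right; exists i. Qed.

Lemma laurent_mon a : @laurent k r (fun s => mon s a).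
Proof.
have [hc hD hM] := laurent_subalg; rewrite /mon.
elim: (index_enum _) => [|i l IH]; first by under eq_fun do rewrite big_nil; apply: hc.
under eq_fun do rewrite big_cons; apply: (hM) => //.
have hX (f : ('I_r -> k) -> k) n : laurent f -> laurent (fun s => f s ^+ n).
  move=> hf; elim: n => [|n IHn]; first exact: hc.
  by under eq_fun do rewrite exprS; apply: (hM).
case: (a i) => n; first by apply: (hX); apply: laurent_coord.
by under eq_fun do rewrite NegzE -exprz_inv; apply: (hX _ n.+1); apply: laurent_coordV.
Qed.

(** A multiplicative Laurent polynomial different from all monomials would be independent of them.
    The index [None] stands for [f] itself. *)
Lemma char_mon (f : ('I_r -> k) -> k) : laurent f -> f (fun=> 1) = 1 ->
  (forall s s', Gm_pow s -> Gm_pow s' -> f (fun i => s i * s' i) = f s * f s') ->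
  exists a, forall s, Gm_pow s -> f s = mon s a.
Proof.
move=> /laurentP [l hl] f1 fM; apply: contrapT => no.
pose M := {s : 'I_r -> k | @Gm_pow k r s}.
pose op (s t : M) : M := exist _ _ (GmM (svalP s) (svalP t)).
pose chi (a : option (wt r)) (x : M) : k := if a is Some a then mon (sval x) a else f (sval x).
pose ws := undup [seq x.2 | x <- l].
pose c (a : option (wt r)) : k := if a is Some a then - \sum_(x <- l | x.2 == a) x.1 else 1.
have := @char_indep k M op _ chi (None :: map Some ws) c _ _ _ _ None (exist _ _ (@Gm1 k r)).
rewrite /= f1 mulr1 => h; suff : (1 : k) = 0 by move/eqP; rewrite oner_eq0.
apply: h; last exact: mem_head.
- by move=> [a|] [s hs] [s' hs'] _ /=; [apply: monM|apply: fM].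
- have hN (a : wt r) : exists x : M, f (sval x) != mon (sval x) a.
    apply: contrapT => h'; apply: no; exists a => s hs; apply/eqP; apply: contraT => ne.
    by case: h'; exists (exist _ s hs).
  move=> [a|] [b|] _ _ //= ab.
  + have [|s hs hab] := @mon_sep k r a b; first by apply: contra ab => /eqP ->.
    by exists (exist (fun s => @Gm_pow k r s) s hs).
  + by have [x hx] := hN a; exists x; rewrite eq_sym.
- rewrite /= map_inj_uniq ?undup_uniq ?andbT; last by move=> ? ? [].
  by apply/negP => /mapP [].
- move=> [s hs]; rewrite big_cons /= mul1r big_map hl //.
  rewrite (@sum_by_weight r k k l (fun y a => y * mon s a)); last by move=> a; rewrite mul0r.
    by rewrite -big_split big1 // => a _ /=; rewrite mulNr subrr.
  by move=> x y a; rewrite mulrDl.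
Qed.

Lemma mon_mul_int s (a : wt r) n : Gm_pow s -> mon s (a *~ n) = mon s a ^ n :> k.
Proof.
move=> hs; case: n => n; first by rewrite -pmulrn mon_mul_nat.
by rewrite NegzE mulrNz -pmulrn monN // mon_mul_nat.
Qed.

End LaurentChar.

Section Chars.
Variables (k : closedFieldType) (G : algGroup k) (F : frame G).
Local Notation kG := (regfun G).
Local Notation d := (fdim F).
Local Notation wt := (wt (frk F)).
Local Notation x := (@fx _ _ F).
Local Notation w := (@fw _ _ F).
Local Notation phi := (@fphi _ _ F).

Definition tor : set G := phi @` @Gm_pow k (frk F).

Lemma phi_inj s s' : Gm_pow s -> Gm_pow s' -> phi s = phi s' -> s = s'.
Proof.
move=> hs hs'; have [hi _ _] := @fphi_emb _ _ F.
by apply: hi; rewrite inE.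
Qed.

Lemma tpar_ex : exists tp : G -> 'I_(frk F) -> k, forall s, Gm_pow s -> tp (phi s) = s.
Proof.
have /choice [tp htp] : forall t : G, exists s, tor t -> Gm_pow s /\ phi s = t.
  move=> t; have [[s hs <-]|nt] := pselect (tor t); first by exists s.
  by exists (fun=> 1).
exists tp => s hs; have [|h1 h2] := htp (phi s); first by exists s.
exact: phi_inj.
Qed.

Definition tpar : G -> 'I_(frk F) -> k := projT1 (cid tpar_ex).
Lemma tparK s : Gm_pow s -> tpar (phi s) = s. Proof. exact: (projT2 (cid tpar_ex)). Qed.

Definition chr (a : wt) (t : G) : k := if `[< tor t >] then mon (tpar t) a else 0.

Lemma tor_phi s : Gm_pow s -> tor (phi s). Proof. by exists s. Qed.

Lemma chrE a s : Gm_pow s -> chr a (phi s) = mon s a.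
Proof. by move=> hs; rewrite /chr asboolT ?tparK //; apply: tor_phi. Qed.

Lemma chr_out a t : ~ tor t -> chr a t = 0.
Proof. by move=> h; rewrite /chr asboolF. Qed.

Lemma phi1' : phi (fun=> 1) = 1%g. Proof. exact: phi1 (@fphiM _ _ F). Qed.

Lemma phiV' s : Gm_pow s -> phi (fun i => (s i)^-1) = (phi s)^-1%g.
Proof. exact: phiV (@fphiM _ _ F) s. Qed.

Lemma chr_character a : character tor (chr a).
Proof.
have [_ _ h3] := @fphi_emb _ _ F; have [f hf ef] := h3 _ (laurent_mon a).
split.
- by exists f => // _ [s hs <-]; rewrite chrE // ef.
- exact: chr_out.
- by rewrite -phi1' chrE ?mon1 //; apply: Gm1.
- by move=> _ _ [s hs <-] [s' hs' <-]; rewrite -fphiM // !chrE ?monM //; apply: GmM.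
Qed.

Lemma character_chr chi : character tor chi -> exists a, chi = chr a.
Proof.
move=> [[f hf ef] h0 h1 hM]; have [_ h2 _] := @fphi_emb _ _ F; have [g hg eg] := h2 _ hf.
have gE s : Gm_pow s -> g s = chi (phi s) by move=> hs; rewrite -eg // -ef //; apply: tor_phi.
have [||a ha] := char_mon hg.
- by rewrite gE ?phi1' //; apply: Gm1.
- move=> s s' hs hs'; rewrite !gE ?fphiM ?hM //; try exact: tor_phi.
  exact: GmM.
exists a; apply/funext => t; have [[s hs <-]|nt] := pselect (tor t).
  by rewrite chrE // -ha // gE.
by rewrite h0 // chr_out.
Qed.

Lemma chrN a : opp_char (chr a) = chr (- a).
Proof.
apply/funext => t; rewrite /opp_char; have [[s hs <-]|nt] := pselect (tor t).
  by rewrite !chrE // monN.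
by rewrite !chr_out // invr0.
Qed.

Lemma chrD a b : add_char (chr a) (chr b) = chr (a + b).
Proof.
apply/funext => t; rewrite /add_char; have [[s hs <-]|nt] := pselect (tor t).
  by rewrite !chrE // monD.
by rewrite !chr_out // mulr0.
Qed.

(** The derivations of [is_root], stated on bundled regular functions and without the condition that
    the weight is nontrivial. *)
Definition wder (H : set G) (a : wt) (D : kG -> k) : Prop :=
  [/\ forall c f g, D (c *: f + g) = c * D f + D g,
      forall f g, D (f * g) = D f * g 1%g + f 1%g * D g,
      forall f, vanish H f -> D f = 0, exists f, D f != 0 &
      forall s f, Gm_pow s -> D (cnj (phi s) f) = mon s a * D f].

Lemma root_wder H a : is_root H tor (chr a) <-> a != 0 /\ exists D, wder H a D.
Proof.
split=> [[_ [t [s hs <-]]]|[a0 [D [h1 h2 h3 [f0 hf0] h4]]]].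
  rewrite chrE // => ha [D [[[D1 D2] D3] [f hf Df] D4]]; split.
    by apply: contra ha => /eqP ->; rewrite mon0.
  exists (fun f : kG => D f); split.
  - by move=> c g h; apply: D1; apply: rf_reg.
  - by move=> g h; apply: D2; apply: rf_reg.
  - by move=> g hg; apply: D3 => //; apply: rf_reg.
  - by exists (RegFun hf).
  - by move=> s' g hs'; rewrite -chrE // -D4 //; [apply: tor_phi|apply: rf_reg].
pose E (f : G -> k) : k := if pselect (reg G f) is left hf then D (RegFun hf) else 0.
have EE (f : kG) : E f = D f.
  rewrite /E; case: pselect => [hf|/(_ (rf_reg f)) //].
  by congr D; apply/regfunP.
have EE' f (hf : reg G f) : E f = D (RegFun hf) by rewrite -EE.
split; first exact: chr_character.
  have [s hs h] := @mon_sep k _ a 0 a0; exists (phi s); first exact: tor_phi.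
  by rewrite chrE // -(mon0 s).
exists E; split.
- split; first split.
  + move=> c f g hf hg; rewrite (EE' _ hf) (EE' _ hg) -h1 -EE; congr E.
  + by move=> f g hf hg; rewrite (EE' _ hf) (EE' _ hg) -[f 1%g]/(RegFun hf 1%g) -[g 1%g]/(RegFun hg 1%g) -h2 -EE.
  + by move=> f hf hv; rewrite (EE' _ hf) h3.
- by exists f0; [apply: rf_reg|rewrite EE].
- move=> _ f [s hs <-] hf; rewrite (EE' _ hf) chrE // -h4 // -EE; congr E.
Qed.

Lemma wder_delta H a D : wder H a D ->
  forall f, D f = \sum_(i | w i == a) D (x i) * delta i f.
Proof.
move=> [h1 h2 h3 _ h4] f; rewrite (pder_delta F h1 h2 f) [RHS]big_mkcond.
apply: eq_bigr => i _; case: eqP => // /eqP ne.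
have [s hs hab] := mon_sep k ne.
have DZ c u : D (c *: u) = c * D u.
  have D0 : D 0 = 0.
    have := h1 1 0 0; rewrite scaler0 addr0 mul1r => /eqP.
    by rewrite -{1}[D 0]addr0 (inj_eq (addrI _)) eq_sym => /eqP.
  by rewrite -[c *: u]addr0 h1 D0 addr0.
have := h4 s (x i) hs; rewrite (_ : cnj (phi s) (x i) = mon s (w i) *: x i); last first.
  by apply/regfunP => y; rewrite cnjE fxw // rfZ.
rewrite DZ => /eqP; rewrite -subr_eq0 -mulrBl mulf_eq0 subr_eq0 (negPf hab) /= => /eqP ->.
by rewrite mul0r.
Qed.

Lemma wder_index H a D : wder H a D -> exists2 i, w i = a & D (x i) != 0.
Proof.
move=> hD; have [_ _ _ [f hf] _] := hD; apply: contrapT => no; case/negP: hf.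
rewrite (wder_delta hD) big1 // => i /eqP wi; have [->|Dx] := eqVneq (D (x i)) 0.
  by rewrite mul0r.
by case: no; exists i.
Qed.

Definition isrt (a : wt) : Prop := a != 0 /\ exists i, w i = a.

Lemma delta_wder i : wder setT (w i) (delta i).
Proof.
split.
- by move=> c f g; rewrite deltaD deltaZ.
- by move=> f g; rewrite deltaM.
- by move=> f hf; rewrite (_ : f = 0) ?delta0 //; apply/regfunP => y; rewrite hf.
- by exists (x i); rewrite delta_x eqxx oner_neq0.
- by move=> s f hs; rewrite delta_cnj.
Qed.

Lemma is_rootP a : is_root setT tor (chr a) <-> isrt a.
Proof.
rewrite root_wder; split=> [[a0 [D /wder_index [i wi _]]]|[a0 [i wi]]].
  by split=> //; exists i.
by split=> //; exists (delta i); rewrite -wi; apply: delta_wder.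
Qed.

End Chars.

Section SL2.
Variables (k : closedFieldType).

Definition mk2 (a b c d : k) : 'M[k]_2 :=
  \matrix_(i, j) if i == 0 then (if j == 0 then a else b) else (if j == 0 then c else d).

Lemma mk2P (A : 'M[k]_2) : A = mk2 (A 0 0) (A 0 1) (A 1 0) (A 1 1).
Proof.
apply/matrixP => i j; rewrite mxE; case: eqP => [->|/eqP i0]; case: eqP => [->|/eqP j0] //.
- by congr (A _ _); apply/val_inj; case: j j0 => [[|[|]]].
- by congr (A _ _); apply/val_inj; case: i i0 => [[|[|]]].
- by congr (A _ _); apply/val_inj; [case: i i0 => [[|[|]]]|case: j j0 => [[|[|]]]].
Qed.

Lemma mk2M a b c d a' b' c' d' : mk2 a b c d *m mk2 a' b' c' d' =
  mk2 (a * a' + b * c') (a * b' + b * d') (c * a' + d * c') (c * b' + d * d').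
Proof. by rewrite [LHS]mk2P !mxE !big_ord_recl !big_ord0 !mxE /= !addr0. Qed.

Lemma det_mk2 a b c d : \det (mk2 a b c d) = a * d - b * c.
Proof.
rewrite (expand_det_row _ 0) !big_ord_recl big_ord0 /cofactor !det_mx11 !mxE /=.
by rewrite addr0 expr0 expr1; ring.
Qed.

Lemma SL2_mk2 a b c d : a * d - b * c = 1 -> SL2 (mk2 a b c d).
Proof. by rewrite /SL2 /= det_mk2. Qed.

Lemma upper2 y : 1%:M + y *: delta_mx 0 1 = mk2 1 y 0 1.
Proof. by rewrite [LHS]mk2P !mxE /= !(mulr0, mulr1, addr0, add0r). Qed.

Lemma lower2 y : 1%:M + y *: delta_mx 1 0 = mk2 1 0 y 1.
Proof. by rewrite [LHS]mk2P !mxE /= !(mulr0, mulr1, addr0, add0r). Qed.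

Lemma diag2 z z' : z *: delta_mx 0 0 + z' *: delta_mx 1 1 = mk2 z 0 0 z'.
Proof. by rewrite [LHS]mk2P !mxE /= !(mulr0, mulr1, addr0, add0r). Qed.

Definition dg (z : k) := mk2 z 0 0 z^-1.

Lemma SL2_dg z : z != 0 -> SL2 (dg z).
Proof. by move=> z0; apply: SL2_mk2; rewrite mulfV // mulr0 subr0. Qed.

End SL2.

(** * Coroots and reflections from homomorphisms of SL_2 *)

Section Coroots.
Variables (k : closedFieldType) (G : algGroup k) (F : frame G).
Local Notation kG := (regfun G).
Local Notation d := (fdim F).
Local Notation wt := (wt (frk F)).
Local Notation x := (@fx _ _ F).
Local Notation w := (@fw _ _ F).
Local Notation phi := (@fphi _ _ F).
Local Notation tor := (tor F).
Local Notation chr := (@chr _ _ F).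
Local Notation isrt := (@isrt _ _ F).

Definition sl2_root (a : wt) (f : 'M[k]_2 -> G) : Prop :=
  SL2_hom tor (chr a) f /\ forall z, z != 0 -> tor (f (dg z)).

Variable a : wt.
Variable f : 'M[k]_2 -> G.
Hypothesis hf : sl2_root a f.

Let fM X Y : SL2 X -> SL2 Y -> f (X *m Y) = (f X * f Y)%g.
Proof. by case: hf => -[_ h _ _] _; apply: h. Qed.

Let f_one : f (mk2 1 0 0 1) = 1%g.
Proof.
have h1 : SL2 (mk2 (1 : k) 0 0 1) by apply: SL2_mk2; rewrite mulr1 mulr0 subr0.
apply: (mulgI (f (mk2 1 0 0 1))); rewrite -fM // mk2M mulg1; congr f.
by rewrite !(mulr0, mul0r, mulr1, addr0, add0r).
Qed.

Let f_upper s y : Gm_pow s ->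
  (phi s * f (mk2 1 y 0 1) * (phi s)^-1)%g = f (mk2 1 (mon s a * y) 0 1).
Proof.
move=> hs; case: hf => -[_ _ [_ _ h] _] _.
by have := h (phi s) y (tor_phi hs); rewrite !upper2 chrE.
Qed.

Let f_lower s y : Gm_pow s ->
  (phi s * f (mk2 1 0 y 1) * (phi s)^-1)%g = f (mk2 1 0 ((mon s a)^-1 * y) 1).
Proof.
move=> hs; case: hf => -[_ _ _ [_ _ h]] _.
by have := h (phi s) y (tor_phi hs); rewrite !lower2 /opp_char chrE.
Qed.

Lemma coroot_ex (b : wt) : exists n : int, forall z, z != 0 -> chr b (f (dg z)) = z ^ n.
Proof.
have [[u hu eu] _ _ hM] := chr_character b.
have [[hreg _ _ _] hT] := hf; have [g hg eg] := hreg _ hu.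
pose h (s : 'I_1 -> k) := g (dg (s ord0)).
have hL : laurent h.
  have [c1 c2 c3] := laurent_subalg k 1.
  apply: (hg [set g | laurent (fun s : 'I_1 -> k => g (dg (s ord0)))]); split.
    by split=> [c|g1 g2|g1 g2]; [apply: c1|apply: c2|apply: c3].
  move=> _ [[i j] _ <-] /=; rewrite /dg /mk2.
  under eq_fun do rewrite mxE; case: eqP => _; case: eqP => _; try exact: c1.
    exact: laurent_coord.
  exact: laurent_coordV.
have hE z : z != 0 -> chr b (f (dg z)) = h (fun=> z).
  by move=> z0; rewrite eu ?eg //; [apply: SL2_dg|apply: hT].
have [||c hc] := char_mon hL.
- rewrite -hE ?oner_neq0 // /dg invr1 f_one -(phi1' F) chrE ?mon1 //; exact: Gm1.
- move=> s s' hs hs'; have e (v : 'I_1 -> k) : v = fun=> v ord0.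
    by apply/funext => i; rewrite (ord1 i).
  rewrite (e s) (e s') -!hE ?mulf_neq0 ?hs ?hs' // -hM; try (apply: hT; by rewrite ?hs ?hs').
  rewrite -fM ?mk2M; try (apply: SL2_dg; by rewrite ?hs ?hs').
  by congr (chr b (f _)); rewrite /dg !(mulr0, mul0r, addr0, add0r) invfM.
exists (c ord0) => z z0; rewrite hE // hc => [|i //].
by rewrite /mon big_ord_recl big_ord0 mulr1.
Qed.

Lemma pow_inj (n n' : int) : (forall z : k, z != 0 -> z ^ n = z ^ n') -> n = n'.
Proof.
move=> h; apply/eqP; apply: contraT => ne.
have [|z z0] := @closed_field_nonroot k (n - n'); first by rewrite subr_eq0.
by rewrite expfzDr // h // -expfzDr // subrr expr0z eqxx.
Qed.

Lemma coroot_refl : exists c : wt -> int, [/\ forall b b', c (b + b') = c b + c b', c a = 2 &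
  exists n : G, forall s, Gm_pow s -> exists2 s', Gm_pow s' &
    (n * phi s * n^-1)%g = phi s' /\ forall b, mon s' b = mon s (b - a *~ c b)].
Proof.
have /choice [c hc] := coroot_ex.
have [_ hT] := hf.
have cD b b' : c (b + b') = c b + c b'.
  apply: pow_inj => z z0; rewrite expfzDr // -!hc // -chrD.
  by [].
have [[_ _ [hemb _ _] _] _] := hf.
have inj y y' : f (mk2 1 y 0 1) = f (mk2 1 y' 0 1) -> y = y'.
  by move=> e; case: hemb => hi _ _; apply: hi; rewrite ?inE // !upper2.
have SU y : SL2 (mk2 (1 : k) y 0 1) by apply: SL2_mk2; rewrite mulr1 mulr0 subr0.
have SV y : SL2 (mk2 (1 : k) 0 y 1) by apply: SL2_mk2; rewrite mulr1 mul0r subr0.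
have fV X Y : SL2 X -> SL2 Y -> X *m Y = mk2 1 0 0 1 -> f Y = (f X)^-1%g.
  by move=> hX hY e; apply: (mulgI (f X)); rewrite -fM // e f_one mulgV.
have simp2 := (mulr0, mul0r, mulr1, mul1r, addr0, add0r).
have ca : c a = 2.
  apply: pow_inj => z z0; rewrite -hc //.
  have [s hs es] := hT z z0; rewrite -es chrE //.
  have z0' : z^-1 != 0 by rewrite invr_eq0.
  have := f_upper 1 hs; rewrite mulr1 es -(fV (dg z) (dg z^-1)); last first.
  - by rewrite /dg mk2M !simp2 invrK mulfV // mulVf.
  - exact: SL2_dg.
  - exact: SL2_dg.
  rewrite -!fM; try by [apply: SL2_dg|apply: SU].
    rewrite /dg !mk2M !simp2 invrK mulfV // mulVf // => /inj <-.
    by rewrite -expr2.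
  rewrite /dg mk2M !simp2; apply: SL2_mk2.
  by rewrite mulfV // mulr0 subr0.
exists c; split=> //.
pose W := mk2 (0 : k) 1 (- 1) 0.
have SW : SL2 W by apply: SL2_mk2; ring.
exists (f W) => s hs; pose sv i := (s i)^-1.
have hsv : Gm_pow sv by apply: GmV.
have m0 : mon sv a != 0 by apply: mon_neq0.
have m0' : mon s a != 0 by apply: mon_neq0.
have WE : W = mk2 1 1 0 1 *m (mk2 1 0 (- 1) 1 *m mk2 1 1 0 1).
  by rewrite !mk2M !simp2 /W subrr addNr ?addr0 // ?subrr; congr mk2; ring.
have wsv b : mon sv b = (mon s b)^-1.
  rewrite -monN // /mon; apply: eq_bigr => i _; rewrite /sv ffunE.
  by rewrite exprz_inv.
(* W is a product of three unitriangular matrices, on each of which conjugation by T is known. So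
   the commutator of T with [f W] is computed inside SL_2 and is diagonal, which gives the
   reflection on characters. *)
have e1 : (phi sv * f W * (phi sv)^-1 = f (dg (mon sv a)) * f W)%g.
  transitivity (phi sv * f (mk2 1 1 0 1) * (phi sv)^-1 *
    ((phi sv * f (mk2 1 0 (- 1) 1) * (phi sv)^-1) * (phi sv * f (mk2 1 1 0 1) * (phi sv)^-1)))%g.
    rewrite WE !fM //; first by rewrite !mulgA !mulgVK.
    by rewrite mk2M !simp2; apply: SL2_mk2; ring.
  rewrite !f_upper // f_lower // mulr1 mulrN1 -!fM //; first last.
  - by rewrite mk2M !simp2; apply: SL2_mk2; ring.
  - exact: SL2_dg.
  congr f; rewrite !mk2M !simp2 mulrN mulNr mulfV // mulVf // mulrN1.
  by congr mk2; ring.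
have [t ht et] := hT _ m0.
exists (fun i => s i * t i); first exact: GmM.
split.
  rewrite fphiM // et; move: e1; rewrite (phiV' hs) invgK => e1.
  apply: (mulgI (phi s)^-1%g); rewrite !mulgA mulVg mul1g e1.
  by rewrite mulgK.
move=> b; rewrite monM -(chrE b ht) et hc // wsv -mulrNz monD // mon_mul_int //.
by rewrite exprz_inv.
Qed.

(** Conjugation by a representative of the reflection permutes the weights of T on the tangent space
    at 1. *)
Lemma refl_root (c : wt -> int) : (forall b b', c (b + b') = c b + c b') -> c a = 2 ->
  (exists n : G, forall s, Gm_pow s -> exists2 s', Gm_pow s' &
    (n * phi s * n^-1)%g = phi s' /\ forall b, mon s' b = mon s (b - a *~ c b)) ->
  forall b, isrt b -> isrt (b - a *~ c b).
Proof.
move=> cD ca [n hn] b [b0 [i wi]].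
have c_lin y m : c (y + a *~ m) = c y + 2 * m.
  have h0 : c 0 = 0 by apply: (addrI (c 0)); rewrite -cD !addr0.
  have hN y' : c (- y') = - c y' by apply: (addrI (c y')); rewrite -cD !subrr.
  have hm y' m' : c (y' *+ m') = c y' *+ m' by elim: m' => [|m' IH] //; rewrite !mulrS cD IH.
  rewrite cD -ca; case: m => m; first by rewrite -pmulrn hm -mulr_natr natz.
  by rewrite NegzE mulrNz hN -pmulrn hm mulrN -mulr_natr natz.
split.
  apply: contra b0 => /eqP e; have : c (b - a *~ c b) = 0.
    by rewrite e; apply: (addrI (c 0)); rewrite -cD !addr0.
  rewrite -mulrNz c_lin => h; have cb : c b = 0 by lia.
  by move: e; rewrite cb mulr0z subr0 => ->.
have [g1 g2 g3 [g g4] g5] := @delta_wder _ _ F i.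
pose D (g : kG) := delta i (cnj n^-1%g g).
have hD : wder setT (b - a *~ c b) D.
  split.
  - by move=> c' u v; rewrite /D cnjD cnjZ g1.
  - by move=> u v; rewrite /D cnjM g2 !cnj1.
  - by move=> u hu; rewrite (_ : u = 0) ?delta0 //; [rewrite /D (_ : cnj _ 0 = 0) ?delta0 //; apply/regfunP|apply/regfunP => y; rewrite hu].
  - exists (cnj n g); rewrite /D (_ : cnj _ _ = g) //.
    by apply/regfunP => y; rewrite !cnjE invgK !mulgA mulgV mul1g mulgK.
  - move=> s u hs; have [s' hs' [e he]] := hn s hs.
    rewrite -he -wi /D -delta_cnj //; congr (delta i).
    apply/regfunP => y; rewrite !cnjE -e !invgM !invgK !mulgA.
    by rewrite !mulgVK mulVg mul1g.
by have [j wj _] := wder_index hD; exists j.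
Qed.

End Coroots.

(** * Positivity, multiplicity one, and root subgroups *)

Section Roots.
Variables (k : closedFieldType) (G : algGroup k) (F : frame G).
Local Notation kG := (regfun G).
Local Notation d := (fdim F).
Local Notation wt := (wt (frk F)).
Local Notation x := (@fx _ _ F).
Local Notation w := (@fw _ _ F).
Local Notation phi := (@fphi _ _ F).
Local Notation tor := (tor F).
Local Notation chr := (@chr _ _ F).
Local Notation isrt := (@isrt _ _ F).

Lemma isrtP Rp a : positive_system tor Rp -> isrt a -> Rp (chr a) \/ Rp (chr (- a)).
Proof.
move=> [_ h _] /is_rootP /h hh; have [|n] := pselect (Rp (chr a)); first by left.
right; rewrite -chrN; apply: contrapT => n'; apply: n; exact/hh.
Qed.

(** The permutation matrix has determinant -1, but conjugation by it preserves SL_2 and exchanges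
    the two unitriangular subgroups. *)
Lemma sl2_rootN a f : sl2_root a f ->
  sl2_root (F := F) (- a) (fun X => f (mk2 0 1 1 0 *m X *m mk2 0 1 1 0)).
Proof.
move=> [[h1 h2 h3 h4] h5]; set S := mk2 0 1 1 0.
have simp2 := (mulr0, mul0r, mulr1, mul1r, addr0, add0r).
have SS : S *m S = 1%:M.
  by rewrite mk2M !simp2 [1%:M]mk2P !mxE.
have SX a' b c e : S *m mk2 a' b c e *m S = mk2 e c b a'.
  by rewrite !mk2M !simp2.
have detS X : SL2 X -> SL2 (S *m X *m S).
  rewrite [X]mk2P SX /SL2 /= !det_mk2 => <-; ring.
split; last first.
  move=> z z0; rewrite /dg SX; have := h5 z^-1; rewrite invr_eq0 => /(_ z0).
  by rewrite /dg invrK.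
split.
- move=> u /h1 [g hg eg]; exists (fun X => g (S *m X *m S)).
    move: hg => /(_ [set g | genalg (@mx_coords k) (fun X => g (S *m X *m S))]); apply; split.
      split=> [c|g1 g2 hg1 hg2|g1 g2 hg1 hg2] A hA; case: (hA) => -[hc hD hM] _; first exact: hc.
        by apply: (hD); [apply: hg1|apply: hg2].
      by apply: (hM); [apply: hg1|apply: hg2].
    move=> _ [[i j] _ <-] A [_ hA]; apply: hA.
    exists ((i == 0)%:R, (j == 0)%:R) => //; apply/funext => X /=.
    rewrite [X in (S *m X *m S)]mk2P SX mxE.
    have e0 : forall i : 'I_2, i == 0 -> (i == 0)%:R = 1 :> 'I_2 by move=> i' ->.
    by case: (i == 0); case: (j == 0).
  by move=> X hX; apply: eg; apply: detS.
- move=> X Y hX hY; rewrite -h2; try exact: detS.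
  by congr f; rewrite !mulmxA; congr (_ *m _ *m _); rewrite -!mulmxA SS mulmx1.
- rewrite -chrN; have e y : S *m (1%:M + y *: delta_mx 0 1) *m S = 1%:M + y *: delta_mx 1 0.
    by rewrite upper2 lower2 SX.
  by rewrite (_ : (fun y => _) = (fun y => f (1%:M + y *: delta_mx 1 0))) //; apply/funext => y; rewrite e.
- rewrite chrN opprK; have e y : S *m (1%:M + y *: delta_mx 1 0) *m S = 1%:M + y *: delta_mx 0 1.
    by rewrite upper2 lower2 SX.
  by rewrite (_ : (fun y => _) = (fun y => f (1%:M + y *: delta_mx 0 1))) //; apply/funext => y; rewrite e.
Qed.

(** A character is extended by 0 outside T, whereas its value on the image of a diagonal matrix is a
    power of z, hence nonzero. So these images lie in T, which [SL2_hom] alone does not say. *)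
Lemma dominant_sl2 Rp lam : positive_system tor Rp -> dominant tor Rp lam ->
  forall a, isrt a -> exists f, sl2_root a f.
Proof.
move=> hRp [[_ h0 _ _] hd].
have H a : Rp (chr a) -> exists f, sl2_root a f.
  move=> /hd [n [f hf hn] _]; exists f; split=> // z z0.
  apply: contrapT => nT; have := hn z z0; rewrite diag2 h0 // => /esym /eqP.
  by rewrite expfz_eq0 (negPf z0) andbF.
move=> a /(isrtP hRp) [/H //|/H [f /sl2_rootN hf]].
by exists (fun X => f (mk2 0 1 1 0 *m X *m mk2 0 1 1 0)); rewrite -[a]opprK.
Qed.

Hypothesis hsl2 : forall a, isrt a -> exists f, sl2_root a f.

Definition rts : seq wt := undup [seq w i | i <- enum 'I_d & w i != 0].

Lemma mem_rts a : a \in rts <-> isrt a.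
Proof.
rewrite mem_undup; split=> [/mapP [i]|[a0 [i wi]]].
  by rewrite mem_filter => /andP [wi _] ->; split=> //; exists i.
by apply/mapP; exists i => //; rewrite mem_filter wi a0 mem_enum.
Qed.

Lemma wt_tf (v : wt) n : v *+ n.+1 = 0 -> v = 0.
Proof.
by move=> e; apply/eqP; apply: contraT => v0; have := wt_mulIn v0 (etrans e (esym (mulr0n v))).
Qed.

Lemma coroots : exists c : wt -> wt -> int,
  [/\ forall a b b', isrt a -> c a (b + b') = c a b + c a b', forall a, isrt a -> c a a = 2 &
   forall a b, isrt a -> isrt b -> c a b < 0 -> a + b = 0 \/ isrt (a + b)].
Proof.
have /choice [c hc] : forall a, exists c : wt -> int, isrt a ->
    [/\ forall b b', c (b + b') = c b + c b', c a = 2 & forall b, isrt b -> isrt (b - a *~ c b)].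
  move=> a; have [ra|] := pselect (isrt a); last by exists (fun=> 0).
  have [f hf] := hsl2 ra; have [c [c1 c2 c3]] := coroot_refl hf.
  by exists c => _; split=> //; apply: (refl_root c1 c2 c3).
exists c; split.
- by move=> a b b' /hc [h _ _]; apply: h.
- by move=> a /hc [].
- move=> a b ra rb ab; have := @root_sum wt rts c wt_tf _ _ _ _ (undup_uniq _) a b.
  rewrite !mem_rts; apply=> //.
  + by move=> a' y z /mem_rts /hc [h _ _]; apply: h.
  + by move=> a' /mem_rts /hc [].
  + by move=> a' b' /mem_rts /hc [_ _ h] /mem_rts hb; apply/mem_rts; apply: h.
  + by apply/negP => /mem_rts [/eqP].
Qed.

(** Pairing with the coroot of the first term [a] forces another term [b] with negative pairing. By
    [root_sum] the two can be replaced by the positive root a + b, which shortens the list; a + b =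
    0 would contradict positivity. *)
Lemma positive_pointed Rp l : positive_system tor Rp -> (forall a, a \in l -> Rp (chr a)) ->
  \sum_(a <- l) a = 0 -> l = [::].
Proof.
move=> [h1 h2 h3]; have [c [cD caa hc]] := coroots.
have rt a : Rp (chr a) -> isrt a by move=> /h1 /is_rootP.
have [n] := ubnP (size l); elim: n l => // n IH [//|a l] sl hl.
rewrite big_cons => e.
have ra : isrt a by apply/rt/hl/mem_head.
have h0 : c a 0 = 0 by apply: (addrI (c a 0)); rewrite -cD // !addr0.
have csum (r : seq wt) : c a (\sum_(b <- r) b) = \sum_(b <- r) c a b.
  by elim: r => [|b r IHr]; rewrite ?big_nil // !big_cons cD // IHr.
have [b bl ab] : exists2 b, b \in l & c a b < 0.
  apply: contrapT => no; have := congr1 (c a) e; rewrite cD // h0 caa // csum.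
  have : 0 <= \sum_(b <- l) c a b.
    rewrite big_seq; apply: sumr_ge0 => b bl; rewrite leNgt; apply/negP => ab.
    by apply: no; exists b.
  move=> g1 g2; have : 0 < 2 + \sum_(b <- l) c a b by rewrite ltr_pwDl.
  by rewrite g2 ltxx.
have rb : isrt b by apply/rt/hl; rewrite inE bl orbT.
have Ra : Rp (chr a) by apply/hl/mem_head.
have Rb : Rp (chr b) by apply: hl; rewrite inE bl orbT.
have [/eqP|rab] := hc _ _ ra rb ab.
  rewrite addrC addr_eq0 => /eqP eb; exfalso.
  by have := (h2 _ (h1 _ Ra)).1 Ra; apply; rewrite chrN -eb.
have Rab : Rp (chr (a + b)) by rewrite -chrD; apply: h3 => //; rewrite chrD; apply/is_rootP.
suff : (a + b) :: rem b l = [::] by [].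
apply: IH.
- move: sl; rewrite /= size_rem // ltnS prednK // lt0n size_eq0.
  by apply: contraL bl => /eqP ->.
- move=> z; rewrite inE => /orP [/eqP -> //|/mem_rem zl]; apply: hl.
  by rewrite inE zl orbT.
- rewrite big_cons; apply: etrans e; rewrite -addrA; congr (_ + _).
  by rewrite [RHS](perm_big _ (perm_to_rem bl)) big_cons.
Qed.

Variable tau : anti_involution G.
Hypothesis hchev : chevalley tor tau.

(** [chevalley] quantifies over all parametrizations: the images under [tau] of both ranges equal
    the range of one and the same parametrization for the opposite root, which SL_2 provides. *)
Lemma root_hom_range a y y' : isrt a -> root_hom tor (chr a) y -> root_hom tor (chr a) y' ->
  range y = range y'.
Proof.
move=> ra hy hy'; have [f [[_ _ _ hz] _]] := hsl2 ra.
have [_ h] := hchev; move/is_rootP: ra => ra.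
have e1 := h _ ra _ _ hy hz; have e2 := h _ ra _ _ hy' hz.
have inv A B : tau @` A = B -> A = tau @` B.
  move=> <-; apply/seteqP; split=> t.
    by move=> At; exists (tau t); [exists t|rewrite antiK].
  by move=> [_ [s As <-] <-]; rewrite antiK.
by rewrite (inv _ _ e1) (inv _ _ e2).
Qed.

Variable p : nat.
Hypothesis char_k : p \in [pchar k].
Hypothesis p2 : (2 < p)%N.

Lemma two_neq0 : (2 : k) != 0.
Proof.
rewrite -(dvdn_pcharf char_k); apply/negP => /(dvdn_leq (isT : 0 < 2)%N).
by rewrite leqNgt p2.
Qed.

(** The coroot of the multiple takes the value 2 on it, so n + 1 divides 2. *)
Lemma root_multiple a n : isrt a -> isrt (a *+ n.+1) -> (n <= 1)%N.
Proof.
move=> ra rna; have [c [cD caa _]] := coroots.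
set b := a *+ n.+1 in rna *.
have h0 : c b 0 = 0 by apply: (addrI (c b 0)); rewrite -cD // !addr0.
have hm m : c b (a *+ m) = c b a *+ m.
  by elim: m => [|m IH] //; rewrite mulrS cD // IH mulrS.
have e : c b a * n.+1%:Z = 2 by rewrite -(caa _ rna) {3}/b hm -[RHS]mulr_natr natz.
have := congr1 absz e; rewrite abszM absz_nat => {}e.
have : (n.+1 %| 2)%N by apply/dvdnP; exists `|c b a|%N; rewrite e.
by move=> /dvdn_leq; apply.
Qed.

(** Two coordinates of the same weight would give, by [root_curve], two parametrizations with
    different directions at 1, contrary to [root_hom_range]. *)
Theorem root_mult_one a i j : isrt a -> w i = a -> w j = a -> i = j.
Proof.
move=> ra wi wj; have a0 := ra.1.
have ray1 l : w l = a -> ray a (w l) by move=> ->; exists 0%N.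
have [li ei] := em_cover (ray1 i wi); have [lj ej] := em_cover (ray1 j wj).
have ee1 l : (ee (al := a) l <= 1)%N.
  by apply: (root_multiple ra); rewrite -eeP; split; [rewrite eeP; apply/negP => /eqP /wt_tf /eqP; apply/negP|exists (em l)].
have ee0 l : w (em (al := a) l) = a -> ee l = 0%N.
  by move=> e; have := eeP l; rewrite e -{1}[a]mulr1n => /(wt_mulIn a0) [].
have ei0 : ee li = 0%N by apply: ee0; rewrite ei.
have ej0 : ee lj = 0%N by apply: ee0; rewrite ej.
have [y hy yE] := root_curve a0 char_k two_neq0 ee1 (T := tor) (alpha := chr a) erefl (fun s => @chrE _ _ F a s) ei0.
have [z hz zE] := root_curve a0 char_k two_neq0 ee1 (T := tor) (alpha := chr a) erefl (fun s => @chrE _ _ F a s) ej0.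
have e := root_hom_range ra hy hz.
have [b _ eb] : range z (y 1) by rewrite -e; exists 1.
have := yE 1 li ei0; rewrite -eb zE // eqxx mulr1; case: eqP => [eij _|_].
  by rewrite -ei -ej eij.
by rewrite mul0r => /esym /eqP; rewrite oner_eq0.
Qed.

Theorem root_hom_lie a y (f : kG) i : isrt a -> root_hom tor (chr a) y -> (forall b, f (y b) = 0) ->
  w i = a -> delta (F := F) i f = 0.
Proof.
move=> ra [[_ hreg hinv] yD yT] hfy wi.
have polP (g : kG) : exists P : {poly k}, forall b, g (y b) = P.[b].
  have [u hu eu] := hreg _ (rf_reg g).
  have [P hP] : exists P : {poly k}, forall b, u b = P.[b].
    apply: (hu [set u | exists P : {poly k}, forall b, u b = P.[b]]); split.
      split=> [c|u1 u2 [P hP] [Q hQ]|u1 u2 [P hP] [Q hQ]].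
      - by exists c%:P => b; rewrite hornerC.
      - by exists (P + Q) => b; rewrite hornerD hP hQ.
      - by exists (P * Q) => b; rewrite hornerM hP hQ.
    by move=> _ ->; exists 'X => b; rewrite hornerX.
  by exists P => b; rewrite eu // hP.
have /choice [P hP] := polP.
have Puniq (g : kG) Q : (forall b, g (y b) = Q.[b]) -> P g = Q.
  move=> h; apply/eqP; rewrite -subr_eq0; apply: contraT => n0.
  have /closed_nonrootP [z] := n0.
  by rewrite rootE !hornerE -hP h subrr eqxx.
pose D (g : kG) := (P g)^`().[0].
have y0 : y 0 = 1%g by apply: (mulgI (y 0)); rewrite -yD addr0 mulg1.
have hD : wder setT a D.
  split.
  - move=> c g h; rewrite /D (Puniq (c *: g + h) (c *: P g + P h)).
      by rewrite derivD derivZ !hornerE.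
    by move=> b; rewrite !rfE !hornerE !hP.
  - move=> g h; rewrite /D (Puniq (g * h) (P g * P h)).
      by rewrite derivM hornerD !hornerM -!hP y0.
    by move=> b; rewrite rfM hornerM !hP.
  - by move=> g hg; rewrite /D (Puniq g 0) ?deriv0 ?horner0 // => b; rewrite hg // horner0.
  - have [g hg eg] := hinv id (fun A hA => hA.2 _ erefl).
    exists (RegFun hg); rewrite /D (Puniq _ 'X) ?derivX ?hornerE ?oner_neq0 // => b.
    by rewrite hornerX /= eg.
  - move=> s g hs; rewrite /D (Puniq (cnj (phi s) g) (P g \Po (mon s a *: 'X))).
      rewrite deriv_comp hornerM horner_comp !hornerE derivZ derivX.
      by rewrite hornerZ hornerC mulr1 mulrC.
    by move=> b; rewrite cnjE yT ?chrE ?hP ?horner_comp ?hornerE //; apply: tor_phi.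
have [j wj Dxj] := wder_index hD.
have ij := root_mult_one ra wi wj.
have : D f = 0 by rewrite /D (Puniq f 0) ?deriv0 ?horner0 // => b; rewrite hfy horner0.
rewrite (wder_delta hD) (bigD1 j) ?wj //= big1 ?addr0; last first.
  by move=> l /andP [/eqP wl /negP]; case; apply/eqP; apply: root_mult_one wl wj.
by move/eqP; rewrite mulf_eq0 (negPf Dxj) ij => /eqP.
Qed.

End Roots.

(** * The centralizer of a maximal torus *)

Section MatrixRep.
Variables (k : closedFieldType) (G : algGroup k).
Local Notation kG := (regfun G).

Definition mxev n (R : 'M[kG]_n) (x : G) : 'M[k]_n := map_mx (rf_ev x) R.

Lemma mxevE n (R : 'M[kG]_n) x i j : mxev R x i j = R i j x.
Proof. by rewrite mxE. Qed.

Let subsp (W : set kG) := [/\ W 0, forall u v, W u -> W v -> W (u + v) & forall c u, W u -> W (c *: u)].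

Let subsp_sum (W : set kG) (I : Type) (l : seq I) (P : pred I) (f : I -> kG) : subsp W ->
  (forall i, P i -> W (f i)) -> W (\sum_(i <- l | P i) f i).
Proof. by move=> [h0 hD _] hf; apply: (big_ind W). Qed.

(** A faithful representation on a finite dimensional space of functions stable under right
    translation, with the entries generating the coordinate ring. The constant 1 is put into [V] to
    make the dimension positive. *)
Lemma matrix_rep : exists (n : nat) (R : 'M[kG]_n.+1),
  [/\ forall x y, mxev R (x * y)%g = mxev R x *m mxev R y, mxev R 1%g = 1%:M &
   forall S : set kG, (forall a, S (rf_const G a)) -> (forall i j, S (R i j)) ->
    (forall u v, S u -> S v -> S (u + v)) -> (forall u v, S u -> S v -> S (u * v)) ->
    forall f, S f].
Proof.
have [r [g hg]] := regfun_gen G.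
pose V : set kG := [set f | forall W, subsp W -> (forall y i, W (rtr y (g i))) -> W 1 -> W f].
have hV : subsp V.
  split=> [W [] //|u v hu hv W hW h1 h2|c u hu W hW h1 h2].
    by case: (hW) => _ hD _; apply: hD; [apply: hu|apply: hv].
  by case: (hW) => _ _ hZ; apply: hZ; apply: hu.
have Vg i : V (g i).
  by move=> W _ h _; rewrite (_ : g i = rtr 1%g (g i)) //; apply/regfunP => x /=; rewrite mulg1.
have Vtr y f : V f -> V (rtr y f).
  move=> hf; apply: (hf [set f | V (rtr y f)]).
  - split=> [|u v hu hv|c u hu] /=.
    + by rewrite (_ : rtr y 0 = 0); [case: hV|apply/regfunP].
    + by rewrite (_ : rtr y (u + v) = rtr y u + rtr y v); [case: hV => _ h _; apply: h|apply/regfunP].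
    + by rewrite (_ : rtr y (c *: u) = c *: rtr y u); [case: hV => _ _ h; apply: h|apply/regfunP].
  - move=> z i /= W _ h _; rewrite (_ : rtr y _ = rtr (y * z)%g (g i)) //.
    by apply/regfunP => x /=; rewrite mulgA.
  - by move=> /= W _ _ h; rewrite (_ : rtr y 1 = 1) //; apply/regfunP.
have [A hA] : exists A : seq kG, forall f, V f -> exists c : nat -> k, f = \sum_(l < size A) c l *: A`_l.
  have /choice [L hL] : forall i, exists L : seq (kG * kG), forall x y,
      g i (x * y)%g = \sum_(p <- L) p.1 x * p.2 y.
    move=> i; have [n [a [b hab]]] := reg_comulE (g i).
    exists [seq (a j, b j) | j <- enum 'I_n] => x y.
    by rewrite hab big_map big_enum.
  pose A := 1 :: flatten [seq [seq p.1 | p <- L i] | i <- enum 'I_r].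
  exists A => f; pose W : set kG := [set f | exists c : nat -> k, f = \sum_(l < size A) c l *: A`_l].
  have hW : subsp W.
    split=> [|u v [c ->] [c' ->]|b u [c ->]].
    - by exists (fun=> 0); rewrite big1 // => l _; rewrite scale0r.
    - exists (fun l => c l + c' l); rewrite -big_split; apply: eq_bigr => l _.
      by rewrite scalerDl.
    - by exists (fun l => b * c l); rewrite scaler_sumr; apply: eq_bigr => l _; rewrite scalerA.
  have WA u : u \in A -> W u.
    move=> /(nthP 0) [l hl <-]; exists (fun j => (j == l)%:R).
    rewrite (bigD1 (Ordinal hl)) //= eqxx scale1r big1 ?addr0 // => j.
    by rewrite -val_eqE /= => /negPf ->; rewrite scale0r.
  move=> hf; apply: (hf W hW) => [y i|]; last by apply: WA; rewrite mem_head.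
  have -> : rtr y (g i) = \sum_(p <- L i) p.2 y *: p.1.
    by apply/regfunP => x /=; rewrite hL rf_sum; apply: eq_bigr => q _; rewrite rfZ mulrC.
  rewrite big_seq; apply: subsp_sum => // q hq; case: hW => _ _; apply; apply: WA.
  rewrite inE; apply/orP; right; apply/flattenP; exists [seq q.1 | q <- L i]; last exact: map_f.
  by apply: map_f; rewrite mem_enum.
(* A basis is obtained as a family of functions dual to a family of points, of maximal length; its
   coordinates are then values at these points. *)
pose P n := `[< exists (v : 'I_n.+1 -> kG) (y : 'I_n.+1 -> G),
  (forall i, V (v i)) /\ forall i j, v i (y j) = (i == j)%:R >].
have P0 : exists n, P n.
  exists 0%N; apply/asboolP; exists (fun=> 1), (fun=> 1%g); split=> [i W //|i j].
  by rewrite !ord1 eqxx rfE.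
have Pb n : P n -> (n <= size A)%N.
  move=> /asboolP [v [y [hv hvy]]].
  have /choice [C hC] := fun i => hA _ (hv i).
  pose M1 := \matrix_(i < n.+1, l < size A) C i l; pose M2 := \matrix_(l < size A, j < n.+1) A`_l (y j).
  have e : M1 *m M2 = 1%:M.
    apply/matrixP => i j; rewrite !mxE -hvy hC rf_sum; apply: eq_bigr => l _.
    by rewrite !mxE rfZ.
  have := mxrankM_maxr M1 M2; rewrite e mxrank1 => /leq_trans h.
  by apply: ltnW; apply: h; apply: rank_leq_row.
have [n /asboolP [v [y [hv hvy]]] hmax] := ex_maxnP P0 Pb.
have expand f : V f -> f = \sum_j f (y j) *: v j.
  move=> hf; apply/eqP; rewrite -subr_eq0; apply: contraT => f0.
  set f' := f - _ in f0; have Vf' : V f'.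
    case: (hV) => _ hD hZ; rewrite /f' -scaleN1r; apply: (hD) => //; apply: (hZ).
    by apply: subsp_sum => // j _; apply: (hZ).
  have f'y j : f' (y j) = 0.
    rewrite /f' !rfE (bigD1 j) //= hvy eqxx mulr1 big1 ?addr0 ?subrr // => i ij.
    by rewrite hvy (negPf ij) mulr0.
  have [z fz] : exists z, f' z != 0.
    apply: contrapT => no; case/eqP: f0; apply/regfunP => z; apply/eqP; rewrite rf0.
    by apply: contraT => h; case: no; exists z.
  suff /hmax : P n.+1 by rewrite ltnn.
  apply/asboolP; exists (fun i => if unlift ord_max i is Some j then v j - (v j z / f' z) *: f'
    else (f' z)^-1 *: f'), (fun i => if unlift ord_max i is Some j then y j else z); split.
    move=> i; case: (unlift _ i) => [j|]; case: (hV) => _ hD hZ; last by apply: (hZ).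
    by rewrite -scaleN1r; apply: (hD) => //; do 2 apply: (hZ).
  move=> i j; case: unliftP => [i'|] ->; case: unliftP => [j'|] ->.
  - by rewrite rfB rfZ f'y mulr0 subr0 hvy (inj_eq lift_inj).
  - by rewrite rfB rfZ divfK // subrr eq_sym (negPf (neq_lift _ _)).
  - by rewrite rfZ f'y mulr0 (negPf (neq_lift _ _)).
  - by rewrite rfZ mulVf // eqxx.
have trE x j : rtr x (v j) = \sum_l v j (y l * x)%g *: v l by apply: expand; apply: Vtr.
exists n, (\matrix_(i, j) ltr (y i) (v j)); split.
- move=> x x'; apply/matrixP => i j; rewrite !mxE /rf_ev /=.
  have := congr1 (fun f : kG => f (y i * x)%g) (trE x' j); rewrite /= mulgA => ->.
  by rewrite rf_sum; apply: eq_bigr => l _; rewrite !mxE rfZ mulrC.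
- by apply/matrixP => i j; rewrite !mxE /rf_ev /= mulg1 hvy eq_sym.
- move=> S Sc Se SD SM f.
  have SZ c u : S u -> S (c *: u) by move=> hu; rewrite rf_scaleE; apply: SM.
  have Ssum (I : Type) (l : seq I) (h : I -> kG) : (forall i, S (h i)) -> S (\sum_(i <- l) h i).
    move=> hh; elim: l => [|i l IH]; last by rewrite big_cons; apply: SD.
    by rewrite big_nil -(rmorph0 (rf_const G)); apply: Sc.
  have Sv j : S (v j).
    rewrite (_ : v j = \sum_l v l 1%g *: ltr (y l) (v j)).
      by apply: Ssum => l; apply: SZ; have := Se l j; rewrite mxE.
    apply/regfunP => x; have := congr1 (fun f : kG => f 1%g) (trE x j); rewrite /= mul1g => ->.
    by rewrite !rf_sum; apply: eq_bigr => l _; rewrite !rfZ mulrC.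
  apply: hg => // i; rewrite (expand _ (Vg i)); apply: Ssum => j; exact: SZ.
Qed.

End MatrixRep.

Section DiagTorus.
Variables (k : closedFieldType) (n : nat).

Lemma mon_comb m (y : 'I_m -> k) (I : finType) (c : I -> int) (v : I -> wt m) : Gm_pow y ->
  mon y (\sum_i v i *~ c i) = \prod_i mon y (v i) ^ c i.
Proof.
move=> hy; rewrite (big_morph (mon y) (fun a b => monD a b hy) (mon0 y)).
by apply: eq_bigr => i _; apply: mon_mul_int.
Qed.

Lemma Gm_mon m m' (y : 'I_m -> k) (b : 'I_m' -> wt m) : Gm_pow y -> Gm_pow (fun i => mon y (b i)).
Proof. by move=> hy i; apply: mon_neq0. Qed.

Definition ee_ m (i : 'I_m) : wt m := [ffun j => (j == i)%:Z].

Lemma mon_ee m (y : 'I_m -> k) i : mon y (ee_ i) = y i.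
Proof.
rewrite /mon (bigD1 i) //= big1 ?mulr1 => [|j /negPf ji]; first by rewrite ffunE eqxx expr1z.
by rewrite ffunE ji expr0z.
Qed.

(** [Lam] defines a subgroup of the diagonal torus. The map pi parametrizes its identity component,
    the characters in [z] cut that component out, and [N] annihilates the component group. *)
Lemma diag_torus (Lam : seq (wt n)) : exists N r (b : 'I_n -> wt r) (a : 'I_r -> wt n) (z : seq (wt n)),
  let pi (s : 'I_r -> k) i := mon s (b i) in
  [/\ (0 < N)%N,
   forall s : 'I_r -> k, Gm_pow s -> forall c, c \in Lam \/ c \in z -> mon (pi s) c = 1,
   forall s : 'I_r -> k, Gm_pow s -> forall j, mon (pi s) (a j) = s j,
   forall y : 'I_n -> k, Gm_pow y -> (forall c, c \in z -> mon y c = 1) -> y = pi (fun j => mon y (a j)) &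
   forall y : 'I_n -> k, Gm_pow y -> (forall c, c \in Lam -> mon y c = 1) -> forall c, c \in z -> mon y c ^+ N = 1].
Proof.
pose M := \matrix_(q < size Lam, l < n) (Lam`_q : wt n) l.
have [L uL [R uR [d _ eM]]] := int_Smith_normal_form M.
set D := (\matrix_(i, j) _) in eM.
(* The rows of [R] form a basis of the character lattice. Those with a nonzero elementary divisor
   span the saturation of [Lam]; the others are coordinates on the torus. [N] is the product of the
   elementary divisors. *)
pose I1 := [set i : 'I_n | (i < size Lam)%N && (d`_i != 0)]%SET.
pose I2 := (~: I1)%SET.
pose em (j : 'I_#|I2|) : 'I_n := enum_val j.
pose rowR i : wt n := [ffun l => R i l].
pose b (l : 'I_n) : wt #|I2| := [ffun j => invmx R l (em j)].
pose N := (\prod_(i in I1) absz (d`_i)%R)%N.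
have DE q i : (L *m D) q i = \sum_(j < size Lam) L q j * (d`_j *+ (j == i :> nat)).
  by rewrite mxE; apply: eq_bigr => j _; rewrite mxE.
have LD0 q i : i \in I2 -> (L *m D) q i = 0.
  rewrite finset.in_setC finset.inE => hi; rewrite DE big1 // => j _.
  case: eqP => [e|_]; last by rewrite mulr0n mulr0.
  move: hi; rewrite -e ltn_ord /= negbK => /eqP ->.
  by rewrite mul0rn mulr0.
have LamE q : Lam`_(nat_of_ord q) = \sum_i rowR i *~ (L *m D) q i.
  apply/ffunP => l; have := congr1 (fun A : 'M_(_, _) => A q l) eM; rewrite !mxE => ->.
  rewrite sum_ffunE; apply: eq_bigr => i _.
  by rewrite ffunMzE ffunE -mulrzl mulrC intz mulrC.
have piR (s : 'I_#|I2| -> k) i : Gm_pow s -> mon (fun l => mon s (b l)) (rowR i) = \prod_j (s j) ^ (i == em j)%:Z.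
  move=> hs; rewrite {1}/mon.
  under eq_bigr do rewrite -mon_mul_int //.
  rewrite -(big_morph (mon s) (fun a b => monD a b hs) (mon0 s)) /mon; apply: eq_bigr => j _.
  congr (_ ^ _); rewrite sum_ffunE; have := congr1 (fun A : 'M_n => A i (em j)) (mulmxV uR).
  rewrite !mxE => e; rewrite -[RHS]natz -e; apply: eq_bigr => l _.
  by rewrite ffunMzE !ffunE -mulrzl intz mulrC.
exists N, #|I2|, b, (fun j => rowR (em j)), [seq rowR i | i <- enum I1] => pi; split.
- rewrite /N; apply: (big_ind (fun m => (0 < m)%N)) => [//|m m' h h'|i].
    by rewrite muln_gt0 h h'.
  by rewrite finset.inE => /andP [_]; rewrite absz_gt0.
- have I1z s i : Gm_pow s -> i \in I1 -> mon (pi s) (rowR i) = 1.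
    move=> hs hi; rewrite piR // big1 // => j _.
    case: eqP => [e|_]; last by rewrite expr0z.
    by have := enum_valP j; rewrite -/(em j) -e finset.in_setC hi.
  move=> s hs c [cL|/mapP [i]]; last by rewrite mem_enum => hi ->; apply: I1z.
  have hq : (index c Lam < size Lam)%N by rewrite index_mem.
  have -> : c = Lam`_(Ordinal hq) by rewrite nth_index.
  rewrite LamE mon_comb; last exact: Gm_mon.
  rewrite big1 // => i _; have [hi|hi] := boolP (i \in I1); first by rewrite I1z // exp1rz.
  by rewrite LD0 ?expr0z // finset.in_setC.
- move=> s hs j; rewrite piR // (bigD1 j) //= eqxx expr1z big1 ?mulr1 // => j' jj'.
  by rewrite (inj_eq enum_val_inj) eq_sym (negPf jj') expr0z.
- move=> y hy hz; apply/funext => l; rewrite /pi -{1}(mon_ee y l).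
  have -> : ee_ l = \sum_i rowR i *~ invmx R l i.
    apply/ffunP => l'; have := congr1 (fun A : 'M_n => A l l') (mulVmx uR); rewrite !mxE => e.
    rewrite ffunE sum_ffunE eq_sym -[LHS]natz -e; apply: eq_bigr => i _.
    by rewrite ffunMzE ffunE -mulrzl intz.
  rewrite mon_comb // (bigID (mem I1)) /= big1 ?mul1r => [|i hi]; last first.
    by rewrite hz ?exp1rz //; apply: map_f; rewrite mem_enum.
  rewrite (eq_bigl (fun i => i \in I2)) => [|i]; last by rewrite finset.in_setC.
  rewrite (big_enum_val (fun i => mon y (rowR i) ^ invmx R l i)) /= [RHS]/mon.
  by apply: eq_bigr => j _; rewrite ffunE.
- move=> y hy hL c /mapP [i]; rewrite mem_enum => hi ->.
  have hd : mon y (rowR i) ^ d`_i = 1.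
    rewrite -mon_mul_int //.
    move: (hi); rewrite finset.inE => /andP [im di].
    have -> : rowR i *~ d`_i = \sum_(q < size Lam) Lam`_q *~ invmx L (Ordinal im) q.
      apply/ffunP => l; have := congr1 (fun A : 'M_(_, _) => (invmx L *m A) (Ordinal im) l) eM.
      rewrite -mulmxA mulKmx // !mxE => e.
      transitivity (\sum_j D (Ordinal im) j * R j l).
        rewrite (bigD1 i) //= mxE eqxx mulr1n big1 ?addr0 => [|j ji].
          by rewrite ffunMzE ffunE -mulrzl intz.
        by rewrite mxE eq_sym (negPf (ji : j != i :> nat)) mulr0n mul0r.
      rewrite -e sum_ffunE; apply: eq_bigr => q _.
      by rewrite ffunMzE mxE -mulrzl intz.
    rewrite mon_comb // big1 // => q _; rewrite hL ?exp1rz //; exact: mem_nth.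
  have : mon y (rowR i) ^+ absz d`_i = 1.
    move: hd; case: (d`_i) => m //=; rewrite NegzE -exprz_inv /= => h.
    by have := congr1 GRing.inv h; rewrite -exprVn invrK invr1.
  by rewrite /N (bigD1 i) //= => h; rewrite exprM h expr1n.
Qed.

End DiagTorus.

Local Notation zwt := wt.

Lemma powp_sub (A : comNzRingType) (p j : nat) (x y : A) : p \in [pchar A] ->
  (x - y) ^+ (p ^ j)%N = x ^+ (p ^ j)%N - y ^+ (p ^ j)%N.
Proof.
move=> hp; elim: j => [|j IH]; first by rewrite !expr1.
by rewrite expnSr !exprM IH -!(pFrobenius_autE hp) rmorphB.
Qed.

Lemma dvdp_prod_pow (k : fieldType) (r : seq k) (g : {poly k}) :
  (forall z, z \in r -> ('X - z%:P) %| g) -> \prod_(z <- r) ('X - z%:P) %| g ^+ size r.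
Proof.
elim: r => [|z r IH] h; first by rewrite big_nil dvd1p.
rewrite big_cons exprS dvdp_mul ?h ?mem_head // IH // => z' hz.
by rewrite h // inE hz orbT.
Qed.

(** The product g of X - z over the distinct eigenvalues satisfies g(B)^q = 0, as q exceeds all
    multiplicities. By Frobenius g(B)^q is the product of the B^q - z^q, whose roots remain
    distinct. *)
Lemma diag_pow (k : closedFieldType) (p j n : nat) (B : 'M[k]_n.+1) : p \in [pchar k] ->
  (n < p ^ j)%N -> diagonalizable (B ^+ (p ^ j)%N).
Proof.
move=> hp hq; set q := (p ^ j)%N in hq *.
have [r er] := closed_field_poly_normal (char_poly B).
rewrite (monicP (char_poly_monic B)) scale1r in er.
have sr : size r = n.+1.
  by have := size_prod_XsubC r id; rewrite -er size_char_poly => -[].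
pose g := \prod_(z <- undup r) ('X - z%:P).
have gq : horner_mx B (g ^+ q) = 0.
  have : char_poly B %| g ^+ q.
    apply: (@dvdp_trans _ (g ^+ size r)); last by rewrite sr dvdp_exp2l.
    rewrite er; apply: dvdp_prod_pow => z zr.
    by rewrite /g dvdp_XsubCl root_prod_XsubC mem_undup.
  by move=> /dvdpP [h ->]; rewrite rmorphM /= Cayley_Hamilton mulr0.
have hpP : p \in [pchar {poly k}] by rewrite (rmorph_pchar (@polyC k)).
have frob (x y : k) : (x ^+ q = y ^+ q) -> x = y.
  move=> e; have := powp_sub j x y hp; rewrite -/q e subrr => /eqP.
  by rewrite expf_eq0 => /andP [_]; rewrite subr_eq0 => /eqP.
apply/diagonalizableP; exists [seq z ^+ q | z <- undup r].
  by rewrite map_inj_uniq ?undup_uniq // => x y; apply: frob.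
apply: mxminpoly_min; rewrite big_map.
rewrite -[RHS]gq /g -prodrXl !rmorph_prod; apply: eq_bigr => z _ /=.
rewrite powp_sub // -/q rmorphB /= horner_mx_X horner_mx_C.
rewrite -polyC_exp [RHS]rmorphB /= horner_mx_C; congr (_ - _).
by rewrite [RHS]rmorphXn /= horner_mx_X.
Qed.

Lemma diag_idem (k : closedFieldType) n (P : 'M[k]_n.+1) : P *m P = P -> diagonalizable P.
Proof.
move=> hP; apply/diagonalizableP; exists [:: 0; 1]; first by rewrite /= inE eq_sym oner_eq0.
apply: mxminpoly_min; rewrite !big_cons big_nil mulr1 rmorphM !rmorphB /= horner_mx_X !horner_mx_C.
by rewrite raddf0 subr0 mulrBr mulr1 -[P * P]/(P *m P) hP subrr.
Qed.

Lemma laurent_family (k : closedFieldType) r (I : finType) (f : I -> ('I_r -> k) -> k) :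
  (forall i, exists2 g, laurent g & forall s, Gm_pow s -> f i s = g s) -> exists (l : seq (wt r)) (C : I -> wt r -> k),
  uniq l /\ forall i s, Gm_pow s -> f i s = \sum_(a <- l) C i a * mon s a.
Proof.
move=> hf; have /choice [L hL] : forall i, exists l : seq (k * wt r), forall s, Gm_pow s ->
    f i s = \sum_(x <- l) x.1 * mon s x.2.
  move=> i; have [g /laurentP [l hl] eg] := hf i; exists l => s hs.
  by rewrite eg ?hl.
exists (undup (flatten [seq [seq x.2 | x <- L i] | i <- enum I])).
exists (fun i a => \sum_(x <- L i | x.2 == a) x.1); split; first exact: undup_uniq.
move=> i s hs; rewrite hL //.
under [RHS]eq_bigr do rewrite mulr_suml; rewrite (exchange_big_dep predT) //=.
rewrite big_seq [RHS]big_seq; apply: eq_bigr => x xL.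
have hx : x.2 \in undup (flatten [seq [seq x.2 | x <- L i] | i <- enum I]).
  rewrite mem_undup; apply/flattenP; exists [seq x.2 | x <- L i]; last exact: map_f.
  by apply: map_f; rewrite mem_enum.
rewrite big_mkcond (bigD1_seq x.2) ?undup_uniq //= eqxx big1 ?addr0 // => a.
by rewrite eq_sym => /negPf ->.
Qed.

Lemma mon_indep_mx (k : closedFieldType) r m n (l : seq (wt r)) (M : wt r -> 'M[k]_(m, n)) : uniq l ->
  (forall s, Gm_pow s -> \sum_(a <- l) mon s a *: M a = 0) -> forall a, a \in l -> M a = 0.
Proof.
move=> ul h a al; apply/matrixP => i j; rewrite mxE.
apply: (@mon_indep k r l (fun a => M a i j) ul) => // s hs.
have := congr1 (fun A : 'M_(m, n) => A i j) (h s hs); rewrite summxE mxE => e.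
by apply: etrans e; apply: eq_bigr => b _; rewrite mxE mulrC.
Qed.

Section Projectors.
Variables (k : closedFieldType) (G : algGroup k) (F : frame G).
Local Notation kG := (regfun G).
Local Notation wt := (wt (frk F)).
Local Notation phi := (@fphi _ _ F).
Variables (n : nat) (R : 'M[kG]_n).
Hypothesis RM : forall x y, mxev R (x * y)%g = mxev R x *m mxev R y.
Hypothesis R1 : mxev R 1%g = 1%:M.

(** [P a] is the matrix coefficient of the monomial [a] in the representation of T; independence of
    monomials turns multiplicativity into orthogonality, and commutation with T into commutation
    with each [P a]. *)
Lemma projectors : exists (l : seq wt) (P : wt -> 'M[k]_n), [/\ uniq l,
  forall s, Gm_pow s -> mxev R (phi s) = \sum_(a <- l) mon s a *: P a,
  \sum_(a <- l) P a = 1%:M,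
  forall a b, a \in l -> b \in l -> P a *m P b = if a == b then P a else 0 &
  forall c, (forall s, Gm_pow s -> (c * phi s = phi s * c)%g) ->
    forall a, a \in l -> comm_mx (mxev R c) (P a)].
Proof.
have [_ hreg _] := @fphi_emb _ _ F.
have [|l [C [ul hC]]] := @laurent_family k (frk F) ('I_n * 'I_n)%type (fun ij s => R ij.1 ij.2 (phi s)).
  by move=> [i j] /=; apply: hreg; apply: rf_reg.
pose P a := \matrix_(i, j) C (i, j) a.
have hP s : Gm_pow s -> mxev R (phi s) = \sum_(a <- l) mon s a *: P a.
  move=> hs; apply/matrixP => i j; rewrite mxevE (hC (i, j)) // summxE.
  by apply: eq_bigr => a _; rewrite !mxE mulrC.
have comm c : (forall s, Gm_pow s -> (c * phi s = phi s * c)%g) ->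
    forall a, a \in l -> comm_mx (mxev R c) (P a).
  move=> hc a al; apply/eqP; rewrite -subr_eq0; apply/eqP.
  apply: (mon_indep_mx (M := fun a => mxev R c *m P a - P a *m mxev R c) ul _ al) => s hs.
  have := congr1 (mxev R) (hc s hs); rewrite !RM hP // mulmx_sumr mulmx_suml => /eqP.
  rewrite -subr_eq0 -sumrB => /eqP e; apply: etrans e; apply: eq_bigr => b _.
  by rewrite scalerBr scalemxAr scalemxAl.
exists l, P; split=> //.
  have := hP _ (@Gm1 k _); rewrite phi1' R1 => ->.
  by apply: eq_bigr => a _; rewrite mon1 scale1r.
have PP s' a : Gm_pow s' -> a \in l -> P a *m mxev R (phi s') = mon s' a *: P a.
  move=> hs' al; apply/eqP; rewrite -subr_eq0; apply/eqP.
  apply: (mon_indep_mx (M := fun a => P a *m mxev R (phi s') - mon s' a *: P a) ul _ al) => s hs.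
  have := RM (phi s) (phi s'); rewrite -fphiM // hP; last exact: GmM.
  rewrite (hP s) // mulmx_suml => /esym /eqP; rewrite -subr_eq0 -sumrB => /eqP e.
  apply: etrans e; apply: eq_bigr => b _.
  by rewrite scalerBr scalemxAl scalerA monM.
move=> a b al bl; apply: subr0_eq.
apply: (mon_indep_mx (M := fun b => P a *m P b - (if a == b then P a else 0)) ul _ bl) => s hs.
have := PP s a hs al; rewrite hP // mulmx_sumr => /eqP; rewrite -subr_eq0 => /eqP e.
apply: etrans e; under eq_bigr do rewrite scalerBr; rewrite sumrB; congr (_ - _).
  by apply: eq_bigr => c _; rewrite scalemxAr.
rewrite (bigD1_seq a) //= eqxx big1 ?addr0 // => c.
by rewrite eq_sym => /negPf ->; rewrite scaler0.
Qed.
End Projectors.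

Section PowerTorus.
Variables (k : closedFieldType) (G : algGroup k) (F : frame G).
Local Notation kG := (regfun G).
Local Notation wt := (wt (frk F)).
Local Notation phi := (@fphi _ _ F).
Local Notation tor := (tor F).
Variables (n' : nat).
Local Notation n := n'.+1.
Variable (R : 'M[kG]_n).
Hypothesis RM : forall x y, mxev R (x * y)%g = mxev R x *m mxev R y.
Hypothesis R1 : mxev R 1%g = 1%:M.
Hypothesis Rgen : forall S : set kG, (forall a, S (rf_const G a)) -> (forall i j, S (R i j)) ->
    (forall u v, S u -> S v -> S (u + v)) -> (forall u v, S u -> S v -> S (u * v)) ->
    forall f, S f.

Lemma mxev_inj x y : mxev R x = mxev R y -> x = y.
Proof.
move=> e; apply: regfun_sep => f; apply: (Rgen (S := [set f : kG | f x = f y])) => /=.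
- by [].
- by move=> i j; have := congr1 (fun A : 'M_n => A i j) e; rewrite !mxevE.
- by move=> u v -> ->.
- by move=> u v -> ->.
Qed.

Lemma mxevV x : mxev R x^-1%g *m mxev R x = 1%:M.
Proof. by rewrite -RM mulVg. Qed.

Lemma mxevX x m : mxev R (x ^+ m)%g = mxev R x ^+ m.
Proof. by elim: m => [|m IH]; rewrite ?R1 // expgS exprS RM IH. Qed.

Let N2 := #|{: 'I_n * 'I_n}|.
Let ij (l : 'I_N2) : 'I_n * 'I_n := enum_val l.
Let ent (M : 'M[k]_n) (l : 'I_N2) : k := M (ij l).1 (ij l).2.
Let evR : {rmorphism {mpoly k[N2]} -> kG} :=
  mmap (rf_const G) (fun l : 'I_N2 => R (ij l).1 (ij l).2).

Let evR_at H x : evR H x = H.@[ent (mxev R x)].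
Proof.
rewrite /evR /= /mmap rf_sum mevalE; apply: eq_bigr => b _.
rewrite rfM /mmap1 rf_prod; congr (_ * _); apply: eq_bigr => l _.
by rewrite rfX /ent mxevE.
Qed.

Let evR_surj f : exists H, evR H = f.
Proof.
apply: (Rgen (S := [set f | exists H, evR H = f])) => /=.
- by move=> a; exists a%:MP; rewrite /evR /= mmapC.
- move=> i j; exists 'X_(enum_rank (i, j)); rewrite /evR /= mmapX mmap1U /ij.
  by rewrite enum_rankK.
- by move=> u v [H <-] [H' <-]; exists (H + H'); rewrite rmorphD.
- by move=> u v [H <-] [H' <-]; exists (H * H'); rewrite rmorphM.
Qed.

Let mpoly_noetherian : noetherian {mpoly k[N2]}.
Proof.
have [A [c [hN _ [x hx]]]] := free_algebra k N2.
have [psi [p1 p2 _]] := hx _ (@mpolyC N2 k) (fun l => 'X_l).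
apply: (noetherian_surj (f := psi)) => // H.
rewrite (mpolyE H); apply: (big_ind (fun H => exists a, psi a = H)).
- by exists 0; rewrite rmorph0.
- by move=> u v [a <-] [b <-]; exists (a + b); rewrite rmorphD.
move=> b _; rewrite -mul_mpolyC mpolyXE_id.
have [a ha] : exists a, psi a = \prod_(i < N2) 'X_i ^+ b i.
  apply: (big_ind (fun H => exists a, psi a = H)).
  - by exists 1; rewrite rmorph1.
  - by move=> u v [a <-] [a' <-]; exists (a * a'); rewrite rmorphM.
  - by move=> i _; exists (x i ^+ b i); rewrite rmorphXn /= p2.
by exists (c H@_b * a); rewrite rmorphM /= p1 ha.
Qed.

(** The image of the representation is closed among all matrices: a matrix satisfying the relations
    between the entries defines an algebra map on the coordinate ring, hence an element of the
    group. *)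
Lemma equations : exists Fs : seq {mpoly k[N2]}, forall M : 'M[k]_n,
  (forall H, H \in Fs -> H.@[ent M] = 0) <-> exists x, mxev R x = M.
Proof.
pose K : set {mpoly k[N2]} := [set H | evR H = 0].
have hK : is_ideal K.
  split=> [|u v|u v] /=; rewrite /K /= ?rmorph0 // ?rmorphD ?rmorphM /=.
    by move=> -> ->; rewrite addr0.
  by move=> ->; rewrite mulr0.
have [Fs eK] := mpoly_noetherian hK; exists Fs => M; split=> [h|[x <-] H hH]; last first.
  rewrite -evR_at; have : K H by rewrite eK; apply: sub_igen.
  by rewrite /K /= => ->; rewrite rf0.
have hM H : K H -> H.@[ent M] = 0.
  rewrite eK => /(_ [set H | H.@[ent M] = 0]); apply=> //.
  split=> [|u v|u v] /=; rewrite ?meval0 ?mevalD ?mevalM //; first by move=> -> ->; rewrite addr0.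
  by move=> ->; rewrite mulr0.
have /choice [P hP] := evR_surj.
have uP f H : evR H = f -> (P f).@[ent M] = H.@[ent M].
  move=> e; apply/eqP; rewrite -subr_eq0 -mevalB; apply/eqP/hM.
  by rewrite /K /= rmorphB /= hP e subrr.
have [c|f g|f g|x hx] := @regfun_point _ G (fun f => (P f).@[ent M]).
- by rewrite (uP _ c%:MP) ?mevalC // /evR /= mmapC.
- by rewrite (uP _ (P f + P g)) ?mevalD // rmorphD /= !hP.
- by rewrite (uP _ (P f * P g)) ?mevalM // rmorphM /= !hP.
exists x; apply/matrixP => i j; rewrite mxevE -hx (uP _ 'X_(enum_rank (i, j))).
  by rewrite mevalXU /ent /ij enum_rankK.
by rewrite /evR /= mmapX mmap1U /ij enum_rankK.
Qed.

Definition DQm (Q : 'M[k]_n) (y : 'I_n -> k) := invmx Q *m diag_mx (\row_i y i) *m Q.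

(** [E] does not depend on [Q]. This is what makes the final exponent uniform over all elements
    centralizing T. *)
Lemma bounded_exponents (H : {mpoly k[N2]}) : exists E : seq (zwt n), forall Q,
  exists L : seq (k * zwt n), (forall x, x \in L -> x.2 \in E) /\
    forall y, Gm_pow y -> H.@[ent (DQm Q y)] = \sum_(x <- L) x.1 * mon y x.2.
Proof.
pose S (H : {mpoly k[N2]}) := exists E : seq (zwt n), forall Q,
  exists L : seq (k * zwt n), (forall x, x \in L -> x.2 \in E) /\
    forall y, Gm_pow y -> H.@[ent (DQm Q y)] = \sum_(x <- L) x.1 * mon y x.2.
have SC c : S c%:MP.
  exists [:: 0] => Q; exists [:: (c, 0)]; split.
    by move=> x; rewrite !inE => /eqP ->.
  by move=> y hy; rewrite mevalC big_seq1 mon0 mulr1.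
have SD u v : S u -> S v -> S (u + v).
  move=> [E hE] [E' hE']; exists (E ++ E') => Q.
  have [L [h1 h2]] := hE Q; have [L' [h1' h2']] := hE' Q; exists (L ++ L'); split.
    by move=> x; rewrite !mem_cat => /orP [/h1 ->|/h1' ->]; rewrite ?orbT.
  by move=> y hy; rewrite mevalD h2 // h2' // big_cat.
have SM u v : S u -> S v -> S (u * v).
  move=> [E hE] [E' hE']; exists [seq e + e' | e <- E, e' <- E'] => Q.
  have [L [h1 h2]] := hE Q; have [L' [h1' h2']] := hE' Q.
  exists [seq (x.1 * x'.1, x.2 + x'.2) | x <- L, x' <- L']; split.
    by move=> _ /allpairsP [[x x'] /= [hx hx' ->]]; apply/allpairsP; exists (x.2, x'.2); split=> //=; [apply: h1|apply: h1'].
  move=> y hy; rewrite mevalM h2 // h2' // big_allpairs_dep mulr_suml; apply: eq_bigr => x _.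
  rewrite mulr_sumr; apply: eq_bigr => x' _ /=; rewrite monD //; ring.
have SX l : S 'X_l.
  exists [seq ee_ i | i <- enum 'I_n] => Q.
  exists [seq (invmx Q (ij l).1 i * Q i (ij l).2, ee_ i) | i <- enum 'I_n]; split.
    by move=> _ /mapP [i hi ->]; apply: map_f.
  move=> y hy; rewrite mevalXU /ent big_map big_enum /DQm -mulmxA mxE; apply: eq_bigr => i _.
  rewrite mon_ee mul_diag_mx !mxE /=; ring.
rewrite (mpolyE H); apply: (big_ind S) => // [|b _]; first by rewrite -mpolyC0.
rewrite -mul_mpolyC; apply: (SM) => //; rewrite mpolyXE_id; apply: (big_ind S); [by rewrite -mpolyC1; apply: SC|exact: SM|move=> i _].
elim: (b i) => [|m IH]; first by rewrite expr0 -mpolyC1.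
by rewrite exprS; apply: (SM).
Qed.

Lemma tor_mul x y : tor x -> tor y -> tor (x * y)%g.
Proof.
by move=> [s hs <-] [s' hs' <-]; rewrite -fphiM //; apply: tor_phi; apply: GmM.
Qed.

Lemma tor1 : tor 1%g.
Proof. by rewrite -(phi1' F); apply: tor_phi; apply: Gm1. Qed.

Lemma torX x m : tor x -> tor (x ^+ m)%g.
Proof. by move=> hx; elim: m => [|m IH]; [apply: tor1|rewrite expgS; apply: tor_mul]. Qed.

Lemma GmX r (s : 'I_r -> k) m : Gm_pow s -> Gm_pow (fun i => s i ^+ m).
Proof. by move=> hs i; rewrite expf_neq0 ?hs. Qed.

Lemma phiX s m : Gm_pow s -> phi (fun i => s i ^+ m) = (phi s ^+ m)%g.
Proof.
move=> hs; elim: m => [|m IH]; first by rewrite expg0 -(phi1' F).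
rewrite expgS -IH -fphiM //; last exact: GmX.
by congr fphi; apply/funext => i; rewrite exprS.
Qed.

Lemma monX r (s : 'I_r -> k) m a : mon (fun i => s i ^+ m) a = mon s a ^+ m.
Proof.
rewrite /mon -prodrXl; apply: eq_bigr => i _.
case: (a i) => c; first by rewrite -!exprnP exprAC.
by rewrite NegzE -!exprnN exprVn -exprAC.
Qed.

Variable p : nat.
Hypothesis char_k : p \in [pchar k].

Section Frame.
Variable Q : 'M[k]_n.
Hypothesis uQ : Q \in unitmx.
Local Notation DQ := (DQm Q).

Let cj (M : 'M[k]_n) := Q *m M *m invmx Q.

Lemma cjD y : cj (DQ y) = diag_mx (\row_i y i).
Proof. by rewrite /cj /DQm !mulmxA mulmxV // mul1mx mulmxK. Qed.

Lemma DQ_inj y y' : DQ y = DQ y' -> y = y'.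
Proof.
move=> e; apply/funext => i; have := congr1 (fun A : 'M_n => cj A i i) e.
by rewrite !cjD !mxE eqxx !mulr1n.
Qed.

Lemma DQM y y' : DQ y *m DQ y' = DQ (fun i => y i * y' i).
Proof.
rewrite /DQm -!mulmxA; congr (_ *m _); rewrite !mulmxA; congr (_ *m _).
rewrite mulmxK // mulmx_diag; congr diag_mx; apply/rowP => i; rewrite !mxE //.
Qed.

Lemma DQ1 : DQ (fun=> 1) = 1%:M.
Proof.
rewrite /DQm (_ : diag_mx _ = 1%:M) ?mulmx1 ?mulVmx //.
by apply/matrixP => i j; rewrite !mxE.
Qed.

Lemma DQX y m : DQ y ^+ m = DQ (fun i => y i ^+ m).
Proof.
elim: m => [|m IH]; first by rewrite expr0 -[1]DQ1.
rewrite exprS IH -[_ * _]/(_ *m _) DQM; congr (DQm _ _).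
by apply/funext => i; rewrite exprS.
Qed.

Lemma DQ_of x : (forall i j, i != j -> cj (mxev R x) i j = 0) ->
  exists2 y, Gm_pow y & mxev R x = DQ y.
Proof.
move=> h; pose y (i : 'I_n) : k := cj (mxev R x) i i.
have e : mxev R x = DQ y.
  have ed : cj (mxev R x) = diag_mx (\row_i y i).
    apply/matrixP => i j; rewrite !mxE; case: eqP => [<-|/eqP nij].
      by rewrite /y /cj mxE.
    by have := h i j nij; rewrite mulr0n /cj mxE.
  by rewrite /DQm -ed /cj !mulmxA mulVmx // mul1mx mulmxKV.
exists y => // i; apply/eqP => yi.
have /mulmx1_unit [_] := mxevV x; rewrite e unitmxE !det_mulmx det_diag.
by rewrite (bigD1 i) //= mxE yi mul0r mulr0 mul0r unitr0.
Qed.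

Lemma DQV x y : Gm_pow y -> mxev R x = DQ y -> mxev R x^-1%g = DQ (fun i => (y i)^-1).
Proof.
move=> hy e; rewrite -[LHS]mulmx1 -DQ1.
rewrite (_ : (fun _ : 'I_n => 1) = (fun i => y i * (y i)^-1)); last first.
  by apply/funext => i; rewrite mulfV ?hy.
by rewrite -DQM mulmxA -e mxevV mul1mx.
Qed.

Let Yf i j : kG := \sum_a \sum_b (Q i a * invmx Q b j) *: R a b.

Lemma YfE x i j : Yf i j x = cj (mxev R x) i j.
Proof.
rewrite rf_sum /cj mxE; under [RHS]eq_bigr do rewrite mxE mulr_suml.
rewrite [RHS]exchange_big; apply: eq_bigr => a _; rewrite rf_sum; apply: eq_bigr => b _.
by rewrite rfZ mxevE mulrAC.
Qed.

Definition Mon (c : zwt n) : kG :=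
  \prod_i (if c i is Negz m then rinv (Yf i i) ^+ m.+1 else Yf i i ^+ `|c i|%N).

Lemma MonE c x y : Gm_pow y -> mxev R x = DQ y -> Mon c x = mon y c.
Proof.
move=> hy e; rewrite rf_prod; apply: eq_bigr => i _.
have Yx : Yf i i x = y i by rewrite YfE e cjD !mxE eqxx mulr1n.
have YV : Yf i i x^-1%g = (y i)^-1 by rewrite YfE (DQV hy e) cjD !mxE eqxx mulr1n.
by case: (c i) => m; rewrite rfX /= ?Yx // YV exprVn.
Qed.

Lemma torus_of_monomials r (b : 'I_n -> zwt r) (a : 'I_r -> zwt n) (z : seq (zwt n)) :
  let pi (s : 'I_r -> k) i := mon s (b i) in
  (forall s, Gm_pow s -> exists x, mxev R x = DQ (pi s)) ->
  (forall s, Gm_pow s -> forall c, c \in z -> mon (pi s) c = 1) ->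
  (forall s, Gm_pow s -> forall j, mon (pi s) (a j) = s j) ->
  (forall y, Gm_pow y -> (forall c, c \in z -> mon y c = 1) -> y = pi (fun j => mon y (a j))) ->
  exists2 T', torus T' & forall x y, Gm_pow y -> mxev R x = DQ y ->
    (forall c, c \in z -> mon y c = 1) -> T' x.
Proof.
move=> pi hx hz ha hy.
have /choice [ph hph] : forall s : 'I_r -> k, exists x : G, Gm_pow s -> mxev R x = DQ (pi s).
  move=> s; have [/hx [x e]|] := pselect (Gm_pow s); first by exists x.
  by exists 1%g.
have Gpi s : Gm_pow s -> Gm_pow (pi s) by move=> hs; apply: Gm_mon.
have phM s s' : Gm_pow s -> Gm_pow s' -> ph (fun i => s i * s' i) = (ph s * ph s')%g.
  move=> hs hs'; apply: mxev_inj; rewrite RM !hph // ?DQM; last exact: GmM.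
  by congr (DQm _ _); apply/funext => i; rewrite /pi monM.
have inT x y : Gm_pow y -> mxev R x = DQ y -> (forall c, c \in z -> mon y c = 1) -> (ph @` @Gm_pow k r) x.
  move=> gy e hc; exists (fun j => mon y (a j)); first exact: Gm_mon.
  by apply: mxev_inj; rewrite hph -?hy //; apply: Gm_mon.
have ph1 : ph (fun=> 1) = 1%g.
  apply: mxev_inj; rewrite R1 hph; last exact: Gm1.
  by rewrite -DQ1; congr (DQm _ _); apply/funext => i; rewrite /pi mon1.
exists (ph @` @Gm_pow k r) => //; split; last first.
  exists r, ph; split=> //; split.
  - move=> s s'; rewrite !inE => hs hs' e; apply/funext => j.
    have /DQ_inj ep : DQ (pi s) = DQ (pi s') by rewrite -!hph // e.
    by rewrite -(ha s hs) -(ha s' hs') ep.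
  - have [c1 c2 c3] := laurent_subalg k r.
    move=> f hf; suff [g hg eg] : exists2 g, laurent g & forall s : 'I_r -> k, Gm_pow s -> RegFun hf (ph s) = g s.
      by exists g.
    move: (RegFun hf) => {hf}f.
    apply: (Rgen (S := [set f : kG | exists2 g, laurent g & forall s : 'I_r -> k, Gm_pow s -> f (ph s) = g s])) => /=.
    + by move=> c; exists (fun=> c).
    + move=> i j; exists (fun s => \sum_l invmx Q i l * pi s l * Q l j); last first.
        move=> s hs; rewrite -mxevE hph // /DQm mul_mx_diag mxE; apply: eq_bigr => l _.
        by rewrite !mxE.
      elim: (index_enum _) => [|l r' IH]; first by under eq_fun do rewrite big_nil; apply: c1.
      under eq_fun do rewrite big_cons; apply: (c2) => //; apply: (c3); last exact: c1.
      apply: (c3); first exact: c1; exact: laurent_mon.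
    + move=> u v [g hg eg] [g' hg' eg']; exists (fun s => g s + g' s); first exact: c2.
      by move=> s hs; rewrite eg ?eg'.
    + move=> u v [g hg eg] [g' hg' eg']; exists (fun s => g s * g' s); first exact: c3.
      by move=> s hs; rewrite eg ?eg'.
  - move=> g /(_ [set g | exists2 f, reg G f & forall s : 'I_r -> k, Gm_pow s -> f (ph s) = g s]); apply.
    split; first split.
    + by move=> c; exists (fun=> c) => //; apply: reg_const.
    + move=> g1 g2 [f1 r1 h1] [f2 r2 h2]; exists (fun u => f1 u + f2 u); first exact: reg_add.
      by move=> s hs; rewrite h1 ?h2.
    + move=> g1 g2 [f1 r1 h1] [f2 r2 h2]; exists (fun u => f1 u * f2 u); first exact: reg_prod.
      by move=> s hs; rewrite h1 ?h2.
    + move=> _ [[j _ <-]|[j _ <-]].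
        exists (Mon (a j)); first exact: rf_reg.
        by move=> s hs; rewrite (MonE _ (Gpi s hs) (hph s hs)) ha.
      exists (Mon (- a j)); first exact: rf_reg.
      by move=> s hs; rewrite (MonE _ (Gpi s hs) (hph s hs)) monN ?ha //; apply: Gpi.
split.
  split.
  - by exists (fun=> 1) => //; apply: Gm1.
  - by move=> _ _ [s hs <-] [s' hs' <-]; rewrite -phM //; exists (fun i => s i * s' i) => //; apply: GmM.
  - move=> _ [s hs <-]; exists (fun i => (s i)^-1); first exact: GmV.
    apply: (mulgI (ph s)); rewrite mulgV -phM //; last exact: GmV.
    by rewrite -ph1; congr ph; apply/funext => i; rewrite mulfV ?hs.
apply/zclosedP; exists [set f | (exists i j, i != j /\ f = Yf i j) \/ (exists2 c, c \in z & f = Mon c - 1)].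
apply/seteqP; split=> x.
  move=> [s hs <-] f [[i [j [nij ->]]]|[c cz ->]].
    by rewrite YfE hph // cjD !mxE (negPf nij).
  by rewrite rfB (MonE _ (Gpi s hs) (hph s hs)) hz // subrr.
move=> h; have [|y gy e] := @DQ_of x.
  by move=> i j nij; rewrite -YfE; apply: h; left; exists i, j.
apply: (inT x y) => // c cz.
have : (Mon c - 1) x = 0 by apply: h; right; exists c.
by rewrite rfB (MonE _ gy e) => /eqP; rewrite subr_eq0 => /eqP.
Qed.

(* By independence of characters, the polynomial equations of a group of diagonal
   matrices can be replaced by equalities of monomials. *)
Lemma diag_equations (Fs : seq {mpoly k[N2]}) (E : seq (zwt n)) (y0 : 'I_n -> k) :
  (forall M : 'M[k]_n, (forall H, H \in Fs -> H.@[ent M] = 0) <-> exists x, mxev R x = M) ->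
  (forall H, H \in Fs -> exists L : seq (k * zwt n), (forall x, x \in L -> x.2 \in E) /\
    forall y, Gm_pow y -> H.@[ent (DQ y)] = \sum_(x <- L) x.1 * mon y x.2) ->
  Gm_pow y0 -> (forall e e', e \in E -> e' \in E ->
    (forall y, Gm_pow y -> (exists x, mxev R x = DQ y) -> mon y (e - e') = 1) -> mon y0 (e - e') = 1) ->
  exists x, mxev R x = DQ y0.
Proof.
move=> hFs hE g0 h0; apply/hFs => H hH; have [L [hL eL]] := hE H hH; rewrite eL //.
pose D := {y : 'I_n -> k | Gm_pow y /\ exists x, mxev R x = DQ y}.
have DMp (y y' : D) : Gm_pow (fun i => sval y i * sval y' i) /\
    exists x, mxev R x = DQ (fun i => sval y i * sval y' i).
  case: y => y [hy [x e]]; case: y' => y' [hy' [x' e']] /=; split; first exact: GmM.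
  by exists (x * x')%g; rewrite RM e e' DQM.
pose op (y y' : D) : D := exist _ _ (DMp y y').
pose D1 : D := exist _ (fun=> 1) (conj (@Gm1 k n) (ex_intro _ 1%g (etrans R1 (esym DQ1)))).
pose eqv e e' := `[< forall y : D, mon (sval y) e = mon (sval y) e' >].
pose rep e := nth 0 E (find (eqv e) E).
have has_rep e : e \in E -> has (eqv e) E.
  by move=> eE; apply/hasP; exists e => //; apply/asboolP.
have repE e : e \in E -> rep e \in E by move=> /has_rep; rewrite has_find => h; apply: mem_nth.
have repP e : e \in E -> forall y : D, mon (sval y) e = mon (sval y) (rep e).
  by move=> /has_rep /(nth_find 0) /asboolP.
pose s := undup [seq rep e | e <- E].
have val0 y (hy : Gm_pow y) : (forall e, e \in E -> mon y e = mon y (rep e)) ->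
    \sum_(x <- L) x.1 * mon y x.2 = \sum_(a <- s) (\sum_(x <- L | rep x.2 == a) x.1) * mon y a.
  move=> hr; under [RHS]eq_bigr do rewrite mulr_suml; rewrite (exchange_big_dep predT) //=.
  rewrite big_seq [RHS]big_seq; apply: eq_bigr => x xL.
  rewrite big_mkcond (bigD1_seq (rep x.2)) ?undup_uniq //=; last first.
    by rewrite mem_undup; apply: map_f; apply: hL.
  rewrite eqxx big1 => [|a]; last by rewrite eq_sym => /negPf ->.
  by rewrite addr0 (hr x.2 (hL x xL)).
have coef0 a : a \in s -> \sum_(x <- L | rep x.2 == a) x.1 = 0.
  move=> sa; have := @char_indep k D op _ (fun a y => mon (sval y) a) s
    (fun a => \sum_(x <- L | rep x.2 == a) x.1) _ _ (undup_uniq _) _ a D1 sa.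
  rewrite /= mon1 mulr1; apply.
  - by move=> a' y y' _; apply: monM.
  - move=> a1 a2; rewrite !mem_undup => /mapP [e eE ->] /mapP [e' eE' ->] ne.
    apply: contrapT => no; case/eqP: ne; congr (nth 0 E _); apply: eq_find => e2.
    have key (y : D) : mon (sval y) e = mon (sval y) e'.
      rewrite (repP e eE) (repP e' eE'); apply/eqP; apply: contraT => ne; case: no.
      by exists y.
    by apply/asboolP/asboolP => h y; rewrite -h key.
  - move=> [y [gy hy]] /=; rewrite -val0 //; last first.
      by move=> e eE; apply: (repP e eE (exist _ y (conj gy hy))).
    by rewrite -eL //; apply: ((hFs _).2 hy).
rewrite val0 //; first by rewrite big_seq big1 // => a /coef0 ->; rewrite mul0r.
move=> e eE; have := h0 e (rep e) eE (repE e eE); rewrite monD // monN // => h.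
have {}h : mon y0 e / mon y0 (rep e) = 1.
  apply: h => y gy hy; rewrite monD // monN // (repP e eE (exist _ y (conj gy hy))) /=.
  by rewrite mulfV // mon_neq0.
by move/eqP: h; rewrite -(inj_eq (mulIf (mon_neq0 (rep e) g0))) mulfVK ?mon_neq0 // mul1r => /eqP.
Qed.

End Frame.

(** For c centralizing T, the power c^q is diagonalizable together with T. The elements of G
    diagonal in that frame form a group whose identity component is a torus T'; T' contains T, so it
    equals T by maximality, and it contains a bounded power of c^q. *)
Theorem power_torus : (forall T', torus T' -> tor `<=` T' -> T' = tor) ->
  exists N, (0 < N)%N /\
    forall c, (forall s, Gm_pow s -> (c * phi s = phi s * c)%g) -> tor (c ^+ N)%g.
Proof.
move=> hmax; have [l [P [ul hP hP1 hPP hPc]]] := projectors F RM R1.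
have [Fs hFs] := equations.
have /choice [EF hEF] := bounded_exponents.
pose E := flatten [seq EF H | H <- Fs].
pose De := [seq e - e' | e <- E, e' <- E].
have /choice [Nb hNb] := fun Lam : seq (zwt n) => diag_torus k Lam.
(* The characters trivial on the diagonal group form a sublist of [De], which depends on c; the
   product over all sublists gives an exponent valid for every c. *)
pose N1 := (\prod_(b : (size De).-tuple bool) Nb (mask b De))%N.
have p_gt1 : (1 < p)%N by apply/prime_gt1/(pcharf_prime char_k).
pose q := (p ^ n)%N; have q_gt : (n < q)%N by apply: ltn_expl.
have N1_gt0 : (0 < N1)%N.
  apply: (big_ind (fun m => 0 < m)%N) => [//|m m' h h'|b _]; first by rewrite muln_gt0 h.
  by have [r [b' [a [z []]]]] := hNb (mask b De).
exists (q * N1)%N; split; first by rewrite muln_gt0 N1_gt0 (leq_ltn_trans _ q_gt).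
move=> c hc; pose A := mxev R c ^+ q.
have commA a : a \in l -> comm_mx A (P a).
  move=> al; rewrite /A -mxevX; apply: hPc => // s hs.
  have h : commute c (phi s) by apply: hc.
  by apply/esym/commuteX; apply/esym.
have [Q uQ hQ] : exists2 Q, Q \in unitmx & all [pred A | similar_diag Q A] (A :: map P l).
  apply/codiagonalizableP; split=> [M M'|M].
    rewrite !inE => /orP [/eqP ->|/mapP [a al ->]] /orP [/eqP ->|/mapP [b bl ->]] //.
    - exact: commA.
    - by apply/esym/commA.
    - by rewrite /comm_mx !hPP // eq_sym; case: eqP => [->|].
  rewrite inE => /orP [/eqP ->|/mapP [a al ->]].
    by apply: (diag_pow _ char_k); apply: ltn_trans q_gt.
  by apply: diag_idem; rewrite hPP // eqxx.
have off M : M \in A :: map P l -> forall i j, i != j -> (Q *m M *m invmx Q) i j = 0.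
  by move=> /(allP hQ) /(diagonalizable_forP _ uQ) h i j nij; apply: h.
have offT s : Gm_pow s -> forall i j, i != j -> (Q *m mxev R (phi s) *m invmx Q) i j = 0.
  move=> hs i j nij; rewrite hP // mulmx_sumr mulmx_suml summxE big_seq big1 // => a al.
  by rewrite -scalemxAr -scalemxAl mxE off ?mulr0 // inE map_f ?orbT.
pose Lam := [seq la <- De | `[< forall y, Gm_pow y -> (exists x, mxev R x = DQm Q y) -> mon y la = 1 >]].
have [b eb] : exists b : (size De).-tuple bool, Lam = mask b De.
  by exists (map_tuple (fun la => `[< forall y, Gm_pow y -> (exists x, mxev R x = DQm Q y) -> mon y la = 1 >]) (in_tuple De)); rewrite /Lam filter_mask.
have [r [b' [a [z [_ h1 h2 h3 h4]]]]] := hNb Lam.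
have inLam y la : Gm_pow y -> (exists x, mxev R x = DQm Q y) -> la \in Lam -> mon y la = 1.
  by move=> gy hy; rewrite mem_filter => /andP [/asboolP h _]; apply: h.
have [||||T' hT' inT'] := @torus_of_monomials Q uQ r b' a z.
- move=> s hs; apply: (diag_equations uQ hFs (E := E)); last first.
  + move=> e e' eE eE' h; apply: h1 => //; left; rewrite mem_filter.
    by apply/andP; split; [apply/asboolP|apply/allpairsP; exists (e, e')].
  + exact: Gm_mon.
  + move=> H hH; have [L [hL eL]] := hEF H Q; exists L; split=> // x xL.
    by apply/flattenP; exists (EF H); [apply: map_f|apply: hL].
- by move=> s hs d dz; apply: h1 => //; right.
- exact: h2.
- exact: h3.
(* Elements of T are N-th powers of elements of T, and N-th powers of diagonal elements of G lie in
   T'. *)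
have eT : T' = tor.
  apply: hmax => // _ [s hs <-].
  have /choice [u hu] : forall i, exists v, v ^+ Nb Lam = s i.
    by move=> i; apply: nth_root; have [? [? [? [? []]]]] := hNb Lam.
  have gu : Gm_pow u.
    move=> i; apply/eqP => ui; have := hs i; rewrite -hu ui expr0n.
    by have [? [? [? [? [+ _ _ _ _]]]]] := hNb Lam; rewrite lt0n => /negPf ->; rewrite eqxx.
  have [y gy ey] := DQ_of uQ (offT u gu).
  have es : phi s = (phi u ^+ Nb Lam)%g by rewrite -phiX //; congr fphi; apply/funext.
  apply: (inT' _ (fun i => y i ^+ Nb Lam)); first exact: GmX.
    by rewrite es mxevX ey DQX.
  move=> d dz; rewrite monX; apply: h4 => // la; apply: inLam => //; by exists (phi u).
have [|y gy ey] := @DQ_of Q uQ (c ^+ q)%g.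
  by move=> i j nij; rewrite mxevX off // inE eqxx.
have t1 : tor ((c ^+ q) ^+ Nb Lam)%g.
  rewrite -eT; apply: (inT' _ (fun i => y i ^+ Nb Lam)); first exact: GmX.
    by rewrite mxevX ey DQX.
  move=> d dz; rewrite monX; apply: h4 => // la; apply: inLam => //; by exists (c ^+ q)%g.
rewrite /N1 (bigD1 b) //= -eb mulnA !expgnA; exact: torX.
Qed.

End PowerTorus.

Lemma charpoly_torsion (k : closedFieldType) (n N : nat) : (0 < N)%N ->
  exists L : seq {poly k}, forall A : 'M[k]_n.+1, A ^+ N = 1 -> char_poly A \in L.
Proof.
move=> N0; have mX : ('X^N - 1 : {poly k}) \is monic by apply: monicXnsubC.
have [r er] := closed_field_poly_normal ('X^N - 1 : {poly k}).
rewrite (monicP mX) scale1r in er.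
have r0 z : z ^+ N = 1 -> z \in r.
  move=> hz; rewrite -root_prod_XsubC -er rootE hornerD hornerN hornerXn hornerC hz.
  by rewrite subrr.
exists [seq \prod_(i < n.+1) ('X - (r`_(t i))%:P) | t : {ffun 'I_n.+1 -> 'I_(size r)}].
move=> A hA; have [s es] := closed_field_poly_normal (char_poly A).
rewrite (monicP (char_poly_monic A)) scale1r in es.
have ss : size s = n.+1.
  by have := size_prod_XsubC s id; rewrite -es size_char_poly => -[].
have sr z : z \in s -> z \in r.
  rewrite -root_prod_XsubC -es -eigenvalue_root_char => /eigenvalueP [v ev v0].
  apply: r0; apply/eqP; rewrite -subr_eq0; have : (z ^+ N - 1) *: v = 0.
    rewrite scalerBl scale1r; suff -> : z ^+ N *: v = v *m A ^+ N by rewrite hA mulmx1 subrr.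
    elim: N {N0 mX er hA} => [|N IH]; first by rewrite expr0 scale1r mulmx1.
    by rewrite exprSr exprSr -[_ * A]/(_ *m A) mulmxA -IH -scalemxAl ev scalerA.
  by move/eqP; rewrite scaler_eq0 (negPf v0) orbF.
have hi (i : 'I_n.+1) : (index (nth 0%R s i) r < size r)%N by rewrite index_mem sr // mem_nth // ss.
apply/mapP; exists [ffun i => Ordinal (hi i)]; first by rewrite mem_enum.
rewrite es (big_nth 0) big_mkord ss; apply: eq_bigr => i _.
by rewrite ffunE /= nth_index // sr // mem_nth // ss.
Qed.

(** [m] is the rank of [P]. *)
Lemma idem_det (k : closedFieldType) (n : nat) (P : 'M[k]_n.+1) : P *m P = P -> exists m,
  (P != 0 -> (0 < m)%N) /\ forall a, \det (a *: P + (1%:M - P)) = a ^+ m.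
Proof.
move=> PP; have [Q uQ /(diagonalizable_forP _ uQ) hQ] := diag_idem PP.
pose D := Q *m P *m invmx Q.
have off (i j : 'I_n.+1) : i != j -> D i j = 0 by move=> ij; apply: hQ.
have eP : P = invmx Q *m D *m Q by rewrite /D !mulmxA mulVmx // mul1mx mulmxKV.
have DD : D *m D = D.
  by rewrite /D !mulmxA mulmxKV // -[Q *m P *m P]mulmxA PP.
have d01 i : D i i = (D i i == 1)%:R.
  have := congr1 (fun A : 'M_n.+1 => A i i) DD; rewrite mxE (bigD1 i) //= big1 ?addr0; last first.
    by move=> j ji; rewrite off ?mul0r // eq_sym.
  move=> e; case: eqP => // ne; apply/eqP; move/eqP: e.
  by rewrite -subr_eq0 -{3}[D i i]mulr1 -mulrBr mulf_eq0 subr_eq0 => /orP [//|/eqP /ne].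
clearbody D; exists #|[pred i | D i i == 1]|; split=> [P0|a].
  rewrite lt0n; apply: contra P0 => /eqP /card0_eq h; apply/eqP; rewrite eP.
  suff -> : D = 0 by rewrite mulmx0 mul0mx.
  apply/matrixP => i j; rewrite [RHS]mxE; have [<-|ij] := eqVneq i j; last exact: off.
  by have := h i; rewrite inE => /= e; rewrite d01 e.
have -> : a *: P + (1%:M - P) = invmx Q *m (a *: D + (1%:M - D)) *m Q.
  rewrite mulmxDr mulmxDl mulmxBr mulmxBl mulmx1 mulVmx // -eP; congr (_ + _).
  by rewrite -scalemxAr -scalemxAl -eP.
rewrite !det_mulmx mulrAC -det_mulmx mulVmx // det1 mul1r.
have -> : a *: D + (1%:M - D) = diag_mx (\row_i (if D i i == 1 then a else 1)).
  apply/matrixP => i j; rewrite !mxE; have [<-|ij] := eqVneq i j; last first.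
    by rewrite (off i j ij) mulr0 subrr addr0.
  rewrite d01; case: eqP => _; rewrite /= ?eqxx ?mulr1 ?subrr ?addr0 ?mulr0 ?subr0 ?add0r //.
  by rewrite eq_sym oner_eq0.
rewrite det_diag -prodr_const [RHS]big_mkcond; apply: eq_bigr => i _.
by rewrite mxE.
Qed.

Lemma proj_mul (k : fieldType) n (A B P : 'M[k]_n) : P *m P = P -> P *m B = B *m P ->
  (A *m P + (1%:M - P)) *m (B *m P + (1%:M - P)) = A *m B *m P + (1%:M - P).
Proof.
move=> PP PB.
have e1 : A *m P *m (B *m P) = A *m B *m P by rewrite -mulmxA [P *m _]mulmxA PB -[B *m P *m P]mulmxA PP mulmxA.
have e2 : A *m P *m (1%:M - P) = 0 by rewrite mulmxBr mulmx1 -mulmxA PP subrr.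
have e3 : (1%:M - P) *m (B *m P) = 0.
  by rewrite mulmxBl mul1mx mulmxA PB -mulmxA PP subrr.
have e4 : (1%:M - P) *m (1%:M - P) = 1%:M - P.
  by rewrite mulmxBr mulmx1 mulmxBl mul1mx PP subrr subr0.
by move: e2 e3 e4; set X := _ - _ => e2 e3 e4; rewrite mulmxDl [A *m P *m _]mulmxDr [X *m _]mulmxDr e1 e2 e3 e4 addr0 add0r.
Qed.

Section Centralizer.
Variables (k : closedFieldType) (G : algGroup k).
Local Notation kG := (regfun G).

Lemma finite_values_const (K : set G) (f : kG) (L : seq k) : zclosed K -> zconnected K -> K 1%g ->
  (forall x, K x -> f x \in L) -> forall x, K x -> f x = f 1%g.
Proof.
move=> cK hK K1 hL.
pose g : kG := \prod_(v <- L | v != f 1%g) (f - rf_const G v).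
pose Z1 := [set x | K x /\ forall i : unit, True -> (f - rf_const G (f 1%g)) x = 0].
pose Z2 := [set x | K x /\ forall i : unit, True -> g x = 0].
have gE x : g x = \prod_(v <- L | v != f 1%g) (f x - v) by rewrite rf_prod.
have e : K = Z1 `|` Z2.
  apply/seteqP; split=> x; last by move=> [[]|[]].
  move=> Kx; have [fx|ne] := eqVneq (f x) (f 1%g).
    by left; split=> // _ _; rewrite rfB fx subrr.
  right; split=> // _ _; rewrite gE; apply/eqP; rewrite prodf_seq_eq0.
  by apply/hasP; exists (f x); rewrite ?hL //= ne subrr eqxx.
have [|||h|h] := hK Z1 Z2 _ _ e; try exact: zclosed_cond.
- apply/seteqP; split=> // x [[_ /(_ tt Logic.I)]]; rewrite rfB /= => /eqP; rewrite subr_eq0 => /eqP fx.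
  move=> [_ /(_ tt Logic.I) /eqP]; rewrite gE prodf_seq_eq0 => /hasP [v _ /andP [ne]].
  by rewrite subr_eq0 fx eq_sym (negPf ne).
- by have : set0 (1%g : G) by rewrite -h; split=> // _ _; rewrite rfB subrr.
move=> x; rewrite e h setU0 => -[_ /(_ tt Logic.I)]; rewrite rfB /= => /eqP.
by rewrite subr_eq0 => /eqP.
Qed.

Lemma shift_iter (x : G) n (f : G -> k) (y : G) :
  iter n (fun h : G -> k => (fun y => h (y * x)%g - h y)) f y =
  \sum_(i < n.+1) (('X - 1) ^+ n : {poly k})`_i * f (y * x ^+ i)%g.
Proof.
elim: n f y => [|n IH] f y.
  by rewrite big_ord_recl big_ord0 addr0 expr0 coef1 mul1r expg0 mulg1.
rewrite iterSr IH; under eq_bigr do rewrite mulrBr; rewrite sumrB.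
set P := _ ^+ n; have sP : (size P <= n.+1)%N by rewrite /P -polyC1 size_exp_XsubC.
have cE i : (('X - 1) ^+ n.+1 : {poly k})`_i = (if i is j.+1 then P`_j else 0) - P`_i.
  by rewrite exprS -/P mulrBl mul1r coefB coefXM; case: i.
under [RHS]eq_bigr do rewrite cE mulrBl; rewrite sumrB; congr (_ - _).
  rewrite [RHS]big_ord_recl mul0r add0r; apply: eq_bigr => i _.
  by rewrite lift0 /= expgSr mulgA.
by rewrite [RHS]big_ord_recr /= nth_default // mul0r addr0.
Qed.

(** In characteristic p the q-th power of right translation minus 1 is translation by x^q minus
    1. *)
Lemma torsion_unipotent (p j : nat) (x : G) : p \in [pchar k] -> (x ^+ (p ^ j)%N = 1)%g -> unipotent x.
Proof.
move=> hp hx f _; exists (p ^ j)%N; apply/funext => y; rewrite shift_iter.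
set q := (p ^ j)%N in hx *.
have hpP : p \in [pchar {poly k}] by rewrite (rmorph_pchar (@polyC k)).
have q0 : (0 < q)%N by rewrite expn_gt0 prime_gt0 // (pcharf_prime hp).
rewrite /q powp_sub // expr1n -/q.
under eq_bigr do rewrite coefB coefXn coef1 mulrBl; rewrite sumrB.
rewrite (bigD1 ord_max) //= eqxx mul1r hx mulg1 big1 => [|i /negPf ne]; last first.
  by rewrite (_ : (i == q :> nat) = false) ?mul0r.
rewrite (bigD1 ord0) //= mul1r expg0 mulg1 big1 => [|i /negPf ne]; last first.
  by rewrite (_ : (i == 0 :> nat)%N = false) ?mul0r.
by rewrite !addr0 subrr.
Qed.

(** The characteristic polynomial takes finitely many values on matrices of bounded order, so it is
    constant on the connected [K] and equal to that of the identity. *)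
Lemma torsion_connected_unipotent (K : set G) (p N : nat) : p \in [pchar k] -> (0 < N)%N ->
  closed_subgroup K -> zconnected K -> (forall x, K x -> x ^+ N = 1)%g ->
  exists j, forall x, K x -> (x ^+ (p ^ j)%N = 1)%g.
Proof.
move=> hp N0 [[K1 _ _] cK] hK hN; have [n [R [RM R1 Rgen]]] := matrix_rep G.
have [L hL] := charpoly_torsion k n N0.
have evc x i : (char_poly R)`_i x = (char_poly (mxev R x))`_i.
  by rewrite /mxev -map_char_poly coef_map.
have cp x : K x -> char_poly (mxev R x) = char_poly (mxev R 1%g).
  move=> Kx; apply/polyP => i; rewrite -!evc.
  have H y : K y -> (char_poly R)`_i y \in [seq P`_i | P : {poly k} <- L].
    by move=> Ky; rewrite evc; apply/map_f/hL; rewrite -(mxevX RM R1) hN.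
  exact: (finite_values_const cK hK K1 H).
have p1 : (1 < p)%N by apply/prime_gt1/(pcharf_prime hp).
exists n.+1 => x Kx; apply: (mxev_inj Rgen); rewrite (mxevX RM R1) R1.
have hpM : p \in [pchar {poly k}] by rewrite (rmorph_pchar (@polyC k)).
have : horner_mx (mxev R x) (('X - 1) ^+ (p ^ n.+1)%N) = 0.
  have : (char_poly (mxev R x)) %| ('X - 1) ^+ (p ^ n.+1)%N.
    rewrite cp // R1 (_ : char_poly _ = ('X - 1) ^+ n.+1).
      by apply: dvdp_exp2l; apply/ltnW/ltn_expl.
    by rewrite /char_poly /char_poly_mx map_scalar_mx /= -raddfB /= det_scalar polyC1.
  by move=> /dvdpP [h ->]; rewrite rmorphM /= Cayley_Hamilton mulr0.
rewrite powp_sub // rmorphB !rmorphXn /= horner_mx_X rmorph1 expr1n => /eqP.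
by rewrite subr_eq0 => /eqP.
Qed.

End Centralizer.

(** * The tangent space of the centralizer of T *)

Section TorusLie.
Variables (k : closedFieldType) (G : algGroup k) (F : frame G).
Local Notation kG := (regfun G).
Local Notation wt := (wt (frk F)).
Local Notation w := (@fw _ _ F).
Local Notation phi := (@fphi _ _ F).
Local Notation tor := (tor F).
Local Notation chr := (@chr _ _ F).
Local Notation isrt := (@isrt _ _ F).

Definition cent : set G := [set c | forall s, Gm_pow s -> (c * phi s = phi s * c)%g].

Lemma wlocus_cent c : wlocus (F := F) (fun a => a = 0) c -> cent c.
Proof.
move=> hc s hs; apply: (mulIg (phi s)^-1%g); rewrite mulgK; apply: regfun_sep => f.
have [l [H [ul hH ->]]] := wvec_decomp (@fphi_emb _ _ F) (@fphiM _ _ F) f.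
rewrite !rf_sum; apply: eq_bigr => a _; rewrite hH //.
have [->|a0] := eqVneq a 0; first by rewrite mon0 mul1r.
have -> : H a c = 0; last by rewrite mulr0.
by rewrite (hc a (H a) (hH a)) ?(wvec_at1 (hH a)) //; apply/eqP.
Qed.

Lemma cent_tor t : tor t -> cent t.
Proof.
move=> [s hs <-] s' hs'; rewrite -!fphiM //; congr fphi.
by apply/funext => i; rewrite mulrC.
Qed.

Lemma cent_closed : closed_subgroup cent.
Proof.
split; first split.
- by move=> s hs; rewrite mul1g mulg1.
- by move=> x y hx hy s hs; rewrite -mulgA hy // mulgA hx // mulgA.
- by move=> x hx s hs; apply: (mulgI x); rewrite mulVKg mulgA hx // mulgK.
apply/zclosedP; exists [set f | exists s g, Gm_pow s /\ f = rtr (phi s) g - ltr (phi s) g].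
apply/seteqP; split=> x hx.
  by move=> f [s [g [hs ->]]]; rewrite rfB /= hx // subrr.
move=> s hs; apply: regfun_sep => g; apply/eqP; rewrite -subr_eq0; apply/eqP.
by apply: (hx (rtr (phi s) g - ltr (phi s) g)); exists s, g.
Qed.

Lemma root_hom_cnj c a y : cent c -> root_hom tor (chr a) y ->
  root_hom tor (chr a) (fun b => c * y b * c^-1)%g.
Proof.
move=> hc [[hi hr hs] hD hT]; split.
- split.
  + by move=> b b' h h' /mulIg /mulgI; apply: hi.
  + move=> f hf; exact: (hr _ (rf_reg (cnj c (RegFun hf)))).
  + move=> g /hs [f hf e]; exists (cnj c^-1%g (RegFun hf)); first exact: rf_reg.
    by move=> b hb; rewrite cnjE /= !mulgA invgK mulVg mul1g mulgVK e.
- by move=> b b'; rewrite hD !mulgA mulgVK.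
- move=> _ b [s hs' <-]; rewrite -hT; last exact: tor_phi.
  rewrite !mulgA -hc // -!mulgA; congr (_ * (_ * (_ * _)))%g.
  by rewrite -!invgM hc.
Qed.

Variable tau : anti_involution G.
Hypothesis hchev : chevalley tor tau.
Variable p : nat.
Hypothesis char_k : p \in [pchar k].
Hypothesis p2 : (2 < p)%N.
Hypothesis hsl2 : forall a, isrt a -> exists f, sl2_root a f.

(** [c] commutes with T, so it acts on the root subgroup by a scalar z; then z^q = 1 with q a power
    of p, hence z = 1. *)
Lemma torsion_cent_root c a y j : isrt a -> root_hom tor (chr a) y -> cent c ->
  (c ^+ (p ^ j)%N = 1)%g -> forall b, (c * y b * c^-1 = y b)%g.
Proof.
move=> ra hy hc hcq; have hy' := root_hom_cnj hc hy.
have er := root_hom_range hsl2 hchev ra hy hy'.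
have [z _ ez] : range y (c * y 1%R * c^-1)%g by rewrite er; exists 1.
have y0 : y 0 = 1%g.
  case: hy => _ hD _; apply: (mulgI (y 0)); by rewrite -hD addr0 mulg1.
have cy b : (c * y b * c^-1)%g = y (z * b).
  have [->|b0] := eqVneq b 0; first by rewrite mulr0 y0 mulg1 mulgV.
  have [s hs es] := mon_surj ra.1 b0.
  case: hy hy' => [_ _ hT] [_ _ hT'].
  have := hT' _ 1 (tor_phi hs); rewrite chrE // es mulr1 => <-.
  by rewrite -ez hT; [rewrite chrE // es mulrC|apply: tor_phi].
have cyX m b : (c ^+ m * y b * (c ^+ m)^-1)%g = y (z ^+ m * b).
  elim: m b => [|m IH] b; first by rewrite expg0 mul1g invg1 mulg1 mul1r.
  rewrite expgSr invgM !mulgA -[(_ * c * y b * _)%g]mulgA -[(_ * c * _)%g]mulgA [(c * _)%g]mulgA cy IH.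
  by rewrite exprSr mulrA.
have z1 : z ^+ (p ^ j)%N = 1.
  have := cyX (p ^ j)%N 1; rewrite hcq mul1g invg1 mulg1 mulr1.
  by case: hy => -[hi _ _] _ _ /hi; rewrite !inE => ->.
move=> b; rewrite cy; suff -> : z = 1 by rewrite mul1r.
have := powp_sub j z 1 char_k; rewrite z1 expr1n subrr => /eqP.
by rewrite expf_eq0 subr_eq0 => /andP [_ /eqP].
Qed.

Hypothesis Gc : zconnected (@setT G).

Lemma reg_conj_orbit (f : kG) (x : G) : exists g : kG, forall y, g y = f (y * x * y^-1)%g.
Proof.
have [n [a [b e]]] := reg_comulE f.
exists (\sum_(i < n) a i * rinv (ltr x (b i))) => y.
by rewrite rf_sum -mulgA e; apply: eq_bigr.
Qed.

(** [Om], the set of g with g K g^-1 inside [K], is stable under right multiplication by the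
    centralizer of T and by the root subgroups, which commute with [K]. These account for all
    weights of the tangent space, so [dense_of_lie] applies. *)
Lemma cent_normal (K : set G) j : closed_subgroup K -> K `<=` cent ->
  (forall c x, cent c -> K x -> K (c * x * c^-1)%g) -> (forall x, K x -> x ^+ (p ^ j)%N = 1)%g ->
  normal_subgroup K.
Proof.
move=> [sK cK] Kc hcK hq; split=> // x0 h Kh.
suff H x : K (x * h * x^-1)%g by rewrite conjgE -{2}[x0]invgK mulgA.
pose Om := [set g : G | forall h, K h -> K (g * h * g^-1)%g].
apply: zclosed_vanish => // f hf; have [g hg] := reg_conj_orbit f h.
rewrite -hg; suff -> : g = 0 by [].
apply: (@dense_of_lie _ _ F _ char_k Om g Gc).
- by move=> h' Kh'; rewrite mul1g invg1 mulg1.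
- move=> y u i Omy hu.
  have [wi|wi] := eqVneq (w i) 0.
    apply: (@wlocus_lie _ _ F p char_k (fun a => a = 0)) => //.
      by move=> a b -> ->; rewrite addr0.
    move=> c /wlocus_cent hc; apply: hu => h' Kh'.
    rewrite invgM !mulgA -[(y * c * h' * _)%g]mulgA -[(y * c * _)%g]mulgA [(c * _)%g]mulgA.
    exact/Omy/hcK.
  have ri : isrt (w i) by split=> //; exists i.
  have [f' [[_ _ hy _] _]] := hsl2 ri.
  apply: (root_hom_lie hsl2 hchev char_k p2 ri hy) => // b; apply: hu => h' Kh'.
  set v := f' _; have e : (v * h' * v^-1 = h')%g.
    have := torsion_cent_root ri hy (Kc _ Kh') (hq _ Kh') b; rewrite -/v => e.
    by apply: (mulIg v); rewrite mulgVK -{1}e mulgVK.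
  rewrite invgM !mulgA -[(y * v * h' * _)%g]mulgA -[(y * v * _)%g]mulgA [(v * _)%g]mulgA e.
  exact: Omy.
- by move=> y Omy; rewrite hg hf //; apply: Omy.
Qed.

Hypothesis Gr : unipotent_radical_trivial G.
Hypothesis hmax : forall T', torus T' -> tor `<=` T' -> T' = tor.

Hypothesis torc : zclosed tor.

(** The determinants on the weight spaces of a faithful representation are multiplicative on the
    centralizer. [E] consists of the elements for which they are N-th roots of unity; a power c^N
    lies in T, and dividing c by an N-th root of c^N taken in T leads into [E]. *)
Lemma cent_decomp : exists (E : set G) (N : nat), [/\ closed_subgroup E, E `<=` cent,
  (0 < N)%N /\ (forall x, E x -> (x ^+ N = 1)%g), forall c x, cent c -> E x -> E (c * x * c^-1)%g &
  forall c, cent c -> exists2 t, tor t & E (t^-1 * c)%g].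
Proof.
have [n [R [RM R1 Rgen]]] := matrix_rep G.
have [N [N0 hN]] := power_torus RM R1 Rgen char_k hmax.
have [l [P [ul hP hP1 hPP hPc]]] := projectors F RM R1.
have PP a : a \in l -> P a *m P a = P a by move=> al; rewrite hPP // eqxx.
have /choice [m hm] : forall a, exists m, a \in l -> (P a != 0 -> (0 < m)%N) /\
    forall z, \det (z *: P a + (1%:M - P a)) = z ^+ m.
  move=> a; have [al|na] := boolP (a \in l); last by exists 0%N.
  by have [m hm] := idem_det (PP a al); exists m.
pose cP a := map_mx (rf_const G) (P a).
pose D a : kG := \det (R *m cP a + (1%:M - cP a)).
have DE a c : D a c = \det (mxev R c *m P a + (1%:M - P a)).
  rewrite -[LHS]/(rf_ev c (D a)) /D -det_map_mx map_mxD map_mxB map_mxM map_mx1.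
  suff -> : map_mx (rf_ev c) (cP a) = P a by [].
  by apply/matrixP => i j; rewrite !mxE.
have DM a c c' : a \in l -> cent c -> cent c' -> D a (c * c')%g = D a c * D a c'.
  move=> al hc hc'; rewrite !DE -det_mulmx RM; congr (\det _).
  have cm : P a *m mxev R c' = mxev R c' *m P a by apply/esym/hPc.
  by rewrite proj_mul // PP.
have cD a s : a \in l -> Gm_pow s -> D a (phi s) = mon s a ^+ m a.
  move=> al hs; rewrite DE -(hm a al).2; congr (\det (_ + _)).
  rewrite hP // mulmx_suml (bigD1_seq a) //= big1_seq ?addr0 => [|b /andP [ba bl]].
    by rewrite -scalemxAl PP.
  by rewrite -scalemxAl hPP // (negPf ba) scaler0.
have D1 a : a \in l -> D a 1%g = 1.
  by move=> al; rewrite -(phi1' F) cD // ?mon1 ?expr1n //; apply: Gm1.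
have [[c1 cM cV] cc] := cent_closed.
have cX c i : cent c -> cent (c ^+ i)%g.
  by move=> hc; elim: i => [//|i IH]; rewrite expgS; apply: cM.
have DX a c i : a \in l -> cent c -> D a (c ^+ i)%g = D a c ^+ i.
  move=> al hc; elim: i => [|i IH]; first by rewrite D1.
  by rewrite expgS exprS DM ?IH //; apply: cX.
have DV a c : a \in l -> cent c -> D a c * D a c^-1%g = 1.
  by move=> al hc; rewrite -DM ?mulgV ?D1 //; apply: cV.
pose E := [set c | cent c /\ forall a, a \in l -> (D a ^+ N - 1) c = 0].
have EP c : E c <-> cent c /\ forall a, a \in l -> D a c ^+ N = 1.
  split=> -[hc h]; split=> // a al; last by rewrite rfB rfX h // subrr.
  by have := h a al; rewrite rfB rfX => /eqP; rewrite subr_eq0 => /eqP.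
pose M := (\prod_(a <- l | P a != 0%R) m a)%N.
have M0 : (0 < M)%N.
  rewrite /M big_seq_cond; apply: (big_ind (fun m => 0 < m)%N) => // [x y hx hy|a /andP [al Pa]].
    by rewrite muln_gt0 hx.
  by apply: (hm a al).1.
exists E, (N * M)%N; split.
- split; last exact: zclosed_cond.
  split.
  + by apply/EP; split=> // a al; rewrite D1 // expr1n.
  + move=> x y /EP [hx ex] /EP [hy ey]; apply/EP; split; first exact: cM.
    by move=> a al; rewrite DM // exprMn ex // ey // mulr1.
  + move=> x /EP [hx ex]; apply/EP; split; first exact: cV.
    move=> a al; have := DV a x al hx => /(congr1 (fun z => z ^+ N)).
    by rewrite exprMn ex // mul1r expr1n.
- by move=> x [].
- split; first by rewrite muln_gt0 N0.
  move=> x /EP [hx ex]; have [s hs es] := hN x hx.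
  rewrite expgnA -es -(phiX _ hs); apply: (mxev_inj Rgen).
  rewrite hP ?R1 -?hP1; last exact: GmX.
  apply: eq_big_seq => a al; have [->|Pa] := eqVneq (P a) 0; first by rewrite scaler0.
  have h : mon s a ^+ m a = 1 by rewrite -cD // es DX ?ex.
  have /dvdnP [m' ->] : (m a %| M)%N by rewrite /M big_mkcond (bigD1_seq a) //= Pa dvdn_mulr.
  by rewrite monX mulnC exprM h expr1n scale1r.
- move=> c x hc /EP [hx ex]; apply/EP; split; first by apply: (cM); [apply: cM|apply: cV].
  move=> a al; rewrite !DM //; try exact: cV; last exact: cM.
  by rewrite mulrAC DV // mul1r ex.
move=> c hc; have [s hs es] := hN c hc.
have /choice [u hu] : forall i, exists v, v ^+ N = s i by move=> i; apply: nth_root.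
have gu : Gm_pow u.
  by move=> i; apply/eqP => ui; have := hs i; rewrite -hu ui expr0n gtn_eqF // eqxx.
have es' : phi s = (phi u ^+ N)%g by rewrite -phiX //; congr fphi; apply/funext.
have tu : tor (phi u) by apply: tor_phi.
exists (phi u) => //; apply/EP; split; first by apply: (cM) => //; apply/cV/cent_tor.
move=> a al; have cu := cent_tor tu; rewrite DM //; last exact: cV.
rewrite exprMn -[D a c ^+ N]DX // -es es' DX // -exprMn mulrC DV // expr1n //.
Qed.

(** The identity component of [E] is unipotent and normal in G, hence trivial, and [E] is finite.
    The centralizer is thus a finite union of cosets of T; multiplying f by a function that vanishes
    on the other cosets but not at 1 reduces the claim to [wlocus_lie]. *)
Theorem torus_lie (f : kG) i : vanish tor f -> w i = 0 -> delta i f = 0.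
Proof.
move=> hf wi; have [E [N [cE Ec [N0 EN] hcE dec]]] := cent_decomp.
have [K [h [cK hK KE hh Kst]]] := identity_component cE.
have KN x : K x -> (x ^+ N = 1)%g by move=> /KE /EN.
have [j hj] := torsion_connected_unipotent char_k N0 cK hK KN.
have nK : normal_subgroup K.
  apply: (cent_normal cK _ _ hj) => [x /KE /Ec //|c x hc Kx].
  apply: (Kst (fun x => c * x * c^-1)%g) => // [g hg||y].
  - exact: (rf_reg (cnj c (RegFun hg))).
  - by rewrite mulg1 mulgV.
  - exact: hcE.
have K1 : K = [set 1%g].
  by apply: Gr => // x Kx; apply: (torsion_unipotent char_k (hj x Kx)).
have [[E1 EM EV] _] := cE.
have hE x y : E x -> E y -> ltr y^-1%g h x = (x == y)%:R.
  move=> Ex Ey; rewrite /= hh; last by apply: (EM) => //; apply: EV.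
  rewrite K1; case: eqP => [->|ne]; first by rewrite mulVg asboolT.
  by rewrite asboolF //= => e; apply: ne; rewrite -[x](mulVKg y) e mulg1.
have [L hL] : exists L : seq G, forall x, E x -> x \in L.
  pose J : set kG := [set u | exists L : seq G, forall x, E x -> x \notin L -> u x = 0].
  have : J 1.
    apply: regfun_unit_ideal.
      split=> [|u v [L hL] [L' hL']|a u [L hL]].
      - by exists [::].
      - exists (L ++ L') => x Ex; rewrite mem_cat negb_or => /andP [h1 h2].
        by rewrite rfD hL // hL' // addr0.
      - by exists L => x Ex h1; rewrite rfM hL // mulr0.
    move=> x; have [Ex|nE] := pselect (E x).
      exists (ltr x^-1%g h); last by rewrite hE // eqxx oner_neq0.
      by exists [:: x] => y Ey; rewrite inE => /negPf e; rewrite hE // e.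
    have [u [hu ux]] : exists u, vanish E u /\ u x != 0.
      apply: contrapT => no; apply: nE; apply: zclosed_vanish => [|u hu]; first by case: cE.
      by apply/eqP; apply: contraT => ux; case: no; exists u.
    by exists u => //; exists [::] => y Ey _; apply: hu.
  move=> [L hL]; exists L => x Ex; apply: contraT => nL.
  by have := hL x Ex nL; rewrite rf1 => /eqP; rewrite oner_eq0.
have /choice [U hU] : forall e, exists u : kG, ~ tor e -> (forall t, tor t -> u (t * e)%g = 0) /\ u 1%g != 0.
  move=> e; have [te|nt] := pselect (tor e); first by exists 0.
  have nt' : ~ tor e^-1%g.
    move=> [s hs es]; apply: nt; rewrite -[e]invgK -es -phiV' //.
    by apply: tor_phi; apply: GmV.
  have [u [hu ue]] : exists u, vanish tor u /\ u e^-1%g != 0.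
    apply: contrapT => no; apply: nt'; apply: zclosed_vanish => [|u hu].
      exact: torc.
    by apply/eqP; apply: contraT => ux; case: no; exists u.
  exists (rtr e^-1%g u) => _; split; last by rewrite /= mul1g.
  by move=> t tt; rewrite /= mulgK hu.
pose u : kG := \prod_(e <- L | ~~ `[< tor e >]) U e.
have u1 : u 1%g != 0.
  by rewrite rf_prod prodf_seq_neq0; apply/allP => e _; apply/implyP => /asboolPn he; apply: (hU e he).2.
have : delta (F := F) i (f * u) = 0.
  apply: (@wlocus_lie _ _ F p char_k (fun a => a = 0)) => //.
    by move=> a b -> ->; rewrite addr0.
  move=> c /wlocus_cent /dec [t tt Ee]; set e := (t^-1 * c)%g in Ee.
  have -> : c = (t * e)%g by rewrite /e mulVKg.
  rewrite rfM; have [te|nt] := pselect (tor e).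
    by rewrite hf ?mul0r //; apply: tor_mul.
  rewrite rf_prod; suff -> : \prod_(e0 <- L | ~~ `[< tor e0 >]) U e0 (t * e)%g = 0 by rewrite mulr0.
  apply/eqP; rewrite prodf_seq_eq0; apply/hasP; exists e; first exact: hL.
  by rewrite (hU e nt).1 // eqxx andbT; apply/asboolPn.
rewrite deltaM (hf _ (@tor1 _ _ F)) mul0r addr0 => /eqP; rewrite mulf_eq0 (negPf u1) orbF.
by move/eqP.
Qed.

End TorusLie.

(** * The big cell *)

Section Szpilrajn.
Variables (X : Type).
Implicit Types (R : set (X * X)).

Definition porder R := [/\ forall x, R (x, x), forall x y, R (x, y) -> R (y, x) -> x = y &
  forall x y z, R (x, y) -> R (y, z) -> R (x, z)].

(** A maximal order that leaves x and y incomparable could be enlarged by all pairs (u, v) with u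
    below x and v above y. *)
Lemma szpilrajn R : porder R -> exists S, [/\ porder S, R `<=` S & forall x y, S (x, y) \/ S (y, x)].
Proof.
(* Membership is expressed through the union with [R], so that the empty union of the empty chain
   qualifies. *)
move=> hR; have [F hF tF|A [hA maxA]] := @Zorn_bigcup _ [set S | porder (S `|` R)].
  have [R1 R2 R3] := hR.
  have up s t : (\bigcup_(S in F) S `|` R) s -> (\bigcup_(S in F) S `|` R) t ->
      (R s /\ R t) \/ exists2 S, F S & (S `|` R) s /\ (S `|` R) t.
    move=> [[S FS Ss]|Rs] [[S' FS' St]|Rt]; last by left.
    - right; have [h|h] := tF _ _ FS FS'.
        by exists S' => //; split; left=> //; apply: h.
      by exists S => //; split; left=> //; apply: h.
    - by right; exists S => //; split; [left|right].
    - by right; exists S' => //; split; [right|left].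
  split=> [x|x y h1 h2|x y z h1 h2]; first by right.
    have [[]|[S FS []]] := up _ _ h1 h2; first exact: R2.
    by have [_ h _] := hF _ FS; apply: h.
  have [[h h']|[S FS [h h']]] := up _ _ h1 h2; first by right; apply: R3 h h'.
  have [_ _ /(_ _ _ _ h h')] := hF _ FS; case=> ?; [left|by right].
  by exists S.
exists (A `|` R); split; [exact: hA|by move=> s; right|move=> x y].
have [a1 a2 a3] := hA; have [|nxy] := pselect ((A `|` R) (x, y)); first by left.
have [|nyx] := pselect ((A `|` R) (y, x)); [by right|exfalso].
pose S : set (X * X) := [set s | (A `|` R) s \/ (A `|` R) (s.1, x) /\ (A `|` R) (y, s.2)].
apply: (maxA S).
  split=> [s As|h]; first by left; left.
  have : S (x, y) by right; split; apply: a1.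
  by move=> /h As; apply: nxy; left.
suff : porder (S `|` R) by [].
have -> : S `|` R = S by apply/setUidPl => s Rs; left; right.
split=> [z|u v|u v z].
- by left; apply: a1.
- move=> [h|[h1 h2]] [h'|[h1' h2']].
  + exact: a2.
  + by case: nyx; apply: (a3 _ _ _ h2'); apply: (a3 _ _ _ h).
  + by case: nyx; apply: (a3 _ _ _ h2); apply: (a3 _ _ _ h').
  + by case: nyx; apply: (a3 _ _ _ h2).
move=> [h|[h1 h2]] [h'|[h1' h2']].
- by left; apply: (a3 _ _ _ h).
- by right; split=> //; apply: (a3 _ _ _ h).
- by right; split=> //; apply: (a3 _ _ _ h2).
- by right.
Qed.
End Szpilrajn.

Section Refine.
Variables (k : closedFieldType) (G : algGroup k) (F : frame G) (x' : 'I_(fdim F) -> regfun G).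
Hypothesis x'1 : forall i, x' i 1%g = 0.
Hypothesis x'w : forall i, wvec (@fphi _ _ F) (fw i) (x' i).
Hypothesis x'x : forall i, ipow (@mx1 k G) 2 (x' i - fx i).

Let x'sum (c : 'I_(fdim F) -> k) : ipow (@mx1 k G) 2 (\sum_i c i *: x' i - \sum_i c i *: fx i).
Proof.
rewrite -sumrB; apply: is_ideal_sum => [|i _]; first exact: m_ideal.
by rewrite -scalerBr; apply: ipowZ.
Qed.

Lemma refine_free (c : 'I_(fdim F) -> k) : ipow (@mx1 k G) 2 (\sum_i c i *: x' i) -> forall i, c i = 0.
Proof.
move=> h; apply: (@fx_free _ _ F); have := is_idealB (@m_ideal k G 2) h (x'sum c).
by rewrite opprB addrC subrK.
Qed.

Lemma refine_span (y : regfun G) : y 1%g = 0 ->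
  exists c : 'I_(fdim F) -> k, ipow (@mx1 k G) 2 (y - \sum_i c i *: x' i).
Proof.
move=> /(@fx_span _ _ F) [c hc]; exists c; have := is_idealB (@m_ideal k G 2) hc (x'sum c).
by rewrite opprB addrA subrK.
Qed.

Definition refine : frame G :=
  Frame (@fphi_emb _ _ F) (@fphiM _ _ F) x'1 x'w refine_free refine_span.

Lemma chr_refine a : chr (F := refine) a = chr (F := F) a.
Proof.
apply/funext => t; have [[s hs <-]|nt] := pselect (tor F t).
  exact: etrans (@chrE _ _ refine a s hs) (esym (@chrE _ _ F a s hs)).
exact: etrans (@chr_out _ _ refine a t nt) (esym (@chr_out _ _ F a t nt)).
Qed.
End Refine.

Section Borel.
Variables (k : closedFieldType) (G : algGroup k) (Rp : set (G -> k)) (B : set G) (tau : anti_involution G).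
Local Notation kG := (regfun G).
Local Notation m := (@mx1 k G).
Variables (p : nat) (char_k : p \in [pchar k]) (p2 : (2 < p)%N).
Hypothesis Gc : zconnected (@setT G).
Hypothesis Gr : unipotent_radical_trivial G.
Hypothesis hB : closed_subgroup B.
Hypothesis Bc : zconnected B.

Section Frame.
Variable F : frame G.
Local Notation wt := (wt (frk F)).
Local Notation x := (@fx _ _ F).
Local Notation w := (@fw _ _ F).
Local Notation phi := (@fphi _ _ F).
Local Notation tor := (tor F).
Local Notation chr := (@chr _ _ F).
Local Notation isrt := (@isrt _ _ F).

Hypothesis hchev : chevalley tor tau.
Hypothesis hsl2 : forall a, isrt a -> exists f, sl2_root a f.
Hypothesis hmax : forall T', torus T' -> tor `<=` T' -> T' = tor.
Hypothesis torc : zclosed tor.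
Hypothesis hRp : positive_system tor Rp.
Hypothesis TB : tor `<=` B.
Hypothesis B_roots : forall alpha : G -> k, is_root B tor alpha <-> Rp (opp_char alpha).

Definition posum (a : wt) : Prop := exists2 l : seq wt, (forall b, b \in l -> Rp (chr b)) & a = \sum_(b <- l) b.

Lemma posum0 : posum 0. Proof. by exists [::]; rewrite ?big_nil. Qed.
Lemma posumD a b : posum a -> posum b -> posum (a + b).
Proof.
move=> [l hl ->] [l' hl' ->]; exists (l ++ l'); rewrite ?big_cat // => c.
by rewrite mem_cat => /orP [/hl|/hl'].
Qed.
Lemma posum1 a : Rp (chr a) -> posum a.
Proof. by move=> ha; exists [:: a]; rewrite ?big_seq1 // => b; rewrite inE => /eqP ->. Qed.

Lemma posum_anti a : posum a -> posum (- a) -> a = 0.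
Proof.
move=> [l hl el] [l' hl' el'].
have := @positive_pointed _ _ F hsl2 Rp (l ++ l') hRp; rewrite big_cat /= -el -el' subrr => /(_ _ erefl) h.
have {}h : l ++ l' = [::] by apply: h => b; rewrite mem_cat => /orP [/hl|/hl'].
by case: l h el {hl} => // _ ->; rewrite big_nil.
Qed.

Lemma total_weight_order : exists le : rel wt, [/\ reflexive le, antisymmetric le, transitive le, total le &
  forall a b, posum (b - a) -> le a b].
Proof.
have [|S [[s1 s2 s3] h t]] := @szpilrajn wt [set ab | posum (ab.2 - ab.1)].
  split=> [a|a b /= h1 h2|a b c /= h1 h2].
  - by rewrite /= subrr; apply: posum0.
  - by apply/esym/subr0_eq/posum_anti; rewrite ?opprB.
  - by rewrite -(subrK b c) -addrA; apply: posumD.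
exists (fun a b => `[< S (a, b) >]); split.
- by move=> a; apply/asboolP.
- by move=> a b /andP [/asboolP h1 /asboolP h2]; apply: s2.
- by move=> b a c /asboolP h1 /asboolP h2; apply/asboolP; apply: s3 h1 h2.
- by move=> a b; apply/orP; have [hh|hh] := t a b; [left|right]; apply/asboolP.
- by move=> a b hab; apply/asboolP; apply: h.
Qed.

Let lie_root (H : set G) i (f : kG) : isrt (w i) -> (exists D, wder H (w i) D) -> vanish H f -> delta i f = 0.
Proof.
move=> ri [D hD] hf; have [_ _ DH _ _] := hD; have [j wj Dj] := wder_index hD.
have one l l' : w l = w i -> w l' = w i -> l = l' by apply: root_mult_one hsl2 _ hchev _ char_k p2 _ _ _ ri.
have := DH f hf; rewrite (wder_delta hD) (bigD1 i) ?eqxx //= big1 ?addr0; last first.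
  by move=> l /andP [/eqP wl /eqP]; case; apply: one.
by move/eqP; rewrite mulf_eq0 -(one j i wj erefl) (negPf Dj) => /eqP.
Qed.

Lemma lie_neg i f : Rp (chr (- w i)) -> vanish B f -> delta i f = 0.
Proof.
move=> hi; have := (B_roots (chr (w i))).2; rewrite chrN => /(_ hi) /root_wder [wi hD].
by apply: lie_root => //; split=> //; exists i.
Qed.

Lemma lie_zero i f : w i = 0 -> vanish B f -> delta i f = 0.
Proof.
move=> wi hf; apply: (torus_lie hchev char_k p2 hsl2 Gc Gr hmax torc _ wi) => t /TB; exact: hf.
Qed.

(** [tau] reverses products and fixes T, so it exchanges conjugation by t with conjugation by t^-1.
    A derivation along [B] of weight minus [w i] thus becomes one along [tau] of [B] of weight
    [w i]. *)
Lemma lie_pos i f : Rp (chr (w i)) -> vanish (tau @` B) f -> delta i f = 0.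
Proof.
move=> hi; have [h1 _ _] := hRp; have /is_rootP ri := h1 _ hi.
have := (B_roots (chr (- w i))).2; rewrite chrN opprK => /(_ hi) /root_wder [_ [D [D1 D2 D3 [g hg] D4]]].
apply: lie_root => //; pose th (f : kG) : kG := RegFun (anti_reg tau (rf_reg f)).
exists (fun f => D (th f)); split.
- by move=> c u v; rewrite -D1; congr D; apply/regfunP.
- by move=> u v; have := D2 (th u) (th v); rewrite /= anti1 => <-; congr D; apply/regfunP.
- by move=> u hu; apply: D3 => b Bb; rewrite /= hu //; exists b.
- by exists (th g); rewrite (_ : th (th g) = g) //; apply/regfunP => y; rewrite /= antiK.
- move=> s u hs; have [ht _] := hchev.
  rewrite (_ : th (cnj (phi s) u) = cnj (phi (fun i => (s i)^-1)) (th u)); last first.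
    have t1 : tau (phi s) = phi s by apply/ht/tor_phi.
    have t2 : tau (phi s)^-1%g = (phi s)^-1%g by rewrite -phiV' // ht //; apply/tor_phi/GmV.
    by apply/regfunP => y; rewrite /= phiV' // invgK !antiM t1 t2 mulgA.
  rewrite D4; last exact: GmV.
  congr (_ * _); rewrite monN; last exact: GmV.
  apply: (mulfI (mon_neq0 (w i) (GmV hs))); rewrite mulfV ?mon_neq0 //; last exact: GmV.
  by rewrite -monM -(mon1 k (w i)); congr mon; apply/funext => j; rewrite mulVf ?hs.
Qed.

Lemma rootV i : [\/ Rp (chr (w i)), Rp (chr (- w i)) | w i = 0].
Proof.
have [->|wi] := eqVneq (w i) 0; first by constructor 3.
have ri : isrt (w i) by split=> //; exists i.
by have [?|?] := isrtP hRp ri; [constructor 1|constructor 2].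
Qed.

(* The closure of tau(B)B has the whole Lie algebra as its tangent space at 1. *)
Theorem big_cell_dense (f : kG) : (forall b b', B b -> B b' -> f (tau b * b')%g = 0) -> f = 0.
Proof.
move=> hf; have [[B1 BM BV] _] := hB.
pose Om := [set g | exists b b', [/\ B b, B b' & g = (tau b * b')%g]].
apply: (@dense_of_lie _ _ F _ char_k Om f Gc).
- by exists 1%g, 1%g; rewrite anti1 mulg1.
- move=> _ g i [b [b' [Bb Bb' ->]]] hg.
  pose v := rtr b' (ltr (tau b) g).
  have vB : vanish B v.
    by move=> z Bz; rewrite /= ; apply: hg; exists b, (z * b')%g; split=> //; apply: BM.
  have vtB : vanish (tau @` B) v.
    move=> _ [z Bz <-]; rewrite /= mulgA -antiM; apply: hg; exists (z * b)%g, b'.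
    by split=> //; apply: BM.
  have v0 j : delta (F := F) j v = 0.
    case: (rootV j) => h; [exact: lie_pos|exact: lie_neg|exact: lie_zero].
  have -> : ltr (tau b * b')%g g = cnj b' v.
    by apply/regfunP => z; rewrite /= -!mulgA mulVg mulg1.
  have := pder_delta F (D := fun f => delta i (cnj b' f)) _ _ v; rewrite /= => ->.
  - by rewrite big1 // => j _; rewrite v0 mulr0.
  - by move=> c u u'; rewrite cnjD cnjZ deltaD deltaZ.
  - by move=> u u'; rewrite cnjM deltaM !cnj1.
by move=> _ [b [b' [Bb Bb' ->]]]; apply: hf.
Qed.

Lemma vanish_cnj s f : Gm_pow s -> vanish B f -> vanish B (cnj (phi s) f).
Proof.
move=> hs hf b Bb; rewrite cnjE hf //; have [[B1 BM BV] _] := hB.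
by apply: (BM); [apply: BM => //|apply: BV]; apply/TB/tor_phi.
Qed.

(** A positive root is not a root of [B], so some function vanishing on [B] has a nonzero derivative
    in the direction j. A weight component of it, scaled, is congruent to [x j] by multiplicity
    one. *)
Lemma coord_in_B j : Rp (chr (w j)) -> exists y : kG,
  [/\ vanish B y, wvec phi (w j) y & ipow m 2 (y - x j)].
Proof.
move=> hj; have [h1 h2 _] := hRp; have /is_rootP rj := h1 _ hj; have wj0 := rj.1.
have [f [hf df]] : exists f, vanish B f /\ delta (F := F) j f != 0.
  apply: contrapT => no; have : is_root B tor (chr (w j)).
    apply/root_wder; split=> //; exists (delta (F := F) j).
    have [d1 d2 _ d4 d5] := delta_wder (F := F) j; split=> // f hf.
    by apply/eqP; apply: contraT => df; case: no; exists f.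
  by move/B_roots; apply: (h2 _ (h1 _ hj)).1.
have [l [H [ul hH ef]]] := wvec_decomp (@fphi_emb _ _ F) (@fphiM _ _ F) f.
have hv := vanish_ideal B.
have vH a : a \in l -> vanish B (H a).
  apply: (@wvec_split _ _ _ phi (vanish B) l H (is_ideal0 hv) _ _ _ ul (fun a _ => hH a) _ a).
  - by move=> u v hu hu'; apply: (is_idealD hv).
  - by move=> c u hu; rewrite rf_scaleE; apply: (is_idealMr _ hv).
  - by move=> s u hs; apply: (vanish_cnj hs).
  - by rewrite -ef.
have [a al da] : exists2 a, a \in l & delta (F := F) j (H a) != 0.
  apply: contrapT => no; move: df; rewrite ef delta_sum big1_seq ?eqxx // => a /andP [_ al].
  by apply/eqP; apply: contraT => da; case: no; exists a.
have wda i : delta (F := F) i (H a) != 0 -> w i = a.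
  move=> di; apply/eqP; apply: contraT => /(mon_sep k) [s hs] /negP [].
  have := delta_cnj (F := F) i (H a) hs; rewrite (_ : cnj _ _ = mon s a *: H a).
    by rewrite deltaZ => /(mulIf di) ->.
  by apply/regfunP => z; rewrite cnjE hH.
have ea := wda _ da; exists ((delta (F := F) j (H a))^-1 *: H a); split.
- by rewrite rf_scaleE; apply: (is_idealMr _ hv (vH a al)).
- by rewrite ea; apply: wvecZ.
have := deltaP F (H a); rewrite (wvec_at1 (hH a)) -?ea // rmorph0 subr0 (bigD1 j) //=.
rewrite big1 ?addr0 => [|i ij]; last first.
  have [e|di] := eqVneq (delta (F := F) i (H (w j))) 0; first by rewrite e scale0r.
  case/eqP: ij; apply: (root_mult_one hsl2 hchev char_k p2 rj) => //.
  by rewrite ea; apply: wda; rewrite -ea.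
rewrite -ea in da *; move=> /(ipowZ (delta (F := F) j (H (w j)))^-1).
by rewrite scalerBr scalerA mulVf // scale1r.
Qed.

Lemma weight_part (J : set kG) (f : kG) a (L : seq (kG * wt)) : is_ideal J ->
  (forall s u, Gm_pow s -> J u -> J (cnj (phi s) u)) -> wvec phi a f ->
  (forall y, y \in L -> wvec phi y.2 y.1) ->
  J (f - \sum_(y <- L) y.1) -> J (f - \sum_(y <- L | y.2 == a) y.1).
Proof.
move=> hJ Jc hf hL hj.
pose l' := undup [seq y.2 | y <- L]; pose F' c : kG := \sum_(y <- L | y.2 == c) y.1.
have eL : \sum_(y <- L) y.1 = \sum_(c <- l') F' c.
  exact: (@sum_by_weight (frk F) kG kG L (fun g _ => g) (fun _ _ _ => erefl) (fun _ => erefl)).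
have F'w c : wvec phi c (F' c).
  rewrite /F' big_seq_cond; apply: (big_ind (wvec phi c)); [exact: wvec0|exact: wvecD|].
  by move=> y /= /andP [/hL hy /eqP <-].
have F'0 c : c \notin l' -> F' c = 0.
  move=> cl; rewrite /F' big_seq_cond big1 // => y /andP [yL /eqP e].
  by case/negP: cl; rewrite mem_undup -e map_f.
have e1 (H : wt -> kG) : (forall c, c \notin l' -> H c = 0) ->
    \sum_(c <- undup (a :: l')) H c = \sum_(c <- l') H c + (if a \in l' then 0 else H a).
  move=> hH; rewrite /= (undup_id (undup_uniq _)); case: ifP => al; first by rewrite addr0.
  by rewrite big_cons addrC.
have e2 : \sum_(c <- undup (a :: l')) (if c == a then f else 0) = f.
  rewrite (bigD1_seq a) ?undup_uniq ?mem_undup ?mem_head //= eqxx big1 ?addr0 // => c.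
  by move=> /negPf ->.
have := @wvec_split _ _ _ phi J (undup (a :: l')) (fun c => (if c == a then f else 0) - F' c).
move=> /(_ _ _ _ _ _ _ _ a); rewrite eqxx; apply.
- exact: is_ideal0.
- by move=> *; apply: is_idealD.
- by move=> c v' hv'; rewrite rf_scaleE; apply: is_idealMr.
- exact: Jc.
- exact: undup_uniq.
- move=> c _; have h : wvec phi c (- F' c) by rewrite -scaleN1r; apply/wvecZ/F'w.
  by apply: wvecD => //; case: eqP => [->|_]; [exact: hf|exact: wvec0].
- rewrite sumrB (e1 F' F'0) -eL; case: ifP => al.
    by rewrite addr0 e2.
  by rewrite (F'0 a) ?al // addr0 e2.
by rewrite mem_undup mem_head.
Qed.

Section Adapted.
Hypothesis xB : forall j, Rp (chr (w j)) -> vanish B (x j).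

Lemma isum_stable n s u : Gm_pow s -> isum (ipow m n) (vanish B) u -> isum (ipow m n) (vanish B) (cnj (phi s) u).
Proof.
move=> hs [a [b [ha hb ->]]]; exists (cnj (phi s) a), (cnj (phi s) b); split.
- exact: cnj_ipow.
- exact: vanish_cnj.
- by rewrite cnjD.
Qed.

Let vB := vanish_ideal B.

(** Modulo functions vanishing on [B] only coordinates of zero or negative weight remain, and no
    monomial in them has weight [a]. So f vanishes on [B] to every order at 1. *)
Lemma wvec_vanish a (f : kG) : wvec phi a f -> ~ posum (- a) -> vanish B f.
Proof.
move=> hf na; apply: flat_vanish => // n.
pose P0 := [pred j : 'I_(fdim F) | ~~ `[< Rp (chr (w j)) >]].
pose em (l : 'I_#|P0|) : 'I_(fdim F) := enum_val l.
have emI : injective em by apply: enum_val_inj.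
have ho : forall j, (forall l, em l != j) -> vanish B (x j).
  move=> j h; apply: xB; apply: contrapT => nR.
  have jP : j \in P0 by rewrite inE; apply/asboolPn.
  by have := h (enum_rank_in jP j); rewrite /em enum_rankK_in ?eqxx.
have hJ : is_ideal (isum (ipow m n) (vanish B)) by apply: isum_ideal => //; apply: m_ideal.
have [|P [_ hP]] := @sub_expand _ _ F _ em (vanish B) emI vB ho 0 n f.
  by apply: isum_l.
pose L : seq (kG * wt) := [seq (rf_const G P@_b * mmap1 (fun l => x (em l)) b, \sum_l w (em l) *+ b l) | b <- msupp P].
have := @weight_part _ f a L hJ (@isum_stable n) hf _ _; rewrite big_map; move=> /(_ _ hP).
have -> : \sum_(y <- L | y.2 == a) y.1 = 0; last first.
  rewrite subr0; apply=> _ /mapP [b _ ->] /=; rewrite -rf_scaleE; apply: wvecZ; apply: wvec_prod => l; apply: wvecX.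
  exact: fxw.
rewrite big_map big_pred0 // => b /=; apply/negP => /eqP e; apply: na; rewrite -e -sumrN.
apply: (big_ind posum); [exact: posum0|exact: posumD|move=> l _].
rewrite -mulNrn; elim: (b l) => [|i IH]; first by rewrite mulr0n; apply: posum0.
rewrite mulrS; apply: posumD => //; have := enum_valP l; rewrite inE => /asboolPn nR.
case: (rootV (em l)) => [/nR //|/posum1 //|->]; rewrite oppr0; exact: posum0.
Qed.

(** Modulo the coordinates of nonzero weight, f is a polynomial in those of weight 0, and it is zero
    to any order by smoothness of T. In the remaining sum of h_j x_j only parts of total weight 0
    count: if [x j] has positive weight it vanishes on [B], otherwise h_j has positive weight and
    vanishes there. *)
Lemma wvec0_vanish (f : kG) : wvec phi 0 f -> vanish tor f -> vanish B f.
Proof.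
move=> hf fT; apply: flat_vanish => // N.
pose P0 := [pred j : 'I_(fdim F) | w j == 0].
pose em (l : 'I_#|P0|) : 'I_(fdim F) := enum_val l.
have emI : injective em by apply: enum_val_inj.
pose I' : set kG := [set v | exists (h : 'I_(fdim F) -> kG) (u : kG), vanish B u /\
  v = \sum_(j | w j != 0) h j * x j + u].
have hI : is_ideal I'.
  split=> [|u v [h [u' [hu ->]]] [h' [v' [hv ->]]]|a v [h [u [hu ->]]]].
  - exists (fun=> 0), 0; split; first exact: (is_ideal0 vB).
    by rewrite big1 ?addr0 // => j _; rewrite mul0r.
  - exists (fun j => h j + h' j), (u' + v'); split; first exact: (is_idealD vB hu hv).
    by under [in RHS]eq_bigr do rewrite mulrDl; rewrite big_split addrACA.
  - exists (fun j => a * h j), (a * u); split; first exact: (is_idealMr a vB hu).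
    by rewrite mulrDr mulr_sumr; under eq_bigr do rewrite mulrA.
have xT j : w j != 0 -> vanish tor (x j).
  move=> wj _ [s hs <-]; have [s' hs' h] := mon_sep k wj.
  have := fxw (f := F) j (phi s) hs'; rewrite -!fphiM //.
  rewrite (_ : (fun i => s' i * s i) = (fun i => s i * s' i)); last by apply/funext => i; rewrite mulrC.
  rewrite fphiM // mulgK -{1}[x j _]mul1r => /eqP; rewrite -subr_eq0 -mulrBl mulf_eq0 subr_eq0.
  by rewrite eq_sym -(mon0 s') (negPf h) => /eqP.
have ho : forall (I : set kG), (forall j, w j != 0 -> I (x j)) -> forall j, (forall l, em l != j) -> I (x j).
  move=> I hh j h; apply: hh; apply: contraT; rewrite negbK => jP.
  by have := h (enum_rank_in (A := P0) jP j); rewrite /em enum_rankK_in ?eqxx.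
have I'T : I' `<=` vanish tor.
  move=> _ [h [u [hu ->]]] t tt; rewrite rfD rf_sum big1 ?add0r => [|j /xT h']; last first.
    by rewrite rfM h' ?mulr0.
  by apply/hu/TB.
have xI' j : w j != 0 -> I' (x j).
  move=> wj; exists (fun l => (l == j)%:R), 0; split; first exact: (is_ideal0 vB).
  rewrite addr0 (bigD1 j) //= eqxx mul1r big1 ?addr0 // => l /andP [_ /negPf ->].
  by rewrite mul0r.
have vT := vanish_ideal tor.
have [|P [hP e]] := @sub_expand _ _ F _ em I' emI hI (ho _ xI') 0 N f.
  exact: (isum_l hI).
have P_0 : P = 0.
  case: N e hP => [|N] e hP.
    by apply/mpolyP => b; rewrite mcoeff0; apply: memN_msupp_eq0; apply/negP => /hP.
  apply/mpolyP => b; rewrite mcoeff0; have [bP|/memN_msupp_eq0 //] := boolP (b \in msupp P).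
  apply: (@sub_smooth _ _ F _ char_k _ em (vanish tor) emI vT (ho _ xT) _ _ _ N P).
  - exact: kG_reduced.
  - move=> l v; apply: vanish_lder => y g ty hg.
    apply: (torus_lie hchev char_k p2 hsl2 Gc Gr hmax torc).
      by move=> t tt; rewrite /= hg //; apply: tor_mul.
    by apply/eqP; have := enum_valP l.
  - by move=> v; apply; apply: tor1.
  - have [a [b' [ha /I'T hb eab]]] := e; exists (- a), (f - b'); split.
    + by rewrite -scaleN1r; apply: ipowZ.
    + exact: (is_idealB vT fT hb).
    + by rewrite -[mmap _ _ _](subKr f) eab opprD addrCA.
  by have /andP [_] := hP _ bP; rewrite ltnS.
have [u [v [hu [h [u' [hu' ev]]] ef]]] := e; rewrite P_0 rmorph0 subr0 in ef.
have /choice [H hH] : forall j, exists L : seq (kG * wt), (forall y, y \in L -> wvec phi y.2 y.1) /\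
    h j = \sum_(y <- L) y.1.
  move=> j; have [l [H [ul hH ->]]] := wvec_decomp (@fphi_emb _ _ F) (@fphiM _ _ F) (h j).
  exists [seq (H a, a) | a <- l]; rewrite big_map; split=> // _ /mapP [a _ ->] /=.
  exact: hH.
pose L : seq (kG * wt) := flatten [seq [seq (y.1 * x j, y.2 + w j) | y <- H j] | j <- enum [pred j | w j != 0]].
have hJ : is_ideal (isum (ipow m N) (vanish B)) by apply: isum_ideal => //; apply: m_ideal.
have LP y : y \in L -> exists j z, [/\ w j != 0, z \in H j & y = (z.1 * x j, z.2 + w j)].
  move=> /flattenP [z0 /mapP [j]]; rewrite mem_enum inE => wj -> /mapP [z hz ->].
  by exists j, z.
have eL : \sum_(y <- L) y.1 = \sum_(j | w j != 0) h j * x j.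
  rewrite big_flatten big_map big_enum; apply: eq_bigr => j _.
  by rewrite big_map /= (hH j).2 mulr_suml.
have := @weight_part _ f 0 L hJ (@isum_stable N) hf _ _.
have wL y : y \in L -> wvec phi y.2 y.1.
  move=> /LP [j [z [wj zH ->]]] /= s g hs; rewrite !rfM ((hH j).1 _ zH) // fxw // monD //.
  by rewrite mulrACA.
move=> /(_ wL); rewrite eL ef ev => /(_ _) hh.
have {}hh : isum (ipow m N) (vanish B) (f - \sum_(y <- L | y.2 == 0) y.1).
  by rewrite ef ev; apply: hh; rewrite addrA addrAC addrK; exists u, u'.
suff : isum (ipow m N) (vanish B) f by rewrite ef ev.
rewrite -[f](subrK (\sum_(y <- L | y.2 == 0) y.1)); apply: is_idealD => //.
rewrite big_seq_cond; apply: is_ideal_sum => // y /andP [yL /eqP y0].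
apply: isum_r; first exact: m_ideal.
have [j [z [wj zH ey]]] := LP y yL; move: y0; rewrite ey /= => /eqP; rewrite addr_eq0 => /eqP z2.
case: (rootV j) => hj.
- by apply: (is_idealMr _ vB); apply: xB.
- rewrite mulrC; apply: (is_idealMr _ vB); apply: (wvec_vanish ((hH j).1 _ zH)).
  rewrite z2 opprK => hp; have := posum_anti hp (posum1 hj).
  by apply/eqP.
- by rewrite hj eqxx in wj.
Qed.

End Adapted.

(** f is homogeneous only on [B]; its component of weight [a] on the whole group has the same
    restriction to [B]. *)
Lemma homog_lift (f : kG) a : (forall s b, Gm_pow s -> B b -> f (phi s * b * (phi s)^-1)%g = mon s a * f b) ->
  exists2 g, wvec phi a g & forall b, B b -> g b = f b.
Proof.
move=> hf; have [l [H [ul hH ef]]] := wvec_decomp (@fphi_emb _ _ F) (@fphiM _ _ F) f.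
pose g : kG := if a \in l then H a else 0.
exists g; first by rewrite /g; case: ifP => // _; apply: wvec0.
move=> b Bb; have h0 : forall c, c \in undup (a :: l) -> (if c \in l then H c b else 0) - (if c == a then f b else 0) = 0.
  apply: (@mon_indep k (frk F) (undup (a :: l)) (fun c => (if c \in l then H c b else 0) - (if c == a then f b else 0))).
    exact: undup_uniq.
  move=> s hs; under eq_bigr do rewrite mulrBl; rewrite sumrB.
  apply/eqP; rewrite subr_eq0; apply/eqP; transitivity (f (phi s * b * (phi s)^-1)%g).
    rewrite ef rf_sum; under [RHS]eq_bigr do rewrite hH //.
    have E : \sum_(c <- l) mon s c * H c b = \sum_(c <- l) (if c \in l then H c b else 0) * mon s c.
      by apply: eq_big_seq => c ->; rewrite mulrC.
    rewrite E /= (undup_id ul); case: ifP => // al.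
    by rewrite big_cons al mul0r add0r.
  rewrite hf //; have E c : (if c == a then f b else 0) * mon s c = if c == a then mon s a * f b else 0.
    by case: eqP => [->|_]; rewrite ?mul0r // mulrC.
  under [RHS]eq_bigr do rewrite E.
  rewrite (bigD1_seq a) ?undup_uniq ?mem_undup ?mem_head //= eqxx big1 ?addr0 // => c.
  by move=> /negPf ->.
have := h0 a; rewrite mem_undup mem_head eqxx => /(_ isT) /eqP; rewrite subr_eq0 => /eqP <-.
by rewrite /g; case: ifP.
Qed.

End Frame.

Lemma refined (F : frame G) : chevalley (tor F) tau ->
  (forall a, isrt (F := F) a -> exists f, sl2_root (F := F) a f) ->
  positive_system (tor F) Rp -> tor F `<=` B ->
  (forall alpha : G -> k, is_root B (tor F) alpha <-> Rp (opp_char alpha)) ->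
  exists (x' : 'I_(fdim F) -> kG) (x'1 : forall i, x' i 1%g = 0) (x'w : forall i, wvec (@fphi _ _ F) (fw i) (x' i))
    (x'x : forall i, ipow m 2 (x' i - fx i)), forall i, Rp (chr (F := F) (fw i)) -> vanish B (x' i).
Proof.
move=> h1 h2 h3 h4 h5.
have /choice [x' hx] : forall j, exists y : kG, [/\ wvec (@fphi _ _ F) (fw j) y, ipow m 2 (y - fx j) &
    Rp (chr (F := F) (fw j)) -> vanish B y].
  move=> j; have [hj|nj] := pselect (Rp (chr (F := F) (fw j))).
    by have [y [y1 y2 y3]] := coord_in_B h1 h2 h3 h4 h5 hj; exists y.
  exists (fx j); split=> //; first exact: fxw.
  by rewrite subrr; apply: (is_ideal0 (@m_ideal k G 2)).
have x'1 j : x' j 1%g = 0.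
  have [_ /(ipow_sub_ideal (mx1_ideal G)) h _] := hx j.
  by move: h; rewrite /mx1 /= fx1 subr0.
by exists x', x'1, (fun j => let: And3 a _ _ := hx j in a), (fun j => let: And3 _ a _ := hx j in a) => i hi; have [_ _] := hx i; apply.
Qed.

Section Main.
Variable F : frame G.
Local Notation wt := (wt (frk F)).
Local Notation phi := (@fphi _ _ F).
Local Notation tor := (tor F).
Hypothesis hchev : chevalley tor tau.
Hypothesis hsl2 : forall a, isrt (F := F) a -> exists f, sl2_root a f.
Hypothesis hmax : forall T', torus T' -> tor `<=` T' -> T' = tor.
Hypothesis torc : zclosed tor.
Hypothesis hRp : positive_system tor Rp.
Hypothesis TB : tor `<=` B.
Hypothesis B_roots : forall alpha : G -> k, is_root B tor alpha <-> Rp (opp_char alpha).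

Theorem B_weight (f : kG) a b : (forall s b, Gm_pow s -> B b -> f (phi s * b * (phi s)^-1)%g = mon s a * f b) ->
  ~ posum (F := F) (- a) -> B b -> f b = 0.
Proof.
move=> /homog_lift [g hg eg] na Bb; rewrite -eg //.
have [x' [x'1 [x'w [x'x hx]]]] := refined hchev hsl2 hRp TB B_roots.
have hx' i : Rp (chr (F := refine x'1 x'w x'x) (fw i)) -> vanish B (x' i) by rewrite chr_refine; apply: hx.
have na' : ~ posum (F := refine x'1 x'w x'x) (- a).
  move=> [l hl el]; apply: na; exists l => // c /hl; by rewrite chr_refine.
have h : vanish B g := @wvec_vanish (refine x'1 x'w x'x) hRp TB hx' a g hg na'.
exact: h.
Qed.

Theorem B_weight0 (f : kG) b : (forall s b, Gm_pow s -> B b -> f (phi s * b * (phi s)^-1)%g = f b) ->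
  vanish tor f -> B b -> f b = 0.
Proof.
move=> hf fT Bb; have [|g hg eg] := @homog_lift F f 0.
  by move=> s b' hs Bb'; rewrite hf // mon0 mul1r.
rewrite -eg //; have [x' [x'1 [x'w [x'x hx]]]] := refined hchev hsl2 hRp TB B_roots.
have gT : vanish tor g by move=> t tt; rewrite eg ?fT //; apply: TB.
have hs' a : isrt (F := refine x'1 x'w x'x) a -> exists f, sl2_root (F := refine x'1 x'w x'x) a f.
  move=> ha; have [f' [hf' hf2]] := @hsl2 a ha; exists f'; split=> //.
  by rewrite chr_refine.
have hx' i : Rp (chr (F := refine x'1 x'w x'x) (fw i)) -> vanish B (x' i) by rewrite chr_refine; apply: hx.
have h : vanish B g := @wvec0_vanish (refine x'1 x'w x'x) hchev hs' hmax torc hRp TB hx' g hg gT.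
exact: h.
Qed.
End Main.

End Borel.

#[global] Arguments gact {k G M} g : rename.

Lemma mklin (k : fieldType) (U V : vectType k) (f : U -> V) :
  (forall a u v, f (a *: u + v) = a *: f u + f v) -> exists L : 'Hom(U, V), forall v, L v = f v.
Proof.
move=> h; pose g : {linear U -> V} := HB.pack f (GRing.isLinear.Build k U V _ f h).
by exists (linfun g) => v; rewrite lfunE.
Qed.

Lemma dual_sep (k : fieldType) (V : vectType k) (v : V) :
  (forall th : 'Hom(V, k^o), th v = 0) -> v = 0.
Proof.
move=> h; rewrite (coord_vbasis (memvf v)) big1 // => i _.
have := h (linfun (coord (vbasis fullv) i : V -> k^o)); rewrite lfunE /= => ->.
by rewrite scale0r.
Qed.

Lemma dual_sep_vspace (k : fieldType) (V : vectType k) (W : {vspace V}) (v : V) :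
  (forall th : 'Hom(V, k^o), (forall w, w \in W -> th w = 0) -> th v = 0) -> v \in W.
Proof.
move=> h; suff : v - projv W v = 0 by move/eqP; rewrite subr_eq0 => /eqP ->; apply: memv_proj.
apply: dual_sep => th; have := h (th \o (\1 - projv W))%VF; rewrite comp_lfunE !lfun_simp; apply.
by move=> w ww; rewrite comp_lfunE !lfun_simp /= projv_id // subrr linear0.
Qed.

(** * Modules *)

Section Weights.
Variables (k : closedFieldType) (G : algGroup k) (F : frame G).
Local Notation kG := (regfun G).
Local Notation wt := (wt (frk F)).
Local Notation phi := (@fphi _ _ F).
Implicit Types (M N : Gmodule G).

Definition mc M (th : 'Hom(M, k^o)) (v : M) : kG := RegFun (gact_reg th v).

Lemma vindep (V : vectType k) (l : seq wt) (u : wt -> V) : uniq l ->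
  (forall s, Gm_pow s -> \sum_(a <- l) mon s a *: u a = 0) -> forall a, a \in l -> u a = 0.
Proof.
move=> ul h a al; apply: dual_sep => th; apply: (mon_indep (c := fun a => th (u a)) ul _ al) => s hs.
have := congr1 th (h s hs); rewrite linear0 linear_sum => e; apply: etrans e.
by apply: eq_bigr => b _; rewrite linearZ mulrC.
Qed.

Lemma weight_sums_eq (V : vectType k) (l l' : seq wt) (u u' : wt -> V) : uniq l -> uniq l' ->
  (forall a, a \notin l -> u a = 0) -> (forall a, a \notin l' -> u' a = 0) ->
  (forall s, Gm_pow s -> \sum_(a <- l) mon s a *: u a = \sum_(a <- l') mon s a *: u' a) ->
  forall a, u a = u' a.
Proof.
move=> ul ul' h h' e a; pose L := undup (l ++ l').
have ext (m : seq wt) (v : wt -> V) s : uniq m -> (forall a, a \in m -> a \in L) ->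
    (forall a, a \notin m -> v a = 0) -> \sum_(a <- m) mon s a *: v a = \sum_(a <- L) mon s a *: v a.
  move=> um mL v0; rewrite [RHS](bigID (mem m)) /= [X in _ + X]big1 ?addr0; last first.
    by move=> b bm; rewrite v0 ?scaler0.
  rewrite -[RHS]big_filter; apply: perm_big; apply: uniq_perm; rewrite ?filter_uniq ?undup_uniq // => b.
  by rewrite mem_filter /=; case: (boolP (b \in m)) => // /mL ->.
have aL b : b \in l -> b \in L by move=> hb; rewrite mem_undup mem_cat hb.
have aL' b : b \in l' -> b \in L by move=> hb; rewrite mem_undup mem_cat hb orbT.
have [La|nLa] := boolP (a \in L); last first.
  rewrite h ?h' //; apply: contra nLa; [exact: aL'|exact: aL].
apply/eqP; rewrite -subr_eq0; apply/eqP.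
apply: (vindep (u := fun a => u a - u' a) (undup_uniq _) _ La) => s hs.
under eq_bigr do rewrite scalerBr; rewrite sumrB -(ext l) // -(ext l') // e //.
by rewrite subrr.
Qed.

(** The list may contain exponents with zero projection. Off the list the projection is 0, so that
    it is defined for all weights. *)
Lemma wp_ex M : exists (lf : seq wt * (wt -> 'End(M))), [/\ uniq lf.1,
  forall s v, Gm_pow s -> gact (phi s) v = \sum_(a <- lf.1) mon s a *: lf.2 a v &
  forall a v, a \notin lf.1 -> lf.2 a v = 0].
Proof.
pose e := vbasis (fullv : {vspace M}); pose d := \dim (fullv : {vspace M}).
pose xi (i : 'I_d) : 'Hom(M, k^o) := linfun (coord e i : M -> k^o).
have [_ hreg _] := @fphi_emb _ _ F.
have [|l [C [ul hC]]] := @laurent_family k (frk F) ('I_d * 'I_d)%type (fun ij s => mc (xi ij.1) e`_ij.2 (phi s)).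
  by move=> [i j]; exact: (hreg _ (gact_reg (xi i) e`_j)).
have /choice [f hf] : forall a, exists L : 'End(M), forall v,
    L v = \sum_i (\sum_j C (i, j) a * coord e j v) *: e`_i.
  move=> a; apply: mklin => c u v; rewrite scaler_sumr -big_split; apply: eq_bigr => i _ /=.
  rewrite scalerA mulr_sumr -scalerDl -big_split; congr (_ *: _); apply: eq_bigr => j _ /=.
  by rewrite linearP /=; ring.
exists (l, fun a => if a \in l then f a else 0); split=> //= [s v hs|a v /negPf ->]; last by rewrite lfunE.
have -> : \sum_(a <- l) mon s a *: (if a \in l then f a else 0) v = \sum_(a <- l) mon s a *: f a v.
  by apply: eq_big_seq => a ->.
rewrite (coord_vbasis (memvf (gact (phi s) v))).
under [RHS]eq_bigr do rewrite hf scaler_sumr; rewrite exchange_big; apply: eq_bigr => i _.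
under [RHS]eq_bigr do rewrite scalerA; rewrite -scaler_suml; congr (_ *: _).
rewrite {1}(coord_vbasis (memvf v)) linear_sum linear_sum /=.
under [RHS]eq_bigr do rewrite mulr_sumr; rewrite exchange_big; apply: eq_bigr => j _ /=.
rewrite !linearZ /= -/e; have := hC (i, j) s hs; rewrite /= lfunE /= => ->.
by rewrite mulr_sumr; apply: eq_bigr => a _; ring.
Qed.

Definition wts M : seq wt := (projT1 (cid (wp_ex M))).1.
Definition wp M (a : wt) : 'End(M) := (projT1 (cid (wp_ex M))).2 a.
Arguments wp {M} a.

Lemma uniq_wts M : uniq (wts M).
Proof. by rewrite /wts; case: cid => lf []. Qed.

Lemma wpE M s (v : M) : Gm_pow s -> gact (phi s) v = \sum_(a <- wts M) mon s a *: wp a v.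
Proof. by have [_ h _] := projT2 (cid (wp_ex M)); apply: h. Qed.

Lemma wp_out M a (v : M) : a \notin wts M -> wp a v = 0.
Proof. by have [_ _ h] := projT2 (cid (wp_ex M)); apply: h. Qed.

Lemma wp_uniq M (l : seq wt) (u : wt -> M) (v : M) : uniq l -> (forall a, a \notin l -> u a = 0) ->
  (forall s, Gm_pow s -> gact (phi s) v = \sum_(a <- l) mon s a *: u a) -> forall a, wp a v = u a.
Proof.
move=> ul hu h; apply: (weight_sums_eq (uniq_wts M) ul) => // [a|s hs]; first exact: wp_out.
by rewrite -h // wpE.
Qed.

Lemma wp_hom M N (f : 'Hom(M, N)) (v : M) :
  (forall s, Gm_pow s -> f (gact (phi s) v) = gact (phi s) (f v)) -> forall a, wp a (f v) = f (wp a v).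
Proof.
move=> h; apply: (wp_uniq (uniq_wts M)) => [a /wp_out ->|s hs]; first by rewrite linear0.
by rewrite -h // wpE // linear_sum; apply: eq_bigr => a _; rewrite linearZ.
Qed.

Lemma wp_sum M (v : M) : \sum_(a <- wts M) wp a v = v.
Proof.
have := wpE v (@Gm1 k (frk F)); rewrite phi1' gact1 id_lfunE => e; rewrite [RHS]e.
by apply: eq_bigr => a _; rewrite mon1 scale1r.
Qed.

Lemma wp_eq M (u v : M) : (forall a, wp a u = wp a v) -> u = v.
Proof. by move=> h; rewrite -(wp_sum u) -(wp_sum v); apply: eq_bigr. Qed.

Lemma wp_act M a s (v : M) : Gm_pow s -> wp a (gact (phi s) v) = gact (phi s) (wp a v).
Proof.
move=> hs; apply: wp_hom => s' hs'; rewrite -!comp_lfunE -!gactM -!fphiM //.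
by congr (gact (phi _) v); apply/funext => i; rewrite mulrC.
Qed.

Lemma wp_phi M a s (v : M) : Gm_pow s -> gact (phi s) (wp a v) = mon s a *: wp a v.
Proof.
move=> hs; rewrite -wp_act //.
apply: (wp_uniq (u := fun a => mon s a *: wp a v) (uniq_wts M)) => [b /wp_out ->|s' hs'].
  by rewrite scaler0.
rewrite -comp_lfunE -gactM -fphiM // wpE; last exact: GmM.
by apply: eq_bigr => b _; rewrite monM scalerA.
Qed.

Lemma wp_wp M a b (v : M) : wp a (wp b v) = if a == b then wp b v else 0.
Proof.
apply: (wp_uniq (u := fun a => if a == b then wp b v else 0) (l := [:: b])) => // [c|s hs].
  by rewrite inE => /negPf ->.
by rewrite big_seq1 eqxx wp_phi.
Qed.

Definition gstable M (V : {vspace M}) := forall (g : G) v, v \in V -> gact g v \in V.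

Lemma wp_stable M (V : {vspace M}) a v : gstable V -> v \in V -> wp a v \in V.
Proof.
move=> hV vV; have [al|/wp_out ->] := boolP (a \in wts M); last exact: mem0v.
apply: dual_sep_vspace => th hth.
apply: (mon_indep (c := fun a => th (wp a v)) (uniq_wts M) _ al) => s hs.
have := hth _ (hV (phi s) _ vV); rewrite wpE // linear_sum => e; apply: etrans e.
by apply: eq_bigr => b _; rewrite linearZ mulrC.
Qed.

Variable tau : anti_involution G.
Hypothesis tau_phi : forall s, Gm_pow s -> tau (phi s) = phi s.

Lemma tdualE M (g : G) (th : tdual tau M) (v : M) : (gact g th : 'Hom(M, k^o)) v = (th : 'Hom(M, k^o)) (gact (tau g) v).
Proof. by rewrite /= dual_actE comp_lfunE. Qed.

Lemma wp_tdual M a (th : tdual tau M) (v : M) : (wp a th : 'Hom(M, k^o)) v = (th : 'Hom(M, k^o)) (wp a v).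
Proof.
rewrite (wp_uniq (M := tdual tau M) (u := fun a => ((th : 'Hom(M, k^o)) \o wp a)%VF) (uniq_wts M)).
- by rewrite comp_lfunE.
- by move=> b hb; apply/lfunP => w; rewrite comp_lfunE wp_out // linear0 lfunE.
move=> s hs; apply/lfunP => w; rewrite tdualE tau_phi // wpE // linear_sum sum_lfunE.
by apply: eq_bigr => b _; rewrite linearZ scale_lfunE comp_lfunE.
Qed.

Variables (B : set G) (le : rel wt).
Hypothesis B_le : forall (f : kG) a c b,
  (forall s b, Gm_pow s -> B b -> f (phi s * b * (phi s)^-1)%g = mon s (a - c) * f b) ->
  B b -> f b != 0 -> le a c.
Hypothesis B_diag : forall (f : kG) b,
  (forall s b, Gm_pow s -> B b -> f (phi s * b * (phi s)^-1)%g = f b) ->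
  vanish (tor F) f -> B b -> f b = 0.
Hypothesis B1 : B 1%g.
Hypothesis BM : forall x y, B x -> B y -> B (x * y)%g.
Hypothesis BV : forall x, B x -> B x^-1%g.
Hypothesis Bphi : forall s, Gm_pow s -> B (phi s).

Lemma monV (s : 'I_(frk F) -> k) a : Gm_pow s -> mon (fun i => (s i)^-1) a = (mon s a)^-1.
Proof.
move=> hs; apply: (mulfI (mon_neq0 a hs)); rewrite mulfV ?mon_neq0 //.
by rewrite -monM -(mon1 k a); congr mon; apply/funext => i; rewrite mulfV ?hs.
Qed.

Lemma phi_inv s M (v : M) a : Gm_pow s -> gact (phi s)^-1%g (wp a v) = (mon s a)^-1 *: wp a v.
Proof. by move=> hs; rewrite -phiV' // wp_phi ?monV //; apply: GmV. Qed.

Lemma coef_conj M (th : 'Hom(M, k^o)) a c (v : M) s (g : G) : Gm_pow s ->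
  mc (th \o wp a)%VF (wp c v) (phi s * g * (phi s)^-1)%g = mon s (a - c) * mc (th \o wp a)%VF (wp c v) g.
Proof.
move=> hs; rewrite /= !gactM !comp_lfunE phi_inv // !linearZ /=.
by rewrite wp_act // wp_phi // linearZ scalerA mulrC -monN // -monD.
Qed.

(** The matrix coefficient from weight c to weight a has weight a - c under conjugation, so it
    vanishes on [B] unless a <= c. *)
Lemma B_triangular M a c b (v : M) : B b -> wp a (gact b (wp c v)) != 0 -> le a c.
Proof.
move=> Bb ne; have [th hth] : exists th : 'Hom(M, k^o), th (wp a (gact b (wp c v))) != 0.
  apply: contrapT => no; case/eqP: ne; apply: dual_sep => th.
  by apply/eqP; apply: contraT => h; case: no; exists th.
apply: (B_le (f := mc (th \o wp a)%VF (wp c v)) (b := b)) => //; last by rewrite /= comp_lfunE.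
by move=> s g hs _; apply: coef_conj.
Qed.

Lemma B_triangular_tau M a c b (v : M) : B b -> wp a (gact (tau b) (wp c v)) != 0 -> le c a.
Proof.
move=> Bb ne; have [th hth] : exists th : 'Hom(M, k^o), th (wp a (gact (tau b) (wp c v))) != 0.
  apply: contrapT => no; case/eqP: ne; apply: dual_sep => th.
  by apply/eqP; apply: contraT => h; case: no; exists th.
apply: (@B_triangular (tdual tau M) c a b th Bb); apply: contra hth => /eqP e; apply/eqP.
have := congr1 (fun f : tdual tau M => (f : 'Hom(M, k^o)) v) e.
by rewrite wp_tdual tdualE wp_tdual => ->; apply: zero_lfunE.
Qed.

Variables (a : wt) (chi : G -> k).
Hypothesis hchi : character B chi.
Hypothesis chi_phi : forall s, Gm_pow s -> chi (phi s) = mon s a.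

Lemma chi_neq0 b : B b -> chi b != 0.
Proof.
case: hchi => _ _ c1 cM Bb; apply/eqP => e; have := cM _ _ Bb (BV Bb).
by rewrite mulgV c1 e mul0r => /eqP; rewrite oner_eq0.
Qed.

Lemma chiV b : B b -> chi b^-1%g = (chi b)^-1.
Proof.
case: (hchi) => _ _ c1 cM Bb; apply: (mulfI (chi_neq0 Bb)).
by rewrite -cM ?mulgV ?c1 ?mulfV ?chi_neq0 //; apply: BV.
Qed.

(** The difference of the two sides, paired with a functional, is a function of weight 0 on [B] that
    vanishes on T. *)
Lemma B_diagonal M b (v : M) : B b -> wp a (gact b (wp a v)) = chi b *: wp a v.
Proof.
move=> Bb; apply: subr0_eq; apply: dual_sep => th; rewrite linearB linearZ /=.
case: (hchi) => -[h rh eh] _ c1 cM.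
pose f := mc (th \o wp a)%VF (wp a v) - @rf_scale k G (th (wp a v)) (RegFun rh).
have fE g : B g -> f g = th (wp a (gact g (wp a v))) - chi g * th (wp a v).
  by move=> Bg; rewrite rfB /= comp_lfunE -eh // mulrC.
rewrite -fE //; apply: B_diag => // [s g hs Bg|_ [s hs <-]].
  have Bs := Bphi hs; have Bg' : B (phi s * g * (phi s)^-1)%g by apply: (BM) (BM Bs Bg) (BV Bs).
  have ec : chi (phi s * g * (phi s)^-1)%g = chi g.
    rewrite cM; [|exact: BM Bs Bg|exact: BV Bs].
    by rewrite cM // chiV // mulrAC mulfV ?chi_neq0 // mul1r.
  rewrite (fE _ Bg') (fE _ Bg) ec; congr (_ - _).
  by have := coef_conj th a a v g hs; rewrite subrr mon0 mul1r /= !comp_lfunE.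
rewrite fE; last exact: Bphi.
by rewrite wp_phi // linearZ linearZ /= wp_wp eqxx chi_phi // subrr.
Qed.

Lemma B_diagonal_tau M b (v : M) : B b -> wp a (gact (tau b) (wp a v)) = chi b *: wp a v.
Proof.
move=> Bb; apply: subr0_eq; apply: dual_sep => th.
have := @B_diagonal (tdual tau M) b th Bb => /(congr1 (fun f : tdual tau M => (f : 'Hom(M, k^o)) v)).
rewrite wp_tdual tdualE wp_tdual scale_lfunE wp_tdual linearB linearZ /= => ->.
by rewrite subrr.
Qed.

End Weights.
Arguments wp {k G F M} a.

Lemma vspace_of (k : fieldType) (V : vectType k) (P : set V) : P 0 ->
  (forall c u v, P u -> P v -> P (c *: u + v)) -> exists W : {vspace V}, forall v, v \in W <-> P v.
Proof.
move=> P0 PD; pose Q (n : nat) := `[< exists2 W : {vspace V}, \dim W = n & forall v, v \in W -> P v >].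
have Q0 : exists n, Q n.
  exists 0%N; apply/asboolP; exists 0%VS; first by rewrite dimv0.
  by move=> v; rewrite memv0 => /eqP ->.
have Qb n : Q n -> (n <= \dim {:V})%N.
  by move=> /asboolP [W <- _]; apply/dimvS/subvf.
have [n /asboolP [W dW hW] maxn] := ex_maxnP Q0 Qb.
exists W => v; split=> [/hW //|Pv]; apply: contraT => vW.
have : Q (\dim (<[v]> + W)%VS).
  apply/asboolP; exists (<[v]> + W)%VS => // u /memv_addP [x /vlineP [c ->] [y yW ->]].
  by apply: PD => //; apply: hW.
move=> /maxn; rewrite -dW => h; move: vW.
have [_ e] := dimv_leqif_eq (addvSr <[v]> W).
have /eqP eW : W == (<[v]> + W)%VS by rewrite -e eqn_leq h dimvS ?addvSr.
by case/negP; rewrite eW; apply: (subvP (addvSl _ _)); apply: memv_line.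
Qed.

Lemma glue0 (k : fieldType) (V N : vectType k) (S D : {vspace V}) (f : 'Hom(V, N)) :
  (forall v, v \in S -> v \in D -> f v = 0) ->
  exists f' : 'Hom(V, N), (forall v, v \in S -> f' v = f v) /\ (forall v, v \in D -> f' v = 0).
Proof.
move=> h; exists (f \o addv_pi1 S D)%VF; split=> v hv; rewrite comp_lfunE.
  have e : addv_pi1 S D v + addv_pi2 S D v = v by apply: addv_pi1_pi2; apply: (subvP (addvSl S D)).
  have h1 : addv_pi1 S D v \in S by apply: memv_pi1.
  have h2 : addv_pi2 S D v \in D by apply: memv_pi2.
  rewrite -[in RHS]e [RHS]linearD /= (h (addv_pi2 S D v)) ?addr0 //.
  by rewrite -[addv_pi2 S D v](addKr (addv_pi1 S D v)) e memvD // memvN.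
have e : addv_pi1 S D v + addv_pi2 S D v = v by apply: addv_pi1_pi2; apply: (subvP (addvSr S D)).
suff -> : addv_pi1 S D v = 0 by rewrite linear0.
by apply: (addIr v); rewrite add0r -{2}(addv_pi2_id S hv).
Qed.

Lemma reflexive_dual (k : fieldType) (N : vectType k) (V : vectType k) (J : V -> 'Hom(N, k^o) -> k) :
  (forall v c x y, J v (c *: x + y) = c * J v x + J v y) ->
  (forall x c u v, J (c *: u + v) x = c * J u x + J v x) ->
  exists h : 'Hom(V, N), forall v (x : 'Hom(N, k^o)), x (h v) = J v x.
Proof.
move=> J1 J2; pose e := vbasis (fullv : {vspace N}).
pose xi i : 'Hom(N, k^o) := linfun (coord e i : N -> k^o).
have J0 v : J v 0 = 0.
  by apply: (addrI (J v 0)); rewrite addr0; have := J1 v 1 0 0; rewrite scale1r addr0 mul1r.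
have [|h hh] := @mklin k V N (fun v => \sum_i J v (xi i) *: e`_i).
  move=> c u v; rewrite scaler_sumr -big_split; apply: eq_bigr => i _ /=.
  by rewrite J2 scalerDl scalerA.
exists h => v x; rewrite hh linear_sum.
have hx : x = \sum_(i < \dim (fullv : {vspace N})) x e`_i *: xi i.
  apply/lfunP => u; rewrite {1}(coord_vbasis (memvf u)) linear_sum sum_lfunE.
  by apply: eq_bigr => i _; rewrite linearZ scale_lfunE lfunE; exact: mulrC.
have JD y z : J v (y + z) = J v y + J v z by rewrite -{1}[y]scale1r J1 mul1r.
have JZ c y : J v (c *: y) = c * J v y by rewrite -[c *: y]addr0 J1 J0 addr0.
rewrite [in RHS]hx (big_morph (J v) JD (J0 v)); apply: eq_bigr => i _; rewrite JZ linearZ.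
exact: mulrC.
Qed.

(** * Induced modules and their twisted duals *)

Section Nabla.
Variables (k : closedFieldType) (G : algGroup k) (F : frame G).
Local Notation kG := (regfun G).
Local Notation wt := (wt (frk F)).
Local Notation phi := (@fphi _ _ F).
Local Notation wp := (@wp _ _ F _).
Variables (tau : anti_involution G) (B : set G) (le : rel wt).
Implicit Types (M N : Gmodule G).

(* All that the module theory uses of G, B and T; le is a total order refining
   the order defined by the positive roots. *)
Record borel_setup : Prop := BorelSetup {
  s_tau : forall s, Gm_pow s -> tau (phi s) = phi s;
  s_le : forall (f : kG) a c b,
    (forall s b, Gm_pow s -> B b -> f (phi s * b * (phi s)^-1)%g = mon s (a - c) * f b) ->
    B b -> f b != 0 -> le a c;
  s_diag : forall (f : kG) b,
    (forall s b, Gm_pow s -> B b -> f (phi s * b * (phi s)^-1)%g = f b) ->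
    vanish (tor F) f -> B b -> f b = 0;
  s_1 : B 1%g;
  s_M : forall x y, B x -> B y -> B (x * y)%g;
  s_V : forall x, B x -> B x^-1%g;
  s_phi : forall s, Gm_pow s -> B (phi s);
  s_cell : forall f : kG, (forall b b', B b -> B b' -> f (tau b * b')%g = 0) -> f = 0;
  s_refl : reflexive le;
  s_anti : antisymmetric le;
  s_trans : transitive le;
  s_total : total le }.

Hypothesis St : borel_setup.

(* N = Ind_B^G chi, with eps the evaluation of functions at 1; unlike is_nabla,
   this form is visibly invariant under isomorphism. *)
Definition nab a chi N (eps : 'Hom(N, k^o)) : Prop := [/\ character B chi,
  forall s, Gm_pow s -> chi (phi s) = mon s a, forall b n, B b -> eps (gact b n) = chi b * eps n,
  forall n, (forall g, eps (gact g n) = 0) -> n = 0 &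
  forall f, ind B chi f -> exists n, forall g, f g = eps (gact g^-1%g n)].

Definition is_nab N := exists a chi eps, @nab a chi N eps.
Definition is_tnab M := exists a chi N eps, @nab a chi N eps /\ M = tdual tau N.

Lemma nabla_nab T a N : T = tor F -> is_nabla T B (@chr _ _ F a) N -> is_nab N.
Proof.
move=> -> [chi [hchi hT [iota [i1 i2 i3 i4]]]].
have iZ c v : iota (c *: v) 1%g = c * iota v 1%g.
  have i0 : iota 0 1%g = 0.
    by apply: (addrI (iota 0 1%g)); rewrite addr0; have := i1 1 0 0 1%g; rewrite scale1r addr0 mul1r.
  by rewrite -[c *: v]addr0 i1 i0 addr0.
have [|eps heps] := @mklin k N k^o (fun n => iota n 1%g); first by move=> c u v; rewrite i1.
have iE n g : iota n g = eps (gact g^-1%g n) by rewrite heps i4 invgK mulg1.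
have chi_ne b : B b -> chi b != 0.
  case: hchi => _ _ c1 cM Bb; apply/eqP => e; have := cM _ _ Bb (s_V St Bb).
  by rewrite mulgV c1 e mul0r => /eqP; rewrite oner_eq0.
exists a, chi, eps; split=> //.
- by move=> s hs; rewrite hT ?chrE //; apply: tor_phi.
- move=> b n Bb; rewrite !heps i4 mulg1; have : ind B chi (iota n) by rewrite -i3; exists n.
  move=> [_ /(_ 1%g b^-1%g (s_V St Bb))]; rewrite mul1g => ->.
  by rewrite (chiV (s_V St) hchi Bb) invrK.
- move=> n hn; apply: i2; apply/funext => g; rewrite !iE hn.
  by rewrite linear0 linear0.
- by move=> f; rewrite -i3 => -[n _ <-]; exists n => g; rewrite iE.
Qed.

Lemma nab_iso a chi N eps M (f : 'Hom(M, N)) : @nab a chi N eps -> lker f = 0%VS -> limg f = fullv ->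
  (forall g v, f (gact g v) = gact g (f v)) -> @nab a chi M (eps \o f)%VF.
Proof.
move=> [h1 h2 h3 h4 h5] k0 i0 hf; split=> //.
- by move=> b n Bb; rewrite !comp_lfunE hf h3.
- move=> n hn; apply/eqP; rewrite -memv0 -k0 memv_ker; apply/eqP/h4 => g.
  by rewrite -hf -comp_lfunE hn.
move=> u /h5 [n hn]; have : n \in limg f by rewrite i0 memvf.
by move=> /memv_imgP [m _ en]; exists m => g; rewrite comp_lfunE hf -en.
Qed.

Definition eqv M N (V : {vspace M}) (f : 'Hom(M, N)) := forall g v, v \in V -> f (gact g v) = gact g (f v).

Lemma eqv_wp M N (V : {vspace M}) (f : 'Hom(M, N)) a v : eqv V f -> v \in V -> f (wp a v) = wp a (f v).
Proof. by move=> hf hv; apply/esym/wp_hom => s _; apply: hf. Qed.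

Section OneNabla.
Variables (a : wt) (chi : G -> k) (N : Gmodule G) (eps : 'Hom(N, k^o)).
Hypothesis hN : nab a chi eps.

Lemma eps_wp c n : eps (wp c n) = if c == a then eps n else 0.
Proof.
have [h1 h2 h3 _ _] := hN.
apply: (@weight_sums_eq _ _ F k^o (wts F N) [:: a] (fun c => eps (wp c n)) (fun c => if c == a then eps n else 0) (uniq_wts F N)) => //.
- by move=> b /wp_out ->; rewrite linear0.
- by move=> b; rewrite inE => /negPf ->.
move=> s hs; rewrite big_seq1 eqxx; have := h3 (phi s) n (s_phi St hs); rewrite h2 // wpE // linear_sum => e.
by apply: etrans e; apply: eq_bigr => b _; rewrite linearZ.
Qed.

Lemma nab_chiV b : B b -> chi b^-1%g = (chi b)^-1.
Proof. by case: hN => h1 _ _ _ _; apply: (chiV (s_V St) h1). Qed.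

Let big (n : N) : kG := rinv (mc eps n).
Let bigE n g : big n g = eps (gact g^-1%g n). Proof. by []. Qed.

(** A function that is semi-invariant under [B] is determined on [tau] of [B] by density. *)
Let big0 n : (forall b, B b -> eps (gact (tau b)^-1%g n) = 0) -> n = 0.
Proof.
have [_ _ h3 h4 _] := hN => h; have e : big n = 0.
  apply: (s_cell St) => b b' Bb Bb'; rewrite bigE invgM gactM comp_lfunE h3; last exact: (s_V St).
  by rewrite h // mulr0.
by apply: h4 => g; have := congr1 (fun f : kG => f g^-1%g) e; rewrite bigE invgK.
Qed.

(** Restriction to [tau] of [B], pulled back by [tau] in order to use the weights of functions on
    [B]. *)
Let lowf (n : N) : kG := RegFun (anti_reg tau (rf_reg (big n))).

Let lowf_conj c n s b : Gm_pow s -> lowf (wp c n) (phi s * b * (phi s)^-1)%g = mon s (c - a) * lowf (wp c n) b.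
Proof.
have [_ h2 h3 _ _] := hN => hs; rewrite /lowf /= !antiM.
have -> : tau (phi s)^-1%g = (phi s)^-1%g by rewrite -phiV' // (s_tau St) //; apply: GmV.
rewrite (s_tau St hs) !invgM invgK !gactM !comp_lfunE wp_phi // !linearZ /=.
rewrite h3; last by apply/(s_V St)/(s_phi St).
rewrite nab_chiV ?h2 //; last exact: (s_phi St).
by rewrite monD // monN // -mulrA.
Qed.

Lemma nab_weights c (n : N) : wp c n != 0 -> le c a.
Proof.
move=> ne; apply: contrapT => nle; case/eqP: ne; apply: big0 => b Bb; apply: contrapT => /eqP h.
apply: nle; apply: (s_le St (f := lowf (wp c n)) (b := b)) => // s g hs _.
exact: lowf_conj.
Qed.

Lemma nab_top n : eps n = 0 -> wp a n = 0.
Proof.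
move=> en; apply: big0 => b Bb.
have := s_diag St (f := lowf (wp a n)) (b := b); apply => //.
  by move=> s g hs _; rewrite lowf_conj // subrr mon0 mul1r.
move=> _ [s hs <-]; rewrite /= (s_tau St hs) phi_inv // linearZ /= eps_wp eqxx en.
exact: mulr0.
Qed.

(** The weight space of [a] has dimension at most 1. The vector may be 0, since the induced module
    is not known to be nonzero. *)
Lemma nab_line : exists n0, forall n, wp a n = eps n *: n0.
Proof.
have [[n1 hn1]|no] := pselect (exists n1, eps n1 != 0).
  exists ((eps n1)^-1 *: wp a n1) => n; apply: subr0_eq.
  have h := @nab_top (n - (eps n / eps n1) *: n1).
  rewrite scalerA -linearZ -linearB; apply: h; rewrite linearB linearZ /=.
  by rewrite -[_ *: _]/(_ * _) divfK // subrr.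
exists 0 => n; rewrite scaler0; apply: nab_top; apply/eqP; apply: contraT => h.
by case: no; exists n.
Qed.

Lemma nab_frobenius M (V : {vspace M}) (psi : 'Hom(M, k^o)) : gstable V ->
  (forall b v, B b -> v \in V -> psi (gact b v) = chi b * psi v) ->
  exists f : 'Hom(M, N), eqv V f /\ forall v, v \in V -> eps (f v) = psi v.
Proof.
have [h1 h2 h3 h4 h5] := hN => hV hpsi.
have /choice [f0 hf0] : forall v : M, exists n, v \in V -> forall g, eps (gact g n) = psi (gact g v).
  move=> v; have [vV|nv] := boolP (v \in V); last by exists 0.
  have [|n hn] := h5 (fun g => psi (gact g^-1%g v)).
    split=> [|g b Bb]; first exact: (rf_reg (rinv (mc psi v))).
    rewrite invgM gactM comp_lfunE hpsi ?nab_chiV //; first exact: (s_V St).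
    exact: hV.
  by exists n => _ g; rewrite -{1}[g]invgK -hn invgK.
have inj u v : (forall g, eps (gact g u) = eps (gact g v)) -> u = v.
  by move=> h; apply: subr0_eq; apply: h4 => g; rewrite linearB linearB /= h subrr.
have [|f hf] := @mklin k M N (fun v => f0 (projv V v)).
  move=> c u v; apply: inj => g; rewrite hf0 ?memv_proj // !linearP /=.
  by rewrite !hf0 ?memv_proj.
have fE v : v \in V -> forall g, eps (gact g (f v)) = psi (gact g v).
  by move=> vV g; rewrite hf projv_id // hf0.
exists f; split=> [g v vV|v vV]; last by have := fE v vV 1%g; rewrite !gact1 !id_lfunE.
apply: inj => g'; rewrite fE; last exact: hV.
by rewrite -[gact g' (gact g v)]comp_lfunE -[gact g' (gact g (f v))]comp_lfunE -!gactM fE.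
Qed.

Lemma nab_eq M (V : {vspace M}) (f f' : 'Hom(M, N)) : gstable V -> eqv V f -> eqv V f' ->
  (forall v, v \in V -> eps (f v) = eps (f' v)) -> forall v, v \in V -> f v = f' v.
Proof.
have [_ _ _ h4 _] := hN => hV hf hf' e v vV; apply: subr0_eq; apply: h4 => g.
by rewrite linearB linearB /= -hf // -hf' // e ?subrr //; apply: hV.
Qed.

Local Notation Delta := (tdual tau N).
Local Notation top := (eps : Delta).

Lemma tnab_weights c (z : Delta) : wp c z != 0 -> le c a.
Proof.
move=> ne; apply: contrapT => nle; case/eqP: ne; apply/lfunP => n.
rewrite (wp_tdual (s_tau St)); suff -> : wp c n = 0 by rewrite linear0 zero_lfunE.
by apply/eqP; apply: contraT => /nab_weights.
Qed.

Lemma tnab_top : wp a top = top.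
Proof.
by apply/lfunP => n; rewrite (wp_tdual (s_tau St)) eps_wp eqxx.
Qed.

Lemma tnab_line (z : Delta) : exists c, wp a z = c *: top.
Proof.
have [n0 h0] := nab_line; exists ((z : 'Hom(N, k^o)) n0); apply/lfunP => n.
rewrite (wp_tdual (s_tau St)) h0 linearZ scale_lfunE /=; exact: mulrC.
Qed.

Lemma tnab_gen (z : Delta) : exists s : seq (k * G), z = \sum_(x <- s) x.1 *: gact x.2 top.
Proof.
have [||W hW] := @vspace_of k Delta [set z | exists s : seq (k * G), z = \sum_(x <- s) x.1 *: gact x.2 top].
- by exists [::]; rewrite big_nil.
- move=> c _ _ [s ->] [s' ->]; exists ([seq (c * x.1, x.2) | x <- s] ++ s').
  rewrite big_cat big_map scaler_sumr; congr (_ + _); apply: eq_bigr => x _ /=.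
  by rewrite scalerA.
apply/hW; apply: dual_sep_vspace => Th hTh.
have [||h hh] := @reflexive_dual k N k^o (fun v x => (v : k) * Th x).
- by move=> v c x y; rewrite linearP /= mulrDr mulrCA.
- by move=> x c u v; rewrite -[c *: u]/(c * u) mulrDl mulrA.
have ev x : Th x = (x : 'Hom(N, k^o)) (h 1) by rewrite hh mul1r.
have [_ _ _ h4 _] := hN; rewrite ev; suff -> : h 1 = 0 by rewrite linear0.
apply: h4 => g; rewrite -[g](antiK tau).
have := tdualE (tau g) top (h 1); rewrite /= => <-; rewrite -[LHS]ev; apply: hTh; apply/hW.
by exists [:: (1, tau g)]; rewrite big_seq1 scale1r.
Qed.

(* Frobenius reciprocity for the dual of M, evaluated at a vector e fixed up to
   chi by tau(B), modulo a submodule K. *)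
Lemma tnab_pairing M (K : {vspace M}) (e : M) : gstable K ->
  (forall b, B b -> gact (tau b) e - chi b *: e \in K) ->
  exists j : 'Hom(tdual tau M, N), forall th : 'Hom(M, k^o), (forall v, v \in K -> th v = 0) ->
    (forall g, j (th \o gact g)%VF = gact (tau g) (j th)) /\ eps (j th) = th e.
Proof.
move=> hK he.
have [||V hV] := @vspace_of k (tdual tau M) [set th | forall v, v \in K -> (th : 'Hom(M, k^o)) v = 0].
- by move=> v _; rewrite zero_lfunE.
- by move=> c x y hx hy v vK; rewrite add_lfunE scale_lfunE hx // hy // scaler0 addr0.
have [|psi hpsi] := @mklin k (tdual tau M) k^o (fun th => (th : 'Hom(M, k^o)) e).
  by move=> c x y; rewrite add_lfunE scale_lfunE.
have sV : gstable V.
  by move=> g th /hV h; apply/hV => v vK; rewrite tdualE h //; apply: hK.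
have [|j [hj ej]] := @nab_frobenius (tdual tau M) V psi sV.
  move=> b th Bb /hV h; rewrite !hpsi tdualE; have := h _ (he b Bb).
  by rewrite linearB linearZ /= => /eqP; rewrite subr_eq0 => /eqP.
exists j => th h; have thV : (th : tdual tau M) \in V by apply/hV.
split=> [g|]; last by rewrite ej.
rewrite -hj //; congr (j _); apply/lfunP => v.
by rewrite tdualE antiK comp_lfunE.
Qed.

(** The universal property of the Weyl module: [q] is fixed by [tau] of [B] up to [chi], since [tau]
    of [B] raises weights and none above [a] occur. *)
Lemma tnab_hom M (q : M) : wp a q = q -> (forall c g, wp c (gact g q) != 0 -> le c a) ->
  exists h : 'Hom(Delta, M), (forall g z, h (gact g z) = gact g (h z)) /\ h top = q.
Proof.
move=> eq hq; have [h1 h2 _ _ _] := hN.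
have K0 : gstable (0%VS : {vspace M}).
  by move=> g v; rewrite !memv0 => /eqP ->; rewrite linear0.
have [|j hj] := tnab_pairing (M := M) (e := q) K0.
  move=> b Bb; rewrite memv0 subr_eq0; apply/eqP; apply: (@wp_eq _ _ F) => c.
  have [->|ca] := eqVneq c a.
    by rewrite -{1}eq (B_diagonal_tau (s_tau St) (s_diag St) (s_M St) (s_V St) (s_phi St) h1 h2) // eq linearZ /= eq.
  rewrite linearZ /= -[in RHS]eq wp_wp (negPf ca) scaler0; apply/eqP; apply: contraT => ne.
  have l1 := hq _ _ ne; rewrite -eq in ne.
  have l2 := B_triangular_tau (s_tau St) (s_le St) Bb ne.
  by case/eqP: ca; apply: (s_anti St); rewrite l1.
have hj' (th : 'Hom(M, k^o)) := hj th (fun v (h : v \in 0%VS) => etrans (congr1 th (eqP (etrans (esym (memv0 v)) h))) (linear0 th)).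
have [||h hh] := @reflexive_dual k M Delta (fun z th => (z : 'Hom(N, k^o)) (j th)).
- by move=> z c x y; rewrite !linearP.
- by move=> x c u v; rewrite add_lfunE scale_lfunE.
exists h; split=> [g z|].
  apply: subr0_eq; apply: dual_sep => th; rewrite linearB /= hh tdualE -(hj' th).1 -hh comp_lfunE.
  by rewrite subrr.
by apply: subr0_eq; apply: dual_sep => th; rewrite linearB /= hh (hj' th).2 subrr.
Qed.

End OneNabla.
End Nabla.

(** * Extension of homomorphisms along filtrations *)

Section Extension.
Variables (k : closedFieldType) (G : algGroup k) (F : frame G).
Local Notation wt := (wt (frk F)).
Local Notation phi := (@fphi _ _ F).
Local Notation wp := (@wp _ _ F _).
Variables (tau : anti_involution G) (B : set G) (le : rel wt).
Hypothesis St : borel_setup tau B le.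
Local Notation nab := (nab (F := F) B).
Local Notation is_nab := (@is_nab _ _ F B).
Local Notation is_tnab := (@is_tnab _ _ F tau B).
Implicit Types (M N P Q : Gmodule G).

Lemma wp_idem M c (v : M) : wp c (wp c v) = wp c v.
Proof. by rewrite wp_wp eqxx. Qed.

Section Quotient.
Variables (M N0 : Gmodule G) (S E : {vspace M}) (a0 : wt) (chi0 : G -> k) (eps0 : 'Hom(N0, k^o)).
Hypothesis hN0 : nab a0 chi0 eps0.
Hypothesis hE : gstable E.
Variable pi : 'Hom(M, tdual tau N0).
Hypothesis piE : (pi @: E = fullv)%VS.
Hypothesis piS : (E :&: lker pi = S)%VS.
Hypothesis hpi : eqv E pi.

Lemma quo_mem v : v \in E -> pi v = 0 -> v \in S.
Proof. by move=> vE pv; rewrite -piS memv_cap vE memv_ker pv eqxx. Qed.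

Lemma quo_sub v : v \in S -> v \in E. Proof. by rewrite -piS memv_cap => /andP []. Qed.

Lemma quo_ker v : v \in S -> pi v = 0.
Proof. by rewrite -piS memv_cap memv_ker => /andP [_ /eqP]. Qed.

Lemma quo_weights v c : v \in E -> ~~ le c a0 -> wp c v \in S.
Proof.
move=> vE nle; apply: quo_mem; first exact: wp_stable.
rewrite (eqv_wp _ hpi vE); apply/eqP; apply: contraT => h.
by rewrite (tnab_weights St hN0 h) in nle.
Qed.

Lemma quo_top : exists e, [/\ e \in E, wp a0 e = e & pi e = eps0].
Proof.
have /memv_imgP [e1 e1E ee] : (eps0 : tdual tau N0) \in (pi @: E)%VS by rewrite piE memvf.
exists (wp a0 e1); rewrite (wp_stable _ hE e1E) wp_wp eqxx; split=> //.
by rewrite (eqv_wp _ hpi e1E) -ee (tnab_top St hN0).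
Qed.

Lemma quo_gen e v : e \in E -> pi e = eps0 -> v \in E ->
  exists s : seq (k * G), v - \sum_(x <- s) x.1 *: gact x.2 e \in S.
Proof.
move=> eE ee vE; have [s hs] := tnab_gen hN0 (pi v); exists s; apply: quo_mem.
  by rewrite memvB // rpred_sum // => x _; rewrite memvZ // hE.
rewrite linearB linear_sum /= hs; apply/eqP; rewrite subr_eq0; apply/eqP/eq_bigr => x _.
by rewrite linearZ /= hpi // ee.
Qed.

End Quotient.

Lemma extend_nab M N N0 (S E : {vspace M}) a0 chi0 (eps0 : 'Hom(N0, k^o)) a chi (eps : 'Hom(N, k^o))
    (f : 'Hom(M, N)) : nab a0 chi0 eps0 -> nab a chi eps -> gstable S -> gstable E ->
  subquotient_iso S E (tdual tau N0) -> eqv S f ->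
  exists f' : 'Hom(M, N), eqv E f' /\ forall v, v \in S -> f' v = f v.
Proof.
move=> hN0 hN hS hE [pi [piE piS hpi]] hf.
have [c1 c2 c3 c4 c5] := hN; have [d1 d2 _ _ _] := hN0.
have SE := quo_sub piS.
have [lea|nle] := boolP (le a0 a).
  (* Frobenius reciprocity asks for a functional on [E] that is semi-invariant under [B]; on weight
     [a] an arbitrary linear projection to [S] is used. Vectors of weight not <= a0 lie in [S], and
     from a weight c <= a0 <= a other than [a] the group [B] cannot reach [a]. *)
  have [psi hpsi] : exists psi : 'Hom(M, k^o), forall v, psi v = eps (f (projv S (wp a v))).
    by exists (eps \o f \o projv S \o wp a)%VF => v; rewrite !comp_lfunE.
  have psi_wp v c : v \in E -> c != a -> psi (wp c v) = 0.
    by move=> vE ca; rewrite hpsi wp_wp eq_sym (negPf ca) !linear0.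
  have psiS v : v \in S -> psi v = eps (f v).
    by move=> vS; rewrite hpsi projv_id ?(wp_stable _ hS) // (eqv_wp _ hf vS) (eps_wp St hN) eqxx.
  have [|f' [hf' ef']] := nab_frobenius St hN (V := E) (psi := psi) hE.
    move=> b v Bb vE; rewrite -[in LHS](wp_sum F v) !linear_sum /=.
    have t c : c != a -> psi (gact b (wp c v)) = 0.
      move=> ca; have [cS|ncS] := boolP (le c a0); last first.
        have vS := quo_weights hN0 hE piS hpi vE ncS.
        rewrite psiS ?hS // hf // c3 // -[wp c v]wp_idem (eqv_wp _ hf) // (eps_wp St hN) (negPf ca).
        exact: mulr0.
      rewrite hpsi; suff -> : wp a (gact b (wp c v)) = 0 by rewrite !linear0.
      apply/eqP; apply: contraT => ne; have l := B_triangular (s_le St) Bb ne.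
      by case/eqP: ca; apply: (s_anti St); rewrite l andbT; apply: (s_trans St) lea.
    have ta : psi (gact b (wp a v)) = chi b * psi v.
      by rewrite hpsi (B_diagonal (s_diag St) (s_M St) (s_V St) (s_phi St) c1 c2) // !linearZ hpsi.
    have [av|nv] := boolP (a \in wts F M).
      by rewrite (bigD1_seq a) ?uniq_wts //= ta big1 ?addr0.
    rewrite big1_seq => [|c /andP [_ cM]]; last by apply: t; apply: contraNneq nv => <-.
    by rewrite hpsi wp_out // !linear0; apply/esym/mulr0.
  exists f'; split=> // v vS; apply: (nab_eq hN hS) => // [g u uS|u uS].
    exact/hf'/SE.
  by rewrite ef' ?psiS //; apply: SE.
have lt : le a a0 by have := s_total St a0 a; rewrite (negPf nle).
have nea c : le a0 c -> ~~ le c a.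
  by move=> h; apply: contra nle => h'; apply: (s_trans St) h h'.
have [e [eE ea ee]] := quo_top hN0 hE piE hpi.
(* Modulo [K] the lift [e] is fixed by [tau] of [B] up to [chi0]: the error lies in [S] and has
   weights above a0, hence above [a], where [f] vanishes. *)
pose K := (S :&: lker f)%VS.
have hK : gstable K.
  move=> g v; rewrite !memv_cap !memv_ker => /andP [vS /eqP fv].
  by rewrite hS //= hf // fv linear0.
have KP v : v \in S -> f v = 0 -> v \in K by move=> vS fv; rewrite memv_cap vS memv_ker fv eqxx.
have [|j hj] := tnab_pairing St hN0 (M := M) (K := K) (e := e) hK.
  move=> b Bb; set d := _ - _; have dE : d \in E by rewrite memvB ?memvZ // hE.
  rewrite -(wp_sum F d) rpred_sum // => c _.
  have [->|ca] := eqVneq c a0.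
    rewrite linearB linearZ /= -{1}ea (B_diagonal_tau (s_tau St) (s_diag St) (s_M St) (s_V St) (s_phi St) d1 d2) //.
    by rewrite subrr mem0v.
  have e0 : wp c e = 0 by rewrite -ea wp_wp (negPf ca).
  have [->|ne] := eqVneq (wp c d) 0; first exact: mem0v.
  have l : le a0 c.
    apply: (B_triangular_tau (s_tau St) (s_le St) (M := M) (v := e) Bb); rewrite ea.
    by apply: contra ne => /eqP h; rewrite linearB linearZ /= h e0 scaler0 subrr.
  have nl : ~~ le c a0 by apply: contra ca => h; apply/eqP/(s_anti St); rewrite h.
  have wS := quo_weights hN0 hE piS hpi dE nl.
  apply: (KP _ wS); rewrite -wp_idem (eqv_wp _ hf wS); apply/eqP; apply: contraT => /(nab_weights St hN).
  by rewrite (negPf (nea _ l)).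
have [||D hD] := @vspace_of k M [set v | exists s : seq (k * G), v = \sum_(x <- s) x.1 *: gact x.2 e].
- by exists [::]; rewrite big_nil.
- move=> c _ _ [s ->] [s' ->]; exists ([seq (c * x.1, x.2) | x <- s] ++ s').
  rewrite big_cat big_map scaler_sumr; congr (_ + _); apply: eq_bigr => x _ /=.
  by rewrite scalerA.
(* A functional that kills [K] factors, on the submodule generated by [e], through the quotient map
   [pi]; so it kills every element of that submodule lying in [S]. Hence [f] on [S] and 0 on the
   submodule agree on the intersection. *)
have [|f' [f1 f2]] := @glue0 k M N S D f.
  move=> v vS /hD [s es]; suff : v \in K by rewrite memv_cap memv_ker => /andP [_ /eqP].
  apply: dual_sep_vspace => th hth; have [h1 h2] := hj th hth.
  have [|ev hev] := @mklin k (tdual tau N0) k^o (fun z => (z : 'Hom(N0, k^o)) (j th)).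
    by move=> c z z'; rewrite add_lfunE scale_lfunE.
  suff -> : th v = ev (pi v) by rewrite (quo_ker piS vS) linear0.
  rewrite es !linear_sum; apply: eq_bigr => x _.
  rewrite !linearZ /= hpi // ee hev tdualE -h1; congr (_ *: _).
  have sK : forall v, v \in K -> (th \o gact x.2)%VF v = 0.
    by move=> u uK; rewrite comp_lfunE hth //; apply: hK.
  by rewrite (hj _ sK).2 comp_lfunE.
exists f'; split=> // g v vE; have [s hs] := quo_gen hN0 hE piS hpi eE ee vE.
set y := \sum_(x <- s) _ in hs; have yD : y \in D by apply/hD; exists s.
have gD : gact g y \in D.
  apply/hD; exists [seq (x.1, (g * x.2)%g) | x <- s]; rewrite big_map linear_sum.
  by apply: eq_bigr => x _; rewrite linearZ /= gactM comp_lfunE.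
rewrite -[v](subrK y); move: (v - y) hs => z hs; rewrite !linearD /= (f2 _ yD) (f2 _ gD) linear0 !addr0.
by rewrite !f1 ?hf ?hS.
Qed.

Lemma dsum_ex M N g : exists L : 'End((M * N)%type), forall v, L v = (gact g v.1, gact g v.2).
Proof. by apply: mklin => a u v; rewrite !linearP. Qed.

Definition dsum_act M N g : 'End((M * N)%type) := projT1 (cid (dsum_ex M N g)).

Lemma dsum_actE M N g v : dsum_act M N g v = (gact g v.1, gact g v.2).
Proof. exact: (projT2 (cid (dsum_ex M N g))). Qed.

Fact dsum_act1 M N : dsum_act M N 1%g = \1%VF.
Proof. by apply/lfunP => -[u v]; rewrite dsum_actE !gact1 !id_lfunE. Qed.

Fact dsum_actM M N x y : dsum_act M N (x * y)%g = (dsum_act M N x \o dsum_act M N y)%VF.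
Proof. by apply/lfunP => -[u v]; rewrite comp_lfunE !dsum_actE /= !gactM !comp_lfunE. Qed.

Fact dsum_act_reg M N (th : 'Hom((M * N)%type, k^o)) (v : (M * N)%type) :
  reg G (fun g => th (dsum_act M N g v)).
Proof.
have [t1 h1] : exists t : 'Hom(M, k^o), forall u, t u = th (u, 0).
  apply: mklin => a u u'; have := linearP th a ((u, 0) : M * N)%type (u', 0) => <-.
  by congr (th _); change ((a *: u + u', 0) = (a *: u + u', a *: (0 : N) + 0)); rewrite scaler0 addr0.
have [t2 h2] : exists t : 'Hom(N, k^o), forall u, t u = th (0, u).
  apply: mklin => a u u'; have := linearP th a ((0, u) : M * N)%type (0, u') => <-.
  by congr (th _); change ((0, a *: u + u') = (a *: (0 : M) + 0, a *: u + u')); rewrite scaler0 addr0.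
have -> : (fun g => th (dsum_act M N g v)) = (fun g => t1 (gact g v.1) + t2 (gact g v.2)).
  apply/funext => g; rewrite dsum_actE h1 h2 -linearD; congr (th (_, _)).
    exact: esym (addr0 _).
  exact: esym (add0r _).
by apply: reg_add; apply: gact_reg.
Qed.

Definition dsum M N : Gmodule G := GModule (dsum_act1 M N) (@dsum_actM M N) (@dsum_act_reg M N).

Definition chain (C : Gmodule G -> Prop) M (r : nat) (U : nat -> {vspace M}) : Prop :=
  [/\ U 0%N = 0%VS, U r = fullv, forall i, (i <= r)%N -> gstable (U i) &
    forall i, (i < r)%N -> exists2 N, C N & subquotient_iso (U i) (U i.+1) N].

Lemma subq_sub M (S E : {vspace M}) N v : subquotient_iso S E N -> v \in S -> v \in E.
Proof. by move=> [pi [_ <- _]]; rewrite memv_cap => /andP []. Qed.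

(** Extend first the composite to the top quotient N of the chain, as g0. On the fibre product of
    [E] and [U i.+1] over N, the map q - f(m), defined for m in [S], takes values in [U i] and
    extends by induction. Subtracting its value from any lift q of g0(v) does not depend on q and
    gives the extension. *)
Lemma extend_chain Q r (U : nat -> {vspace Q}) : chain is_nab r U ->
  forall i, (i <= r)%N -> forall M (S E : {vspace M}) X (f : 'Hom(M, Q)), is_tnab X ->
  subquotient_iso S E X -> gstable S -> gstable E -> eqv S f -> (forall v, v \in S -> f v \in U i) ->
  exists f' : 'Hom(M, Q), [/\ eqv E f', forall v, v \in S -> f' v = f v & forall v, v \in E -> f' v \in U i].
Proof.
move=> [U0 Ur Us Uq]; elim=> [|i IH] hi M S E X f hX hSE hS hE hf fU.
  exists 0; split=> [g v _|v /fU|v _]; rewrite ?zero_lfunE ?linear0 ?mem0v //.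
  by rewrite U0 memv0 => /eqP ->.
have [N [a [chi [eps hN]]] [pi [piE piS hpi]]] := Uq i hi.
have [a0 [chi0 [N0 [eps0 [hN0 eX]]]]] := hX; subst X.
have SE v : v \in S -> v \in E := subq_sub hSE.
have UU v : v \in U i -> v \in U i.+1 by rewrite -piS memv_cap => /andP [].
have kerU v : v \in U i.+1 -> pi v = 0 -> v \in U i.
  by move=> h1 h2; rewrite -piS memv_cap h1 memv_ker h2 eqxx.
have [|g0 [hg0 g0S]] := @extend_nab M N N0 S E a0 chi0 eps0 a chi eps (pi \o f)%VF hN0 hN hS hE hSE.
  by move=> g v vS; rewrite !comp_lfunE hf // hpi // fU.
(* A linear section, not equivariant; independence of the lift restores equivariance at the end. *)
pose sg : 'Hom(N, Q) := (projv (U i.+1) \o (pi \o projv (U i.+1))^-1)%VF.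
have sgU n : sg n \in U i.+1 by rewrite comp_lfunE memv_proj.
have sgP n : pi (sg n) = n.
  have : n \in limg (pi \o projv (U i.+1))%VF.
    have /memv_imgP [q qU ->] : n \in (pi @: U i.+1)%VS by rewrite piE memvf.
    by apply/memv_imgP; exists q; rewrite ?memvf // comp_lfunE projv_id.
  by move=> /limg_lfunVK e; rewrite -[RHS]e /sg !comp_lfunE.
have [||E2 hE2] := @vspace_of k (dsum M Q) [set x | [/\ (x : (M * Q)%type).1 \in E, (x : (M * Q)%type).2 \in U i.+1 & g0 (x : (M * Q)%type).1 = pi (x : (M * Q)%type).2]].
- by split; rewrite ?mem0v ?linear0.
- move=> c [x1 x2] [y1 y2] [/= h1 h2 h3] [/= h1' h2' h3'].
  change [/\ c *: x1 + y1 \in E, c *: x2 + y2 \in U i.+1 & g0 (c *: x1 + y1) = pi (c *: x2 + y2)].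
  by split; rewrite ?memvD ?memvZ // !linearP /= h3 h3'.
have [||S2 hS2] := @vspace_of k (dsum M Q) [set x | [/\ (x : (M * Q)%type).1 \in S, (x : (M * Q)%type).2 \in U i.+1 & g0 (x : (M * Q)%type).1 = pi (x : (M * Q)%type).2]].
- by split; rewrite ?mem0v ?linear0.
- move=> c [x1 x2] [y1 y2] [/= h1 h2 h3] [/= h1' h2' h3'].
  change [/\ c *: x1 + y1 \in S, c *: x2 + y2 \in U i.+1 & g0 (c *: x1 + y1) = pi (c *: x2 + y2)].
  by split; rewrite ?memvD ?memvZ // !linearP /= h3 h3'.
have sE2 : gstable E2.
  move=> g x /hE2 [x1 x2 x3]; apply/hE2; rewrite /= !dsum_actE /=.
  by split; [apply: hE|apply: Us|rewrite hg0 // x3 hpi].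
have sS2 : gstable S2.
  move=> g x /hS2 [x1 x2 x3]; apply/hS2; rewrite /= !dsum_actE /=.
  by split; [apply: hS|apply: Us|rewrite hg0 ?x3 ?hpi //; apply: SE].
have [f2 hf2] : exists f2 : 'Hom(dsum M Q, Q), forall x, f2 x = (x : (M * Q)%type).2 - f (x : (M * Q)%type).1.
  apply: mklin => c [x1 x2] [y1 y2].
  change (c *: x2 + y2 - f (c *: x1 + y1) = c *: (x2 - f x1) + (y2 - f y1)).
  by rewrite linearP scalerBr opprD addrACA.
have [|||f2' [e1 e2 e3]] := IH (ltnW hi) (dsum M Q) S2 E2 (tdual tau N0) f2 hX _ sS2 sE2.
- have [p0 [p1 p2' p3]] := hSE.
  have [pp hpp] : exists pp : 'Hom(dsum M Q, tdual tau N0), forall x, pp x = p0 (x : (M * Q)%type).1.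
    by apply: mklin => c x y; rewrite linearP.
  exists pp; split.
  + apply/vspaceP => z; rewrite memvf; apply/idP.
    have /memv_imgP [v vE ->] : z \in (p0 @: E)%VS by rewrite p1 memvf.
    apply/memv_imgP; exists ((v, sg (g0 v)) : dsum M Q); last by rewrite hpp.
    by apply/hE2; split=> //=; rewrite sgP.
  + apply/vspaceP => x; apply/idP/idP; rewrite memv_cap memv_ker hpp.
      move=> /andP [/hE2 [x1 x2 x3] /eqP px]; apply/hS2; split=> //.
      by rewrite -p2' memv_cap x1 memv_ker px eqxx.
    move=> /hS2 [x1 x2 x3]; apply/andP; split; first by apply/hE2; split=> //; apply: SE.
    by move: x1; rewrite -p2' memv_cap memv_ker => /andP [].
  + by move=> g x /hE2 [x1 x2 x3]; rewrite !hpp /= dsum_actE /= p3.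
- by move=> g x /hS2 [x1 x2 x3]; rewrite !hf2 /= dsum_actE /= hf // linearB.
- move=> x /hS2 [x1 x2 x3]; rewrite hf2; apply: kerU; first by rewrite memvB ?fU.
  by rewrite linearB /= -x3 g0S // comp_lfunE subrr.
have [f' hf'] : exists f' : 'Hom(M, Q), forall v, f' v = sg (g0 v) - f2' ((v, sg (g0 v)) : dsum M Q).
  apply: mklin => c u v; rewrite !linearP /=; set x := f2' (u, _); set y := f2' (v, _).
  have -> : f2' ((c *: u + v, c *: sg (g0 u) + sg (g0 v)) : dsum M Q) = c *: x + y.
    exact: (linearP f2' c ((u, sg (g0 u)) : dsum M Q) ((v, sg (g0 v)) : dsum M Q)).
  by rewrite scalerBr opprD addrACA.
have inE2 v : v \in E -> ((v, sg (g0 v)) : dsum M Q) \in E2 by move=> vE; apply/hE2; split=> //=; rewrite sgP.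
exists f'; split.
- move=> g v vE; rewrite !hf'.
  pose q0 := sg (g0 (gact g v)) - gact g (sg (g0 v)).
  have e0 : ((gact g v, sg (g0 (gact g v))) : dsum M Q) = gact g ((v, sg (g0 v)) : dsum M Q) + ((0, q0) : dsum M Q).
    by rewrite /= dsum_actE; congr (_, _) => /=; rewrite ?addr0 // /q0 addrC subrK.
  have z0 : ((0, q0) : dsum M Q) \in S2.
    apply/hS2; split=> /=; first exact: mem0v.
      by rewrite memvB // Us.
    by rewrite linear0 linearB /= sgP hpi // sgP hg0 // subrr.
  rewrite e0 linearD /= e1 ?inE2 // (e2 _ z0) hf2 /= linear0 subr0.
  by rewrite linearB /= /q0 opprD opprB addrCA [X in - _ + X]addrC subrK addrC.
- move=> v vS; have h : ((v, sg (g0 v)) : dsum M Q) \in S2.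
    by apply/hS2; split=> //=; rewrite sgP.
  by rewrite hf' (e2 _ h) hf2 /= opprB addrC subrK.
move=> v vE; rewrite hf' memvB //; apply: UU; apply: e3; exact: inE2.
Qed.

End Extension.

Section Realize.
Variables (k : closedFieldType) (G : algGroup k) (F : frame G).
Local Notation wt := (wt (frk F)).
Local Notation phi := (@fphi _ _ F).
Local Notation wp := (@wp _ _ F _).
Variables (tau : anti_involution G) (B : set G) (le : rel wt).
Hypothesis St : borel_setup tau B le.
Local Notation is_nab := (@is_nab _ _ F B).
Local Notation is_tnab := (@is_tnab _ _ F tau B).
Implicit Types (M N P Q : Gmodule G).

Definition hw l Q (q : Q) := wp l q = q /\ forall c g, wp c (gact g q) != 0 -> le c l.

(** [xi] kills the part of weight l of the submodule generated by the weights above l. *)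
Definition cohw l P (xi : 'Hom(P, k^o)) :=
  forall v c g, le l c -> c != l -> xi (wp l (gact g (wp c v))) = 0.

Lemma le_neq c l : le l c -> c != l -> ~~ le c l.
Proof. by move=> h; apply: contra => h'; apply/eqP/(s_anti St); rewrite h' h. Qed.

(** Induction along the Weyl filtration of [P]: each extension is corrected by a map from the new
    Weyl quotient, so that the lift of its top vector gets the prescribed value. *)
Lemma realize P Q rP rQ (W : nat -> {vspace P}) (U : nat -> {vspace Q}) l (u : Q) (xi : 'Hom(P, k^o)) :
  chain is_tnab rP W -> chain is_nab rQ U -> hw l u -> cohw l xi ->
  exists f : Ghom P Q, (forall v, f (wp l v) = xi (wp l v) *: u) /\
    forall c v, le l c -> c != l -> f (wp c v) = 0.
Proof.
move=> [W0 Wr Ws Wq] hU [ul hu] hxi.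
suff H j : (j <= rP)%N -> exists f : 'Hom(P, Q), [/\ eqv (W j) f, forall v, v \in W j -> f (wp l v) = xi (wp l v) *: u &
    forall c v, v \in W j -> le l c -> c != l -> f (wp c v) = 0].
  have [f [f1 f2 f3]] := H rP (leqnn _); rewrite Wr in f1 f2 f3.
  have hf : f \in @equivariant k G P Q by apply/equivariantP => g v; apply: f1; apply: memvf.
  by exists (GHom hf); split=> [v|c v] /=; [apply: f2; apply: memvf|apply: f3; apply: memvf].
have u0 c g : le l c -> c != l -> wp c (gact g u) = 0.
  by move=> h ne; apply/eqP; apply: contraT => /hu; rewrite (negPf (le_neq h ne)).
elim: j => [|j IH] hj.
  exists 0; split=> [g v _|v|c v _ _ _]; rewrite ?zero_lfunE ?linear0 //.
  by rewrite W0 memv0 => /eqP ->; rewrite !linear0 scale0r.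
have [f [f1 f2 f3]] := IH (ltnW hj); have [X hX hq] := Wq j hj.
have hW := Ws j (ltnW hj); have hE := Ws j.+1 hj.
have [U0 Ur _ _] := hU.
have [|f0 [g1 g2 _]] := extend_chain St hU (leqnn _) hX hq hW hE f1.
  by move=> v _; rewrite Ur memvf.
have [nu [chi [N [eps [hN eX]]]]] := hX; subst X.
have [pi [piE piS hpi]] := hq.
have WE := quo_sub piS; have Wk := quo_ker piS.
have fW c v : v \in W j -> wp c v = v -> le l c -> c != l -> f v = 0.
  by move=> vW <-; apply: f3.
have fWl v : v \in W j -> wp l v = v -> f v = xi v *: u by move=> vW e; rewrite -e f2 // e.
have lowW c v : v \in W j.+1 -> ~~ le c nu -> wp c v \in W j := quo_weights St hN hE piS hpi (c := c) (v := v).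
(* When nu < l the new quotient has no weights >= l, and any extension already has the required
   values. *)
have [ln|nln] := boolP (le l nu); last first.
  have inW c v : v \in W j.+1 -> le l c -> wp c v \in W j.
    by move=> vE lc; apply: lowW => //; apply: contra nln; apply: (s_trans St).
  exists f0; split=> // [v vE|c v vE lc ne].
    have vW := inW _ _ vE (s_refl St l); rewrite g2 // fWl //; exact: wp_idem.
  by have vW := inW _ _ vE lc; rewrite g2 // (fW c) //; exact: wp_idem.
have [e [eE ea ee]] := quo_top St hN hE piE hpi.
(* The defect [q] has weight nu and generates a submodule with weights <= nu, so it is the image of
   the top vector under some map from the Weyl module; that map is subtracted. *)
pose x0 : k := if nu == l then xi e else 0.
pose q := f0 e - x0 *: u.
have f0wp c v : v \in W j.+1 -> f0 (wp c v) = wp c (f0 v) := eqv_wp c g1 (v := v).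
have qa : wp nu q = q.
  rewrite /q linearB linearZ /= -f0wp // ea /x0; case: eqP => [->|_]; first by rewrite ul.
  by rewrite !scale0r.
have qw c g : wp c (gact g q) != 0 -> le c nu.
  apply: contraNT => nc; have lc : le nu c by have := s_total St nu c; rewrite (negPf nc) orbF.
  have llc := s_trans St ln lc; have cl : c != l by apply: contraNneq nc => ->.
  rewrite /q linearB linearZ linearB linearZ /= u0 // scaler0 subr0 -g1 // -f0wp; last exact: hE.
  have cW : wp c (gact g e) \in W j by apply: lowW => //; apply: hE.
  by rewrite g2 // (fW c) //; exact: wp_idem.
have [h [h1 h2]] := tnab_hom St hN qa qw.
pose f' := f0 - (h \o pi)%VF.
have f'E v : f' v = f0 v - h (pi v) by rewrite !lfun_simp.
have f'W v : v \in W j -> f' v = f v by move=> vW; rewrite f'E Wk // linear0 subr0 g2.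
have f'e : f' e = x0 *: u by rewrite f'E ee h2 /q opprB addrC subrK.
have f'v : eqv (W j.+1) f' by move=> g v vE; rewrite !f'E g1 // hpi // h1 linearB.
have f'wp c v : v \in W j.+1 -> f' (wp c v) = wp c (f' v) := eqv_wp c f'v (v := v).
exists f'; split=> //.
  move=> v vE; have [en|ne] := eqVneq nu l.
    have [t ht] := tnab_line St hN (pi v).
    have wW : wp l v - t *: e \in W j.
      apply: (quo_mem piS); first by rewrite memvB ?memvZ // wp_stable.
      by rewrite linearB linearZ /= (eqv_wp _ hpi vE) ee -en ht subrr.
    rewrite -(subrK (t *: e) (wp l v)); move: wW; set w := _ - _ => wW.
    have lw : wp l w = w by rewrite /w linearB linearZ /= wp_idem; move: ea; rewrite en => ->.
    have fw : f' w = xi w *: u by rewrite f'W // fWl.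
    clearbody f' w; rewrite linearD linearZ /= f'e fw [xi (_ + _)]linearD linearZ /= /x0 en eqxx scalerDl.
    by rewrite scalerA [xi (t *: e)]linearZ_LR [xi e * t]mulrC.
  have [s hs] := quo_gen hN hE piS hpi eE ee vE.
  set y := \sum_(x <- s) _ in hs.
  have hx0 : x0 = 0 by rewrite /x0 (negPf ne).
  have fy : f' (wp l y) = 0.
    rewrite !linear_sum big1 // => x _; rewrite !linearZ /= f'wp; last exact: hE.
    by rewrite f'v // f'e hx0 scale0r !linear0.
  have xy : xi (wp l y) = 0.
    by rewrite !linear_sum big1 // => x _; rewrite !linearZ /= -ea hxi // scaler0.
  rewrite -(subrK y v); move: (v - y) hs => w hw; rewrite !linearD /= fy xy !addr0.
  by rewrite f'W ?wp_stable // fWl ?wp_stable //; exact: wp_idem.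
move=> c v vE lc cl; have [en|ne] := eqVneq nu l.
  have cW : wp c v \in W j by apply: lowW => //; rewrite en; apply: le_neq.
  by rewrite f'W // (fW c) //; exact: wp_idem.
have [s hs] := quo_gen hN hE piS hpi eE ee vE.
set y := \sum_(x <- s) _ in hs.
have fy : f' (wp c y) = 0.
  rewrite !linear_sum big1 // => x _; rewrite !linearZ /= f'wp; last exact: hE.
  by rewrite f'v // f'e /x0 (negPf ne) scale0r !linear0.
rewrite -(subrK y v); move: (v - y) hs => w hw; rewrite !linearD /= fy addr0.
by rewrite f'W ?wp_stable // (fW c) ?wp_stable //; exact: wp_idem.
Qed.

End Realize.

Lemma vspace_eqP (k : fieldType) (V : vectType k) (U W : {vspace V}) : (forall v, v \in U <-> v \in W) -> U = W.
Proof.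
by move=> h; apply/eqP; rewrite eqEsubv; apply/andP; split; apply/subvP => v /h.
Qed.

Lemma bilinear_hom (k : fieldType) (V W : vectType k) (J : V -> W -> k) :
  (forall v c x y, J v (c *: x + y) = c * J v x + J v y) ->
  (forall x c u v, J (c *: u + v) x = c * J u x + J v x) ->
  exists h : 'Hom(V, 'Hom(W, k^o)), forall v x, h v x = J v x.
Proof.
move=> J1 J2; have /choice [f hf] : forall v, exists L : 'Hom(W, k^o), forall x, L x = J v x.
  by move=> v; apply: mklin => c x y; rewrite J1.
have [|h hh] := @mklin k V 'Hom(W, k^o) f; last by exists h => v x; rewrite hh hf.
by move=> c u v; apply/lfunP => x; rewrite add_lfunE scale_lfunE !hf J2.
Qed.

Section Idempotent.
Variables (k : fieldType) (V : vectType k) (phi : 'End(V)).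

Inductive pol : 'End(V) -> Prop :=
| pol1 : pol \1%VF
| polP c x y : pol x -> pol y -> pol (c *: x + y)
| polX x : pol x -> pol (phi \o x)%VF.

Lemma polM x y : pol x -> pol y -> pol (x \o y)%VF.
Proof.
move=> hx hy; elim: hx => [|c u v _ hu _ hv|u _ hu]; first by rewrite comp_lfun1l.
  by rewrite comp_lfunDl -comp_lfunZl; apply: polP.
by rewrite -comp_lfunA; apply: polX.
Qed.

Lemma pol_comm y : (phi \o y = y \o phi)%VF -> forall x, pol x -> (x \o y = y \o x)%VF.
Proof.
move=> h x; elim=> [|c u v _ hu _ hv|u _ hu]; first by rewrite comp_lfun1l comp_lfun1r.
  by rewrite comp_lfunDl -comp_lfunZl comp_lfunDr -comp_lfunZr hu hv.
by rewrite -comp_lfunA hu !comp_lfunA h.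
Qed.

Lemma pol_phi x : pol x -> (x \o phi = phi \o x)%VF.
Proof. exact: pol_comm. Qed.

(** Among the subspaces of polynomials in [phi] that are stable under [phi] and contain an element
    not killing [u], take a smallest one, [J]. Multiplication by such an element a of [J], and by
    [phi], is bijective on [J]; writing a = a f and f = [phi] q gives the idempotent f. *)
Lemma pol_idem (u : V) (c0 : k) : phi u = c0 *: u -> phi u != 0 ->
  exists q : 'End(V), [/\ pol q, forall v, phi (q (phi (q v))) = phi (q v) & phi (q u) != 0].
Proof.
move=> hu hu0; have eig x : pol x -> exists c, x u = c *: u.
  elim=> [|c y z _ [a ha] _ [b hb]|y _ [a ha]]; first by exists 1; rewrite id_lfunE scale1r.
    by exists (c * a + b); rewrite add_lfunE scale_lfunE ha hb scalerA scalerDl.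
  by exists (a * c0); rewrite comp_lfunE ha linearZ /= hu scalerA.
pose good (J : {vspace 'End(V)}) := [/\ forall x, x \in J -> pol x, forall x, x \in J -> (phi \o x)%VF \in J &
  exists2 a, a \in J & (a : 'End(V)) u != 0].
have ex : exists n, `[< exists2 J, good J & \dim J = n >].
  have [||A hA] := @vspace_of k 'End(V) pol.
  - by rewrite -[0](addNr \1%VF) -scaleN1r; apply: polP; exact: pol1.
  - by move=> c x y; exact: polP.
  exists (\dim A); apply/asboolP; exists A => //; split=> [x /hA //|x /hA hx|]; first exact/hA/polX.
  by exists phi => //; apply/hA; rewrite -[phi]comp_lfun1r; apply/polX/pol1.
have [n /asboolP [J [J1 J2 [a aJ au]] dJ] minJ] := ex_minnP ex.
have pJ x y : pol x -> y \in J -> (x \o y)%VF \in J.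
  move=> hx yJ; elim: hx => [|c z t _ hz _ ht|z _ hz]; first by rewrite comp_lfun1l.
    by rewrite comp_lfunDl -comp_lfunZl memvD // memvZ.
  by rewrite -comp_lfunA; apply: J2.
have nz x : pol x -> x u != 0 -> exists2 c, c != 0 & x u = c *: u.
  by move=> /eig [c e] ne; exists c => //; apply: contraNneq ne => c0'; rewrite e c0' scale0r.
have key b : pol b -> b u != 0 -> exists L : 'End('End(V)), [/\ forall x, L x = (b \o x)%VF, (L @: J)%VS = J &
    forall x, x \in J -> (b \o x)%VF = 0 -> x = 0].
  move=> pb bu; have [|L hL] := @mklin k 'End(V) 'End(V) (fun x => (b \o x)%VF).
    by move=> c x y; rewrite comp_lfunDr comp_lfunZr.
  exists L; have sJ : (L @: J <= J)%VS.
    by apply/subvP => _ /memv_imgP [x xJ ->]; rewrite hL; apply: pJ.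
  have gJ : good (L @: J)%VS.
    split=> [x /(subvP sJ)/J1 //|_ /memv_imgP [x xJ ->]|].
      rewrite hL comp_lfunA -(pol_phi pb) -comp_lfunA -hL.
      by apply: memv_img; apply: J2.
    exists (b \o a)%VF; first by rewrite -hL memv_img.
    have [c cn ea] := nz _ (J1 _ aJ) au.
    by rewrite comp_lfunE ea linearZ /= scaler_eq0 negb_or cn.
  have dL : (\dim J <= \dim (L @: J))%N.
    by rewrite dJ; apply: minJ; apply/asboolP; exists (L @: J)%VS.
  have eJ : (L @: J)%VS = J by apply/eqP; rewrite eqEdim sJ.
  split=> // x xJ bx; have := limg_ker_dim L J; rewrite eJ => /eqP.
  rewrite -[X in _ == X]add0n eqn_add2r dimv_eq0 => /eqP k0.
  by apply/eqP; rewrite -memv0 -k0 memv_cap xJ memv_ker hL bx eqxx.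
have [La [hLa eLa injLa]] := key _ (J1 _ aJ) au.
have pphi : pol phi by rewrite -[phi]comp_lfun1r; apply/polX/pol1.
have [Lp [hLp eLp _]] := key _ pphi hu0.
have : a \in (La @: J)%VS by rewrite eLa.
move=> /memv_imgP [f fJ]; rewrite hLa => af.
have ff : (f \o f)%VF = f.
  apply/eqP; rewrite -subr_eq0; apply/eqP/injLa; first by rewrite memvB // pJ //; apply: J1.
  rewrite comp_lfunDr -scaleN1r -comp_lfunZr scaleN1r comp_lfunA -!af subrr //.
have : f \in (Lp @: J)%VS by rewrite eLp.
move=> /memv_imgP [q qJ]; rewrite hLp => fq; exists q; split; first exact: J1.
  by move=> v; rewrite -!(comp_lfunE phi q) -fq -[f (f v)]comp_lfunE ff.
rewrite -comp_lfunE -fq; apply: contraNneq au => fu.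
by rewrite af comp_lfunE fu linear0.
Qed.

End Idempotent.

(** * Forms on tilting modules and cells *)

Section Duality.
Variables (k : closedFieldType) (G : algGroup k) (F : frame G).
Local Notation wt := (wt (frk F)).
Local Notation phi := (@fphi _ _ F).
Local Notation wp := (@wp _ _ F _).
Variables (tau : anti_involution G) (B : set G) (le : rel wt).
Hypothesis St : borel_setup tau B le.
Local Notation is_nab := (@is_nab _ _ F B).
Local Notation is_tnab := (@is_tnab _ _ F tau B).
Implicit Types (M N P Q : Gmodule G).

Lemma perp_ex M (U : {vspace M}) : exists V : {vspace tdual tau M},
  forall th, th \in V <-> forall v, v \in U -> (th : 'Hom(M, k^o)) v = 0.
Proof.
apply: (@vspace_of k (tdual tau M) (fun th => forall v, v \in U -> (th : 'Hom(M, k^o)) v = 0)).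
  by move=> v _; rewrite zero_lfunE.
by move=> c x y hx hy v vU; rewrite add_lfunE scale_lfunE hx // hy // scaler0 addr0.
Qed.

Definition perp M (U : {vspace M}) : {vspace tdual tau M} := projT1 (cid (perp_ex U)).

Lemma perpP M (U : {vspace M}) (th : tdual tau M) :
  th \in perp U <-> forall v, v \in U -> (th : 'Hom(M, k^o)) v = 0.
Proof. exact: (projT2 (cid (perp_ex U))). Qed.

Lemma perp_stable M (U : {vspace M}) : gstable U -> gstable (perp U).
Proof. by move=> hU g th /perpP h; apply/perpP => v vU; rewrite tdualE h //; apply: hU. Qed.

Lemma subquotient_dual M (S E : {vspace M}) N : gstable E -> subquotient_iso S E N ->
  subquotient_iso (perp E) (perp S) (tdual tau N).
Proof.
move=> hE [pi [piE piS hpi]].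
have piS' v : v \in E -> pi v = 0 -> v \in S by move=> vE pv; rewrite -piS memv_cap vE memv_ker pv eqxx.
have SE v : v \in S -> v \in E /\ pi v = 0 by rewrite -piS memv_cap memv_ker => /andP [? /eqP].
have [s hs] : exists s : 'Hom(N, M), forall n, s n \in E /\ pi (s n) = n.
  pose f := (pi \o projv E)%VF; have ff : limg f = fullv.
    apply: vspace_eqP => n; split=> _; first exact: memvf.
    have /memv_imgP [v vE ->] : n \in (pi @: E)%VS by rewrite piE memvf.
    by apply/memv_imgP; exists v; rewrite ?memvf // /f comp_lfunE projv_id.
  exists (projv E \o f^-1)%VF => n; rewrite comp_lfunE memv_proj; split=> //.
  have : n \in limg f by rewrite ff memvf.
  by move=> /limg_lfunVK; rewrite /f comp_lfunE.
have [|pi' hpi'] := @mklin k (tdual tau M) (tdual tau N) (fun th => ((th : 'Hom(M, k^o)) \o s)%VF).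
  by move=> c u v; rewrite comp_lfunDl comp_lfunZl.
exists pi'; split.
- apply: vspace_eqP => eta; split=> [|_]; first by rewrite memvf.
  apply/memv_imgP; exists ((eta : 'Hom(N, k^o)) \o pi)%VF.
    by apply/perpP => v /SE [_ e]; rewrite comp_lfunE e linear0.
  by rewrite hpi'; apply/lfunP => n; rewrite !comp_lfunE (hs n).2.
- apply: vspace_eqP => th; rewrite memv_cap memv_ker hpi'; split.
    move=> /andP [/perpP hth /eqP e]; apply/perpP => v vE; have [sE sp] := hs (pi v).
    rewrite -(subrK (s (pi v)) v) linearD /= hth ?add0r; last first.
      by apply: piS'; rewrite ?memvB // linearB /= sp subrr.
    by have := congr1 (fun f : 'Hom(N, k^o) => f (pi v)) e; rewrite comp_lfunE zero_lfunE.
  move=> /perpP hth; apply/andP; split; first by apply/perpP => v /SE [? _]; apply: hth.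
  by apply/eqP/lfunP => n; rewrite comp_lfunE zero_lfunE hth //; apply: (hs n).1.
move=> g th /perpP hth; rewrite !hpi'; apply/lfunP => n; rewrite tdualE !comp_lfunE tdualE.
apply: subr0_eq; rewrite -linearB; apply: hth; have [sE sp] := hs n.
apply: piS'; first by rewrite memvB ?hE //; apply: (hs _).1.
by rewrite linearB /= (hs _).2 hpi // sp subrr.
Qed.

Lemma chain_dual (C C' : Gmodule G -> Prop) M r (U : nat -> {vspace M}) : (forall N, C N -> C' (tdual tau N)) ->
  chain C r U -> exists U' : nat -> {vspace tdual tau M}, chain C' r U'.
Proof.
move=> hC [U0 Ur Us Uq]; exists (fun i => perp (U (r - i)%N)); split.
- rewrite subn0 Ur; apply: vspace_eqP => th; split=> [/perpP h|].
    by rewrite memv0; apply/eqP/lfunP => v; rewrite h ?memvf // zero_lfunE.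
  by rewrite memv0 => /eqP ->; apply/perpP => v _; rewrite zero_lfunE.
- rewrite subnn U0; apply: vspace_eqP => th; split=> [_|_]; first exact: memvf.
  by apply/perpP => v; rewrite memv0 => /eqP ->; rewrite linear0.
- by move=> i _; apply/perp_stable/Us/leq_subr.
move=> i hi; have hj : (r - i.+1 < r)%N by lia.
have [N CN hq] := Uq _ hj; exists (tdual tau N); first exact: hC.
have e : (r - i.+1).+1 = (r - i)%N by lia.
by move: hq; rewrite e; apply: subquotient_dual; apply/Us/leq_subr.
Qed.

Lemma tdual_nab N : is_nab N -> is_tnab (tdual tau N).
Proof. by move=> [a [chi [eps h]]]; exists a, chi, N, eps. Qed.

Lemma tdual_tnab M : is_tnab M -> is_nab (tdual tau M).
Proof.
move=> [a [chi [N [eps [hN ->]]]]]; exists a, chi.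
pose V := tdual tau (tdual tau N).
have [||h hh] := @reflexive_dual k N V (fun v x => (v : 'Hom(tdual tau N, k^o)) x).
- by move=> v c x y; rewrite linearP.
- by move=> x c u v; rewrite add_lfunE scale_lfunE.
exists (eps \o h)%VF; apply: (nab_iso hN).
- apply/vspace_eqP => v; rewrite memv_ker memv0; split=> /eqP.
    by move=> hv; apply/eqP/lfunP => x; rewrite -hh hv linear0 zero_lfunE.
  by move=> ->; rewrite linear0.
- apply/vspace_eqP => n; split=> _; first exact: memvf.
  have [|v hv] := @mklin k (tdual tau N) k^o (fun x => (x : 'Hom(N, k^o)) n).
    by move=> c x y; rewrite add_lfunE scale_lfunE.
  apply/memv_imgP; exists (v : V); first exact: memvf.
  by apply: subr0_eq; apply: dual_sep => x; rewrite linearB /= hh hv subrr.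
move=> g v; apply: subr0_eq; apply: dual_sep => x; rewrite linearB /= hh tdualE.
have -> : x (gact g (h v)) = (gact (tau g) (x : tdual tau N) : 'Hom(N, k^o)) (h v) by rewrite tdualE antiK.
by rewrite hh subrr.
Qed.

Definition tilt Q := (exists r U, @chain _ _ is_tnab Q r U) /\ (exists r U, @chain _ _ is_nab Q r U).

Lemma tilt_dual Q : tilt Q -> tilt (tdual tau Q).
Proof.
move=> [[r [U h]] [r' [U' h']]]; split.
  by have [V hV] := chain_dual tdual_nab h'; exists r', V.
by have [V hV] := chain_dual tdual_tnab h; exists r, V.
Qed.

Lemma subquotient_Giso M (S E : {vspace M}) N N' : Giso N N' -> subquotient_iso S E N -> subquotient_iso S E N'.
Proof.
move=> [f [kf lf]] [pi [h1 h2 h3]]; exists (f \o pi)%VF; split.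
- by rewrite limg_comp h1.
- apply: vspace_eqP => v; rewrite -h2 !memv_cap !memv_ker comp_lfunE.
  have -> : (f (pi v) == 0) = (pi v == 0); last by [].
  by rewrite -memv_ker kf memv0.
by move=> g v vE; rewrite !comp_lfunE h3 //; move/equivariantP: (ghomP f) => ->.
Qed.

Lemma filtered_chain (C C' : Gmodule G -> Prop) M :
  (forall N, C N -> exists2 N', C' N' & Giso N N') -> filtered C M -> exists r U, @chain _ _ C' M r U.
Proof.
move=> hC [r [U [U0 Ur Us Uq]]]; exists r, U; split=> // [i hi g v|i hi]; first exact: Us.
have [_ [N CN hq]] := Uq i hi; have [N' CN' iso] := hC _ CN.
by exists N' => //; apply: subquotient_Giso iso hq.
Qed.

Lemma Giso_refl M : Giso M M.
Proof.
exists (ghom_id M); split=> /=; apply: vspace_eqP => v; rewrite ?memv_ker ?id_lfunE ?memv0 //.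
by split=> _; rewrite ?memvf //; apply/memv_imgP; exists v; rewrite ?memvf ?id_lfunE.
Qed.

Lemma tilting_tilt T Rp Q : T = tor F -> tilting T B Rp tau Q -> tilt Q.
Proof.
move=> eT [h1 h2]; have cT mu : dominant T Rp mu -> exists a, mu = @chr _ _ F a.
  by rewrite eT => -[/character_chr h _].
split; [apply: filtered_chain h1|apply: filtered_chain h2] => N [mu /cT [a ->]].
  move=> [N' hN iso]; exists (tdual tau N') => //; exact: (tdual_nab (nabla_nab St eT hN)).
by move=> hN; exists N; [exact: (nabla_nab St eT hN)|exact: Giso_refl].
Qed.

End Duality.

Section Form.
Variables (k : closedFieldType) (G : algGroup k) (F : frame G).
Local Notation wt := (wt (frk F)).
Local Notation phi := (@fphi _ _ F).
Local Notation wp := (@wp _ _ F _).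
Variables (tau : anti_involution G) (B : set G) (le : rel wt).
Hypothesis St : borel_setup tau B le.
Hypothesis two0 : (2 : k) != 0.
Variable Q : Gmodule G.
Hypothesis hQ : tilt F tau B Q.
Local Notation Qd := 'Hom(Q, k^o).
Implicit Types (e : 'End(Q)) (th eta : Qd).

Definition form_ok (b : 'Hom(Q, Qd)) := (forall v w, b v w = b w v) /\ (forall g v w, b (gact g v) w = b v (gact (tau g) w)).
Definition coform_ok (c : 'Hom(Qd, Q)) := (forall th eta, th (c eta) = eta (c th)) /\
  (forall g th, c (th \o gact (tau g))%VF = gact g (c th)).

Lemma top_weight e : e != \1%VF -> (forall v, e (e v) = e v) -> (forall g v, e (gact g v) = gact g (e v)) ->
  exists (l : wt) (u : Q), [/\ u != 0, e u = 0, wp l u = u & forall v (c : wt), e v = 0 -> wp c v != 0 -> le c l].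
Proof.
move=> e1 ee eg; have wpe (a : wt) v : e v = 0 -> e (wp a v) = 0.
  move=> ev; have := @eqv_wp _ _ F _ _ fullv e a v (fun g v _ => eg g v) (memvf v).
  by rewrite ev linear0.
pose X (c : wt) := `[< exists2 v, e v = 0 & wp c v != 0 >].
have [v0 [ev0 v00]] : exists v, e v = 0 /\ v != 0.
  apply: contrapT => no; case/eqP: e1; apply/lfunP => v; rewrite id_lfunE.
  apply/eqP; rewrite -subr_eq0; apply: contraT => h; case: no; exists (e v - v); split=> //.
  by rewrite linearB /= ee subrr.
have [c0 hc0] : exists c, X c.
  apply: contrapT => no; case/eqP: v00; apply: (@wp_eq _ _ F) => c; rewrite linear0; apply/eqP.
  by apply: contraT => h; case: no; exists c; apply/asboolP; exists v0.
have [l [Xl lmax]] : exists l, X l /\ forall c, X c -> le c l.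
  have Xw c : X c -> c \in wts F Q.
    by move=> /asboolP [v _]; apply: contraNT => /wp_out ->.
  pose s := sort le [seq c <- wts F Q | X c].
  have sX c : (c \in s) = X c.
    by rewrite mem_sort mem_filter; case: (boolP (X c)) => // /Xw ->.
  have ss : sorted le s by apply: sort_sorted; exact: (s_total St).
  exists (last c0 s); have ls : last c0 s \in s.
    by move: hc0; rewrite -sX; case: (s) => // a r _; rewrite /= mem_last.
  split; first by rewrite -sX.
  move=> c; rewrite -sX => cs; have := sorted_leq_nth (s_trans St) (s_refl St) c0 ss.
  move=> h; have := h (index c s) (size s).-1; rewrite !inE nth_index // nth_last; apply.
  - by rewrite index_mem.
  - by case: (s) cs => // a r _; rewrite /= ltnS.
  - by rewrite -ltnS prednK ?index_mem //; case: (s) cs.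
have /asboolP [v ev wv] := Xl.
exists l, (wp l v); split; [by []|exact: wpe|exact: wp_idem|].
by move=> w c ew ww; apply: lmax; apply/asboolP; exists w.
Qed.

(** [u] is a vector of highest weight in the kernel of [e] and [th] a functional supported on the
    same kernel with value 1 at [u]. The factor 2 comes from adding each realized map to its
    transpose. *)
Lemma form_seed e : e != \1%VF -> (forall v, e (e v) = e v) -> (forall g v, e (gact g v) = gact g (e v)) ->
  exists b c u th, [/\ form_ok b, coform_ok c, e u = 0 /\ u != 0, forall v, th (e v) = 0 &
    b u = 2 *: th /\ c th = 2 *: u].
Proof.
move=> e1 ee eg; have [l [u [u0 eu lu top]]] := top_weight e1 ee eg.
have [th0 hth0] : exists th0 : Qd, th0 u = 1.
  have [th1 h1] : exists th1 : Qd, th1 u != 0.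
    apply: contrapT => no; case/eqP: u0; apply: dual_sep => x; apply/eqP.
    by apply: contraT => h; case: no; exists x.
  exists ((th1 u)^-1 *: th1); rewrite scale_lfunE; exact: mulVf.
have wpe (a : wt) v : wp a (e v) = e (wp a v).
  by apply/esym/(@eqv_wp _ _ F _ _ fullv e a v (fun g v _ => eg g v) (memvf v)).
pose t := \1%VF - e; have tE v : t v = v - e v by rewrite !lfun_simp.
have et v : e (t v) = 0 by rewrite tE linearB /= ee subrr.
have tg g v : t (gact g v) = gact g (t v) by rewrite !tE eg linearB.
have wpt (a : wt) v : wp a (t v) = t (wp a v) by rewrite !tE -wpe linearB.
pose th : Qd := (th0 \o wp l \o t)%VF.
have thE v : th v = th0 (wp l (t v)) by rewrite !comp_lfunE.
have thu : th u = 1 by rewrite thE tE eu subr0 lu.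
have thl v : th (wp l v) = th v by rewrite !thE -!wpt wp_idem.
have high (c : wt) v : le l c -> c != l -> t (wp c v) = 0.
  move=> lc cl; apply/eqP; apply: contraT => ne; have h := top (t v) c (et v).
  by rewrite wpt in h; case/negP: (le_neq St lc cl); apply: h.
have hu : @hw _ _ F le l Q u.
  split=> // c g; apply: top; by rewrite eg eu linear0.
have hth : @hw _ _ F le l (tdual tau Q) th.
  split=> [|c g ne].
    by apply/lfunP => v; rewrite (wp_tdual (s_tau St)) thl.
  apply: contrapT => /negP nle; case/eqP: ne; apply/lfunP => v.
  rewrite (wp_tdual (s_tau St)) tdualE thE tg high ?linear0 ?zero_lfunE //.
    by have := s_total St l c; rewrite (negPf nle) orbF.
  by apply: contraNneq nle => ->; apply: (s_refl St).
have cu : @cohw _ _ F le l Q th.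
  by move=> v c g lc cl; rewrite thl thE tg high // !linear0.
have [|ev hev] := @mklin k (tdual tau Q) k^o (fun x => (x : Qd) u).
  by move=> c x y; rewrite add_lfunE scale_lfunE.
have cth : @cohw _ _ F le l (tdual tau Q) ev.
  move=> x c g lc cl; rewrite hev (wp_tdual (s_tau St)) lu tdualE (wp_tdual (s_tau St)).
  suff -> : wp c (gact (tau g) u) = 0 by rewrite linear0.
  apply/eqP; apply: contraT => /top h; case/negP: (le_neq St lc cl); apply: h.
  by rewrite eg eu linear0.
have [[r [W hW]] [r' [U hU]]] := hQ; have [[s [W' hW']] [s' [U' hU']]] := tilt_dual hQ.
have [b0 [hb0 _]] := realize St hW hU' hth cu.
have [c0 [hc0 _]] := realize St hW' hU hu cth.
have b0g g v w : (b0 (gact g v) : Qd) w = (b0 v : Qd) (gact (tau g) w).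
  by move/equivariantP: (ghomP b0) => ->; rewrite tdualE.
have c0g g (x : tdual tau Q) : c0 (gact g x) = gact g (c0 x).
  by move/equivariantP: (ghomP c0) => ->.
have b0w w : wp l (b0 w) = b0 (wp l w).
  by apply: wp_hom => s0 _; move/equivariantP: (ghomP b0) => ->.
have c0w (x : tdual tau Q) : wp l (c0 x) = c0 (wp l x) by apply: wp_hom => s0 _; exact: c0g.
have [||b hb] := @bilinear_hom k Q Q (fun v w => (b0 v : Qd) w + (b0 w : Qd) v).
- by move=> v a x y; rewrite !linearP add_lfunE scale_lfunE /= mulrDr addrACA.
- by move=> x a y v; rewrite !linearP add_lfunE scale_lfunE /= mulrDr addrACA.
have [||c hc] := @reflexive_dual k Q (tdual tau Q) (fun y x => (x : Qd) (c0 y) + (y : Qd) (c0 x)).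
- by move=> v a x y; rewrite !linearP add_lfunE scale_lfunE /= mulrDr addrACA.
- by move=> x a y v; rewrite !linearP add_lfunE scale_lfunE /= mulrDr addrACA.
exists b, c, u, th; split=> //.
- split=> [v w|g v w]; first by rewrite !hb addrC.
  rewrite !hb b0g; congr (_ + _).
  by rewrite -[in LHS](antiK tau g) -b0g.
- split=> [x y|g x]; first by rewrite !hc addrC.
  apply: subr0_eq; apply: dual_sep => y; rewrite linearB /= hc.
  have -> : y (gact g (c x)) = (y \o gact g)%VF (c x) by rewrite comp_lfunE.
  rewrite hc !comp_lfunE.
  have -> : c0 (x \o gact (tau g))%VF = gact g (c0 x).
    by rewrite -c0g; congr (c0 _); apply/lfunP => v; rewrite tdualE comp_lfunE.
  have -> : c0 (y \o gact g)%VF = gact (tau g) (c0 y).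
    by rewrite -c0g; congr (c0 _); apply/lfunP => v; rewrite tdualE comp_lfunE antiK.
  by rewrite subrr.
- by move=> v; rewrite thE tE ee subrr !linear0.
split.
  apply/lfunP => w; rewrite hb scale_lfunE -{1}lu hb0 lu thu scale1r.
  have -> : (b0 w : Qd) u = th w.
    rewrite -lu -(wp_tdual (s_tau St) l (b0 w)) b0w hb0 scale_lfunE thl thu; exact: mulr1.
  by rewrite scaler_nat mulr2n.
apply: subr0_eq; apply: dual_sep => x; rewrite linearB linearZ /= hc.
have -> : c0 (th : tdual tau Q) = u by rewrite -hth.1 hc0 hth.1 hev thu scale1r.
have -> : th (c0 x) = x u.
  rewrite -thl c0w.
  by rewrite hc0 hev (wp_tdual (s_tau St)) lu linearZ /= thu; exact: mulr1.
by rewrite scaler_nat mulr2n; exact: subrr.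
Qed.

(* A symmetric pair (b, c) that are generalised inverses of each other is
   enlarged on the kernel of the projector c o b. *)
Lemma form_step b c : form_ok b -> coform_ok c -> (forall v, b (c (b v)) = b v) ->
  (forall th, c (b (c th)) = c th) -> (c \o b)%VF != \1%VF -> exists b' c',
  [/\ form_ok b', coform_ok c', forall v, b' (c' (b' v)) = b' v, forall th, c' (b' (c' th)) = c' th &
    (\dim (limg (c \o b)%VF) < \dim (limg (c' \o b')%VF))%N].
Proof.
move=> [bs bg] [cs cg] bcb cbc; set e := (c \o b)%VF => e1.
have eE v : e v = c (b v) by rewrite comp_lfunE.
have beg (b1 : 'Hom(Q, Qd)) c1 : form_ok b1 -> coform_ok c1 -> forall g v, c1 (b1 (gact g v)) = gact g (c1 (b1 v)).
  move=> [_ h1] [_ h2] g v; rewrite -h2; congr (c1 _); apply/lfunP => w.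
  by rewrite h1 comp_lfunE.
have ee v : e (e v) = e v by rewrite !eE cbc.
have eg g v : e (gact g v) = gact g (e v) by rewrite !eE (beg b c).
have [b0 [c0 [u [th [[b0s b0g] [c0s c0g] [eu u0] the [b0u c0th]]]]]] := form_seed e1 ee eg.
(* Compressing b0 and c0 by 1 - e makes them orthogonal to (b, c), so that the two pairs can be
   added. *)
pose t := \1%VF - e; have tE v : t v = v - e v by rewrite !lfun_simp.
have et v : e (t v) = 0 by rewrite tE linearB /= ee subrr.
have te v : t (e v) = 0 by rewrite tE ee subrr.
have tg g v : t (gact g v) = gact g (t v) by rewrite !tE eg linearB.
have [||b1 hb1] := @bilinear_hom k Q Q (fun v w => b0 (t v) (t w)).
- by move=> v a x y; rewrite !linearP.
- by move=> x a y v; rewrite !linearP add_lfunE scale_lfunE.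
have [|c1 hc1] := @mklin k Qd Q (fun x => t (c0 (x \o t)%VF)).
  by move=> a x y; rewrite comp_lfunDl -comp_lfunZl !linearP.
have ok1 : form_ok b1 by split=> *; rewrite !hb1 ?tg // b0g.
have cok1 : coform_ok c1.
  split=> [x y|g x]; rewrite !hc1.
    by have := c0s (x \o t)%VF (y \o t)%VF; rewrite !comp_lfunE.
  rewrite -tg -c0g; congr (t (c0 _)); apply/lfunP => v; by rewrite !comp_lfunE tg.
have b1u : b1 u = 2 *: th.
  by apply/lfunP => w; rewrite hb1 tE eu subr0 b0u !scale_lfunE tE linearB /= the subr0.
have c1th : c1 th = 2 *: u.
  rewrite hc1; have -> : (th \o t)%VF = th.
    by apply/lfunP => w; rewrite comp_lfunE tE linearB /= the subr0.
  by rewrite c0th linearZ /= tE eu subr0.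
have b1e v : b1 (e v) = 0 by apply/lfunP => w; rewrite hb1 te linear0 !zero_lfunE.
have b1e' v w : b1 v (e w) = 0 by rewrite ok1.1 b1e zero_lfunE.
have ec1 x : e (c1 x) = 0 by rewrite hc1 et.
have c1e x : c1 (x \o e)%VF = 0.
  rewrite hc1; have -> : ((x \o e) \o t)%VF = 0; last by rewrite !linear0.
  by apply/lfunP => w; rewrite comp_lfunE comp_lfunE et linear0 zero_lfunE.
clearbody t; move: ok1 cok1 {hb1 hc1} => [b1s b1g] [c1s c1g].
pose f0 := (c1 \o b1)%VF; have f0E v : f0 v = c1 (b1 v) by rewrite comp_lfunE.
clearbody f0; have f0u : f0 u = 4 *: u by rewrite f0E b1u linearZ /= c1th scalerA -natrM.
have f0u' : f0 u != 0 by rewrite f0u scaler_eq0 negb_or u0 (natrM _ 2 2) mulf_neq0.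
(* The composite f0 of c1 and b1 has eigenvalue 4 = 2 * 2 on [u], nonzero because p > 2. Polynomials
   in f0 are self-adjoint for b1, so composing with them preserves symmetry. *)
have [q [pq ff fu]] := pol_idem f0u f0u'.
have f0g g v : f0 (gact g v) = gact g (f0 v) by rewrite !f0E (beg b1 c1).
have polg (x : 'End(Q)) : pol f0 x -> forall g v, x (gact g v) = gact g (x v).
  elim=> [|a y z _ hy _ hz|y _ hy] g v; rewrite ?id_lfunE //.
    by rewrite !add_lfunE !scale_lfunE hy hz !linearP.
  by rewrite !comp_lfunE hy f0g.
have pol_f0 (x : 'End(Q)) : pol f0 x -> forall v, x (f0 v) = f0 (x v).
  by move=> px v; rewrite -!comp_lfunE pol_phi.
have pols (x : 'End(Q)) : pol f0 x -> forall v w, b1 (x v) w = b1 v (x w).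
  elim=> [|a y z _ hy _ hz|y py hy] v w; rewrite ?id_lfunE //.
    by rewrite !add_lfunE !scale_lfunE !linearP add_lfunE scale_lfunE hy hz.
  rewrite !comp_lfunE -[f0 (y w)]pol_f0 // -hy f0E b1s c1s f0E.
  by [].
have polc (x : 'End(Q)) : pol f0 x -> forall y z : Qd, y (x (c1 z)) = z (x (c1 y)).
  elim=> [|a x1 x2 _ h1 _ h2|x1 p1 h1] y z; rewrite ?id_lfunE //.
    by rewrite !add_lfunE !scale_lfunE [LHS]linearP [RHS]linearP /= h1 h2.
  rewrite !comp_lfunE !f0E -[LHS]c1s -[in RHS]c1s b1s.
  by rewrite -[RHS]b1s -pols // b1s.
pose f := (f0 \o q)%VF; have fE v : f v = f0 (q v) by rewrite comp_lfunE.
have pf : pol f0 f by apply: polX.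
have pfq : pol f0 (f \o q)%VF by apply: polM.
clearbody f.
(* With f = f0 q idempotent, c2 after b2 equals f: the new pair consists of generalised inverses. *)
pose b2 := (b1 \o f)%VF; pose c2 := (f \o q \o c1)%VF.
have b2E v : b2 v = b1 (f v) by rewrite comp_lfunE.
have c2E x : c2 x = f (q (c1 x)) by rewrite comp_lfunE comp_lfunE.
clearbody b2 c2; have fff v : f (f v) = f v by rewrite !fE ff.
have f0e v : f0 (e v) = 0 by rewrite f0E b1e linear0.
have fe v : f (e v) = 0 by rewrite fE -pol_f0 // f0e linear0.
have ef v : e (f v) = 0 by rewrite fE f0E ec1.
have c2b2 v : c2 (b2 v) = f v.
  by rewrite c2E b2E -f0E pol_f0 // -fE fff fff.
have xe (x : Qd) : (x \o e)%VF = b (c x).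
  by apply/lfunP => v; rewrite comp_lfunE eE cs bs.
have cb2 v : c (b2 v) = 0.
  rewrite -cbc -xe; have -> : (b2 v \o e)%VF = 0; last by rewrite !linear0.
  by apply/lfunP => w; rewrite comp_lfunE b2E b1e' zero_lfunE.
have c2b v : c2 (b v) = 0 by rewrite c2E -bcb -xe c1e !linear0.
have bc2 x : b (c2 x) = 0 by rewrite -bcb -eE c2E ef linear0.
have b2c x : b2 (c x) = 0 by rewrite b2E -cbc -eE fe linear0.
have fc2 x : f (c2 x) = c2 x by rewrite c2E fff.
have fc x : f (c x) = 0 by rewrite -cbc -eE fe.
have cbE v : (c + c2) ((b + b2) v) = e v + f v.
  by rewrite !add_lfunE !linearD /= cb2 c2b c2b2 addr0 add0r -eE.
exists (b + b2), (c + c2); split.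
- split=> [v w|g v w]; rewrite !add_lfunE.
    by rewrite bs; congr (_ + _); rewrite !b2E pols // b1s.
  by rewrite bg !b2E polg // b1g.
- split=> [x y|g x].
    rewrite !add_lfunE !linearD /= cs; congr (_ + _).
    by rewrite !c2E -!(comp_lfunE f q) polc.
  rewrite !add_lfunE cg linearD /=; congr (_ + _).
  by rewrite !c2E -!(comp_lfunE f q) c1g polg.
- move=> v; rewrite cbE !add_lfunE !linearD /= eE bcb.
  by rewrite b2c add0r -{1}c2b2 bc2 addr0 !b2E fff.
- move=> x; rewrite cbE add_lfunE !linearD /= fc2 fc eE cbc add0r.
  by rewrite eE bc2 linear0 addr0.
have efE v : ((c + c2)%R \o (b + b2)%R)%VF v = e v + f v by rewrite comp_lfunE cbE.
have sub : (limg e <= limg ((c + c2)%R \o (b + b2)%R)%VF)%VS.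
  apply/subvP => _ /memv_imgP [v _ ->]; apply/memv_imgP; exists (e v); rewrite ?memvf //.
  by rewrite efE ee fe addr0.
rewrite ltn_neqAle dimvS // andbT; apply/eqP => ed.
have /eqP eq : limg e == limg ((c + c2)%R \o (b + b2)%R)%VF by rewrite -(dimv_leqif_eq sub).2; apply/eqP.
have : f u \in limg e.
  rewrite eq; apply/memv_imgP; exists (f u); rewrite ?memvf // efE ef fff add0r //.
move=> /memv_imgP [w _ ew]; case/eqP: fu; rewrite -fE.
by rewrite -fff ew fe.
Qed.

Lemma nondegenerate_form : exists b : 'Hom(Q, Qd),
  [/\ forall v w, b v w = b w v, forall g v w, b (gact g v) w = b v (gact (tau g) w),
  forall th, exists v, b v = th & forall v, (forall w, b v w = 0) -> v = 0].
Proof.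
pose X n := `[< exists b c, [/\ form_ok b, coform_ok c, forall v, b (c (b v)) = b v, forall th, c (b (c th)) = c th &
  \dim (limg (c \o b)%VF) = n] >].
have X0 : exists n, X n.
  exists (\dim (limg ((0 : 'Hom(Qd, Q)) \o (0 : 'Hom(Q, Qd)))%VF)); apply/asboolP; exists 0, 0; split=> //.
  - by split=> *; rewrite !zero_lfunE.
  - by split=> *; rewrite !zero_lfunE !linear0.
  - by move=> v; rewrite !zero_lfunE.
  - by move=> v; rewrite !zero_lfunE.
have Xb n : X n -> (n <= \dim {:Q})%N.
  by move=> /asboolP [b [c [_ _ _ _ <-]]]; apply/dimvS/subvf.
have [n /asboolP [b [c [hb hc bcb cbc dn]]] nmax] := ex_maxnP X0 Xb.
have [e1|e1] := eqVneq (c \o b)%VF \1%VF; last first.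
  have [b' [c' [h1 h2 h3 h4 h5]]] := form_step hb hc bcb cbc e1.
  have : X (\dim (limg (c' \o b')%VF)) by apply/asboolP; exists b', c'.
  by move=> /nmax; rewrite leqNgt -dn h5.
have cb v : c (b v) = v by rewrite -comp_lfunE e1 id_lfunE.
have [bs bg] := hb; have [cs cg] := hc; exists b; split=> //.
  move=> th; exists (c th); apply/lfunP => v.
  by rewrite bs -[in RHS](cb v) cs.
move=> v hv; rewrite -(cb v); have -> : b v = 0; last by rewrite linear0.
by apply/lfunP => w; rewrite hv zero_lfunE.
Qed.

End Form.

Lemma seq_max (T U : eqType) (le : rel U) (f : T -> U) (X : pred T) (s : seq T) :
  reflexive le -> transitive le -> total le -> has X s ->
  exists x, [/\ x \in s, X x & forall y, y \in s -> X y -> le (f y) (f x)].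
Proof.
move=> lr lt ltot; elim: s => // y s IH /=; have [/IH [x [xs Xx hx]] _|ns] := boolP (has X s); last first.
  rewrite orbF => Xy; exists y; rewrite inE eqxx; split=> // z; rewrite inE => /predU1P [-> //|zs Xz].
  by case/hasP: ns; exists z.
have [Xy|nXy] := boolP (X y && le (f x) (f y)).
  case/andP: Xy => Xy lxy; exists y; rewrite inE eqxx; split=> // z; rewrite inE => /predU1P [-> //|zs Xz].
  exact: lt (hx _ zs Xz) lxy.
exists x; rewrite inE xs orbT; split=> // z; rewrite inE => /predU1P [-> Xy|]; last exact: hx.
by have := ltot (f x) (f y); move: nXy; rewrite Xy /= => /negPf ->.
Qed.

Lemma span_pairs (k : fieldType) (V : lmodType k) (I : eqType) (D : set I) (v : I -> V) (s : seq (k * I)) :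
  (forall y, y \in s -> D y.2) -> in_span D v (\sum_(y <- s) y.1 *: v y.2).
Proof.
move=> hD; exists (undup [seq y.2 | y <- s]), (fun i => \sum_(y <- s | y.2 == i) y.1); split.
  by move=> i; rewrite mem_undup => /mapP [y /hD h ->].
under [RHS]eq_bigr do rewrite scaler_suml big_mkcond; rewrite exchange_big; apply: eq_big_seq => y ys /=.
have yu : y.2 \in undup [seq y.2 | y <- s] by rewrite mem_undup map_f.
by rewrite (bigD1_seq _ yu (undup_uniq _)) /= eqxx big1 ?addr0 // => i; rewrite eq_sym => /negPf ->.
Qed.

(** * The involution and the cellular basis *)

Section Cells.
Variables (k : closedFieldType) (G : algGroup k) (F : frame G).
Local Notation wt := (wt (frk F)).
Local Notation phi := (@fphi _ _ F).
Local Notation wp := (@wp _ _ F _).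
Variables (tau : anti_involution G) (B : set G) (le : rel wt).
Hypothesis St : borel_setup tau B le.
Hypothesis two0 : (2 : k) != 0.
Implicit Types (P Q R : Gmodule G) (l c : wt).
Local Notation tilt := (tilt F tau B).
Local Notation hw l v := (@hw _ _ F le l _ v).

Lemma ghomE P Q (f : Ghom P Q) g v : f (gact g v) = gact g (f v).
Proof. by move/equivariantP: (ghomP f) => ->. Qed.

Lemma ghom_wp P Q (f : Ghom P Q) c v : wp c (f v) = f (wp c v).
Proof. by apply: wp_hom => s _; exact: ghomE. Qed.

Lemma ghom_sumE (I : Type) (s : seq I) P Q (f : I -> Ghom P Q) (a : I -> k) v :
  (\sum_(i <- s) a i *: f i : Ghom P Q) v = \sum_(i <- s) a i *: f i v.
Proof.
elim: s => [|i s IH]; first by rewrite !big_nil /= zero_lfunE.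
by rewrite !big_cons -IH /= add_lfunE scale_lfunE.
Qed.

(** Guarding by [tilt P] makes the choice of a form a total function of the object, so that [adj] is
    defined on all homomorphisms. *)
Lemma form_ex P : exists b : 'Hom(P, 'Hom(P, k^o)), tilt P ->
  [/\ forall v w, b v w = b w v, forall g v w, b (gact g v) w = b v (gact (tau g) w),
  forall th, exists v, b v = th & forall v, (forall w, b v w = 0) -> v = 0].
Proof.
have [hP|nP] := pselect (tilt P); last by exists 0.
by have [b hb] := nondegenerate_form St two0 hP; exists b.
Qed.

Definition form P := projT1 (cid (form_ex P)).

Section FormTheory.
Variable P : Gmodule G.
Hypothesis hP : tilt P.

Lemma form_sym v w : form P v w = form P w v.
Proof. by have [h _ _ _] := projT2 (cid (form_ex P)) hP; apply: h. Qed.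

Lemma form_act g v w : form P (gact g v) w = form P v (gact (tau g) w).
Proof. by have [_ h _ _] := projT2 (cid (form_ex P)) hP; apply: h. Qed.

Lemma form_onto th : exists v, form P v = th.
Proof. by have [_ _ h _] := projT2 (cid (form_ex P)) hP; apply: h. Qed.

Lemma form_inj v w : (forall x, form P v x = form P w x) -> v = w.
Proof.
move=> e; apply: subr0_eq; have [_ _ _ h] := projT2 (cid (form_ex P)) hP; apply: h => x.
by rewrite -/(form P) linearB add_lfunE opp_lfunE e subrr.
Qed.

Lemma form_wp c v w : form P (wp c v) w = form P v (wp c w).
Proof.
have e : wp c (form P v : tdual tau P) = form P (wp c v).
  by apply: wp_hom => s _; apply/lfunP => x; rewrite form_act tdualE.
by rewrite -(wp_tdual (s_tau St)) e.
Qed.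

End FormTheory.

Lemma adj_ex P Q (f : Ghom P Q) : exists f' : Ghom Q P, tilt P -> tilt Q ->
  forall p q, form P (f' q) p = form Q q (f p).
Proof.
have [hP|nP] := pselect (tilt P); last by exists 0.
have [hQ|nQ] := pselect (tilt Q); last by exists 0.
have /choice [f' hf'] : forall q, exists p', forall p, form P p' p = form Q q (f p).
  move=> q; have [p' hp'] := form_onto hP (form Q q \o f)%VF; exists p' => p.
  by rewrite hp' comp_lfunE.
have [|L hL] := @mklin k Q P f'.
  move=> a u v; apply: (form_inj hP) => p; rewrite hf' !linearP add_lfunE scale_lfunE.
  by rewrite add_lfunE scale_lfunE !hf'.
have hg : L \in @equivariant k G Q P.
  apply/equivariantP => g v; apply: (form_inj hP) => p.
  by rewrite !hL hf' (form_act hQ) (form_act hP) hf' ghomE.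
by exists (GHom hg) => _ _ p q; rewrite /= hL hf'.
Qed.

Definition adj P Q (f : Ghom P Q) : Ghom Q P := projT1 (cid (adj_ex f)).

Lemma adjE P Q (f : Ghom P Q) : tilt P -> tilt Q -> forall p q, form P (adj f q) p = form Q q (f p).
Proof. exact: (projT2 (cid (adj_ex f))). Qed.

Lemma ghom_ext P Q (f h : Ghom P Q) : (forall v, f v = h v) -> f = h.
Proof. by move=> e; apply: val_inj; apply/lfunP. Qed.

Lemma adjP P Q (a : k) (f h : Ghom P Q) : tilt P -> tilt Q -> adj (a *: f + h) = a *: adj f + adj h.
Proof.
move=> hP hQ; apply: ghom_ext => q; apply: (form_inj hP) => p.
by rewrite adjE //= !add_lfunE !scale_lfunE !linearP add_lfunE scale_lfunE !adjE.
Qed.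

Lemma adj1 P : tilt P -> adj (ghom_id P) = ghom_id P.
Proof. by move=> hP; apply: ghom_ext => q; apply: (form_inj hP) => p; rewrite adjE //= !id_lfunE. Qed.

Lemma adjM P Q R (f : Ghom Q R) (h : Ghom P Q) : tilt P -> tilt Q -> tilt R ->
  adj (ghom_comp f h) = ghom_comp (adj h) (adj f).
Proof.
move=> hP hQ hR; apply: ghom_ext => q; apply: (form_inj hP) => p.
by rewrite adjE //= !comp_lfunE !adjE.
Qed.

Lemma adjK P Q (f : Ghom P Q) : tilt P -> tilt Q -> adj (adj f) = f.
Proof.
move=> hP hQ; apply: ghom_ext => q; apply: (form_inj hQ) => p.
by rewrite adjE // form_sym // adjE // form_sym.
Qed.

Lemma hwV_ex l P : exists W : {vspace P}, forall v, v \in W <-> hw l v.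
Proof.
apply: vspace_of.
  by split=> [|c g]; rewrite ?linear0 // eqxx.
move=> a u v [u1 u2] [v1 v2]; split=> [|c g]; first by rewrite [LHS]linearP /= u1 v1.
rewrite [gact g _]linearP [wp c _]linearP /=; have [/u2 //|/negPn/eqP ->] := boolP (wp c (gact g u) != 0).
by rewrite scaler0 add0r; apply: v2.
Qed.

Definition hwV l P : {vspace P} := projT1 (cid (hwV_ex l P)).

Lemma hwP l P (v : P) : v \in hwV l P <-> hw l v.
Proof. exact: (projT2 (cid (hwV_ex l P))). Qed.

(** The set K(P, l); its size is the number of independent vectors of weight l generating a
    submodule with weights <= l. *)
Definition idx l P := 'I_(\dim (hwV l P)).
Definition bas l P (i : idx l P) : P := (vbasis (hwV l P))`_i.

Lemma bas_hw l P (i : idx l P) : hw l (bas i).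
Proof. by apply/hwP/vbasis_mem/mem_nth; rewrite size_tuple. Qed.

Lemma hw_bas l P (v : P) : hw l v -> v = \sum_i coord (vbasis (hwV l P)) i v *: bas i.
Proof. by move=> /hwP h; rewrite {1}(coord_vbasis h). Qed.

Lemma bas_dual l P (i : idx l P) : exists th : 'Hom(P, k^o), forall j, th (bas j) = (j == i)%:R.
Proof.
exists (linfun (coord (vbasis (hwV l P)) i : P -> k^o)) => j.
by rewrite lfunE /= coord_free ?(basis_free (vbasisP _)) // eq_sym.
Qed.

Lemma hw_ghom l P Q (f : Ghom P Q) (v : P) : hw l v -> hw l (f v).
Proof.
move=> [h1 h2]; split=> [|c g]; first by rewrite ghom_wp h1.
rewrite -ghomE ghom_wp => ne; apply: (h2 c g); apply: contraNneq ne => ->.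
by rewrite linear0.
Qed.

Lemma hw_high l c P (v : P) g : hw l v -> le l c -> c != l -> wp c (gact g v) = 0.
Proof.
move=> [_ h] lc cl; apply/eqP; apply: contraT => /h.
by rewrite (negPf (le_neq St lc cl)).
Qed.

Lemma form_cohw l P (w : P) : tilt P -> hw l w -> @cohw _ _ F le l P (form P w).
Proof.
move=> hP hw_ v c g lc cl; rewrite -form_wp // hw_.1 -[g](antiK tau) -form_act //.
by rewrite -form_wp // (hw_high _ hw_) // linear0 zero_lfunE.
Qed.

(** The form identifies the functionals allowed in [realize] with the vectors allowed there. *)
Lemma cohw_form l P (xi : 'Hom(P, k^o)) : tilt P -> @cohw _ _ F le l P xi ->
  (forall v, xi (wp l v) = xi v) -> exists2 w, hw l w & form P w = xi.
Proof.
move=> hP hxi xil; have [w ew] := form_onto hP xi; exists w => //; split.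
  by apply: (form_inj hP) => x; rewrite form_wp // ew.
move=> c g ne; apply: contrapT => /negP nle; case/eqP: ne; apply: (form_inj hP) => v.
rewrite form_wp // form_act // ew -xil linear0 zero_lfunE hxi //.
  by have := s_total St l c; rewrite (negPf nle) orbF.
by apply: contraNneq nle => ->; apply: (s_refl St).
Qed.

Definition rank1 l P Q (f : Ghom P Q) (u : Q) (w : P) :=
  (forall v, f (wp l v) = form P w v *: u) /\ forall c v, le l c -> c != l -> f (wp c v) = 0.

Lemma rank1_ex l P Q (u : Q) (w : P) : exists f : Ghom P Q, tilt P -> tilt Q -> hw l u -> hw l w -> rank1 l f u w.
Proof.
have [hP|nP] := pselect (tilt P); last by exists 0.
have [hQ|nQ] := pselect (tilt Q); last by exists 0.
have [hu|nu] := pselect (hw l u); last by exists 0.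
have [hw_|nw] := pselect (hw l w); last by exists 0.
have [[r [W hW]] _] := hP; have [_ [r' [U hU]]] := hQ.
have [f [h1 h2]] := realize St hW hU hu (form_cohw hP hw_).
by exists f => _ _ _ _; split=> // v; rewrite h1 -form_wp // hw_.1.
Qed.

Definition seed l P Q (i : idx l Q) (j : idx l P) : Ghom P Q := projT1 (cid (rank1_ex l (bas i) (bas j))).

Lemma seedP l P Q (i : idx l Q) (j : idx l P) : tilt P -> tilt Q -> rank1 l (seed i j) (bas i) (bas j).
Proof. by move=> hP hQ; apply: (projT2 (cid (rank1_ex l (bas i) (bas j)))) => //; apply: bas_hw. Qed.

Lemma rank1_adj l P Q (f : Ghom P Q) u w : tilt P -> tilt Q -> hw l u -> hw l w ->
  rank1 l f u w -> rank1 l (adj f) w u.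
Proof.
move=> hP hQ hu hw_ [h1 h2]; split=> [v|c v lc cl]; apply: (form_inj hP) => p.
  rewrite adjE // form_wp // ghom_wp h1 linearZ /= linearZ scale_lfunE /= (form_sym hQ v u).
  exact: mulrC.
by rewrite adjE // form_wp // ghom_wp h2 // !linear0 zero_lfunE.
Qed.

(** Seeds are arbitrary choices and the adjoint of a seed need not be one; the average with the
    adjoint of the opposite seed has the same values in weights >= l and is compatible with the
    involution. *)
Definition cell l P Q (i : idx l Q) (j : idx l P) : Ghom P Q := 2^-1 *: (seed i j + adj (seed j i)).

Lemma cellP l P Q (i : idx l Q) (j : idx l P) : tilt P -> tilt Q -> rank1 l (cell i j) (bas i) (bas j).
Proof.
move=> hP hQ; have [h1 h2] := seedP i j hP hQ.
have [h3 h4] := rank1_adj hQ hP (bas_hw _) (bas_hw _) (seedP j i hQ hP).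
split=> [v|c v lc cl]; rewrite /= scale_lfunE add_lfunE.
  by rewrite h1 h3 -mulr2n -scaler_nat scalerA mulVf // scale1r.
by rewrite h2 // h4 // addr0 scaler0.
Qed.

Lemma cell_adj l P Q (i : idx l Q) (j : idx l P) : tilt P -> tilt Q -> adj (cell i j) = cell j i.
Proof.
move=> hP hQ; rewrite /cell -[2^-1 *: (seed i j + _)]addr0 adjP // -[seed i j]scale1r adjP // scale1r adjK //.
have -> : adj (0 : Ghom P Q) = 0 by have := adjP (-1) (0 : Ghom P Q) 0 hP hQ; rewrite !scaleN1r oppr0 addr0 addNr.
by rewrite addr0 scale1r addrC.
Qed.

(** [D] is a lower set of weights outside which f vanishes. At the largest weight m of [P] in [D]
    the values of f lie in [hwV m Q], so f is there a combination of cells of weight m; subtracting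
    it leaves fewer weights. *)
Lemma lower_span P Q (hP : tilt P) (hQ : tilt Q) (D : pred wt) (f : Ghom P Q) :
  (forall c l, le c l -> D l -> D c) -> (forall c v, ~~ D c -> f (wp c v) = 0) ->
  exists s : seq (k * {l : wt & (idx l Q * idx l P)%type}), (forall y, y \in s -> D (tag y.2)) /\
    f = \sum_(y <- s) y.1 *: cell (tagged y.2).1 (tagged y.2).2.
Proof.
have [n] := ubnP (count D (wts F P)); elim: n D f => // n IH D f hn hD hf.
have [hs|nh] := boolP (has D (wts F P)); last first.
  exists [::]; split=> //; rewrite big_nil; apply: ghom_ext => v /=; rewrite zero_lfunE -(wp_sum F v) linear_sum.
  rewrite big_seq big1 // => c cw; apply: hf; apply: contra nh => Dc; apply/hasP; by exists c.
have [m [ms Dm hm]] := seq_max id (s_refl St) (s_trans St) (s_total St) hs.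
have high c v : le m c -> c != m -> f (wp c v) = 0.
  move=> mc cm; have [cw|/wp_out ->] := boolP (c \in wts F P); last by rewrite linear0.
  apply: hf; apply: contra cm => Dc; apply/eqP/(s_anti St); by rewrite mc (hm c).
have fhw v : hw m (f (wp m v)).
  split=> [|c g ne]; first by rewrite ghom_wp wp_idem.
  apply: contrapT => /negP nle; case/eqP: ne; rewrite -ghomE ghom_wp high //.
    by have := s_total St m c; rewrite (negPf nle) orbF.
  by apply: contraNneq nle => ->; apply: (s_refl St).
(* Each coordinate of f on the weight space of m is a functional as in [cohw], hence given by the
   form and a vector of [hwV m P]. *)
have /choice [w hw_] : forall i : idx m Q, exists w : P, hw m w /\
    forall v, form P w v = coord (vbasis (hwV m Q)) i (f (wp m v)).
  move=> i; have [|xi hxi] := @mklin k P k^o (fun v => coord (vbasis (hwV m Q)) i (f (wp m v))).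
    by move=> a u v; rewrite !linearP.
  have [|v|w hw1 ew] := @cohw_form m P xi hP; last by exists w; split=> // v; rewrite ew hxi.
    by move=> v c g mc cm; rewrite hxi wp_idem -ghom_wp ghomE high // !linear0.
  by rewrite !hxi wp_idem.
pose A i j := coord (vbasis (hwV m P)) j (w i).
have wE i : w i = \sum_j A i j *: bas j by apply: hw_bas; exact: (hw_ i).1.
pose S := [seq (A i j, Tagged (fun l => (idx l Q * idx l P)%type) (i, j)) | i <- enum (idx m Q), j <- enum (idx m P)].
pose f1 := \sum_(y <- S) y.1 *: cell (tagged y.2).1 (tagged y.2).2.
have f1E : f1 = \sum_i \sum_j A i j *: cell i j.
  by rewrite /f1 big_allpairs_dep /= big_enum; apply: eq_bigr => i _; rewrite big_enum.
have f1v v : f1 v = \sum_i \sum_j A i j *: cell i j v.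
  rewrite f1E; have e (I : finType) (h : I -> Ghom P Q) : (\sum_i h i : Ghom P Q) v = \sum_i h i v.
    have := ghom_sumE (enum I) h (fun=> 1) v; rewrite !big_enum /=.
    by under eq_bigr do rewrite scale1r; under [in RHS]eq_bigr do rewrite scale1r.
  rewrite e; apply: eq_bigr => i _; rewrite e; apply: eq_bigr => j _.
  by rewrite /= scale_lfunE.
pose D' c := le c m && (c != m).
have [|c l cl /andP [lm lne]|c v nD|s [s1 s2]] := IH D' (f - f1).
- rewrite -ltnS; apply: leq_trans hn; rewrite ltnS.
  have e := count_predUI (pred1 m) D' (wts F P).
  have h0 : (0 < count (pred1 m) (wts F P))%N by rewrite -has_count has_pred1.
  have hI : count (predI (pred1 m) D') (wts F P) = 0%N.
    by apply/eqP; rewrite -leqn0 leqNgt -has_count; apply/hasPn => c _; rewrite /= /D'; case: eqP => //= ->; rewrite andbF.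
  have hU : (count (predU (pred1 m) D') (wts F P) <= count D (wts F P))%N.
    by apply: sub_count => c /orP [/eqP -> //|/andP [h _]]; apply: hD h Dm.
  by rewrite hI addn0 in e; rewrite e in hU; apply: leq_trans hU; rewrite -add1n leq_add2r.
- rewrite /D' (s_trans St cl lm) /=; apply: contra lne => /eqP cm.
  by apply/eqP/(s_anti St); rewrite lm -cm cl.
- have fE : (f - f1) (wp c v) = f (wp c v) - f1 (wp c v) by rewrite /= !lfun_simp.
  rewrite fE f1v; have [->|cm] := eqVneq c m.
    apply/eqP; rewrite subr_eq0; apply/eqP; rewrite (hw_bas (fhw v)); apply: eq_bigr => i _.
    rewrite -(hw_ i).2 wE linear_sum sum_lfunE scaler_suml; apply: eq_bigr => j _.
    by rewrite linearZ scale_lfunE (cellP i j hP hQ).1 scalerA.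
  have mc : le m c by have := s_total St m c; move: nD; rewrite /D' cm andbT => /negPf ->; rewrite orbF.
  rewrite high // sub0r big1 ?oppr0 // => i _; rewrite big1 // => j _.
  by rewrite (cellP i j hP hQ).2 // scaler0.
exists (s ++ S); split=> [y|]; last by rewrite big_cat -s2 /= -/f1 subrK.
rewrite mem_cat => /orP [/s1 /andP [h _]|]; first exact: hD h Dm.
by move=> /allpairsP [[i j] [_ _ ->]].
Qed.

(** A functional dual to [bas i], and a vector representing through the form a functional dual to
    [bas j], single out one cell. *)
Lemma cell_test l P Q (i : idx l Q) (j : idx l P) : tilt P -> tilt Q -> exists (th : 'Hom(Q, k^o)) (v : P),
  (forall i' j', th (cell i' j' v) = ((i' == i) && (j' == j))%:R) /\
  forall c (i' : idx c Q) (j' : idx c P), le c l -> c != l -> th (cell i' j' v) = 0.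
Proof.
move=> hP hQ; have [th hth] := bas_dual i; have [et het] := bas_dual j; have [v hv] := form_onto hP et.
exists th, (wp l v); split=> [i' j'|c i' j' cl ne].
  by rewrite (cellP i' j' hP hQ).1 form_sym // hv het linearZ /= hth -mulnb natrM [RHS]mulrC.
by rewrite (cellP i' j' hP hQ).2 ?linear0 // eq_sym.
Qed.

Local Notation cidx P Q := {l : wt & (idx l Q * idx l P)%type}.

Definition celt P Q (x : cidx P Q) : Ghom P Q := cell (tagged x).1 (tagged x).2.

Lemma celt_test P Q (x : cidx P Q) : tilt P -> tilt Q -> exists (th : 'Hom(Q, k^o)) (v : P),
  th (celt x v) = 1 /\ forall y : cidx P Q, le (tag y) (tag x) -> y != x -> th (celt y v) = 0.
Proof.
move=> hP hQ; case: x => l [i j]; have [th [v [h1 h2]]] := cell_test i j hP hQ.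
exists th, v; split=> [|[c [i' j']] /= cl ne]; first by rewrite /celt /= h1 !eqxx.
have [e|cl'] := eqVneq c l; last exact: h2.
subst c; rewrite /celt /= h1; case: andP => // -[/eqP ei /eqP ej].
by case/eqP: ne; rewrite ei ej.
Qed.

Lemma celt_inj P Q : tilt P -> tilt Q -> forall x y : cidx P Q, tag x = tag y -> celt x = celt y -> x = y.
Proof.
move=> hP hQ x y txy e; have [th [v [h1 h2]]] := celt_test x hP hQ.
apply/eqP; rewrite eq_sym; apply: contraT => ne.
by have := h2 y; rewrite txy (s_refl St) -e h1 => /(_ isT ne)/eqP; rewrite oner_eq0.
Qed.

Lemma celt_indep P Q : tilt P -> tilt Q -> lin_indep (@celt P Q).
Proof.
move=> hP hQ s a us hs; apply: contrapT => /existsNP [i /not_implyP [si /eqP ai]].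
have hh : has (fun x => a x != 0) s by apply/hasP; exists i.
have [x [xs ax hx]] := seq_max (@tag _ _) (s_refl St) (s_trans St) (s_total St) hh.
have [th [v [h1 h2]]] := celt_test x hP hQ.
case/eqP: ax; have := congr1 (fun f : Ghom P Q => th (f v)) hs.
rewrite ghom_sumE linear_sum (bigD1_seq x) //= zero_lfunE linear0 linearZ /= h1.
rewrite big_seq_cond big1 => [|y /andP [ys yx]]; last first.
  rewrite linearZ /=; have [->|ay] := eqVneq (a y) 0; first exact: mul0r.
  by rewrite h2 ?hx //; exact: mulr0.
by rewrite addr0 => <-; exact/esym/mulr1.
Qed.

Lemma celt_span P Q : tilt P -> tilt Q -> forall f : Ghom P Q, in_span setT (@celt P Q) f.
Proof.
move=> hP hQ f; have [//|//|s [_ ->]] := lower_span hP hQ (D := xpredT) (f := f).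
exact: (@span_pairs _ _ _ setT (@celt P Q) s).
Qed.

(** The scalars are the coordinates of f applied to [bas i], so they do not involve [j]. Both sides
    agree on all weights >= l, and [lower_span] expands the difference in lower cells. *)
Lemma celt_mul Q R l (f : Ghom Q R) : tilt Q -> tilt R -> exists r : idx l Q -> idx l R -> k,
  forall P (i : idx l Q) (j : idx l P), tilt P ->
  in_span [set x : cidx P R | le (tag x) l && (tag x != l)] (@celt P R)
    (ghom_comp f (cell i j) - \sum_m r i m *: cell m j).
Proof.
move=> hQ hR; exists (fun i m => coord (vbasis (hwV l R)) m (f (bas i))) => P i j hP.
set h := _ - _; have hE v : h v = f (cell i j v) - \sum_m coord (vbasis (hwV l R)) m (f (bas i)) *: cell m j v.
  have := ghom_sumE (enum (idx l R)) (fun m => cell m j) (fun m => coord (vbasis (hwV l R)) m (f (bas i))) v.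
  by rewrite !big_enum /h /= add_lfunE opp_lfunE => ->; rewrite comp_lfunE.
have [c c' cc' /andP [c'l ne]|c v nD|s [hs ->]] := lower_span hP hR (D := fun c => le c l && (c != l)) (f := h).
- rewrite (s_trans St cc' c'l) /=; apply: contra ne => /eqP e.
  by apply/eqP/(s_anti St); rewrite c'l -e cc'.
- rewrite hE; have [->|cl] := eqVneq c l.
    rewrite (cellP i j hP hQ).1 linearZ /= {1}(hw_bas (hw_ghom f (bas_hw i))) scaler_sumr -sumrB.
    by rewrite big1 // => m _; rewrite (cellP m j hP hR).1 !scalerA mulrC subrr.
  have lc : le l c by have := s_total St l c; move: nD; rewrite cl andbT => /negPf ->; rewrite orbF.
  rewrite (cellP i j hP hQ).2 // linear0 sub0r big1 ?oppr0 // => m _.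
  by rewrite (cellP m j hP hR).2 // scaler0.
exact: (@span_pairs _ _ _ [set x : cidx P R | le (tag x) l && (tag x != l)] (@celt P R) s).
Qed.

Theorem cellular_tilt (S : Gmodule G -> Prop) : (forall Q, S Q -> tilt Q) ->
  cellular (@full_subcat k (module_cat G) S).
Proof.
move=> hS.
pose L : porderType (Order.Disp tt tt) := HB.pack wt (Order.Le_isPOrder.Build (Order.Disp tt tt) wt (s_refl St) (s_anti St) (s_trans St)).
have ltE (x y : L) : (x < y)%O = le x y && (x != y) by rewrite lt_neqAle andbC.
have tl (P : {P | S P}) : tilt (sval P) by apply: hS; exact: (svalP P).
constructor; unshelve refine (@CellDatum k (@full_subcat k (module_cat G) S) (fun (P Q : {P | S P}) (f : Ghom (sval P) (sval Q)) => adj f) _ _ _ _ (Order.Disp tt tt) L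
  (fun (P : {P | S P}) (l : wt) => idx l (sval P)) (fun (P Q : {P | S P}) (l : wt) (i : idx l (sval Q)) (j : idx l (sval P)) => cell i j) _ _ _ _).
- by move=> P Q a f g; apply: adjP.
- by move=> P; apply: adj1.
- by move=> P Q R f g; apply: adjM.
- by move=> P Q f; apply: adjK.
- move=> P Q l i i' j j' e.
  have := celt_inj (tl P) (tl Q) (x := Tagged (fun l => (idx l (sval Q) * idx l (sval P))%type) (i, j))
    (y := Tagged (fun l => (idx l (sval Q) * idx l (sval P))%type) (i', j')) erefl e.
  move=> /eqP; rewrite -tag_eqE /tag_eq eqxx tagged_asE /= => /eqP [-> ->] //.
- by move=> P Q; split; [exact: celt_indep|exact: celt_span].
- by move=> P Q l i j; apply: cell_adj.
move=> Q R l f; have [r hr] := celt_mul l f (tl Q) (tl R); exists r => P i j.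
have -> : [set x : {m : L & (idx m (sval R) * idx m (sval P))%type} | (tag x < l)%O] =
  [set x | le (tag x) l && (tag x != l)] by apply/funext => x /=; rewrite ltE.
exact: hr.
Qed.

End Cells.

Lemma cellular_zero (k : fieldType) (A : lincat k) :
  (forall (P Q : A) (f g : Defs.hom P Q), f = g) -> cellular A.
Proof.
move=> h; constructor; unshelve refine (@CellDatum k A (fun P Q f => 0) _ _ _ _ _ bool (fun P l => 'I_0)
  (fun P Q l i j => 0) _ _ _ _); try by move=> *; apply: h.
- by move=> P Q l [].
- move=> P Q; split=> [s a _ _ [l [[i hi] j]] //|f].
  by exists [::], (fun=> 0); split=> //; apply: h.
by move=> Q R l f; exists (fun=> fun=> 0) => P [].
Qed.

Lemma filtered_false (k : closedFieldType) (G : algGroup k) (C : Gmodule G -> Prop) M :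
  (forall N, ~ C N) -> filtered C M -> (fullv : {vspace M}) = 0%VS.
Proof.
move=> hC [[|r] [U [U0 Ur _ Uq]]]; first by rewrite -Ur U0.
by have [_ [N /hC]] := Uq 0%N isT.
Qed.

Theorem proposition2p4 (k : closedFieldType) (p : nat)
    (char_k : p \in [pchar k]) (p_gt2 : (2 < p)%N)
    (G : algGroup k) (G_red : connected_reductive G)
    (T : set G) (T_max : maximal_torus T)
    (Rp : set (G -> k)) (Rp_pos : positive_system T Rp)
    (rhoX : rho_in_X T Rp)
    (B : set G) (B_borel : borel B) (TB : T `<=` B)
    (B_roots : forall alpha : G -> k,
       is_root B T alpha <-> Rp (opp_char alpha))
    (tau : anti_involution G) (tau_chev : chevalley T tau) :
  cellular (tilting_cat T B Rp tau).
Proof.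
(* Without a dominant weight no homomorphisms from SL_2 are available, but then every filtration has
   length 0 and all objects are zero. *)
have [[lam hlam]|nolam] := pselect (exists lam, dominant T Rp lam); last first.
  apply: cellular_zero => -[P hP] [Q hQ] f g; apply: val_inj; apply/lfunP => v.
  have P0 : (fullv : {vspace P}) = 0%VS.
    by apply: filtered_false hP.1 => N [mu hmu _]; apply: nolam; exists mu.
  by have := memvf (v : P); rewrite P0 memv0 => /eqP ->; rewrite !linear0.
have [[[_ Tcl] [r [phi [h1 h2 h3]]]] hmax] := T_max.
have [d [x [w [x1 xw xf xs]]]] := cotangent_basis h1 h3.
pose F := Frame h1 h3 x1 xw xf xs.
have eT : T = tor F by rewrite h2.
clearbody F; rewrite eT in hlam hmax Tcl Rp_pos TB B_roots tau_chev.
have [Gc Gr] := G_red; have [[hB Bc _] _] := B_borel.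
have hsl2 := fun a => dominant_sl2 Rp_pos hlam (a := a).
have [le [l1 l2 l3 l4 l5]] := total_weight_order hsl2 Rp_pos.
have St : @borel_setup _ _ F tau B le.
  have [[B1 BM BV] _] := hB; split=> //.
  - by move=> s hs; apply: tau_chev.1; exists s.
  - move=> f a c b hf Bb fb; apply: l5; apply: contrapT => nle; case/eqP: fb.
    apply: (B_weight char_k p_gt2 hB Bc tau_chev hsl2 Rp_pos TB B_roots hf) => //.
    by rewrite opprB.
  - by move=> f b hf vf Bb; apply: (B_weight0 char_k p_gt2 Gc Gr hB Bc tau_chev hsl2 hmax Tcl Rp_pos TB B_roots hf vf Bb).
  - by move=> s hs; apply: TB; exists s.
  - exact: (big_cell_dense char_k p_gt2 Gc Gr hB tau_chev hsl2 hmax Tcl Rp_pos TB B_roots).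
apply: (cellular_tilt St (two_neq0 char_k p_gt2)) => Q hQ; exact: (tilting_tilt St eT hQ).
Qed.
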